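(* Assume that $\langle \alpha+2\rho,\beta\rangle\neq 0$ for all $\alpha\in\pi(\Lambda)$ and all $\beta\in\pi(\Lambda)\setminus\{0\}$. Let $M$ be a non-trivial simple $\Lambda$-graded cuspidal $W_\pi$-module. Then $M$ is isomorphic to one of the following $W_\pi$-modules: (1) $\mathcal S_\Gamma$ for some $\Gamma\in\mathbb C^2/\pi(\Lambda)$ such that $-\rho\notin\Gamma$ and $-2\rho\notin\Gamma$; (2) $\mathcal S_{-\rho+\pi(\Lambda)}/\mathbb C L_{-\rho}$, or its restricted dual; (3) $\mathcal M^n(\Gamma)$ for some integer $n\ge 2$ and some $\Gamma\in\mathbb C^2/\pi(\Lambda)$. Moreover, any two different modules among the modules $\mathcal S_\Gamma$ (with $\Gamma\in\mathbb C^2/\pi(\Lambda)$, $-\rho\notin\Gamma$ and $-2\rho\notin\Gamma$), $\mathcal S_{-\rho+\pi(\Lambda)}/\mathbb C L_{-\rho}$, the restricted dual of $\mathcal S_{-\rho+\pi(\Lambda)}/\mathbb C L_{-\rho}$, and $\mathcal M^n(\Gamma)$ (with $n\ge 2$ an integer and $\Gamma\in\mathbb C^2/\pi(\Lambda)$) are non-isomorphic.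
   Context: Let $N>1$, $\Lambda=\mathbb Z^N$, $\rho=(1,1)\in\mathbb C^2$, and let $\langle\cdot,\cdot\rangle$ be the standard symplectic form on $\mathbb C^2$, $\langle(a,b),(c,d)\rangle=ad-bc$. Let $\pi:\Lambda\hookrightarrow\mathbb C^2$ be an injective additive map such that (i) $\pi(\Lambda)\not\subset\mathbb C\rho$; (ii) $2\rho\notin\pi(\Lambda)$; (iii) $\pi(\Lambda)$ does not lie in a complex line. $\mathcal S=\bigoplus_{\lambda\in\mathbb C^2}\mathbb C L_\lambda$ is the Poisson algebra with commutative product $L_\lambda\cdot L_\mu=L_{\lambda+\mu+\rho}$ and bracket $\{L_\lambda,L_\mu\}=\langle\lambda+\rho,\mu+\rho\rangle L_{\lambda+\mu}$. $W_\pi\subset\mathcal S$ is the Lie subalgebra with basis $(L_\lambda)_{\lambda\in\pi(\Lambda)}$. A $W_\pi$-module $M$ is $\Lambda$-graded if there is a coset $\Gamma\in\mathbb C^2/\pi(\Lambda)$ with $M=\bigoplus_{\mu\in\Gamma}M_\mu$, where $M_\mu=\{m\in M: L_0.m=\langle\rho,\mu\rangle m\}$. It is cuspidal if it is $\Lambda$-graded and the dimensions of the homogeneous components $M_\mu$ are (finite and) uniformly bounded. Under the hypothesis of the claim, any submodule of a graded module is graded. A simple module is non-trivial if it is not the one-dimensional module on which $W_\pi$ acts by $0$. The restricted dual of a graded module is the direct sum of the duals of its homogeneous components, with the contragredient action. For $\Gamma\in\mathbb C^2/\pi(\Lambda)$, $\mathcal S_\Gamma=\bigoplus_{\mu\in\Gamma}\mathbb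 C L_\mu\subset\mathcal S$ with $W_\pi$ acting by the Poisson bracket; $\mathbb C L_{-\rho}$ is a trivial submodule of $\mathcal S_{-\rho+\pi(\Lambda)}$. Let $V=\mathbb C^2$. The symmetric algebra $S^\bullet V$ carries the Poisson bracket determined by $\{\alpha,\beta\}=\langle\alpha,\beta\rangle 1$ for $\alpha,\beta\in V$; then $S^2V$ is a Lie algebra (isomorphic to $\mathfrak{sl}_2$) acting on each $S^nV$ by the bracket. For $n\ge0$ and $\Gamma\in\mathbb C^2/\pi(\Lambda)$, $\mathcal M^n(\Gamma)=\bigoplus_{\mu\in\Gamma}L_\mu\otimes S^nV$ is the $W_\pi$-module with action $$L_\lambda.(L_\mu\otimes u)=\langle\lambda+\rho,\mu+\rho\rangle L_{\lambda+\mu}\otimes u+\tfrac12 L_{\lambda+\mu}\otimes\{\lambda(\lambda+\rho),u\},\qquad \lambda\in\pi(\Lambda),\ \mu\in\Gamma,\ u\in S^nV,$$ where $\lambda(\lambda+\rho)$ denotes the product in $S^2V$. *)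

(* Defs.v *)
From HB Require Import structures.
From mathcomp Require Import all_boot all_algebra.
From mathcomp Require Import boolp classical_sets functions cardinality fsbigop.
From mathcomp Require Import reals complex mpoly ring.

Set Implicit Arguments.
Unset Strict Implicit.
Unset Printing Implicit Defensive.

Import GRing.Theory Num.Theory.
Local Open Scope classical_set_scope.
Local Open Scope ring_scope.
Local Open Scope quotient_scope.

Record lieAlgebra (K : fieldType) := LieAlgebra {
  lie_space :> lmodType K;
  lie_br : lie_space -> lie_space -> lie_space;
  lie_br_linl : forall y, linear (lie_br^~ y);
  lie_br_linr : forall x, linear (lie_br x);
  lie_brxx : forall x, lie_br x x = 0;
  lie_jacobi : forall x y z,
    lie_br x (lie_br y z) + lie_br y (lie_br z x) + lie_br z (lie_br x y) = 0
}.

Record lieModule (K : fieldType) (L : lieAlgebra K) := LieModule {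
  lmod_space :> lmodType K;
  lact : L -> lmod_space -> lmod_space;
  lact_linl : forall m, linear (lact^~ m);
  lact_linr : forall x, linear (lact x);
  lact_br : forall x y m,
    lact (lie_br x y) m = lact x (lact y m) - lact y (lact x m)
}.

Section LieModules.
Variables (K : fieldType) (L : lieAlgebra K).
Implicit Types M : lieModule L.

Definition lmod_iso (M1 M2 : lieModule L) :=
  exists f : M1 -> M2,
    [/\ linear f, bijective f & forall x m, f (lact x m) = lact x (f m)].

Record lieSubmodule M := LieSubmodule {
  lsub :> set M;
  lsub0 : lsub 0;
  lsubP : forall a m m', lsub m -> lsub m' -> lsub (a *: m + m');
  lsub_act : forall (x : L) m, lsub m -> lsub (lact x m)
}.

Definition lmod_simple M :=
  (exists m : M, m != 0) /\
  forall N : lieSubmodule M, N = [set 0] :> set M \/ N = [set: M] :> set M.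

Definition lmod_trivial M :=
  (exists2 e : M, e != 0 & forall m : M, exists c : K, m = c *: e) /\
  forall (x : L) (m : M), lact x m = 0.

End LieModules.

(* Quotient of a module by a submodule: the underlying abelian group is the   *)
(* library quotient [Quotient.quot], to which scaling and action are added.   *)
Section QuotientModule.
Variables (K : fieldType) (L : lieAlgebra K) (M : lieModule L).
Variable N : lieSubmodule M.

Definition lsub_pred : {pred M} := fun m => `[< lsub N m >].

Lemma lsub_predE m : (m \in lsub_pred) = `[< lsub N m >]. Proof. by []. Qed.

Fact lsub_submod_closed : submod_closed lsub_pred.
Proof.
split=> [|a u v]; rewrite !lsub_predE; first exact/asboolP/lsub0.
by move=> /asboolP Nu /asboolP Nv; apply/asboolP/lsubP.
Qed.

HB.instance Definition _ :=
  GRing.isSubmodClosed.Build K M lsub_pred lsub_submod_closed.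

Definition lquot : Type := Quotient.quot lsub_pred.
HB.instance Definition _ := GRing.Zmodule.on lquot.

Definition to_lquot (m : M) : lquot := \pi_(Quotient.quot lsub_pred) m.
Definition of_lquot (q : lquot) : M := repr (q : Quotient.quot lsub_pred).

Lemma of_lquotK q : to_lquot (of_lquot q) = q. Proof. exact: reprK. Qed.

Lemma to_lquotP m m' : to_lquot m = to_lquot m' <-> lsub N (m - m').
Proof.
rewrite /to_lquot; split=> [/eqP|Nm].
  by rewrite -Quotient.idealrBE lsub_predE => /asboolP.
by apply/eqP; rewrite -Quotient.idealrBE lsub_predE; apply/asboolP.
Qed.

Lemma to_lquotD m m' : to_lquot (m + m') = to_lquot m + to_lquot m'.
Proof. by rewrite /to_lquot !piE. Qed.

Definition lquot_scale (a : K) (q : lquot) := to_lquot (a *: of_lquot q).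
Definition lquot_act (x : L) (q : lquot) := to_lquot (lact x (of_lquot q)).

Lemma lquot_scaleE a m : lquot_scale a (to_lquot m) = to_lquot (a *: m).
Proof.
apply/to_lquotP; rewrite -scalerBr -[_ *: _]addr0.
by apply: lsubP; [apply/to_lquotP; rewrite of_lquotK | exact: lsub0].
Qed.

Lemma lact_linear_sub (x : L) (m m' : M) : lact x (m - m') = lact x m - lact x m'.
Proof.
by rewrite addrC -scaleN1r lact_linr scaleN1r addrC.
Qed.

Lemma lquot_actE x m : lquot_act x (to_lquot m) = to_lquot (lact x m).
Proof.
apply/to_lquotP; rewrite -lact_linear_sub; apply: lsub_act.
by apply/to_lquotP; rewrite of_lquotK.
Qed.

Fact lquot_scaleA a b q : lquot_scale a (lquot_scale b q) = lquot_scale (a * b) q.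
Proof. by rewrite -[q]of_lquotK !lquot_scaleE scalerA. Qed.
Fact lquot_scale1 : left_id 1 lquot_scale.
Proof. by move=> q; rewrite -[q]of_lquotK lquot_scaleE scale1r. Qed.
Fact lquot_scaleDr : right_distributive lquot_scale +%R.
Proof.
move=> a q r; rewrite -[q]of_lquotK -[r]of_lquotK -to_lquotD !lquot_scaleE.
by rewrite scalerDr to_lquotD.
Qed.
Fact lquot_scaleDl q : {morph lquot_scale^~ q : a b / a + b}.
Proof.
by move=> a b; rewrite -[q]of_lquotK !lquot_scaleE scalerDl to_lquotD.
Qed.

HB.instance Definition _ := GRing.Zmodule_isLmodule.Build K lquot
  lquot_scaleA lquot_scale1 lquot_scaleDr lquot_scaleDl.

Lemma to_lquot_linear : linear to_lquot.
Proof. by move=> a u v; rewrite to_lquotD -lquot_scaleE. Qed.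

Fact lquot_act_linl q : linear (lquot_act^~ q).
Proof.
by move=> a x y; rewrite -[q]of_lquotK !lquot_actE lact_linl to_lquot_linear.
Qed.
Fact lquot_act_linr x : linear (lquot_act x).
Proof.
move=> a q r; rewrite -[q]of_lquotK -[r]of_lquotK -to_lquot_linear.
by rewrite !lquot_actE lact_linr to_lquot_linear.
Qed.
Fact lquot_act_br x y q :
  lquot_act (lie_br x y) q =
  lquot_act x (lquot_act y q) - lquot_act y (lquot_act x q).
Proof.
rewrite -[q]of_lquotK !lquot_actE lact_br addrC -scaleN1r to_lquot_linear.
by rewrite scaleN1r addrC.
Qed.

Definition lmod_quot : lieModule L :=
  LieModule lquot_act_linl lquot_act_linr lquot_act_br.

End QuotientModule.

(* [dsum A V] is the direct sum of copies of V indexed by the elements of A,  *)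
(* realised as the finitely supported functions on I that vanish off A.       *)
Section DirectSum.
Variables (K : fieldType) (I : choiceType) (A : set I) (V : lmodType K).
Implicit Types f g : I -> V.

Definition supp f : set I := [set i | f i != 0].

Definition dsum_pred : {pred I -> V} :=
  fun f => `[< finite_set (supp f) /\ supp f `<=` A >].

Lemma dsum_predP f :
  reflect (finite_set (supp f) /\ supp f `<=` A) (f \in dsum_pred).
Proof. exact: asboolP. Qed.

Fact dsum_submod_closed : submod_closed dsum_pred.
Proof.
split=> [|a f g /dsum_predP[ff fA] /dsum_predP[gf gA]]; apply/dsum_predP.
  have -> : supp 0 = set0 by apply/seteqP; split=> i //=; rewrite /supp /= eqxx.
  by split.
have sU : supp (a *: f + g) `<=` supp f `|` supp g.
  move=> i; rewrite /supp /=; have [f0|] := eqVneq (f i) 0; last by left.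
  have [g0|] := eqVneq (g i) 0; last by right.
  by rewrite addrfctE scalrfctE f0 g0 scaler0 addr0 eqxx.
split; first by apply: (sub_finite_set sU); rewrite finite_setU.
by apply: (subset_trans sU) => i [/fA|/gA].
Qed.

HB.instance Definition _ :=
  GRing.isSubmodClosed.Build K (I -> V) dsum_pred dsum_submod_closed.

Record dsum := DSum { dsum_fun :> I -> V; _ : dsum_fun \in dsum_pred }.

HB.instance Definition _ := [isSub for dsum_fun].
HB.instance Definition _ := [Choice of dsum by <:].
HB.instance Definition _ := [SubChoice_isSubLmodule of dsum by <:].

Definition single (a : I) (v : V) : I -> V := fun i => if i == a then v else 0.

Fact single_subproof a v : A a -> single a v \in dsum_pred.
Proof.
move=> Aa; have s1 : supp (single a v) `<=` [set a].
  move=> i; rewrite /supp /= /single.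
  by case: (i =P a) => // _; rewrite eqxx.
apply/dsum_predP; split; first exact: sub_finite_set s1 (finite_set1 a).
by move=> i /s1 ->.
Qed.

Definition dsum_single a (Aa : A a) v : dsum := DSum (single_subproof v Aa).

End DirectSum.

Section DirectSumTheory.
Variables (K : fieldType) (I : choiceType).

Lemma supp_single (V : lmodType K) (a : I) (v : V) :
  supp (single a v) `<=` [set a].
Proof. by move=> i; rewrite /supp /= /single; case: (i =P a); rewrite // eqxx. Qed.

Lemma single_linear (V : lmodType K) (a : I) : linear (@single K I V a).
Proof.
move=> c u v; apply/funext => i; rewrite addrfctE scalrfctE /single.
by case: eqP => // _; rewrite scaler0 addr0.
Qed.

Variables (A : set I) (V : lmodType K).
Implicit Types f g : dsum A V.

Lemma dsum_inj f g : (f : I -> V) = g -> f = g.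
Proof. exact: val_inj. Qed.

Lemma dsum_supp f : finite_set (supp f) /\ supp f `<=` A.
Proof. by case: f => f /=/dsum_predP. Qed.

Lemma dsum_lin (c : K) f g : (c *: f + g : dsum A V) = c *: (f : I -> V) + g :> (I -> V).
Proof. by []. Qed.

Lemma dsum_ind (P : dsum A V -> Prop) :
  P 0 -> (forall f g, P f -> P g -> P (f + g)) ->
  (forall a (Aa : A a) v, P (dsum_single Aa v)) -> forall f, P f.
Proof.
move=> P0 PD PS f.
have [/finite_seqP[s sE] sA] := dsum_supp f.
have {sE} : supp f `<=` [set` s] by rewrite sE.
elim: s f sA => [|a s IH] f sA fs.
  suff -> : f = 0 by [].
  apply: dsum_inj; apply/funext => i; apply/eqP/negPn/negP => fi.
  by have := fs i fi.
have [fa0|fa0] := eqVneq (f a) 0.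
  apply: IH => // i fi; have := fs i fi; rewrite /= inE => /orP[/eqP ia|//].
  by move: fi; rewrite /supp /= ia fa0 eqxx.
have Aa : A a by exact: sA.
pose h : dsum A V := f - dsum_single Aa (f a).
have -> : f = h + dsum_single Aa (f a) by rewrite subrK.
have hE i : h i = f i - single a (f a) i by [].
have hs i : h i != 0 -> i != a /\ f i != 0.
  rewrite hE /single; case: (eqVneq i a) => [->|ia]; first by rewrite subrr eqxx.
  by rewrite subr0.
apply: PD => //; apply: IH => i /hs[ia fi]; first exact: sA.
by have := fs i fi; rewrite /= inE (negPf ia).
Qed.

End DirectSumTheory.

(* The extension to finitely supported functions of a rule                    *)
(*   L_a . (L_b (x) v) = L_(a + b) (x) B a b v.                               *)
Section BilinearExtension.
Variables (K : fieldType) (I : zmodType) (V : lmodType K).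
Variable B : I -> I -> V -> V.

Definition bilin_ext (f : I -> K^o) (g : I -> V) : I -> V :=
  \sum_(a \in supp f) \sum_(b \in supp g) f a *: single (a + b) (B a b (g b)).

Hypothesis B_linear : forall a b, linear (B a b).

Let B0 a b : B a b 0 = 0.
Proof.
by have := B_linear a b (-1) 0 0; rewrite !scaleN1r !addNr.
Qed.

Let single0 (a : I) : single a (0 : V) = 0.
Proof. by apply/funext => j; rewrite /single; case: ifP. Qed.

Lemma bilin_ext_seq (X Y : seq I) f g : uniq X -> uniq Y ->
    supp f `<=` [set` X] -> supp g `<=` [set` Y] ->
  bilin_ext f g = \sum_(a <- X) \sum_(b <- Y) f a *: single (a + b) (B a b (g b)).
Proof.
move=> uX uY fX gY.
have inner a : \sum_(b \in supp g) f a *: single (a + b) (B a b (g b)) =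
    \sum_(b <- Y) f a *: single (a + b) (B a b (g b)).
  apply: fsbig_fwiden => // b [_ /negP/negPn/eqP gb].
  by rewrite /preimage /= gb B0 single0 scaler0.
rewrite /bilin_ext; under eq_fsbigr do rewrite inner.
apply: fsbig_fwiden => // a [_ /negP/negPn/eqP fa].
by rewrite /preimage /= fa big1 // => b _; rewrite scale0r.
Qed.

Let fin_seq (W : lmodType K) (h1 h2 : I -> W) :
    finite_set (supp h1) -> finite_set (supp h2) ->
  exists X : seq I, [/\ uniq X, supp h1 `<=` [set` X] & supp h2 `<=` [set` X]].
Proof.
move=> /finite_seqP[s1 E1] /finite_seqP[s2 E2].
exists (undup (s1 ++ s2)); split; first exact: undup_uniq.
  by rewrite E1 => i /= i1; rewrite mem_undup mem_cat i1.
by rewrite E2 => i /= i1; rewrite mem_undup mem_cat i1 orbT.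
Qed.

Let supp_lin (W : lmodType K) (c : K) (h1 h2 : I -> W) (X : seq I) :
  supp h1 `<=` [set` X] -> supp h2 `<=` [set` X] ->
  supp (c *: h1 + h2) `<=` [set` X].
Proof.
move=> h1X h2X i; rewrite /supp /=.
have [h10|/h1X//] := eqVneq (h1 i) 0; have [h20|/h2X//] := eqVneq (h2 i) 0.
by rewrite addrfctE scalrfctE h10 h20 scaler0 addr0 eqxx.
Qed.

Lemma bilin_ext_linl (A D : set I) (c : K) (f f' : dsum A K^o) (g : dsum D V) :
  bilin_ext (c *: (f : I -> K^o) + f') g =
  c *: bilin_ext f g + bilin_ext f' g.
Proof.
have [X [uX fX f'X]] := fin_seq (dsum_supp f).1 (dsum_supp f').1.
have [Y [uY gY _]] := fin_seq (dsum_supp g).1 (dsum_supp g).1.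
rewrite !(bilin_ext_seq uX uY) //; last exact: supp_lin.
rewrite scaler_sumr -big_split; apply: eq_bigr => a _ /=.
rewrite scaler_sumr -big_split; apply: eq_bigr => b _ /=.
by rewrite scalerA -scalerDl addrfctE scalrfctE.
Qed.

Lemma bilin_ext_linr (A D : set I) (c : K) (f : dsum A K^o) (g g' : dsum D V) :
  bilin_ext f (c *: (g : I -> V) + g') =
  c *: bilin_ext f g + bilin_ext f g'.
Proof.
have [X [uX fX _]] := fin_seq (dsum_supp f).1 (dsum_supp f).1.
have [Y [uY gY g'Y]] := fin_seq (dsum_supp g).1 (dsum_supp g').1.
rewrite !(bilin_ext_seq uX uY) //; last exact: supp_lin.
rewrite scaler_sumr -big_split; apply: eq_bigr => a _ /=.
rewrite scaler_sumr -big_split; apply: eq_bigr => b _ /=.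
have -> : (c *: (g : I -> V) + g') b = c *: g b + g' b by [].
rewrite B_linear single_linear scalerDr !scalerA.
by rewrite [c * _]mulrC.
Qed.

Lemma bilin_ext_dsum (A D E : set I) (f : dsum A K^o) (g : dsum D V) :
    (forall a b, A a -> D b -> E (a + b)) ->
  bilin_ext f g \in dsum_pred E (V:=V).
Proof.
move=> ADE.
have [X [uX fX _]] := fin_seq (dsum_supp f).1 (dsum_supp f).1.
have [Y [uY gY _]] := fin_seq (dsum_supp g).1 (dsum_supp g).1.
rewrite (bilin_ext_seq uX uY) //.
apply: rpred_sum => a _; apply: rpred_sum => b _.
have [->|fa] := eqVneq (f a) 0; first by rewrite scale0r rpred0.
have [->|gb] := eqVneq (g b) 0; first by rewrite B0 single0 scaler0 rpred0.
apply/rpredZ/single_subproof/ADE; first exact: (dsum_supp f).2.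
exact: (dsum_supp g).2.
Qed.

Lemma bilin_ext_single (a b : I) (c : K) (v : V) :
  bilin_ext (single a (c : K^o)) (single b v) = c *: single (a + b) (B a b v).
Proof.
rewrite (@bilin_ext_seq [:: a] [:: b]) //.
- by rewrite !big_seq1 /single !eqxx.
- by move=> i /supp_single /= ->; rewrite inE.
- by move=> i /supp_single /= ->; rewrite inE.
Qed.

End BilinearExtension.

Section BilinearDsum.
Variables (K : fieldType) (I : zmodType) (V : lmodType K).
Variables (B : I -> I -> V -> V) (B_linear : forall a b, linear (B a b)).
Variables (A D : set I) (AD : forall a b, A a -> D b -> D (a + b)).

Definition bilin_dsum (f : dsum A K^o) (g : dsum D V) : dsum D V :=
  DSum (bilin_ext_dsum B_linear f g AD).

Lemma bilin_dsum_linl g : linear (bilin_dsum^~ g).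
Proof. by move=> c f f'; apply/dsum_inj/bilin_ext_linl. Qed.

Lemma bilin_dsum_linr f : linear (bilin_dsum f).
Proof. by move=> c g g'; apply/dsum_inj/bilin_ext_linr. Qed.

Lemma bilin_dsum_single a b (Aa : A a) (Db : D b) (c : K) v :
  bilin_dsum (dsum_single Aa (c : K^o)) (dsum_single Db v) =
  dsum_single (AD Aa Db) (c *: B a b v).
Proof.
apply: dsum_inj; rewrite /= bilin_ext_single //; apply/funext => i.
by rewrite scalrfctE /single; case: eqP => // _; rewrite scaler0.
Qed.

End BilinearDsum.

Section LinearFacts.
Variables (K : fieldType) (U V : lmodType K) (h : U -> V).
Hypothesis h_lin : linear h.

Lemma linear_fun0 : h 0 = 0.
Proof. by have := h_lin (-1) 0 0; rewrite !scaleN1r !addNr. Qed.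
Lemma linear_funZ c u : h (c *: u) = c *: h u.
Proof. by have := h_lin c u 0; rewrite linear_fun0 !addr0. Qed.
Lemma linear_funD u v : h (u + v) = h u + h v.
Proof. by have := h_lin 1 u v; rewrite !scale1r. Qed.
Lemma linear_funN u : h (- u) = - h u.
Proof. by rewrite -!scaleN1r linear_funZ. Qed.
End LinearFacts.

Section Symplectic.
Variable K : numFieldType.
Local Notation vec := 'rV[K]_2.
Implicit Types u v w : vec.

Definition sympl u v : K := u 0 0 * v 0 1 - u 0 1 * v 0 0.

Definition rho : vec := const_mx 1.

(* S is the space of finitely supported functions on K^2, L_a being the       *)
(* indicator function [single a 1] of a.                                      *)
Definition poisson_rule (a b : vec) (c : K^o) : K^o :=
  sympl (a + rho) (b + rho) *: c.

Fact poisson_rule_linear a b : linear (poisson_rule a b).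
Proof. by move=> c u v; rewrite /poisson_rule scalerDr !scalerA mulrC. Qed.

Definition poisson_br (f g : vec -> K^o) : vec -> K^o :=
  bilin_ext poisson_rule f g.

Lemma poisson_br_L a b :
  poisson_br (single a (1 : K^o)) (single b (1 : K^o)) =
  sympl (a + rho) (b + rho) *: single (a + b) (1 : K^o).
Proof.
rewrite /poisson_br bilin_ext_single ?scale1r; last exact: poisson_rule_linear.
exact: linear_funZ (@single_linear _ _ _ _) _ _.
Qed.

End Symplectic.

Arguments rho {K}.

(* S^n V for V = K^2: homogeneous polynomials of degree n in two variables,   *)
(* the vector v standing for the linear form v_0 X_0 + v_1 X_1.               *)
Section SymmetricAlgebra.
Variable K : numFieldType.
Local Notation vec := 'rV[K]_2.
Local Notation SV := {mpoly K[2]}.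
Implicit Types (u v w : vec) (p q : SV).

Definition sym_lin v : SV := v 0 0 *: 'X_0 + v 0 1 *: 'X_1.

(* The bracket with {u, v} = sympl u v on V: see sym_br_lin, sym_brM and       *)
(* sym_br_jacobi.                                                             *)
Definition sym_br p q : SV :=
  p^`M(0) * q^`M(1) - p^`M(1) * q^`M(0).

Let dX i j : ('X_i : SV)^`M(j) = (i == j)%:R.
Proof.
rewrite mderivX mnm1E; case: eqP => [->|_]; last by rewrite scale0r.
have -> : (U_(j) - U_(j) = 0 :> 'X_{1..2})%MM.
  by apply/mnmP => k; rewrite mnmBE mnm0E subnn.
by rewrite mpolyX0 scale1r.
Qed.

Lemma sym_br_lin u v : sym_br (sym_lin u) (sym_lin v) = (sympl u v)%:MP.
Proof.
rewrite /sym_br /sym_lin !mderivD !mderivZ !dX /= !scaler0 !addr0 !add0r.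
by rewrite -!mul_mpolyC !mulr1 -!rmorphM -rmorphB.
Qed.

Lemma sym_brM p q r : sym_br (p * q) r = p * sym_br q r + sym_br p r * q.
Proof. by rewrite /sym_br !mderivM; ring. Qed.

Lemma sym_brC p q : sym_br p q = - sym_br q p.
Proof. by rewrite /sym_br; ring. Qed.

Lemma sym_brMr p q r : sym_br p (q * r) = q * sym_br p r + sym_br p q * r.
Proof. by rewrite sym_brC sym_brM [sym_br p r]sym_brC [sym_br p q]sym_brC; ring. Qed.

Lemma sym_br_jacobi p q r :
  sym_br p (sym_br q r) - sym_br q (sym_br p r) = sym_br (sym_br p q) r.
Proof.
rewrite /sym_br !(mderivB, mderivM).
rewrite ![_^`M(1)^`M(0)]mderiv_comm; ring.
Qed.

Lemma sym_br_linr p : linear (sym_br p).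
Proof.
move=> c q r; rewrite /sym_br !(mderivD, mderivZ) -!mul_mpolyC; ring.
Qed.

Lemma sym_br_linl p : linear (sym_br^~ p).
Proof.
move=> c q r; rewrite /sym_br !(mderivD, mderivZ) -!mul_mpolyC; ring.
Qed.

Lemma mderiv_homog n (p : SV) i : p \is n.-homog for mdeg ->
  if n is n'.+1 then p^`M(i) \is n'.-homog for mdeg else p^`M(i) = 0.
Proof.
move=> /dhomogP hp.
have hm m : m \in msupp p^`M(i) -> (mdeg m).+1 = n.
  rewrite mcoeff_msupp mcoeff_deriv => pm0.
  have mp : (m + U_(i))%MM \in msupp p.
    by rewrite mcoeff_msupp; apply: contraNneq pm0 => ->; rewrite mul0rn.
  by have : mdeg (m + U_(i))%MM = n := hp _ mp; rewrite mdegD mdeg1 addn1.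
case: n hp hm => [|n] _ hm; last by apply/dhomogP => m /hm[].
by apply/msuppnil0; case: (msupp _) hm => // m s /(_ m (mem_head _ _)).
Qed.

Lemma sym_br_homog n p q : p \is 2.-homog for mdeg -> q \is n.-homog for mdeg ->
  sym_br p q \is n.-homog for mdeg.
Proof.
move=> p2 qn; have := mderiv_homog _ qn; rewrite /sym_br.
case: n {qn} => [|n] dq; first by rewrite !dq !mulr0 subr0; exact: rpred0.
have dp i : p^`M(i) \is 1.-homog for mdeg := mderiv_homog i p2.
by rewrite -[n.+1]add1n; apply: rpredB; exact: dhomogM.
Qed.

Lemma sym_lin_homog v : sym_lin v \is 1.-homog for mdeg.
Proof.
by apply: rpredD; apply: rpredZ; rewrite dhomogX; apply/eqP; exact: mdeg1.
Qed.

Local Notation sym_pow n := (dhomog 2 K n).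

Fact sym_act_subproof n u v (p : sym_pow n) :
  sym_br (sym_lin u * sym_lin v) p \is n.-homog for mdeg.
Proof.
apply: sym_br_homog; last exact: dhomog_is_dhomog.
exact: dhomogM (sym_lin_homog u) (sym_lin_homog v).
Qed.

(* The action of the element u v of S^2 V on S^n V. *)
Definition sym_act n u v (p : sym_pow n) : sym_pow n :=
  DHomog (sym_act_subproof u v p).

(* L_a . (L_b (x) p) = L_(a + b) (x) tensor_rule a b p in M^n(Gamma).         *)
Definition tensor_rule n (a b : vec) (p : sym_pow n) : sym_pow n :=
  sympl (a + rho) (b + rho) *: p + 2^-1 *: sym_act a (a + rho) p.

Let sym_pow_inj n (p q : sym_pow n) :
  p = q :> SV -> p = q.
Proof. by move=> pq; apply: val_inj. Qed.

Fact tensor_rule_linear n a b : linear (@tensor_rule n a b).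
Proof.
move=> c p q; rewrite /tensor_rule.
have -> : sym_act a (a + rho) (c *: p + q) =
    c *: sym_act a (a + rho) p + sym_act a (a + rho) q.
  by apply: sym_pow_inj; exact: sym_br_linr.
by rewrite !scalerDr !scalerA ![_ * c]mulrC addrACA.
Qed.

Lemma sym_br_quadratic a b :
    let q (x : vec) := sym_lin x * sym_lin (x + rho) in
  sym_br (q a) (q b) =
  2 *: (sympl (a + rho) (b + rho) *: q (a + b) - sympl (a + rho) b *: q b
        + sympl (b + rho) a *: q a).
Proof.
rewrite /= sym_brM !sym_brMr !sym_br_lin /sym_lin /sympl !mxE -!mul_mpolyC.
rewrite !(rmorphB, rmorphD, rmorphM, rmorph1, rmorphN, rmorph_nat) /=.
ring.
Qed.

Lemma tensor_rule_br n a b g (p : sym_pow n) :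
  sympl (a + rho) (b + rho) *: tensor_rule (a + b) g p =
  tensor_rule a (b + g) (tensor_rule b g p) -
  tensor_rule b (a + g) (tensor_rule a g p).
Proof.
apply: sym_pow_inj.
pose q (x : vec) := sym_lin x * sym_lin (x + rho).
pose s := sympl (a + rho) (b + rho).
pose P : SV := p.
pose tr (x y : vec) (r : SV) : SV := sympl (x + rho) (y + rho) *: r + 2^-1 *: sym_br (q x) r.
suff : s *: tr (a + b) g P = tr a (b + g) (tr b g P) - tr b (a + g) (tr a g P) by [].
have E := sym_br_jacobi (q a) (q b) P.
rewrite sym_br_quadratic -/q -/s in E.
rewrite (linear_funZ (sym_br_linl P)) !(linear_funD (sym_br_linl P)) in E.
rewrite (linear_funN (sym_br_linl P)) !(linear_funZ (sym_br_linl P)) in E.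
rewrite /tr !(linear_funD (sym_br_linr _)) !(linear_funZ (sym_br_linr _)).
set AB := sym_br (q a) (sym_br (q b) P) in E *.
set BA := sym_br (q b) (sym_br (q a) P) in E *.
set A := sym_br (q a) P in E *; set B := sym_br (q b) P in E *.
set C := sym_br (q (a + b)) P in E *.
have -> : AB = BA + 2 *: (s *: C - sympl (a + rho) b *: B + sympl (b + rho) a *: A).
  by rewrite -E addrC subrK.
clear E.
have two : (2 : K) != 0 by rewrite pnatr_eq0.
set T := _ + sympl (b + rho) a *: A.
rewrite ![2^-1 *: (_ + 2^-1 *: _)]scalerDr ![2^-1 *: (BA + _)]scalerDr.
rewrite [2^-1 *: (2 *: T)]scalerA mulVf // scale1r /T /s.
move: (2^-1) => h; rewrite /sympl !mxE -!mul_mpolyC.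
rewrite !(rmorphB, rmorphD, rmorphM, rmorph1, rmorphN) /=.
ring.
Qed.
Lemma poisson_rule_br (a b g : vec) (c : K^o) :
  sympl (a + rho) (b + rho) *: poisson_rule (a + b) g c =
  poisson_rule a (b + g) (poisson_rule b g c) -
  poisson_rule b (a + g) (poisson_rule a g c).
Proof.
rewrite /poisson_rule !scalerA -scalerBl; congr (_ *: _).
by rewrite /sympl !mxE; ring.
Qed.

End SymmetricAlgebra.

Section WAlgebra.
Variables (K : numFieldType) (N : nat).
Local Notation vec := 'rV[K]_2.
Variable pi : {additive 'rV[int]_N -> vec}.

Definition lattice : set vec := range pi.

Record coset := Coset {
  coset_set :> set vec;
  coset_ax : exists g : vec, coset_set = [set g + v | v in lattice]
}.

Definition coset_at (g : vec) : coset := Coset (ex_intro _ g erefl).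

Lemma latticeD a b : lattice a -> lattice b -> lattice (a + b).
Proof. by move=> [x _ <-] [y _ <-]; exists (x + y) => //; rewrite raddfD. Qed.

Lemma lattice0 : lattice 0.
Proof. by exists 0 => //; rewrite raddf0. Qed.

Lemma coset_at_refl g : coset_set (coset_at g) g.
Proof. by exists 0; [exact: lattice0 | rewrite addr0]. Qed.

Lemma coset_stable (G : coset) a b : lattice a -> coset_set G b -> coset_set G (a + b).
Proof.
have [g ->] := coset_ax G; move=> la [v lv <-]; exists (a + v); first exact: latticeD.
by rewrite addrCA.
Qed.

(* W_pi is the subspace of S of the functions supported in pi(Z^N), with the  *)
(* bracket of S.                                                              *)
Definition W_br : dsum lattice K^o -> dsum lattice K^o -> dsum lattice K^o :=
  bilin_dsum (@poisson_rule_linear K) latticeD.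

Lemma W_brE x y : W_br x y = poisson_br x y :> (vec -> K).
Proof. by []. Qed.

Section Action.
Variables (V : lmodType K) (B : vec -> vec -> V -> V).
Hypothesis B_linear : forall a b, linear (B a b).
Hypothesis B_br : forall a b g v,
  sympl (a + rho) (b + rho) *: B (a + b) g v =
  B a (b + g) (B b g v) - B b (a + g) (B a g v).
Variable D : set vec.
Hypothesis AD : forall a b, lattice a -> D b -> D (a + b).

Lemma bilin_dsum_br (f f' : dsum lattice K^o) (g : dsum D V) :
  bilin_dsum B_linear AD (W_br f f') g =
  bilin_dsum B_linear AD f (bilin_dsum B_linear AD f' g) -
  bilin_dsum B_linear AD f' (bilin_dsum B_linear AD f g).
Proof.
set act := bilin_dsum B_linear AD.
have actl h : linear (act^~ h) := bilin_dsum_linl B_linear AD h.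
have actr h : linear (act h) := bilin_dsum_linr B_linear AD h.
have brl h : linear (W_br^~ h) := bilin_dsum_linl _ _ h.
have brr h : linear (W_br h) := bilin_dsum_linr _ _ h.
elim/dsum_ind: f => [|f1 f2 IH1 IH2|a Aa c].
- rewrite (linear_fun0 (brl _)) !(linear_fun0 (actl _)).
  by rewrite (linear_fun0 (actr _)) subrr.
- rewrite (linear_funD (brl _)) !(linear_funD (actl _)) IH1 IH2.
  rewrite (linear_funD (actr _)).
  by rewrite opprD addrACA.
elim/dsum_ind: f' => [|f1 f2 IH1 IH2|b Ab d].
- rewrite (linear_fun0 (brr _)) !(linear_fun0 (actl _)).
  by rewrite (linear_fun0 (actr _)) subrr.
- rewrite (linear_funD (brr _)) !(linear_funD (actl _)) IH1 IH2.
  rewrite (linear_funD (actr _)).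
  by rewrite opprD addrACA.
elim/dsum_ind: g => [|f1 f2 IH1 IH2|g Dg v].
- by rewrite !(linear_fun0 (actr _)) subrr.
- by rewrite !(linear_funD (actr _)) IH1 IH2 opprD addrACA.
rewrite /W_br !bilin_dsum_single /act !bilin_dsum_single.
apply: dsum_inj.
have subE (h k : dsum D V) : (h - k : dsum D V) = (h : vec -> V) - k :> (vec -> V) by [].
rewrite subE /=.
have -> : b + (a + g) = a + (b + g) by rewrite addrCA.
have -> : a + b + g = a + (b + g) by rewrite addrA.
rewrite -[in RHS]scaleN1r [RHS]addrC -single_linear; congr single.
rewrite scaleN1r [RHS]addrC.
rewrite !(linear_funZ (B_linear _ _)) /poisson_rule !scalerA.
have -> : (c * sympl (a + rho) (b + rho)) *: d =
    c * d * sympl (a + rho) (b + rho) :> K by exact: mulrAC.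
rewrite -[LHS]scalerA B_br scalerBr; congr (_ - _ *: _).
exact: mulrC.
Qed.

End Action.

Fact W_brC x y : W_br x y = - W_br y x.
Proof.
have brl h : linear (W_br^~ h) := bilin_dsum_linl _ _ h.
have brr h : linear (W_br h) := bilin_dsum_linr _ _ h.
elim/dsum_ind: x => [|f1 f2 IH1 IH2|a Aa c].
- by rewrite (linear_fun0 (brl _)) (linear_fun0 (brr _)) oppr0.
- by rewrite (linear_funD (brl _)) (linear_funD (brr _)) IH1 IH2 opprD.
elim/dsum_ind: y => [|f1 f2 IH1 IH2|b Ab d].
- by rewrite (linear_fun0 (brl _)) (linear_fun0 (brr _)) oppr0.
- by rewrite (linear_funD (brl _)) (linear_funD (brr _)) IH1 IH2 opprD.
rewrite /W_br !bilin_dsum_single; apply: dsum_inj.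
have oppE (h : dsum lattice K^o) : (- h : dsum lattice K^o) = - (h : vec -> K^o) :> (vec -> K^o) by [].
rewrite oppE /= [b + a]addrC -scaleN1r -[RHS]addr0.
have <- : single (a + b) (0 : K^o) = 0.
  by apply/funext => j; rewrite /single; case: ifP.
rewrite -single_linear addr0; congr single.
rewrite /poisson_rule /sympl /GRing.scale /= !mxE; ring.
Qed.

Fact W_brxx x : W_br x x = 0.
Proof.
have /eqP := W_brC x x; rewrite -subr_eq0 opprK -mulr2n -scaler_nat scaler_eq0.
by rewrite pnatr_eq0 => /eqP.
Qed.

Fact W_jacobi x y z :
  W_br x (W_br y z) + W_br y (W_br z x) + W_br z (W_br x y) = 0.
Proof.
have brr h : linear (W_br h) := bilin_dsum_linr _ _ h.
have E := bilin_dsum_br (@poisson_rule_linear K) (@poisson_rule_br K) latticeD x y z.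
rewrite [W_br z (W_br x y)]W_brC [W_br (W_br x y) z]E -/W_br.
by rewrite [W_br z x]W_brC (linear_funN (brr y)) subrr.
Qed.

Definition W : lieAlgebra K := LieAlgebra
  (bilin_dsum_linl (@poisson_rule_linear K) latticeD)
  (bilin_dsum_linr (@poisson_rule_linear K) latticeD)
  W_brxx W_jacobi.

Definition L_ (a : vec) (la : lattice a) : W := dsum_single la (1 : K^o).

Definition S_mod (G : coset) : lieModule W := @LieModule K W (dsum G K^o)
  (bilin_dsum (@poisson_rule_linear K) (@coset_stable G))
  (bilin_dsum_linl _ _) (bilin_dsum_linr _ _)
  (bilin_dsum_br (@poisson_rule_linear K) (@poisson_rule_br K) (@coset_stable G)).

Lemma S_mod_actE G (x : W) (m : S_mod G) :
  (lact x m : dsum G K^o) = poisson_br (x : dsum lattice K^o) (m : dsum G K^o)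
    :> (vec -> K).
Proof. by []. Qed.

(* M^n(Gamma): finitely supported functions Gamma -> S^n V.                   *)
Definition M_mod (n : nat) (G : coset) : lieModule W :=
  @LieModule K W (dsum G (dhomog 2 K n))
  (bilin_dsum (@tensor_rule_linear K n) (@coset_stable G))
  (bilin_dsum_linl _ _) (bilin_dsum_linr _ _)
  (bilin_dsum_br (@tensor_rule_linear K n) (@tensor_rule_br K n) (@coset_stable G)).

End WAlgebra.

Definition dim_le (K : fieldType) (V : lmodType K) (P : set V) (d : nat) :=
  exists2 e : 'I_d -> V, forall i, P (e i) &
    forall v, P v -> exists c : 'I_d -> K, v = \sum_(i < d) c i *: e i.

Section GradedModules.
Variables (K : numFieldType) (N : nat).
Local Notation vec := 'rV[K]_2.
Variable pi : {additive 'rV[int]_N -> vec}.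
Implicit Types (M : lieModule (W pi)) (G : coset pi).

Definition weight_space M (mu : vec) : set M :=
  [set m | lact (L_ (lattice0 pi)) m = sympl rho mu *: m].
Arguments weight_space : clear implicits.

(* M is the (internal) direct sum of the weight_space M mu, mu in G.          *)
Definition graded_by M G := forall m : M, exists! f : dsum G M,
  (forall mu, coset_set G mu -> weight_space M mu (f mu)) /\
  m = \sum_(mu \in coset_set G) f mu.

Definition cuspidal M := exists G,
  graded_by M G /\
  exists d, forall mu, coset_set G mu -> dim_le (weight_space M mu) d.

Lemma weight_space_L M a (la : lattice pi a) mu m :
  weight_space M mu m -> weight_space M (a + mu) (lact (L_ la) m).
Proof.
rewrite /weight_space /= => wm.
have /eqP := lact_br (L_ (lattice0 pi)) (L_ la) m; rewrite eq_sym subr_eq => /eqP ->.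
rewrite wm (linear_funZ (lact_linr _)).
have -> : lie_br (L_ (lattice0 pi)) (L_ la) = sympl rho (a + rho) *: L_ la.
  rewrite /= /W_br bilin_dsum_single; apply: dsum_inj => /=.
  rewrite add0r scale1r /poisson_rule add0r.
  rewrite (linear_funZ (@single_linear _ _ _ a)) //.
rewrite (linear_funZ (lact_linl _)) -scalerDl; congr (_ *: _).
by rewrite /sympl !mxE; ring.
Qed.

End GradedModules.

Arguments weight_space {K N pi} M mu.

(* The restricted dual of M, graded by G: the direct sum of the duals of the  *)
(* M_mu is the space of linear forms on M vanishing on all but finitely many  *)
(* of the M_mu.                                                               *)
Section RestrictedDual.
Variables (K : numFieldType) (N : nat).
Local Notation vec := 'rV[K]_2.
Variable pi : {additive 'rV[int]_N -> vec}.
Variables (M : lieModule (W pi)) (G : coset pi).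
Implicit Types phi : M -> K^o.

Definition form_supp phi : set vec :=
  [set mu | coset_set G mu /\ exists2 m, weight_space M mu m & phi m != 0].

Definition rdual_pred : {pred M -> K^o} :=
  fun phi => `[< linear phi /\ finite_set (form_supp phi) >].

Lemma rdual_predP phi :
  reflect (linear phi /\ finite_set (form_supp phi)) (phi \in rdual_pred).
Proof. exact: asboolP. Qed.

Fact rdual_submod_closed : submod_closed rdual_pred.
Proof.
split=> [|a f g /rdual_predP[fl ff] /rdual_predP[gl gf]]; apply/rdual_predP.
  split; first by move=> c u v; rewrite /= scaler0 addr0.
  by apply: (@sub_finite_set _ _ set0) => // mu [_ [m _]] /=; rewrite eqxx.
split=> [c u v|].
  have E w : (a *: f + g) w = a *: f w + g w by [].
  by rewrite !E fl gl !scalerDr !scalerA [c * a]mulrC addrACA.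
apply: (@sub_finite_set _ _ (form_supp f `|` form_supp g)); last by rewrite finite_setU.
move=> mu [Gmu [m wm]]; have -> : (a *: f + g) m = a *: f m + g m by [].
have [f0|fn] := eqVneq (f m) 0; last by left; split=> //; exists m.
have [g0|gn] := eqVneq (g m) 0; last by right; split=> //; exists m.
by rewrite f0 g0 scaler0 addr0 eqxx.
Qed.

HB.instance Definition _ :=
  GRing.isSubmodClosed.Build K (M -> K^o) rdual_pred rdual_submod_closed.

Record rdual := RDual { rdual_fun :> M -> K^o; _ : rdual_fun \in rdual_pred }.

HB.instance Definition _ := [isSub for rdual_fun].
HB.instance Definition _ := [Choice of rdual by <:].
HB.instance Definition _ := [SubChoice_isSubLmodule of rdual by <:].

Lemma rdualP (phi : rdual) : linear phi /\ finite_set (form_supp phi).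
Proof. by case: phi => f /= /rdual_predP. Qed.

Definition contragr (x : W pi) phi : M -> K^o := fun m => - phi (lact x m).

Fact contragr_subproof x (phi : rdual) : contragr x phi \in rdual_pred.
Proof.
have phil := (rdualP phi).1.
have contr_lin y : linear (contragr y phi).
  by move=> c u v; rewrite /contragr lact_linr phil opprD scalerN.
elim/dsum_ind: x => [|x y Px Py|a la c].
- have -> : contragr (0 : W pi) phi = 0; last exact: rpred0.
  apply/funext => m; rewrite /contragr (linear_fun0 (lact_linl m)).
  by rewrite (linear_fun0 phil) oppr0.
- have -> : contragr (x + y : W pi) phi = contragr x phi + contragr y phi.
    apply/funext => m; rewrite /contragr (linear_funD (lact_linl m)).
    by rewrite (linear_funD phil) opprD.
  exact: rpredD.
have -> : dsum_single la c = (c : K) *: L_ la.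
  apply: dsum_inj; rewrite /= -(linear_funZ (@single_linear _ _ _ a)).
  by congr single; exact/esym/mulr1.
apply/rdual_predP; split; first exact: contr_lin.
apply: sub_finite_set (finite_image (fun mu => mu - a) (rdualP phi).2).
move=> mu [Gmu [m wm]]; rewrite /contragr (linear_funZ (lact_linl m)).
rewrite (linear_funZ phil) => phim; exists (a + mu); last by rewrite addrC addKr.
split; first exact: coset_stable.
exists (lact (L_ la) m); first exact: weight_space_L.
by apply: contraNneq phim => ->; rewrite scaler0 oppr0.
Qed.

Definition rdual_act (x : W pi) (phi : rdual) : rdual :=
  RDual (contragr_subproof x phi).

Fact rdual_act_linl (phi : rdual) : linear (rdual_act^~ phi).
Proof.
have phil := (rdualP phi).1.
move=> c x y; apply: val_inj; apply/funext => m /=.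
by rewrite /contragr lact_linl phil opprD -scalerN.
Qed.

Fact rdual_act_linr x : linear (rdual_act x).
Proof.
move=> c f g; apply: val_inj; apply/funext => m /=.
by rewrite /contragr [LHS]opprD -scalerN.
Qed.

Fact rdual_act_br x y (phi : rdual) :
  rdual_act (lie_br x y) phi =
  rdual_act x (rdual_act y phi) - rdual_act y (rdual_act x phi).
Proof.
have phil := (rdualP phi).1.
apply: val_inj; apply/funext => m /=; rewrite /contragr lact_br.
rewrite (linear_funD phil) (linear_funN phil) opprB.
transitivity (- - phi (lact y (lact x m)) - (- - phi (lact x (lact y m)))) => //.
by rewrite !opprK.
Qed.

Definition lmod_rdual : lieModule (W pi) :=
  LieModule rdual_act_linl rdual_act_linr rdual_act_br.

End RestrictedDual.

Section Models.
Variables (K : numFieldType) (N : nat).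
Local Notation vec := 'rV[K]_2.
Variable pi : {additive 'rV[int]_N -> vec}.

Definition rho_coset : coset pi := coset_at pi (- rho).

Definition L_mrho : S_mod rho_coset :=
  dsum_single (coset_at_refl pi (- rho)) (1 : K^o).

Lemma L_mrho_act x : lact x L_mrho = 0.
Proof.
elim/dsum_ind: x => [|x y Px Py|a la c].
- exact: linear_fun0 (lact_linl L_mrho).
- by rewrite (linear_funD (lact_linl L_mrho)) Px Py addr0.
rewrite /= /L_mrho bilin_dsum_single; apply: dsum_inj => /=.
rewrite /poisson_rule addNr /sympl !mxE !mulr0 subr0 scale0r scaler0.
exact: linear_fun0 (@single_linear _ _ _ _).
Qed.

Let line : set (S_mod rho_coset) := [set m | exists c : K, m = c *: L_mrho].

Let line0 : line 0. Proof. by exists 0; rewrite scale0r. Qed.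

Let lineP a m m' : line m -> line m' -> line (a *: m + m').
Proof.
by move=> [c ->] [d ->]; exists (a * c + d); rewrite scalerDl scalerA.
Qed.

Let line_act (x : W pi) m : line m -> line (lact x m).
Proof.
move=> [c ->]; exists 0.
by rewrite scale0r (linear_funZ (lact_linr x)) L_mrho_act scaler0.
Qed.

Definition C_L_mrho : lieSubmodule (S_mod rho_coset) :=
  @LieSubmodule _ _ (S_mod rho_coset) [set m | exists c : K, m = c *: L_mrho]
    line0 lineP line_act.

Definition S_quot : lieModule (W pi) := lmod_quot C_L_mrho.
Definition S_quot_dual : lieModule (W pi) := lmod_rdual S_quot rho_coset.

Variant model :=
  | ModelS of coset pi
  | ModelQuot
  | ModelQuotDual
  | ModelM of nat & coset pi.

Definition admissible (m : model) : Prop :=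
  match m with
  | ModelS G => ~ coset_set G (- rho) /\ ~ coset_set G (- (2 *: rho))
  | ModelM n _ => (2 <= n)%N
  | _ => True
  end.

Definition model_module (m : model) : lieModule (W pi) :=
  match m with
  | ModelS G => S_mod G
  | ModelQuot => S_quot
  | ModelQuotDual => S_quot_dual
  | ModelM n G => M_mod n G
  end.

End Models.

(* Main.v *)
Require Import Defs.
From mathcomp Require Import all_boot all_order all_algebra.
From mathcomp Require Import boolp classical_sets functions cardinality fsbigop.
From mathcomp Require Import vector falgebra mxpoly.
From mathcomp Require Import reals complex mpoly zify ring lra.

(** Write [r x] for [sympl rho (pi x)] and [om x y] for the symplectic form of
    [pi x] and [pi y]. The genericity hypothesis makes [r] injective on the
    lattice, so that a grading is a decomposition into eigenspaces of [L 0].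

    Why a simple cuspidal module is a module of binary forms. For a lattice
    vector [al] the operators [L (n al)], rescaled, satisfy the relations of
    the Witt algebra. In a module over the Witt algebra with weight spaces of
    bounded dimension, the products [e_x e_y] with [x + y] fixed form a
    polynomial of bounded degree in [x]: some iterated difference of them, a
    window, vanishes. Far from the weight zero the operators [e_n] have an
    asymptotic expansion ([E_expand]); windows decrease at infinity, so all
    traces of words containing a window vanish ([T_eq0]), products of windows
    are nilpotent and hence vanish ([PO_eq0]), and the identity [jacobi_Q]
    turns products of windows into single ones ([far_windows]). For large
    steps the operators are injective everywhere ([near_inj]), which carries
    the vanishing to the rest of the module ([good_windows]). Commutators with
    the other generators extend it to the products
    [L (l - i al) L (l' + i al)] for all [l] and [l'] ([lattice_windows]).

    The functions [y |-> L (y - x) v], up to finitely many values, therefore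
    lie in one space of finite dimension, and the module is described by
    matrices [D x] that depend polynomially on [x] ([exists_lmodel]). They
    satisfy the commutation rule of [degree_two]; in an irreducible model
    abelian ideals act by scalars, and this bounds the degree of [D] by two.
    The linear and the quadratic part of [D] are then combinations of an
    sl2-triple and a scalar ([sl2_structure]), and a row of lowest weight
    converts the model into binary forms of some degree [k] ([form_model]).

    If [k] is at least two, the fourth difference of products of two
    generators is the square of a quadratic form and does not depend on the
    label; irreducibility of the forms of degree [k] under sl2 makes the map
    onto ([iso_forms]). If [k] is zero, the weight spaces are lines and the
    labels that do not occur are determined ([rank_one_modules]). If [k] is
    one, contraction of a form with its label leads back to [k = 0], unless
    the module consists of differentials ([degree_one_modules]).

    Why the models differ. A homomorphism between two models is given by
    coefficient maps that intertwine the actions label by label, and whose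
    labels differ by a fixed multiple of [rho]. For weight lines the scalar by
    which [L (- j) L j] acts determines the label ([rank_one_shift]). For
    forms of degree at least two the fourth difference shows that the
    coefficient maps do not depend on the label and commute with sl2, so that
    the labels agree, and the Casimir operator gives the degree
    ([forms_iso_eq]). *)

Set Implicit Arguments.
Unset Strict Implicit.
Unset Printing Implicit Defensive.

Import Order.TTheory GRing.Theory Num.Theory.
Local Open Scope classical_set_scope.
Local Open Scope ring_scope.

(** * Identities in modules *)

Section ModuleIdentities.
Variables (K : pzRingType) (V : lmodType K).

(** Linear combinations of atoms, for deciding identities between them
    coefficient by coefficient. *)
Inductive mexp := MVar of nat | MZero | MAdd of mexp & mexp | MOpp of mexp | MScale of K & mexp.

Fixpoint mexp_val (env : seq V) (e : mexp) : V :=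
  match e with
  | MVar i => nth 0 env i
  | MZero => 0
  | MAdd a b => mexp_val env a + mexp_val env b
  | MOpp a => - mexp_val env a
  | MScale c a => c *: mexp_val env a
  end.

Fixpoint mcoef (i : nat) (e : mexp) : K :=
  match e with
  | MVar j => if eqn i j then 1 else 0
  | MZero => 0
  | MAdd a b => mcoef i a + mcoef i b
  | MOpp a => - mcoef i a
  | MScale c a => c * mcoef i a
  end.

Lemma mexp_valE env e : mexp_val env e = \sum_(i < size env) mcoef i e *: nth 0 env i.
Proof.
have mcoefV i j : mcoef i (MVar j) = (i == j)%:R by rewrite /= eqnE; case: eqP.
elim: e => [j| |a IHa b IHb|a IHa|c a IHa].
- under eq_bigr do rewrite mcoefV.
  have [js|js] := ltnP j (size env); last first.
    rewrite /= nth_default // big1 // => i _.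
    have /negPf -> : nat_of_ord i != j by apply: contraL js => /eqP <-; rewrite -ltnNge.
    by rewrite scale0r.
  rewrite (bigD1 (Ordinal js)) //= eqxx scale1r big1 ?addr0 // => i ij.
  have /negPf -> : nat_of_ord i != j by apply: contra ij => /eqP ij; apply/eqP/val_inj.
  by rewrite scale0r.
- by rewrite big1 // => i _; rewrite scale0r.
- by rewrite /= IHa IHb -big_split; apply: eq_bigr => i _; rewrite scalerDl.
- by rewrite /= IHa -sumrN; apply: eq_bigr => i _; rewrite scaleNr.
- by rewrite /= IHa scaler_sumr; apply: eq_bigr => i _; rewrite scalerA.
Qed.

Fixpoint mcoefs_eq (n : nat) (a b : mexp) : Prop :=
  if n is n'.+1 then mcoef n' a = mcoef n' b /\ mcoefs_eq n' a b else True.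

Lemma mod_eq env a b : mcoefs_eq (size env) a b -> mexp_val env a = mexp_val env b.
Proof.
have H n : mcoefs_eq n a b -> forall i, (i < n)%N -> mcoef i a = mcoef i b.
  elim: n => // n IH /= [Hn {}/IH H] i.
  by rewrite ltnS leq_eqVlt => /orP[/eqP->|/H].
by move/H => {}H; rewrite !mexp_valE; apply: eq_bigr => i _; rewrite H.
Qed.

End ModuleIdentities.

Ltac mod_add x env :=
  match env with
  | nil => constr:(x :: nil)
  | ?y :: _ => let _ := match goal with _ => unify x y end in env
  | ?y :: ?r => let r' := mod_add x r in constr:(y :: r')
  end.

Ltac mod_atoms V env t :=
  lazymatch t with
  | (?a + ?b)%R => let env' := mod_atoms V env a in mod_atoms V env' b
  | (- ?a)%R => mod_atoms V env a
  | (?c *: ?a)%R => mod_atoms V env a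
  | 0%R => env
  | _ => mod_add t env
  end.

Ltac mod_index x env :=
  match env with
  | ?y :: _ => let _ := match goal with _ => unify x y end in constr:(0%N)
  | _ :: ?r => let n := mod_index x r in constr:(n.+1)
  end.

Ltac mod_reify K V env t :=
  lazymatch t with
  | (?a + ?b)%R => let a' := mod_reify K V env a in let b' := mod_reify K V env b in
      constr:(@MAdd K a' b')
  | (- ?a)%R => let a' := mod_reify K V env a in constr:(@MOpp K a')
  | (?c *: ?a)%R => let a' := mod_reify K V env a in constr:(@MScale K c a')
  | 0%R => constr:(@MZero K)
  | _ => let n := mod_index t env in constr:(@MVar K n)
  end.

(** Reduces an identity between linear combinations to its coefficients. *)
Ltac modred K V :=
  lazymatch goal with
  | |- ?a = ?b =>
    let env := mod_atoms V (@nil V) a in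
    let env := mod_atoms V env b in
    let a' := mod_reify K V env a in
    let b' := mod_reify K V env b in
    refine (@mod_eq K V env a' b' _); cbn [mcoefs_eq mcoef size eqn]; do ?[split] => //
  end.

Ltac modring K V := modred K V; ring.

(** * Growth of sequences *)

(** All asymptotic statements are about positions [k] that tend to plus
    infinity. *)
Definition ev (P : int -> Prop) := exists K0 : int, forall k, K0 <= k -> P k.

Lemma ev_and P Q : ev P -> ev Q -> ev (fun k => P k /\ Q k).
Proof.
move=> [a Pa] [b Qb]; exists (Num.max a b) => k; rewrite ge_max => /andP[ak bk].
by split; [apply: Pa | apply: Qb].
Qed.

Lemma ev_imp (P Q : int -> Prop) : (forall k, P k -> Q k) -> ev P -> ev Q.
Proof. by move=> PQ [a Pa]; exists a => k /Pa/PQ. Qed.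

Lemma ev_imp2 (P Q S : int -> Prop) :
  (forall k, P k -> Q k -> S k) -> ev P -> ev Q -> ev S.
Proof. by move=> PQ eP eQ; apply: ev_imp (ev_and eP eQ) => k []; apply: PQ. Qed.

Lemma ev_shift (P : int -> Prop) c : ev P -> ev (fun k => P (k + c)).
Proof. by move=> [a Pa]; exists (a - c) => k ak; apply: Pa; lia. Qed.

Lemma ev_ge c : ev (fun k => c <= k).
Proof. by exists c. Qed.

Lemma ev_true (P : int -> Prop) : (forall k, P k) -> ev P.
Proof. by move=> H; exists 0 => k _. Qed.

Lemma ev_sym (T : Type) (f g : int -> T) : ev (fun k => f k = g k) -> ev (fun k => g k = f k).
Proof. exact: ev_imp. Qed.

Lemma ev_seq (T : eqType) (s : seq T) (P : T -> int -> Prop) :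
  (forall x, x \in s -> ev (P x)) -> ev (fun k => forall x, x \in s -> P x k).
Proof.
elim: s => [|x s IH] H; first exact: ev_true.
apply: ev_imp2 (H x (mem_head _ _)) (IH _) => [k Px Ps y|y ys].
  by rewrite inE => /orP[/eqP->|/Ps].
by apply: H; rewrite inE ys orbT.
Qed.

Lemma ev_nat n (P : nat -> int -> Prop) :
  (forall i, (i < n)%N -> ev (P i)) -> ev (fun k => forall i, (i < n)%N -> P i k).
Proof.
move=> H; apply: ev_imp (@ev_seq nat (iota 0 n) P _) => [k Pk i iN|i].
  by apply: Pk; rewrite mem_iota.
by rewrite mem_iota => /H.
Qed.

Section Growth.
Variable R : archiRealFieldType.
Implicit Types (g h : int -> R).

(** The exponent [a] may be negative; the estimates below need decay of every
    order. *)
Definition bO (a : int) g := exists C, 0 <= C /\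
  ev (fun k => 0 < k /\ g k <= C * k%:~R ^ a).

Let kge (k : int) : 0 < k -> 1 <= k%:~R :> R.
Proof. by move=> k0; rewrite ler1z; lia. Qed.

Lemma bO_le a b g : a <= b -> bO a g -> bO b g.
Proof.
move=> ab [C [C0 H]]; exists C; split=> //; apply: ev_imp H => k [k0 gk].
split=> //; apply: le_trans gk _; apply: ler_wpM2l => //.
exact: ler_weXz2l (kge k0) _ _ ab.
Qed.

Lemma bO_ev a g h : ev (fun k => h k <= g k) -> bO a g -> bO a h.
Proof.
move=> E [C [C0 H]]; exists C; split=> //; apply: ev_imp2 E H => k hg [k0 gk].
by split=> //; apply: le_trans gk.
Qed.

Lemma bO_eq a g h : (forall k, h k <= g k) -> bO a g -> bO a h.
Proof. by move=> hg; apply: bO_ev; apply: ev_true. Qed.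

Lemma bOD a g h : bO a g -> bO a h -> bO a (fun k => g k + h k).
Proof.
move=> [C [C0 H]] [C' [C0' H']]; exists (C + C'); split; first exact: addr_ge0.
by apply: ev_imp2 H H' => k [k0 gk] [_ hk]; split=> //; rewrite mulrDl lerD.
Qed.

Lemma bOM a b g h : (forall k, 0 <= g k) -> (forall k, 0 <= h k) ->
  bO a g -> bO b h -> bO (a + b) (fun k => g k * h k).
Proof.
move=> g0 h0 [C [C0 H]] [C' [C0' H']]; exists (C * C'); split; first exact: mulr_ge0.
apply: ev_imp2 H H' => k [k0 gk] [_ hk]; split=> //.
rewrite expfzDr ?intr_eq0; last by lia.
by rewrite mulrACA; apply: ler_pM.
Qed.

Lemma bO_const c : bO 0 (fun _ => c).
Proof.
exists `|c|; split=> //; exists 1 => k k1; split; first by lia.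
by rewrite expr0z mulr1 ler_norm.
Qed.

Lemma bO0 a : bO a (fun _ => 0).
Proof. by exists 0; split=> //; exists 1 => k k1; rewrite mul0r; split=> //; lia. Qed.

Lemma bOZ a c g : (forall k, 0 <= g k) -> bO a g -> bO a (fun k => c * g k).
Proof.
move=> g0 H; apply: (@bO_eq _ (fun k => `|c| * g k)) => [k|].
  by apply: ler_wpM2r => //; rewrite ler_norm.
by rewrite -[a]add0r; apply: bOM => //; apply: bO_const.
Qed.

Lemma bO_id : bO 1 (fun k => `|k%:~R|).
Proof.
exists 1; split=> //; exists 1 => k k1; split; first by lia.
by rewrite mul1r expr1z ger0_norm // ler0z; lia.
Qed.

Lemma bO_shift a g c : bO a g -> bO a (fun k => g (k + c)).
Proof.
move=> [C [C0 H]]; exists (C * 2 ^+ `|a|%N); split; first by rewrite mulr_ge0 ?exprn_ge0.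
apply: ev_imp2 (ev_shift c H) (ev_ge (1 + 2 * `|c|)) => k [kc0 gk] k1.
have k0 : 0 < k by lia.
split=> //; apply: le_trans gk _; rewrite -mulrA; apply: ler_wpM2l => //.
have K0 : 0 < k%:~R :> R by rewrite ltr0z.
have Kc0 : 0 < (k + c)%:~R :> R by rewrite ltr0z.
have A1 : (k + c)%:~R <= 2 * k%:~R :> R.
  by rewrite -[2]/(2%:~R) -intrM ler_int; lia.
have A2 : k%:~R <= 2 * (k + c)%:~R :> R.
  by rewrite -[2]/(2%:~R) -intrM ler_int; lia.
case: a {H} => n.
  rewrite absz_nat -!exprnP -exprMn; apply: lerXn2r => //; rewrite nnegrE; first exact: ltW.
  by rewrite mulr_ge0 // ltW.
rewrite NegzE abszN absz_nat -!exprnN.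
rewrite -[_^-1]mul1r ler_pdivrMr ?exprn_gt0 // mulrAC ler_pdivlMr ?exprn_gt0 //.
rewrite mul1r -exprMn; apply: lerXn2r => //; rewrite nnegrE; first exact: ltW.
by rewrite mulr_ge0 // ltW.
Qed.

(** A nonnegative periodic quantity that tends to zero vanishes; this is what
    turns the asymptotic estimates below into exact identities. *)
Lemma bO_periodic a g (N : int) : a < 0 -> 0 < N -> (forall k, 0 <= g k) ->
  ev (fun k => g (k + N) = g k) -> bO a g -> ev (fun k => g k = 0).
Proof.
move=> a0 N0 g0 [K1 HN] /(bO_le (_ : a <= -1)); case; first by lia.
move=> C [C0 [K2 H]]; exists (Num.max K1 K2) => k; rewrite ge_max => /andP[k1 k2].
apply/eqP/negPn/negP => gk.
have {}gk : 0 < g k by rewrite lt_def gk g0.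
have per (n : nat) : g (k + n%:Z * N) = g k.
  elim: n => [|n IH]; first by rewrite mul0r addr0.
  rewrite -IH -[in RHS]HN; first by congr g; lia.
  by nia.
have := archi_boundP (divr_ge0 C0 (ltW gk)); set n := Num.bound _ => Cn.
have [|p1 p2] := H (k + n.+1%:Z * N); first by nia.
move: p2; rewrite per exprN1 ler_pdivlMr ?ltr0z // mulrC -ler_pdivlMr // => p2.
have : (n%:R : R) < n%:R.
  apply: le_lt_trans (le_trans _ p2) Cn.
  by rewrite -[n%:R]/(n%:Z%:~R) ler_int; have [k0 _] := H k k2; nia.
by rewrite ltxx.
Qed.

End Growth.

(** * Symbols *)

Section MatrixGrowth.
Variables (R : realType) (D : nat).
Local Notation K := R[i].
Local Notation mx := 'M[K]_D.
Local Notation nm := (@ComplexField.Normc.normc R).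

Definition mnorm m n (A : 'M[K]_(m, n)) : R := \sum_i \sum_j nm (A i j).

Lemma nm_ge0 (z : K) : 0 <= nm z.
Proof. by case: z => a b; apply: sqrtr_ge0. Qed.

Lemma nmM : {morph nm : x y / x * y}.
Proof. exact: ComplexField.Normc.normcM. Qed.

Lemma nmN z : nm (- z) = nm z.
Proof. exact: normcN. Qed.

Lemma nm_sum (I : finType) (F : I -> K) : nm (\sum_i F i) <= \sum_i nm (F i).
Proof.
elim/big_ind2: _ => [|x1 x2 y1 y2 h1 h2|//]; first by rewrite ComplexField.Normc.normc0.
exact: le_trans (le_normcD _ _) (lerD h1 h2).
Qed.

Lemma nm_int (n : int) : nm n%:~R = `|n%:~R|.
Proof.
have H (p : nat) : nm p%:R = p%:R.
  by rewrite normcMn ComplexField.Normc.normc1.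
case: n => p; first by rewrite -pmulrn H ger0_norm.
by rewrite NegzE !mulrNz nmN normrN -!pmulrn H ger0_norm.
Qed.

Lemma mnorm_ge0 m n (A : 'M[K]_(m, n)) : 0 <= mnorm A.
Proof. by apply: sumr_ge0 => i _; apply: sumr_ge0 => j _; apply: nm_ge0. Qed.

Lemma mnormD m n (A B : 'M[K]_(m, n)) : mnorm (A + B) <= mnorm A + mnorm B.
Proof.
rewrite -big_split; apply: ler_sum => i _; rewrite -big_split; apply: ler_sum => j _.
by rewrite mxE; apply: le_normcD.
Qed.

Lemma mnormN m n (A : 'M[K]_(m, n)) : mnorm (- A) = mnorm A.
Proof. by apply: eq_bigr => i _; apply: eq_bigr => j _; rewrite mxE nmN. Qed.

Lemma mnormZ m n c (A : 'M[K]_(m, n)) : mnorm (c *: A) = nm c * mnorm A.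
Proof.
rewrite mulr_sumr; apply: eq_bigr => i _; rewrite mulr_sumr; apply: eq_bigr => j _.
by rewrite mxE nmM.
Qed.

Lemma mnorm0_eq m n (A : 'M[K]_(m, n)) : mnorm A = 0 -> A = 0.
Proof.
move=> /eqP; rewrite psumr_eq0 => [/allP H|i _]; last first.
  by apply: sumr_ge0 => j _; apply: nm_ge0.
apply/matrixP => i j; rewrite mxE; have := H i (mem_index_enum _).
rewrite psumr_eq0 => [/allP H'|l _]; last exact: nm_ge0.
by apply: ComplexField.Normc.eq0_normc; apply/eqP/H'/mem_index_enum.
Qed.

Lemma mnormM m n p (A : 'M[K]_(m, n)) (B : 'M[K]_(n, p)) :
  mnorm (A *m B) <= mnorm A * mnorm B.
Proof.
have row_le l : \sum_j nm (B l j) <= mnorm B.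
  rewrite /mnorm (bigD1 l) //= lerDl; apply: sumr_ge0 => i _.
  by apply: sumr_ge0 => j _; apply: nm_ge0.
rewrite [X in _ <= X * _]/mnorm mulr_suml; apply: ler_sum => i _.
apply: le_trans (_ : \sum_j \sum_l nm (A i l) * nm (B l j) <= _).
  apply: ler_sum => j _; rewrite mxE; apply: le_trans (nm_sum _) _.
  by apply: ler_sum => l _; rewrite nmM.
rewrite exchange_big mulr_suml; apply: ler_sum => l _.
by rewrite -mulr_sumr; apply: ler_wpM2l => //; apply: nm_ge0.
Qed.

Lemma nm_trace (A : mx) : nm (\tr A) <= mnorm A.
Proof.
apply: le_trans (nm_sum _) _; apply: ler_sum => i _.
by rewrite (bigD1 i) //= lerDl; apply: sumr_ge0 => j _; apply: nm_ge0.
Qed.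

Definition mO (a : int) (f : int -> mx) := bO a (fun k => mnorm (f k)).

Lemma mO_ev a f g : ev (fun k => f k = g k) -> mO a f -> mO a g.
Proof. by move=> E; apply: bO_ev; apply: ev_imp E => k ->. Qed.

Lemma mO_le a b f : a <= b -> mO a f -> mO b f.
Proof. exact: bO_le. Qed.

Lemma mO0 a : mO a (fun _ => 0).
Proof. by apply: bO_eq (bO0 _ a) => k; rewrite /mnorm big1 // => i _; rewrite big1 // => j _; rewrite mxE ComplexField.Normc.normc0. Qed.

Lemma mOD a f g : mO a f -> mO a g -> mO a (fun k => f k + g k).
Proof. by move=> F G; apply: bO_eq (bOD F G) => k; apply: mnormD. Qed.

Lemma mON a f : mO a f -> mO a (fun k => - f k).
Proof. by apply: bO_eq => k; rewrite mnormN. Qed.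

Lemma mOB a f g : mO a f -> mO a g -> mO a (fun k => f k - g k).
Proof. by move=> F /mON; apply: mOD. Qed.

Lemma mOM a b f g : mO a f -> mO b g -> mO (a + b) (fun k => f k *m g k).
Proof.
move=> F G; apply: bO_eq (bOM _ _ F G) => k; [exact: mnormM | exact: mnorm_ge0..].
Qed.

Lemma mO_const A : mO 0 (fun _ => A).
Proof. exact: bO_const. Qed.

Lemma mOZ a c f : mO a f -> mO a (fun k => c *: f k).
Proof.
by move=> F; apply: bO_eq (bOZ (nm c) _ F) => k; rewrite ?mnormZ ?mnorm_ge0.
Qed.

Lemma mO_shift a f c : mO a f -> mO a (fun k => f (k + c)).
Proof. exact: bO_shift. Qed.

Lemma mnorm_scalar c : mnorm (c%:M : mx) = D%:R * nm c.
Proof.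
rewrite /mnorm (eq_bigr (fun _ => nm c)) => [|i _].
  by rewrite sumr_const card_ord mulr_natl.
rewrite (bigD1 i) //= mxE eqxx mulr1n big1 ?addr0 // => j ji.
by rewrite mxE eq_sym (negPf ji) mulr0n ComplexField.Normc.normc0.
Qed.

Lemma mO_kap (s : K) : mO 1 (fun k => (s + k%:~R)%:M).
Proof.
have H : bO 1 (fun k => D%:R * (nm s + `|k%:~R : R|)).
  apply: bOZ => [k|]; first by rewrite addr_ge0 // nm_ge0.
  by apply: bOD (@bO_id _); apply: bO_le (bO_const (nm s)).
apply: bO_eq H => k; rewrite mnorm_scalar; apply: ler_wpM2l => //.
by apply: le_trans (le_normcD _ _) _; rewrite nm_int.
Qed.

Lemma ev_kap_big (s : K) (B : R) : ev (fun k => B < nm (s + k%:~R)).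
Proof.
have := archi_boundP (_ : 0 <= `|B| + nm s); set N := Num.bound _ => HN.
exists N%:Z => k Nk; have := HN (addr_ge0 (normr_ge0 _) (nm_ge0 _)) => {}HN.
have E : nm (k%:~R : K) <= nm (s + k%:~R) + nm s.
  apply: le_trans (_ : nm ((s + k%:~R) - s) <= _); first by rewrite addrC addKr.
  by apply: le_trans (le_normcD _ _) _; rewrite nmN.
have E2 : (N%:R : R) <= nm (k%:~R : K).
  by rewrite nm_int ger0_norm ?ler0z; [rewrite -[N%:R]/(N%:Z%:~R) ler_int | lia].
have := ler_norm B; lra.
Qed.

Lemma ev_kap_neq0 (s : K) : ev (fun k => s + k%:~R != 0).
Proof.
apply: ev_imp (ev_kap_big s 0) => k; apply: contraTneq => ->.
by rewrite ComplexField.Normc.normc0 ltxx.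
Qed.

Lemma nmV (z : K) : nm z^-1 = (nm z)^-1.
Proof. exact: ComplexField.Normc.normcV. Qed.

Lemma mO_kapV (s : K) : mO (-1) (fun k => (s + k%:~R)^-1%:M).
Proof.
exists (D%:R * 2); split; first by rewrite mulr_ge0.
have H := ev_kap_big s 0.
have := archi_boundP (_ : 0 <= 2 * nm s); set N := Num.bound _ => HN.
apply: ev_imp2 H (ev_ge (N%:Z + 1)) => k k0 Nk.
have {}HN := HN (mulr_ge0 (ler0n _ 2) (nm_ge0 _)).
split; first by lia.
rewrite mnorm_scalar nmV -mulrA exprN1; apply: ler_wpM2l => //.
have kk : (k%:~R : R) <= nm (s + k%:~R) + nm s.
  rewrite -[k%:~R]ger0_norm ?ler0z -?nm_int; last by lia.
  apply: le_trans (_ : nm ((s + k%:~R) - s) <= _); first by rewrite addrC addKr.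
  by apply: le_trans (le_normcD _ _) _; rewrite nmN.
have Nk' : (N%:R : R) <= k%:~R by rewrite -[N%:R]/(N%:Z%:~R) ler_int; lia.
have k0' : 0 < k%:~R :> R by rewrite ltr0z; lia.
rewrite -[_^-1]mul1r ler_pdivrMr // mulrAC ler_pdivlMr //; lra.
Qed.

Definition dn (f : int -> int -> mx) n k := f (n + 1) k - f n k.
Definition dk (f : int -> int -> mx) n k := f n (k + 1) - f n k.

(** A family is a symbol of order [a] to depth [J] when each of up to [J]
    differences, in the index or in the position, lowers its growth by one. *)
Fixpoint Sym J (a : int) (f : int -> int -> mx) : Prop :=
  (forall n, mO a (f n)) /\
  if J is J'.+1 then Sym J' (a - 1) (dn f) /\ Sym J' (a - 1) (dk f) else True.

Lemma Sym_mO J a f : Sym J a f -> forall n, mO a (f n).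
Proof. by case: J => [|J] []. Qed.

Lemma Sym_ev J a f g : (forall n, ev (fun k => f n k = g n k)) ->
  Sym J a f -> Sym J a g.
Proof.
elim: J a f g => [|J IH] a f g E [F H]; (split; [move=> n; exact: mO_ev (E n) (F n) | ]) => //.
case: H => Hn Hk; split.
  apply: IH Hn => n; apply: ev_imp2 (E n) (E (n + 1)) => k.
  by rewrite /dn => -> ->.
apply: IH Hk => n; apply: ev_imp2 (E n) (ev_shift 1 (E n)) => k.
by rewrite /dk => -> ->.
Qed.

Lemma Sym_eq J a f g : (forall n k, f n k = g n k) -> Sym J a f -> Sym J a g.
Proof. by move=> E; apply: Sym_ev => n; apply: ev_true. Qed.

Lemma Sym_pred J a f : Sym J.+1 a f -> Sym J a f.
Proof.
elim: J a f => [|J IH] a f [F [Hn Hk]]; split=> //.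
by split; apply: IH.
Qed.

Lemma SymD J a f g : Sym J a f -> Sym J a g -> Sym J a (fun n k => f n k + g n k).
Proof.
elim: J a f g => [|J IH] a f g [F H] [G H']; (split; [move=> n; exact: mOD | ]) => //.
case: H => Hn Hk; case: H' => Hn' Hk'; split.
  by apply: Sym_eq (IH _ _ _ Hn Hn') => n k; rewrite /dn opprD addrACA.
by apply: Sym_eq (IH _ _ _ Hk Hk') => n k; rewrite /dk opprD addrACA.
Qed.

Lemma SymN J a f : Sym J a f -> Sym J a (fun n k => - f n k).
Proof.
elim: J a f => [|J IH] a f [F H]; (split; [move=> n; exact: mON | ]) => //.
case: H => Hn Hk; split.
  by apply: Sym_eq (IH _ _ Hn) => n k; rewrite /dn opprD.
by apply: Sym_eq (IH _ _ Hk) => n k; rewrite /dk opprD.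
Qed.

Lemma Sym_shift J a f c d : Sym J a f -> Sym J a (fun n k => f (n + c) (k + d)).
Proof.
elim: J a f => [|J IH] a f [F H]; (split; [move=> n; exact: mO_shift (F _) | ]) => //.
case: H => Hn Hk; split.
  by apply: Sym_eq (IH _ _ Hn) => n k; rewrite /dn addrAC.
by apply: Sym_eq (IH _ _ Hk) => n k; rewrite /dk addrAC.
Qed.

Lemma Sym_anti J a f c d : Sym J a f -> Sym J a (fun i k => f (c - i) (k + (d + i))).
Proof.
elim: J a f c d => [|J IH] a f c d [F H]; (split; [move=> n; exact: mO_shift (F _) | ]) => //.
case: H => Hn Hk; split.
  apply: Sym_eq (SymD (SymN (IH _ _ (c - 1) (d + 1) Hn)) (IH _ _ c d Hk)) => n k.
  rewrite /dn /dk opprB.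
  have -> : c - 1 - n + 1 = c - n by lia.
  have -> : c - 1 - n = c - (n + 1) by lia.
  have -> : k + (d + 1 + n) = k + (d + (n + 1)) by lia.
  have -> : k + (d + n) + 1 = k + (d + (n + 1)) by lia.
  by rewrite addrA subrK.
by apply: Sym_eq (IH _ _ c d Hk) => n k; rewrite /dk [k + 1 + _]addrAC.
Qed.

Lemma SymM J a b f g : Sym J a f -> Sym J b g ->
  Sym J (a + b) (fun n k => f n k *m g n k).
Proof.
elim: J a b f g => [|J IH] a b f g F G; (split; first by move=> n; apply: mOM (Sym_mO F n) (Sym_mO G n)) => //.
have F' := Sym_pred F; have G' := Sym_pred G.
case: F => _ [Fn Fk]; case: G => _ [Gn Gk]; split.
  have A := IH _ _ _ _ Fn (Sym_shift 1 0 G').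
  have B := IH _ _ _ _ F' Gn.
  have -> : a + b - 1 = a - 1 + b by lia.
  have E : a + (b - 1) = a - 1 + b by lia.
  rewrite E in B; apply: Sym_eq (SymD A B) => n k.
  by rewrite /dn addr0 mulmxBl mulmxBr addrA subrK.
have A := IH _ _ _ _ Fk (Sym_shift 0 1 G').
have B := IH _ _ _ _ F' Gk.
have -> : a + b - 1 = a - 1 + b by lia.
have E : a + (b - 1) = a - 1 + b by lia.
rewrite E in B; apply: Sym_eq (SymD A B) => n k.
by rewrite /dk addr0 mulmxBl mulmxBr addrA subrK.
Qed.

Lemma Sym0 J a : Sym J a (fun _ _ => 0).
Proof.
elim: J a => [|J IH] a; (split; [move=> n; exact: mO0 | ]) => //.
by split; apply: Sym_eq (IH _) => n k; rewrite /dn /dk subrr.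
Qed.

Lemma Sym_const J A : Sym J 0 (fun _ _ => A).
Proof.
case: J => [|J]; (split; [move=> n; exact: mO_const | ]) => //.
by split; apply: Sym_eq (Sym0 J _) => n k; rewrite /dn /dk subrr.
Qed.

Lemma Sym_n J (c : K) : Sym J 1 (fun n k => (n%:~R + c)%:M).
Proof.
case: J => [|J]; (split; [move=> n; exact: mO_le (mO_const _) | ]) => //.
split.
  apply: Sym_eq (Sym_const J 1%:M) => n k; rewrite /dn -raddfB /=; congr _%:M.
  by rewrite intrD; ring.
by apply: Sym_eq (Sym0 J _) => n k; rewrite /dk subrr.
Qed.

Lemma Sym_kap J (s : K) : Sym J 1 (fun n k => (s + k%:~R)%:M).
Proof.
case: J => [|J]; (split; [move=> n; exact: mO_kap | ]) => //.
split; first by apply: Sym_eq (Sym0 J _) => n k; rewrite /dn subrr.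
apply: Sym_eq (Sym_const J 1%:M) => n k; rewrite /dk -raddfB /=; congr _%:M.
by rewrite intrD; ring.
Qed.

Lemma Sym_kapV J (s : K) : Sym J (-1) (fun n k => (s + n%:~R + k%:~R)^-1%:M).
Proof.
elim: J s => [|J IH] s; (split; [move=> n; exact: mO_kapV | ]) => //.
have H : Sym J (-1 - 1) (fun n k => - ((s + n%:~R + k%:~R)^-1%:M *m (s + 1 + n%:~R + k%:~R)^-1%:M)).
  exact: SymN (SymM (IH s) (IH (s + 1))).
have E n : ev (fun k => s + n%:~R + k%:~R != 0 /\ s + 1 + n%:~R + k%:~R != 0).
  exact: ev_and (ev_kap_neq0 _) (ev_kap_neq0 _).
split; apply: Sym_ev H => n; apply: ev_imp (E n) => k [h1 h2].
all: rewrite /dn /dk -scalar_mxM -raddfB /= -raddfN /= ; congr _%:M; rewrite ?intrD.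
  have -> : s + (n%:~R + 1%:~R) + k%:~R = s + 1 + n%:~R + k%:~R by ring.
  by field; rewrite h1 h2.
have -> : s + n%:~R + (k%:~R + 1%:~R) = s + 1 + n%:~R + k%:~R by ring.
by field; rewrite h1 h2.
Qed.

End MatrixGrowth.

Fixpoint wd (V : zmodType) m (F : int -> V) (n : int) : V :=
  if m is m'.+1 then wd m' F n - wd m' F (n + 1) else F n.

Section Differences.
Variable V : zmodType.
Implicit Types (F G : int -> V).

Lemma eq_wd m F G : (forall n, F n = G n) -> forall n, wd m F n = wd m G n.
Proof. by move=> E; elim: m => [|m IH] n //=; rewrite !IH. Qed.

Lemma wdD m F G n : wd m (fun i => F i + G i) n = wd m F n + wd m G n.
Proof. by elim: m n => [|m IH] n //=; rewrite !IH opprD addrACA. Qed.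

Lemma wdN m F n : wd m (fun i => - F i) n = - wd m F n.
Proof. by elim: m n => [|m IH] n //=; rewrite !IH opprD. Qed.

Lemma wdB m F G n : wd m (fun i => F i - G i) n = wd m F n - wd m G n.
Proof. by rewrite wdD wdN. Qed.

Lemma wd_shift m F c n : wd m (fun i => F (i + c)) n = wd m F (n + c).
Proof. by elim: m n => [|m IH] n //=; rewrite !IH addrAC. Qed.

Lemma wdSr m F n : wd m.+1 F n = wd m (fun i => F i - F (i + 1)) n.
Proof. by rewrite wdB wd_shift. Qed.

Lemma wd_const m c n : wd m.+1 (fun _ => c : V) n = 0.
Proof. by elim: m n => [|m IH] n /=; [rewrite subrr | rewrite /= in IH; rewrite !IH subrr]. Qed.

End Differences.

Section SymbolDifferences.
Variables (R : realType) (D : nat).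
Local Notation mx := 'M[R[i]]_D.

Lemma Sym_wd J a (f : int -> int -> mx) n :
  Sym J a f -> mO (a - J%:Z) (fun k => wd J (fun i => f i k) n).
Proof.
elim: J a f n => [|J IH] a f n.
  by move=> [H _]; apply: mO_le (H n); lia.
move=> [_ [Hn _]]; have := mON (IH _ _ n Hn).
have -> : a - 1 - J%:Z = a - J.+1%:Z by lia.
apply: mO_ev; apply: ev_true => k; rewrite wdSr -wdN.
by apply: eq_wd => i; rewrite /dn opprB.
Qed.

End SymbolDifferences.

(** * Expansions at infinity of modules over the Witt algebra *)

Section MoreSymbols.
Variables (R : realType) (D : nat).
Local Notation K := R[i].
Local Notation mx := 'M[K]_D.
Local Notation nm := (@ComplexField.Normc.normc R).

(** Fixing the index keeps the order, as only the differences in the position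
    remain. *)
Lemma Sym_fix J a j (f : int -> int -> mx) : Sym J a f -> Sym J a (fun n k => f j k).
Proof.
elim: J a f => [|J IH] a f [F H]; (split; [by move=> n; exact: F | ]) => //.
case: H => Hn Hk; split; first by apply: Sym_eq (@Sym0 _ _ J _) => n k; rewrite /dn subrr.
by apply: Sym_eq (IH _ _ Hk) => n k.
Qed.

Lemma Sym_diag J a (f : int -> int -> mx) : Sym J a f -> Sym J a (fun n k => f n (k + n)).
Proof.
elim: J a f => [|J IH] a f [F H]; (split; [by move=> n; exact: mO_shift (F _) | ]) => //.
case: H => Hn Hk; split.
  apply: Sym_eq (SymD (Sym_shift 0 1 (IH _ _ Hn)) (IH _ _ Hk)) => n k.
  rewrite /dn /dk addr0 [k + 1 + n]addrAC -[k + n + 1]addrA.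
  exact: subrKA.
by apply: Sym_eq (IH _ _ Hk) => n k; rewrite /dk [k + 1 + n]addrAC.
Qed.

Lemma Sym_sum J a p (f : 'I_p -> int -> int -> mx) :
  (forall i, Sym J a (f i)) -> Sym J a (fun n k => \sum_i f i n k).
Proof.
elim: p f => [|p IH] f H.
  by apply: Sym_eq (@Sym0 _ _ J a) => n k; rewrite big_ord0.
apply: Sym_eq (SymD (H ord0) (IH _ (fun i => H (lift ord0 i)))) => n k.
by rewrite big_ord_recl.
Qed.

(** A recurrence with small error carries smallness from [J] consecutive
    indices to all indices. *)
Lemma small_extend2 J c n1 (g : int -> int -> mx) :
  (forall n, mO c (fun k => wd J (fun i => g i k) n)) ->
  (forall n, n1 <= n < n1 + J%:Z -> mO c (g n)) -> forall n, mO c (g n).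
Proof.
elim: J g => [|J IH] g Hw Hg; first exact: Hw.
have Hh : forall n, mO c (fun k => g n k - g (n + 1) k).
  apply: (IH (fun n k => g n k - g (n + 1) k)) => n.
    by apply: mO_ev (Hw n); apply: ev_true => k; rewrite wdSr.
  by move=> n1n; apply: mOB; apply: Hg; lia.
have up (p : nat) : mO c (g (n1 + p%:Z)).
  elim: p => [|p IHp]; first by apply: Hg; lia.
  apply: mO_ev (mOB IHp (Hh (n1 + p%:Z))); apply: ev_true => k.
  have -> : n1 + p.+1%:Z = n1 + p%:Z + 1 by lia.
  by rewrite opprB addrC subrK.
have dw (p : nat) : mO c (g (n1 - p%:Z)).
  elim: p => [|p IHp]; first by apply: Hg; lia.
  apply: mO_ev (mOD (Hh (n1 - p.+1%:Z)) IHp); apply: ev_true => k.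
  have -> : n1 - p.+1%:Z + 1 = n1 - p%:Z by lia.
  by rewrite subrK.
move=> n; have [h|h] := leP n1 n.
  by have := up `|n - n1|%N; congr (mO _ (g _)); lia.
by have := dw `|n - n1|%N; congr (mO _ (g _)); lia.
Qed.

Lemma ev_const (T : Type) (h : int -> T) :
  ev (fun k => h k = h (k - 1)) -> exists Y, ev (fun k => h k = Y).
Proof.
move=> [k0 H]; exists (h k0); exists k0 => k k0k.
have -> : k = k0 + `|k - k0|%N%:Z by lia.
elim: `|k - k0|%N => [|p IH]; first by rewrite addr0.
rewrite H; last by lia.
by rewrite -IH; congr h; lia.
Qed.

End MoreSymbols.

Section FarWitt.
Variables (R : realType) (D : nat).
Local Notation K := R[i].
Local Notation mx := 'M[K]_D.
Local Notation nm := (@ComplexField.Normc.normc R).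
Variables (s : K) (E : int -> int -> mx).
Local Notation kap k := (s + k%:~R).
Hypothesis E_br : forall n m, ev (fun k =>
  E n (k + m) *m E m k - E m (k + n) *m E n k = (m - n)%:~R *: E (n + m) k).
Hypothesis E_0 : ev (fun k => E 0 k = (kap k)%:M).
Hypothesis E_m1 : ev (fun k => E (-1) k = (kap k)%:M).

Definition psi (i : nat) (n k : int) : K :=
  \prod_(l < i) ((n%:~R + 1 - l%:R) * (kap k + n%:~R - l%:R)^-1).

Lemma psi0 n k : psi 0 n k = 1.
Proof. by rewrite /psi big_ord0. Qed.

Lemma psiS i n k : psi i.+1 n k = psi i n k * ((n%:~R + 1 - i%:R) * (kap k + n%:~R - i%:R)^-1).
Proof. by rewrite /psi big_ord_recr. Qed.

Lemma psi_eq0 i p k : (p < i)%N -> psi i (p%:Z - 1) k = 0.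
Proof.
move=> pi; rewrite /psi (bigD1 (Ordinal pi)) //=.
by rewrite intrB subrK -pmulrn subrr !mul0r.
Qed.

Lemma psi_Sym J i : Sym J 0 (fun n k => (psi i n k)%:M : mx).
Proof.
elim: i => [|i IH].
  by apply: Sym_eq (Sym_const J 1%:M) => n k; rewrite psi0.
apply: Sym_eq (SymM IH (SymM (Sym_n _ J (1 - i%:R)) (Sym_kapV D J (s - i%:R)))) => n k.
rewrite -!scalar_mxM psiS; congr (_ * (_ * _^-1))%:M; ring.
Qed.

Lemma psi_mO i n : mO (- i%:Z) (fun k => (psi i n k)%:M : mx).
Proof.
elim: i => [|i IH].
  by apply: mO_ev (mO_const 1%:M); apply: ev_true => k; rewrite psi0.
have H : mO (- i%:Z + -1) (fun k => (psi i n k)%:M *m ((n%:~R + 1 - i%:R) *: (kap k + n%:~R - i%:R)^-1%:M) : mx).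
  apply: mOM => //; apply: mOZ; apply: mO_ev (mO_kapV D (s + n%:~R - i%:R)).
  by apply: ev_true => k; congr (_^-1)%:M; ring.
have -> : - i.+1%:Z = - i%:Z + -1 by lia.
by apply: mO_ev H; apply: ev_true => k; rewrite psiS scale_scalar_mx -scalar_mxM.
Qed.

(** The functions [psi i] solve the recurrence that the relation [[e_(-1),
    e_n] = (n + 1) e_(n - 1)] imposes. *)
Lemma psi_rec i n k : (forall l, (l < i.+1)%N -> kap k + n%:~R - l%:R != 0) ->
  (kap k + n%:~R) * kap k * psi i n k - kap k * kap (k - 1) * psi i n (k - 1) =
  (n%:~R + 1) * kap k * psi i (n - 1) k.
Proof.
move=> nz.
have nz' l : (l < i)%N -> kap k + n%:~R - 1 - l%:R != 0.
  move=> li; have := nz l.+1 li; congr (_ != 0); rewrite -natr1; ring.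
have q1 : psi i n (k - 1) * (kap k + n%:~R - i%:R) = psi i n k * (kap k + n%:~R).
  rewrite /psi; elim: i nz {nz'} => [|i IH] nz; first by rewrite !big_ord0 subr0.
  rewrite !big_ord_recr /=.
  have h1 := nz i (leqW (leqnn _)); have h2 := nz i.+1 (leqnn _).
  have -> : kap (k - 1) + n%:~R - i%:R = kap k + n%:~R - i.+1%:R.
    by rewrite intrB -natr1; ring.
  have {IH} := IH (fun l li => nz l (leqW li)).
  set P := \prod_(l < i) _; set Q := \prod_(l < i) _ => IH.
  set a := _ - i%:R in h1 IH *; set b := _ - i.+1%:R in h2 *.
  transitivity (P * a * ((n%:~R + 1 - i%:R) / a)); first by field; rewrite h1 h2.
  by rewrite IH; field.
have q2 : (n%:~R + 1) * psi i (n - 1) k * (kap k + n%:~R - i%:R) =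
    psi i n k * (n%:~R + 1 - i%:R) * (kap k + n%:~R).
  rewrite /psi; elim: i nz {nz' q1} => [|i IH] nz; first by rewrite !big_ord0 !subr0; ring.
  rewrite !big_ord_recr /=.
  have h1 := nz i (leqW (leqnn _)); have h2 := nz i.+1 (leqnn _).
  have -> : (n - 1)%:~R + 1 - i%:R = n%:~R + 1 - i.+1%:R :> K.
    by rewrite intrB -natr1; ring.
  have -> : kap k + (n - 1)%:~R - i%:R = kap k + n%:~R - i.+1%:R.
    by rewrite intrB -natr1; ring.
  have {IH} := IH (fun l li => nz l (leqW li)).
  set P := \prod_(l < i) _; set Q := \prod_(l < i) _ => IH.
  set a := _ + _ - i%:R in h1 IH *; set b := _ + _ - i.+1%:R in h2 *.
  transitivity ((n%:~R + 1) * P * a * ((n%:~R + 1 - i.+1%:R) / a)); first by field; rewrite h1 h2.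
  by rewrite IH; field.
have n0 : kap k + n%:~R - i%:R != 0 by apply: nz.
apply: (mulIf n0); rewrite mulrBl.
have -> : (n%:~R + 1) * kap k * psi i (n - 1) k * (kap k + n%:~R - i%:R) =
   kap k * ((n%:~R + 1) * psi i (n - 1) k * (kap k + n%:~R - i%:R)) by ring.
rewrite q2.
have -> : kap k * kap (k - 1) * psi i n (k - 1) * (kap k + n%:~R - i%:R) =
   kap k * kap (k - 1) * (psi i n (k - 1) * (kap k + n%:~R - i%:R)) by ring.
rewrite q1 intrB; ring.
Qed.

Lemma psi_top p k : (forall l, (l < p.+1)%N -> kap k + p%:R - l%:R != 0) ->
  kap k * psi p.+1 p%:Z k * (\prod_(l < p) (kap k + p%:R - l%:R)) = (p.+1)`!%:R.
Proof.
move=> nz; rewrite /psi big_ord_recr /= -pmulrn.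
have -> : kap k + p%:R - p%:R = kap k by ring.
have -> : p%:R + 1 - p%:R = 1 :> K by ring.
have k0 : kap k != 0 by have := nz p (leqnn _); rewrite addrK.
have -> : kap k * (\prod_(l < p) ((p%:R + 1 - l%:R) / (kap k + p%:R - l%:R)) * (1 / kap k)) *
   (\prod_(l < p) (kap k + p%:R - l%:R)) =
   \prod_(l < p) ((p%:R + 1 - l%:R) / (kap k + p%:R - l%:R) * (kap k + p%:R - l%:R)).
  rewrite [RHS]big_split /=; set P := \prod_(l < p) _; set Q := \prod_(l < p) _.
  by field.
rewrite (eq_bigr (fun l : 'I_p => ((p.+1 - l)%N)%:R)); last first.
  move=> l _; rewrite divfK; last by apply: nz; have := ltn_ord l; lia.
  by rewrite natrB ?natr1 // ; have := ltn_ord l; lia.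
have {nz k0} : forall q, (q <= p)%N -> (\prod_(l < q) ((p.+1 - l)%N)%:R * ((p.+1 - q)`!)%:R = (p.+1)`!%:R :> K).
  elim=> [|q IH] qp; first by rewrite big_ord0 mul1r subn0.
  rewrite big_ord_recr /= -mulrA -natrM -IH; last by lia.
  congr (_ * _%:R); have -> : (p.+1 - q = (p.+1 - q.+1).+1)%N by lia.
  by rewrite factS.
by move=> /(_ p (leqnn _)); rewrite subSnn mulr1.
Qed.

Lemma ev_nz n i : ev (fun k => forall l, (l < i)%N -> kap k + n%:~R - l%:R != 0).
Proof.
apply: ev_nat => l _; apply: ev_imp (ev_kap_neq0 (s + n%:~R - l%:R)) => k.
by congr (_ != 0); ring.
Qed.

(** A partial sum of the expansion of [e_n] in the functions [psi i], with
    constant matrices as coefficients. *)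
Definition trunc (X : nat -> mx) I n k := kap k *: \sum_(i < I.+1) psi i n k *: X i.

Lemma trunc_Sym J X I : Sym J 1 (trunc X I).
Proof.
have H : Sym J (1 + (0 + 0)) (fun n k => (kap k)%:M *m \sum_(i < I.+1) ((psi i n k)%:M *m X i)).
  apply: SymM (Sym_kap _ _ _) _; apply: Sym_sum => i.
  by have := SymM (psi_Sym J i) (Sym_const J (X i)); rewrite addr0.
apply: Sym_eq H => n k; rewrite mul_scalar_mx /trunc; congr (_ *: _).
by apply: eq_bigr => i _; rewrite mul_scalar_mx.
Qed.

(** In the gauge where [e_(-1)] is scalar every [e_n] with [n >= -1] is a
    rational function of the position, determined by constant matrices. *)
Lemma E_trunc I : exists X, [/\ X 0%N = 1%:M &
  forall p, (p <= I)%N -> ev (fun k => E (p%:Z - 1) k = trunc X I (p%:Z - 1) k)].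
Proof.
elim: I => [|I [X [X0 HX]]].
  exists (fun _ => 1%:M); split=> // p; rewrite leqn0 => /eqP->.
  apply: ev_imp E_m1 => k; rewrite sub0r => ->.
  by rewrite /trunc big_ord1 psi0 scale1r scale_scalar_mx mulr1.
pose Pi k := \prod_(l < I) (kap k + I%:R - l%:R).
pose G k := E I%:Z k - trunc X I I%:Z k.
have EG : ev (fun k => (kap k + I%:R) *: G k = kap k *: G (k - 1)).
  have e1 := E_br (-1) I%:Z.
  have e2 := ev_shift I%:Z E_m1.
  have e3 := HX I (leqnn _).
  have e4 := ev_nz I%:Z I.+2.
  apply: ev_imp2 (ev_and e4 (ev_and E_m1 e1)) (ev_and e2 e3) => k [nz [em1 br]] [em1' eI].
  move: br; rewrite em1 em1' mul_scalar_mx mul_mx_scalar.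
  have -> : -1 + I%:Z = I%:Z - 1 by lia.
  rewrite eI opprK => br.
  rewrite /G !scalerBr.
  have -> : (kap k + I%:R) *: E I%:Z k = kap k *: E I%:Z (k - 1) + (I%:~R + 1) *: trunc X I (I%:Z - 1) k.
    have -> : I%:~R + 1 = (I%:Z + 1)%:~R :> K by rewrite intrD.
    rewrite -br [RHS]addrC subrK.
    by rewrite intrD -pmulrn addrA.
  rewrite -addrA; congr (_ + _); rewrite /trunc !scalerA !scaler_sumr -!sumrN -!big_split.
  apply: eq_bigr => i _ /=; rewrite !scalerA -!scaleNr -!scalerDl; congr (_ *: _).
  have := @psi_rec i I%:Z k _; rewrite -pmulrn => H.
  rewrite -H; first by rewrite /GRing.scale /=; ring.
  by move=> l li; apply: nz; have := ltn_ord i; lia.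
have [Y HY] : exists Y, ev (fun k => Pi k *: G k = Y).
  apply: ev_const; apply: ev_imp2 EG (ev_kap_neq0 s) => k + k0.
  rewrite /Pi; case: (I) => [|J].
    by rewrite !big_ord0 addr0 !scale1r => /(scalerI k0).
  move=> H; rewrite big_ord_recl big_ord_recr /= subr0 mulrC -!scalerA H !scalerA.
  congr (_ *: _); congr (_ * _).
    by apply: eq_bigr => l _; rewrite /bump /= add1n intrB -!natr1; ring.
  by rewrite intrB -natr1; ring.
pose Y' := (I.+1`!%:R : K)^-1 *: Y.
exists (fun i => if i == I.+1 then Y' else X i); split=> // p.
have trE n k : trunc (fun i => if i == I.+1 then Y' else X i) I.+1 n k =
    trunc X I n k + (kap k * psi I.+1 n k) *: Y'.
  rewrite /trunc big_ord_recr /= eqxx scalerDr scalerA; congr (_ *: _ + _).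
  by apply: eq_bigr => i _; have := ltn_ord i; case: eqP => // ->; rewrite ltnn.
rewrite leq_eqVlt ltnS => /orP[/eqP->|pI]; last first.
  by apply: ev_imp (HX p pI) => k ->; rewrite trE psi_eq0 ?mulr0 ?scale0r ?addr0 // ltnS.
have -> : I.+1%:Z - 1 = I%:Z by lia.
apply: ev_imp2 HY (ev_nz I%:Z I.+1) => k HY nz.
rewrite trE /Y' scalerA -HY scalerA -/(trunc _ _ _ _).
have := @psi_top I k; rewrite -/(Pi k) pmulrn => /(_ nz) H.
rewrite mulrAC H mulfV ?scale1r; last by rewrite pnatr_eq0 -lt0n fact_gt0.
by rewrite /G addrC subrK.
Qed.

End FarWitt.

Lemma sylvester_bound (R : realType) (nn Cs Cq : R) : 1 <= nn -> 0 <= Cs -> 0 <= Cq ->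
  exists2 C, 1 <= C & [/\ nn + Cs <= C, Cs <= C, nn ^+ 2 + nn * Cs + Cq <= C & Cq <= C].
Proof. by move=> h1 h2 h3; exists (nn + nn ^+ 2 + nn * Cs + Cs + Cq + 1); [nra | split; nra]. Qed.

Lemma sylvester_arith (R : realType) (t a b r2 r3 nn C : R) : 1 <= nn -> 1 <= C -> 20 * C < t ->
  0 <= a -> 0 <= b -> 0 <= r2 -> 0 <= r3 ->
  t * b <= t * a + C * a + C * b + r2 -> nn * (t * a) <= C * a + C * b + r3 ->
  a <= 2 * C * (r2 / t) + 2 * (r3 / t).
Proof.
move=> nn1 C1 tC a0 b0 r20 r30 i1 i2; have t0 : 0 < t by lra.
have i3 : b <= 4 * a + r2 by nra.
rewrite !mulrA -mulrDl ler_pdivlMr //.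
have i4 : t * a <= nn * (t * a) by rewrite ler_peMl // mulr_ge0 // ltW.
nra.
Qed.

Lemma sylvester_sum (R : realType) (X1 X2 X3 a b c1 c2 C : R) :
  0 <= a -> 0 <= b -> c1 <= C -> c2 <= C ->
  X1 <= X2 + X3 -> X2 <= c1 * a -> X3 <= c2 * b -> X1 <= C * a + C * b.
Proof. by move=> *; nra. Qed.

Lemma zmod_telescope (V : zmodType) (a b d e u : V) :
  a - d + (b - d) + (u - a - (b - d)) - (e - d) = u - e.
Proof.
rewrite addrACA subrr addr0 [u - a]addrC addrACA subrr add0r opprB addrACA.
by rewrite addNr add0r.
Qed.

Section FarWittExpansion.
Variables (R : realType) (D : nat).
Local Notation K := R[i].
Local Notation mx := 'M[K]_D.
Local Notation nm := (@ComplexField.Normc.normc R).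
Variables (s : K) (E : int -> int -> mx).
Local Notation kap k := (s + k%:~R).
Hypothesis E_br : forall n m, ev (fun k =>
  E n (k + m) *m E m k - E m (k + n) *m E n k = (m - n)%:~R *: E (n + m) k).
Hypothesis E_0 : ev (fun k => E 0 k = (kap k)%:M).
Hypothesis E_m1 : ev (fun k => E (-1) k = (kap k)%:M).
Local Notation trunc := (trunc s).
Local Notation psi := (psi s).

Lemma mO0_bound m n (f : int -> 'M[K]_(m, n)) : bO 0 (fun k => mnorm (f k)) ->
  exists C, 0 <= C /\ ev (fun k => mnorm (f k) <= C).
Proof.
move=> [C [C0 H]]; exists C; split=> //; apply: ev_imp H => k [_].
by rewrite expr0z mulr1.
Qed.

Lemma bO_kapV : bO (-1) (fun k => (nm (kap k))^-1).
Proof.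
have := mO_kapV 1 s; apply: bO_eq => k.
by rewrite mnorm_scalar mul1r nmV.
Qed.

Lemma mnormM_boundr c (A B : mx) : mnorm B <= c -> mnorm (A *m B) <= c * mnorm A.
Proof.
move=> Bc; apply: le_trans (mnormM _ _) _; rewrite mulrC.
exact: ler_wpM2r (mnorm_ge0 _) _ _ Bc.
Qed.

Lemma mnormM_boundl c (A B : mx) : mnorm A <= c -> mnorm (A *m B) <= c * mnorm B.
Proof. by move=> Bc; apply: le_trans (mnormM _ _) (ler_wpM2r (mnorm_ge0 _) Bc). Qed.

(** No operator of nonzero degree commutes with both [e_1] and [e_2] at
    infinity, because there [e_1 e_1] is [kap e_2] while the two sides see
    different values of [kap]. *)
Lemma sylvester n c (x : int -> mx) : n != 0 -> mO 1 (E 1) ->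
  mO 0 (fun k => E 2 k - (kap k)%:M) ->
  mO 0 (fun k => E 1 (k + 1) *m E 1 k - (kap (k + 1)) *: E 2 k) ->
  mO c (fun k => E 1 (k + n) *m x k - x (k + 1) *m E 1 k) ->
  mO c (fun k => E 2 (k + n) *m x k - x (k + 2) *m E 2 k) -> mO c x.
Proof.
move=> n0 E1 HS HQ HR1 HR2.
set S := fun k => E 2 k - _ in HS; set Q := fun k => E 1 (k + 1) *m _ - _ in HQ.
set R1 := fun k => _ - x (k + 1) *m _ in HR1; set R2 := fun k => _ - x (k + 2) *m _ in HR2.
pose R3 k := E 1 (k + 1 + n) *m R1 k + R1 (k + 1) *m E 1 k - kap (k + 1) *: R2 k.
have HR3 : mO (c + 1) R3.
  apply: mOB; first apply: mOD.
  - rewrite addrC; apply: mOM HR1; apply: mO_ev (mO_shift (1 + n) E1).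
    by apply: ev_true => k; rewrite addrA.
  - exact: mOM (mO_shift 1 HR1) E1.
  - rewrite addrC; apply: mO_ev (mOM (mO_shift 1 (mO_kap D s)) HR2).
    by apply: ev_true => k; rewrite mul_scalar_mx.
have eq1 k : kap k *: x (k + 2) = kap k *: x k + (n%:~R *: x k + S (k + n) *m x k - x (k + 2) *m S k - R2 k).
  rewrite /S /R2 !mulmxBl !mulmxBr mul_scalar_mx mul_mx_scalar.
  have -> : kap (k + n) = kap k + n%:~R by rewrite intrD addrA.
  set A := E 2 _ *m _; set B := x _ *m _; move: A B => A B.
  by apply/matrixP => i j; rewrite !mxE; ring.
have eq2 k : n%:~R *: (kap k *: x k) = - (n%:~R ^+ 2 *: x k) - n%:~R *: (S (k + n) *m x k)
    - Q (k + n) *m x k + x (k + 2) *m Q k + R3 k.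
  rewrite /R3 /R2 /R1 /Q /S !(mulmxBl, mulmxBr).
  have -> : k + 1 + 1 = k + 2 by rewrite -addrA.
  have -> : k + 1 + n = k + n + 1 by rewrite addrAC.
  rewrite !mulmxA -!scalemxAl -!scalemxAr mul_scalar_mx.
  have -> : kap (k + n) = kap k + n%:~R by rewrite intrD addrA.
  have -> : kap (k + n + 1) = kap k + n%:~R + 1 by rewrite !intrD !addrA.
  have -> : kap (k + 1) = kap k + 1 by rewrite !intrD !addrA.
  set A := E 2 _ *m _; set B := x _ *m E 2 _; set C := E 1 (k + n + 1) *m _ *m x k.
  set F := E 1 (k + n + 1) *m _ *m E 1 k; set G := x _ *m _ *m E 1 k; move: A B C F G => A B C F G.
  by apply/matrixP => i j; rewrite !mxE; ring.
have [Cs [Cs0 bS]] := mO0_bound HS; have [Cq [Cq0 bQ]] := mO0_bound HQ.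
pose nn := nm n%:~R; have nnE c' A : mnorm (n%:~R *: A : 'M[K]_(c', D)) = nn * mnorm A by rewrite mnormZ.
have nnE2 A : mnorm (n%:~R ^+ 2 *: A : mx) = nn ^+ 2 * mnorm A by rewrite mnormZ expr2 nmM -expr2.
have nn1 : 1 <= nn by rewrite /nn nm_int -intr_norm ler1z; lia.
have [C C1 [Ca Cb Cc Cd]] := sylvester_bound nn1 Cs0 Cq0.
clearbody nn.
have key : ev (fun k => mnorm (x k) <= 2 * C * (mnorm (R2 k) * (nm (kap k))^-1) + 2 * (mnorm (R3 k) * (nm (kap k))^-1)).
  have b1 := ev_and bS (ev_shift n bS); have b2 := ev_and bQ (ev_shift n bQ).
  apply: ev_imp2 (ev_and b1 b2) (ev_kap_big s (20 * C)) => k [[s1 s2] [q1 q2]].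
  move=> tC; apply: (@sylvester_arith R (nm (kap k)) (mnorm (x k)) (mnorm (x (k + 2))) (mnorm (R2 k)) (mnorm (R3 k)) nn C nn1 C1 tC); rewrite ?mnorm_ge0 //.
    have h2 := mnormM_boundl (x k) s2.
    have h3 := mnormM_boundr (x (k + 2)) s1.
    have h4 := mnormD (n%:~R *: x k + S (k + n) *m x k) (- (x (k + 2) *m S k)).
    have h5 := mnormD (n%:~R *: x k) (S (k + n) *m x k).
    rewrite mnormN in h4; rewrite nnE in h5.
    have h6 := sylvester_sum (mnorm_ge0 (x k)) (mnorm_ge0 (x (k + 2))) Ca Cb h4.
    have {}h6 := h6 (le_trans h5 _) h3; rewrite mulrDl lerD2l in h6.
    have {}h6 := h6 h2.
    rewrite -mnormZ (eq1 k); apply: le_trans (mnormD _ _) _.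
    apply: le_trans (lerD (lexx _) (mnormD _ _)) _; rewrite mnormN mnormZ.
    apply: le_trans (lerD (lexx _) (lerD h6 (lexx _))) _.
    by rewrite !addrA.
  have h3 := mnormM_boundr (x (k + 2)) q1.
  have h2 := mnormM_boundl (x k) q2.
  have h1 := mnormM_boundl (x k) s2.
  rewrite -mnormZ -nnE (eq2 k).
  apply: le_trans (mnormD _ _) _; rewrite lerD2r.
  apply: (sylvester_sum (mnorm_ge0 (x k)) (mnorm_ge0 (x (k + 2))) Cc Cd (mnormD _ _) _ h3).
  apply: le_trans (mnormD _ _) _; rewrite mnormN [X in _ <= X]mulrDl; apply: lerD h2.
  apply: le_trans (mnormD _ _) _; rewrite mnormN mnormN nnE2 nnE mulrDl lerD2l -mulrA.
  by apply: ler_wpM2l h1; apply: le_trans nn1.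
have pos (f : int -> mx) k : 0 <= mnorm (f k) / nm (kap k).
  by rewrite divr_ge0 ?mnorm_ge0 ?nm_ge0.
apply: bO_ev key _; apply: bOD; [apply: bOZ (pos _) _ | apply: bOZ (pos _) _].
  apply: (bO_le (_ : c + -1 <= c)); first by lia.
  by apply: bOM (bO_kapV) => // k; rewrite ?invr_ge0 ?mnorm_ge0 ?nm_ge0.
have -> : c = c + 1 + -1 by lia.
by apply: bOM (bO_kapV) => // k; rewrite ?invr_ge0 ?mnorm_ge0 ?nm_ge0.
Qed.

Lemma mO_sum (T : Type) (r : seq T) (P : pred T) a (f : T -> int -> mx) :
  (forall i, P i -> mO a (f i)) -> mO a (fun k => \sum_(i <- r | P i) f i k).
Proof.
move=> H; elim: r => [|i r IH].
  by apply: mO_ev (@mO0 _ _ a); apply: ev_true => k; rewrite big_nil.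
have [Pi|Pi] := boolP (P i).
  by apply: mO_ev (mOD (H i Pi) IH); apply: ev_true => k; rewrite big_cons Pi.
by apply: mO_ev IH; apply: ev_true => k; rewrite big_cons (negPf Pi).
Qed.

(** Leading behaviour of the truncated families, up to a term of order [-q]. *)
Lemma trunc_head (X : nat -> mx) q I n : (q <= I.+1)%N ->
  mO (1 - q%:Z) (fun k => trunc X I n k - kap k *: \sum_(i < q) psi i n k *: X i : mx).
Proof.
move=> qI.
have H : mO (1 + - q%:Z) (fun k => (kap k)%:M *m \sum_(q <= i < I.+1) ((psi i n k)%:M *m X i)).
  apply: mOM; first exact: mO_kap.
  rewrite (_ : (fun k => _) = (fun k => \sum_(i <- index_iota q I.+1 | (q <= i)%N) (psi i n k)%:M *m X i)).
    apply: mO_sum => i qi; rewrite -[- q%:Z]addr0.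
    apply: mOM (mO_const _); apply: mO_le (psi_mO _ _ _ _) => //; lia.
  by apply/funext => k; rewrite big_nat_cond [RHS]big_nat_cond; apply: eq_bigl => i; case: (q <= i)%N; rewrite ?andbF ?andbT.
apply: mO_ev H; apply: ev_true => k; rewrite mul_scalar_mx -scalerBr; congr (_ *: _).
rewrite -[X in X - _](big_mkord xpredT (fun i => psi i n k *: X i)).
rewrite -[X in _ - X](big_mkord xpredT (fun i => psi i n k *: X i)).
rewrite [X in X - _](big_cat_nat (leq0n q) qI) /= [RHS]addrAC subrr add0r.
by apply: eq_bigr => i _; rewrite mul_scalar_mx.
Qed.

Lemma kap_psi1 k : kap k != 0 -> kap k * psi 1 0 k = 1.
Proof. by move=> k0; rewrite psiS psi0 !subr0 add0r addr0 !mul1r mulfV. Qed.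

(** The expansion at infinity of all the [e_n]; those with [n < -1] inherit it
    from the others by uniqueness. *)
Lemma E_expand (B J : nat) : exists I X, [/\ (2 < I)%N, X 0%N = 1%:M, X 1%N = 0,
  forall n : int, -1 <= n < 3 -> ev (fun k => E n k = trunc X I n k) &
  forall n : int, `|n| <= B%:Z -> mO (- J%:Z) (fun k => E n k - trunc X I n k : mx)].
Proof.
pose I := (B + J + 8)%N.
have [X [X0 HX]] := E_trunc E_br E_m1 I.
have exact (n : int) : -1 <= n < I%:Z -> ev (fun k => E n k = trunc X I n k).
  move=> nI; have := HX `|(n + 1)%R|%N; have -> : `|(n + 1)%R|%N%:Z - 1 = n by lia.
  by apply; lia.
have X1 : X 1%N = 0.
  have [|k0 H] := ev_and (ev_kap_neq0 s) (ev_and E_0 (exact 0 _)); first by lia.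
  have [k1 [h1 h2]] := H k0 (lexx _); move: h2; rewrite h1 /trunc /I !addnS.
  rewrite big_ord_recl big_ord_recl big1 /= => [|i _].
    rewrite addr0 X0 scalerDr scalerA psi0 mulr1 scalerA kap_psi1 // scale1r.
    rewrite scale_scalar_mx mulr1 => H1.
    by apply: (@addrI _ (kap k0)%:M); rewrite addr0 [RHS]H1.
  by rewrite [psi _ _ _](@psi_eq0 _ s _ 1) // scale0r.
exists I, X; split=> //; first by rewrite /I; lia.
  by move=> n n3; apply: exact; rewrite /I; lia.
pose F := trunc X I.
pose Cd (j n k : int) := F j (k + n) *m F n k - F n (k + j) *m F j k - (n - j)%:~R *: F (n + j) k.
have FS L : Sym L 1 F by apply: trunc_Sym.
have CS L j : Sym L 2 (Cd j).
  have A1 := SymM (Sym_diag (Sym_fix j (FS L))) (FS L).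
  have A2 := SymM (Sym_shift 0 j (FS L)) (Sym_fix j (FS L)).
  have A3 := SymM (Sym_n D L (- j%:~R)) (Sym_shift j 0 (FS L)).
  apply: Sym_eq (SymD (SymD A1 (SymN A2)) (SymN A3)) => n k.
  by rewrite /Cd !addr0 mul_scalar_mx intrB.
have Csmall (j n : int) : 1 <= j <= 2 -> mO (- J%:Z) (Cd j n).
  move=> j12; apply: (@small_extend2 _ _ (J + 2)%N _ (-1)) => {n} n.
    have := Sym_wd n (CS (J + 2)%N j); apply: mO_le; lia.
  move=> n1; apply: mO_ev (mO0 _ _ _); apply: ev_sym.
  have h1 : ev (fun k => E j k = F j k) by apply: exact; rewrite /I; lia.
  have h2 : ev (fun k => E n k = F n k) by apply: exact; rewrite /I; lia.
  have h3 : ev (fun k => E (n + j) k = F (n + j) k) by apply: exact; rewrite /I; lia.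
  have h4 := ev_and (ev_shift n h1) (ev_shift j h2).
  apply: ev_imp2 (ev_and (ev_and h1 h2) (ev_and h3 h4)) (E_br j n) => k [[a1 a2] [a3 [a4 a5]]] br.
  by rewrite /Cd -a1 -a2 -a3 -a4 -a5 br [j + n]addrC subrr.
pose x n k := E n k - F n k.
suff main (p : nat) : forall n : int, -1 - p%:Z <= n < I%:Z -> mO (- J%:Z) (x n).
  by move=> n nB; apply: (main B); rewrite /I; lia.
elim: p => [|p IH] n np.
  by apply: mO_ev (mO0 _ _ _); apply: ev_sym; apply: ev_imp (exact n _) => [k|]; [rewrite /x => ->; rewrite subrr | lia].
have [|np'] := boolP (-1 - p%:Z <= n); first by move=> ?; apply: IH; lia.
have n0 : n != 0 by lia.
have Rj (j : int) : 1 <= j <= 2 -> mO (- J%:Z) (fun k => E j (k + n) *m x n k - x n (k + j) *m E j k).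
  move=> j12.
  have h1 : ev (fun k => E j k = F j k) by apply: exact; rewrite /I; lia.
  have h2 : mO (- J%:Z) (x (n + j)) by apply: IH; lia.
  have := mOB (mOZ (n - j)%:~R h2) (Csmall j n j12); apply: mO_ev.
  apply: ev_imp2 (ev_and h1 (ev_shift n h1)) (E_br j n) => k [a1 a2] br.
  rewrite /x /Cd -a1 -a2 !mulmxBl !mulmxBr [n + j]addrC.
  move: br => /eqP; rewrite subr_eq => /eqP ->.
  by apply/matrixP => u v; rewrite !mxE; ring.
have Ej (j : int) : 1 <= j <= 2 -> ev (fun k => F j k = E j k).
  by move=> ?; apply: ev_sym; apply: exact; rewrite /I; lia.
have EF (j : int) : 1 <= j <= 2 -> mO (-1) (fun k => E j k - (kap k)%:M).
  move=> j12; have I2 : (2 <= I.+1)%N by rewrite /I; lia.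
  have := @trunc_head X 2 I j I2; apply: mO_ev.
  apply: ev_imp (Ej j j12) => k <-.
  rewrite big_ord_recl big_ord1 /= X0 X1 psi0 scaler0 addr0 scale1r.
  by rewrite scale_scalar_mx mulr1.
apply: (sylvester n0 _ _ _ (Rj 1 _) (Rj 2 _)) => //.
- exact: mO_ev (Ej 1 isT) (Sym_mO (FS 0%N) 1).
- exact: mO_le (EF 2 isT).
have S1 := EF 1 isT; have S2 := EF 2 isT.
have T1 := mOM (mO_shift 1 S1) (mO_kap D s).
have T2 := mOM (mO_shift 1 (mO_kap D s)) S1.
have T3 := mOM (mO_shift 1 S1) S1.
have T4 := mOM (mO_shift 1 (mO_kap D s)) S2.
have {}T3 : mO 0 (fun k => (E 1 (k + 1) - (kap (k + 1))%:M) *m (E 1 k - (kap k)%:M)).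
  by apply: mO_le T3.
have := mOB (mOD (mOD T1 T2) T3) T4; apply: mO_ev; apply: ev_true => k.
rewrite !(mulmxBl, mulmxBr) !(mul_scalar_mx, mul_mx_scalar).
exact: zmod_telescope.
Qed.

Lemma E_mO n : mO 1 (E n).
Proof.
have [I [X [_ _ _ _ H]]] := E_expand `|n| 0.
have h := mO_le (isT : - 0%:Z <= 1) (H n (lexx _)).
by apply: mO_ev (mOD h (Sym_mO (trunc_Sym s 0 X I) n)); apply: ev_true => k; rewrite subrK.
Qed.

(** A window: a high difference of the products [e_x e_y] with [x + y] fixed.
    *)
Definition OmE m (a b : int) k := wd m (fun i => E (a - i) (k + (b + i)) *m E (b + i) k) 0.

(** Each difference in the index lowers the order of the symbol of [e_x e_y],
    which is two, by one. *)
Lemma OmE_mO m a b : mO (2 - m%:Z) (OmE m a b).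
Proof.
pose B := (`|a| + `|b| + m + 1)%N.
have [I [X [_ _ _ _ H]]] := E_expand B m.
pose F := trunc X I; have FS L : Sym L 1 F by apply: trunc_Sym.
have S := SymM (Sym_anti a b (FS m)) (Sym_shift b 0 (FS m)).
have := Sym_wd 0 S; set G := fun k => wd m _ 0 => HG.
suff HD : mO (2 - m%:Z) (fun k => OmE m a b k - G k).
  by apply: mO_ev (mOD HD HG); apply: ev_true => k; rewrite subrK.
pose d i k := E (a - i) (k + (b + i)) *m E (b + i) k - F (a - i) (k + (b + i)) *m F (i + b) (k + 0).
suff Hd (j : nat) : forall i, 0 <= i -> i + j%:Z <= m%:Z -> mO (2 - m%:Z) (fun k => wd j (fun i => d i k) i).
  by apply: mO_ev (Hd m 0 _ _) => //; apply: ev_true => k; rewrite /OmE /G -wdB.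
elim: j => [|j IH] i i0 ij; last by apply: mOB; apply: IH; lia.
have h1 : `|a - i| <= B%:Z by rewrite /B; lia.
have h2 : `|b + i| <= B%:Z by rewrite /B; lia.
have {h1} h1 := mO_shift (b + i) (H _ h1).
have {h2} h2 := H _ h2.
have {}h1 : mO (- m%:Z) (fun k => E (a - i) (k + (b + i)) - F (a - i) (k + (b + i))).
  exact: h1.
have {}h2 : mO (- m%:Z) (fun k => E (b + i) k - F (b + i) k) by exact: h2.
have A1 := mOM h1 (E_mO (b + i)).
have A2 := mOM (mO_shift (b + i) (Sym_mO (FS 0%N) (a - i))) h2.
have {}A2 : mO (2 - m%:Z) (fun k => F (a - i) (k + (b + i)) *m (E (b + i) k - F (b + i) k)).
  by apply: mO_le A2; lia.
have {}A1 : mO (2 - m%:Z) (fun k => (E (a - i) (k + (b + i)) - F (a - i) (k + (b + i))) *m E (b + i) k).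
  by apply: mO_le A1; lia.
apply: mO_ev (mOD A1 A2); apply: ev_true => k.
by rewrite /d /= mulmxBl mulmxBr addr0 [i + b]addrC addrA subrK.
Qed.

End FarWittExpansion.

(** * Algebras of nilpotent matrices *)

Section NilAlgebra.
Variables (K : fieldType) (aT : falgType K).
Implicit Types (U B S : {vspace aT}).

Lemma span_ind (vT : vectType K) (s : seq vT) (P : vT -> Prop) :
  P 0 -> (forall a u v, P u -> P v -> P (a *: u + v)) ->
  (forall u, u \in s -> P u) -> forall x, x \in <<s>>%VS -> P x.
Proof.
move=> P0 PD Ps x xs; have := coord_span (X := in_tuple s) xs => ->.
elim/big_ind: _ => // [u v Pu Pv|i _]; first by rewrite -[u]scale1r; apply: PD.
by rewrite -[_ *: _]addr0; apply: PD => //; apply/Ps/mem_nth.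
Qed.

Lemma prodv_ind U B (P : aT -> Prop) :
  P 0 -> (forall a u v, P u -> P v -> P (a *: u + v)) ->
  (forall u v, u \in U -> v \in B -> P (u * v)) -> forall x, x \in (U * B)%VS -> P x.
Proof.
move=> P0 PD PM x; rewrite unlock; apply: span_ind => // u.
by case/allpairsP => [[a b] /= [aU bB ->]]; apply: PM; apply: vbasis_mem.
Qed.

Lemma nil_absorb (y b : aT) S : (S * <[b]> <= S)%VS -> (exists n, b ^+ n = 0) ->
  y - y * b \in S -> y \in S.
Proof.
move=> Sb [n bn] yS.
have H i : y - y * b ^+ i \in S.
  elim: i => [|i IH]; first by rewrite expr0 mulr1 subrr mem0v.
  have -> : y - y * b ^+ i.+1 = (y - y * b) + (y - y * b ^+ i) * b.
    by rewrite mulrBl -mulrA -exprSr addrA subrK.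
  by apply: rpredD => //; apply: (subvP Sb); rewrite memv_mul // memv_line.
by have := H n; rewrite bn mulr0 subr0.
Qed.

(** An algebra of nilpotent elements moves every nonzero space it stabilises
    to a smaller one: a maximal stable proper subspace absorbs everything. *)
Lemma nil_shrink B S : (B * B <= B)%VS -> (forall b, b \in B -> exists n, b ^+ n = 0) ->
  (S * B)%VS = S -> S = 0%VS.
Proof.
move=> BB Bnil SB; apply/eqP/negPn/negP => S0.
pose good n := exists2 S0 : {vspace aT}, [/\ (S0 <= S)%VS, (S0 * B <= S0)%VS & S0 != S] & (\dim S0 = n)%N.
have [T [TS TB TneS] Tmax] : exists2 T : {vspace aT}, [/\ (T <= S)%VS, (T * B <= T)%VS & T != S] &
    forall T' : {vspace aT}, (T' <= S)%VS -> (T' * B <= T')%VS -> T' != S -> (\dim T' <= \dim T)%N.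
  pose P n := `[< good n >].
  have ex : exists n, P n.
    by exists 0%N; apply/asboolP; exists 0%VS; rewrite ?dimv0 // sub0v prod0v eq_sym.
  have ub n : P n -> (n <= \dim S)%N.
    by move=> /asboolP[T [TS _ _] <-]; apply: dimvS.
  case: (ex_maxnP ex ub) => n /asboolP[T [TS TB TneS] dT] nmax.
  exists T => // T' h1 h2 h3; rewrite dT; apply: nmax; apply/asboolP.
  by exists T'.
have key y : y \in S -> y \notin T -> (<[y]> * B <= T)%VS.
  move=> yS yT; apply: contraNT yT => yB.
  pose T' := (T + <[y]> * B)%VS.
  have TT' : (T <= T')%VS by apply: addvSl.
  have T'S : (T' <= S)%VS.
    by rewrite subv_add TS -SB prodvSl // -memvE.
  have T'B : (T' * B <= T')%VS.
    by rewrite /T' prodvDl addvS // -prodvA prodvSr.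
  have [T'E|T'ne] := eqVneq T' S; last first.
    have := Tmax T' T'S T'B T'ne; rewrite (geq_leqif (dimv_leqif_sup TT')) => T'T.
    by case/negP: yB; apply: subv_trans T'T; apply: addvSr.
  have : y \in T' by rewrite T'E.
  case/memv_addP => t tT [w]; rewrite /= => wyB yE.
  have [b bB wE] : exists2 b, b \in B & w = y * b.
    apply: (@prodv_ind <[y]>%VS B (fun w => exists2 b, b \in B & w = y * b) _ _ _ _ wyB) => [|a u v [b1 b1B ->] [b2 b2B ->]|u v /vlineP[c ->] vB].
    - by exists 0; rewrite ?mem0v // mulr0.
    - by exists (a *: b1 + b2); rewrite ?memvD ?memvZ // mulrDr scalerAr.
    - by exists (c *: v); rewrite ?memvZ // -scalerAl scalerAr.
  apply: (@nil_absorb y b T); last by rewrite {1}yE wE addrK.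
    by apply: subv_trans TB; apply: prodvSr; rewrite -memvE.
  exact: Bnil.
have : (S * B <= T)%VS.
  apply/prodvP => y b yS bB; have [yT|yT] := boolP (y \in T).
    by apply: (subvP TB); apply: memv_mul.
  by apply: (subvP (key y yS yT)); apply: memv_mul => //; apply: memv_line.
rewrite SB => ST; case/negP: TneS.
by rewrite eqEsubv TS ST.
Qed.

(** The spaces obtained from the whole space by repeated multiplication with
    [B] shrink until they vanish. *)
Lemma nil_power B : (B * B <= B)%VS -> (forall b, b \in B -> exists n, b ^+ n = 0) ->
  (B ^+ (\dim {:aT}).+1)%VS = 0%VS.
Proof.
move=> BB Bnil; set d := \dim {:aT}.
have dec n : (B ^+ n.+2 <= B ^+ n.+1)%VS.
  elim: n => [|n IH]; first by rewrite expv_line_0 || rewrite !expvSl expv0 prodv1.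
  by rewrite expvSl [in X in (_ <= X)%VS]expvSl prodvSr.
have H n : (B ^+ n.+1 == 0)%VS || (\dim (B ^+ n.+1) + n <= d)%N.
  elim: n => [|n /orP[/eqP IH|IH]]; first by rewrite addn0 dimvS ?orbT ?subvf.
    by rewrite expvSr IH prod0v eqxx.
  have [E|NE] := eqVneq (B ^+ n.+2)%VS (B ^+ n.+1)%VS.
    by rewrite expvSr in E; rewrite expvSr E (nil_shrink BB Bnil E) eqxx.
  have : (\dim (B ^+ n.+2) < \dim (B ^+ n.+1))%N.
    by rewrite ltn_neqAle dimvS // andbT; apply: contra NE => /eqP e; rewrite eqEdim dec e leqnn.
  by move=> lt; apply/orP; right; lia.
have := H d; case/orP => [/eqP//|].
by move=> dd; apply/eqP; rewrite -dimv_eq0; lia.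
Qed.

End NilAlgebra.

Section TraceNil.
Variables (K : numFieldType) (D' : nat).
Local Notation mx := 'M[K]_D'.+1.

Lemma trace_nilpotent (b : mx) : (forall j, \tr (b ^+ j.+1) = 0) -> exists n, b ^+ n = 0.
Proof.
move=> tr0.
have [t Et] : exists t, \rank (b ^+ (2 ^ t.+1)) = \rank (b ^+ (2 ^ t)).
  have le t : (\rank (b ^+ (2 ^ t.+1)) <= \rank (b ^+ (2 ^ t)))%N.
    by rewrite expnS mulnC muln2 -addnn exprD; apply: mxrankM_maxl.
  have H t : (exists t, \rank (b ^+ (2 ^ t.+1)) = \rank (b ^+ (2 ^ t))) \/ (\rank (b ^+ (2 ^ t)) + t <= D'.+1)%N.
    elim: t => [|t [IH|IH]]; [|by left|]; first by right; rewrite addn0 rank_leq_row.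
    have [E|NE] := eqVneq (\rank (b ^+ (2 ^ t.+1))) (\rank (b ^+ (2 ^ t))); first by left; exists t.
    by right; have := le t; lia.
  by case: (H D'.+2) => //; lia.
set c := b ^+ (2 ^ t) in Et; exists (2 ^ t)%N; rewrite -/c.
have trc j : \tr (c ^+ j.+1) = 0.
  rewrite /c -exprM; have : (0 < 2 ^ t * j.+1)%N by rewrite muln_gt0 expn_gt0.
  by case: (2 ^ t * j.+1)%N => // p _; apply: tr0.
have {}Et : \rank (c ^+ 2) = \rank c by rewrite -Et /c -exprM mulnC -expnS.
have [rk0|rn0] := posnP (\rank c); first by apply/eqP; rewrite -mxrank_eq0 rk0.
have [r [L [N [r0 cE grank]]]] : exists r (L : 'M_(D'.+1, r)) (N : 'M_(r, D'.+1)),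
    [/\ (0 < r)%N, c = L *m N & \rank (N *m L) = r].
  exists (\rank c), (col_base c), (row_base c); split=> //; first by rewrite mulmx_base.
  have cE := mulmx_base c; move: (col_base c) (row_base c) cE => L N cE.
  have c2 : c ^+ 2 = L *m (N *m L *m N).
    transitivity ((L *m N) *m (L *m N)); first by rewrite cE.
    by rewrite !mulmxA.
  apply/eqP; rewrite eqn_leq rank_leq_row -[X in (X <= _)%N]Et c2.
  by apply: leq_trans (mxrankM_maxr _ _) (mxrankM_maxl _ _).
case: r r0 L N cE grank => // r _ L N cE; set g := N *m L => grank.
have trg j : \tr (g ^+ j.+1) = 0.
  have E : N *m c ^+ j *m L = g ^+ j.+1.
    elim: j => [|j IH]; first by rewrite expr0 mulmx1 expr1.
    by rewrite exprSr -mulmxE {2}cE !mulmxA [in RHS]exprSr -IH -mulmxE -!mulmxA.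
  rewrite -E mxtrace_mulC mulmxA -cE -[X in \tr X]/(c * c ^+ j) -exprS; exact: trc.
have gu : g \in unitmx by rewrite -row_free_unit -row_leq_rank grank.
have := Cayley_Hamilton g; move=> /(congr1 mxtrace).
rewrite -[char_poly g]coefK poly_def size_char_poly rmorph_sum raddf_sum raddf0.
rewrite big_ord_recl big1 => [|i _]; last first.
  by rewrite /= linearZ /= rmorphXn /= horner_mx_X linearZ /= trg mulr0.
rewrite addr0 /= linearZ /= rmorphXn /= horner_mx_X expr0 linearZ /= mxtrace1 char_poly_det.
move/eqP; rewrite !mulf_eq0 signr_eq0 pnatr_eq0 orbF /=.
by move: gu; rewrite unitmxE unitfE => /negPf ->.
Qed.

(** It suffices to test traces on short words, since longer ones add nothing
    to their span. *)
Lemma trace_nil_power (T : finType) (X : T -> mx) :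
  (forall n (w : n.-tuple T), (0 < n)%N -> (n <= D'.+1 * D'.+1)%N ->
     \tr (\prod_(t <- w) X t) = 0) ->
  forall y : 'I_(D'.+1 * D'.+1).+1 -> mx,
    (forall i, exists c : T -> K, y i = \sum_t c t *: X t) -> \prod_i y i = 0.
Proof.
move=> trX y yX; pose U := <<[seq X t | t <- enum T]>>%VS.
have dimE : \dim {: mx} = (D'.+1 * D'.+1)%N by rewrite dimvf.
have words n A z : z \in (U ^+ n)%VS ->
    (forall w : n.-tuple T, \tr (A * \prod_(t <- w) X t) = 0) -> \tr (A * z) = 0.
  elim: n A z => [|n IH] A z.
    rewrite expv0 => /vlineP[c ->] /(_ [tuple]); rewrite big_nil mulr1 => trA.
    by rewrite -scalerAr mulr1 linearZ /= trA mulr0.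
  rewrite expvSl => zU trw; move: z zU; apply: prodv_ind => [|c u v Pu Pv|u v uU vU].
  - by rewrite mulr0 raddf0.
  - by rewrite mulrDr -scalerAr linearP /= Pu Pv mulr0 addr0.
  move: u uU; apply: span_ind => [|c u1 u2 P1 P2|u /mapP[t _ ->]].
  - by rewrite mul0r mulr0 raddf0.
  - by rewrite mulrDl mulrDr -scalerAl -scalerAr linearP /= P1 P2 mulr0 addr0.
  rewrite mulrA; apply: IH vU _ => w.
  by have := trw [tuple of t :: w]; rewrite big_cons mulrA.
have trU z : z \in (U * agenv U)%VS -> \tr z = 0.
  rewrite /agenv big_distrr /= => /memv_sumP[u uP ->].
  rewrite raddf_sum big1 // => i _ /=; have := uP i isT; rewrite -expvSl => ui.
  rewrite -[u i]mul1r; apply: words ui _ => w; rewrite mul1r.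
  by apply: trX => //; rewrite -dimE; apply: ltn_ord.
pose B := (U * agenv U)%VS.
have BB : (B * B <= B)%VS.
  rewrite /B -prodvA prodvSr // prodvA -[X in (_ <= X)%VS]agenvM prodvSl //.
  by rewrite [X in (_ <= X)%VS]agenvEr addvSr.
have Bnil b : b \in B -> exists n, b ^+ n = 0.
  move=> bB; apply: trace_nilpotent => j; apply: trU.
  elim: j => [|j IH]; first by rewrite expr1.
  by rewrite exprSr; apply: (subvP BB); apply: memv_mul.
have B0 := nil_power BB Bnil; rewrite dimE in B0.
have UB : (U <= B)%VS by rewrite -[X in (X <= _)%VS]prodv1 prodvSr // sub1_agenv.
have {}yX i : y i \in U.
  have [c ->] := yX i; apply: rpred_sum => t _; apply/rpredZ/memv_span/map_f.
  by rewrite mem_enum.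
have : \prod_i y i \in (B ^+ (D'.+1 * D'.+1).+1)%VS.
  move: (_.+1) y yX => q; elim: q => [|q IH] y yX.
    by rewrite big_ord0 expv0 memv_line.
  rewrite big_ord_recl expvSl; apply: memv_mul; first exact: (subvP UB).
  exact: IH.
by rewrite B0 memv0 => /eqP.
Qed.

End TraceNil.

Lemma ev_fin (T : finType) (P : T -> int -> Prop) :
  (forall x, ev (P x)) -> ev (fun k => forall x, P x k).
Proof.
move=> H; apply: ev_imp (@ev_seq T (enum T) P (fun x _ => H x)) => k Pk x.
by apply: Pk; rewrite mem_enum.
Qed.

Lemma wd_ev (V : zmodType) m (F G : int -> int -> V) :
  (forall i, ev (fun k => F i k = G i k)) ->
  forall n, ev (fun k => wd m (F^~ k) n = wd m (G^~ k) n).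
Proof.
move=> H; elim: m => [|m IH] n //=.
by apply: ev_imp2 (IH n) (IH (n + 1)) => k -> ->.
Qed.

Lemma wdZ (K : fieldType) (V : lmodType K) m (c : K) (F : int -> V) n :
  wd m (fun i => c *: F i) n = c *: wd m F n.
Proof. by elim: m n => [|m IH] n //=; rewrite !IH scalerBr. Qed.

Lemma wd_idZ (K : fieldType) (V : lmodType K) m (F : int -> V) n :
  wd m (fun i => i%:~R *: F i) n = n%:~R *: wd m F n - m%:R *: wd m.-1 F (n + 1).
Proof.
elim: m n => [|m IH] n; first by rewrite /= scale0r subr0.
rewrite /= !IH; case: m {IH} => [|m] /=; modred K V; rewrite ?intrD -?natr1; ring.
Qed.

Lemma wd_linN (K : fieldType) (V : lmodType K) m (c : int) (F : int -> V) :
  wd m (fun i => (c - i)%:~R *: F i) 0 = c%:~R *: wd m F 0 + m%:R *: wd m.-1 F 1.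
Proof.
rewrite (@eq_wd _ m _ (fun i => c%:~R *: F i - i%:~R *: F i)) => [|i]; last first.
  by rewrite intrB scalerBl.
by rewrite wdB wdZ wd_idZ scale0r !add0r opprK.
Qed.

Lemma wd_linD (K : fieldType) (V : lmodType K) m (c : int) (F : int -> V) :
  wd m (fun i => (c + i)%:~R *: F i) 0 = c%:~R *: wd m F 0 - m%:R *: wd m.-1 F 1.
Proof.
rewrite (@eq_wd _ m _ (fun i => c%:~R *: F i + i%:~R *: F i)) => [|i]; last first.
  by rewrite intrD scalerDl.
by rewrite wdD wdZ wd_idZ scale0r !add0r.
Qed.

Lemma wd_sum (T : Type) (V : zmodType) m (r : seq T) (F : T -> int -> V) n :
  wd m (fun i => \sum_(p <- r) F p i) n = \sum_(p <- r) wd m (F p) n.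
Proof. by elim: m n => [|m IH] n //=; rewrite !IH sumrB. Qed.

(** * Traces of words *)

Section FarWords.
Variables (R : realType) (D : nat).
Local Notation K := R[i].
Local Notation mx := 'M[K]_D.
Local Notation nm := (@ComplexField.Normc.normc R).
Variables (s : K) (E : int -> int -> mx).
Local Notation kap k := (s + k%:~R).
Hypothesis E_br : forall n m, ev (fun k =>
  E n (k + m) *m E m k - E m (k + n) *m E n k = (m - n)%:~R *: E (n + m) k).
Hypothesis E_0 : ev (fun k => E 0 k = (kap k)%:M).
Hypothesis E_m1 : ev (fun k => E (-1) k = (kap k)%:M).
Local Notation OmE := (OmE E).

Definition dgw (w : seq int) : int := \sum_(n <- w) n.

Fixpoint wordmx (w : seq int) (k : int) : mx :=
  if w is n :: w' then E n (k + dgw w') *m wordmx w' k else 1%:M.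

Lemma dgw_cons n w : dgw (n :: w) = n + dgw w. Proof. by rewrite /dgw big_cons. Qed.
Lemma dgw_cat u v : dgw (u ++ v) = dgw u + dgw v. Proof. by rewrite /dgw big_cat. Qed.

Lemma W_cat u v k : wordmx (u ++ v) k = wordmx u (k + dgw v) *m wordmx v k.
Proof.
elim: u => [|n u IH] /=; first by rewrite mul1mx.
by rewrite IH mulmxA dgw_cat -addrA [dgw v + _]addrC.
Qed.

(** The words obtained by commuting the letter [n] through a word. *)
Fixpoint bumps (n : int) (w : seq int) : seq (int * seq int) :=
  if w is a :: w' then (a - n, (a + n) :: w') :: [seq (p.1, a :: p.2) | p <- bumps n w'] else [::].

Lemma bumpsP n w p : p \in bumps n w -> size p.2 = size w /\ dgw p.2 = dgw w + n.
Proof.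
elim: w p => [|a w IH] p //=; rewrite inE => /orP[/eqP->|/mapP[q /IH[q1 q2] ->]] /=.
  by rewrite !dgw_cons addrAC.
by rewrite q1 !dgw_cons q2 addrA.
Qed.

Lemma W_comm n w : ev (fun k => wordmx (n :: w) k =
  wordmx (rcons w n) k + \sum_(p <- bumps n w) p.1%:~R *: wordmx p.2 k).
Proof.
elim: w => [|a w IH].
  by apply: ev_true => k; rewrite /= big_nil addr0.
have Eb := ev_shift (dgw w) (E_br n a).
apply: ev_imp2 IH Eb => k IH Eb.
have -> : wordmx (n :: a :: w) k = E n (k + dgw w + a) *m E a (k + dgw w) *m wordmx w k.
  by rewrite /= dgw_cons mulmxA [a + _]addrC addrA.
move: Eb => /eqP; rewrite subr_eq => /eqP ->; rewrite mulmxDl -scalemxAl.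
have -> : bumps n (a :: w) = (a - n, (a + n) :: w) :: [seq (p.1, a :: p.2) | p <- bumps n w] by [].
rewrite big_cons big_map [n + a]addrC addrCA; congr (_ + _).
rewrite -mulmxA -[E n _ *m wordmx w k]/(wordmx (n :: w) k) IH mulmxDr.
have -> : rcons (a :: w) n = a :: rcons w n by [].
have dr : dgw (rcons w n) = dgw w + n by rewrite -cats1 dgw_cat dgw_cons /dgw big_nil addr0.
rewrite [wordmx (a :: _) k]/= dr addrA; congr (_ + _).
rewrite mulmx_sumr; apply: eq_big_seq => p /bumpsP[_ dp].
by rewrite -scalemxAr /= dp addrA.
Qed.

Definition pw w k : K := \tr (wordmx w k).

Lemma pw_rot n w k : n + dgw w = 0 -> pw (rcons w n) k = pw (n :: w) (k + n).
Proof.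
move=> nw; rewrite /pw -cats1 W_cat mxtrace_mulC /= dgw_cons /dgw big_nil !addr0 mulmx1 -/(dgw w).
by rewrite -addrA nw addr0.
Qed.

Definition T m a b w k := wd m (fun i : int => pw ((a - i) :: (b + i) :: w) k) 0.

Lemma T_OmE m a b w k : T m a b w k = \tr (OmE m a b (k + dgw w) *m wordmx w k).
Proof.
rewrite /T /OmE; elim: m (0 : int) => [|m IH] n /=; last by rewrite !IH mulmxBl raddfB.
by rewrite /pw /= dgw_cons mulmxA [b + n + _]addrC addrA.
Qed.

Lemma T_shift m c d w k :
  wd m (fun i : int => pw ((c - i) :: (d + i) :: w) k) 1 = T m (c - 1) (d + 1) w k.
Proof.
rewrite -[1]add0r -wd_shift; apply: eq_wd => i; congr (pw [:: _, _ & _] _); lia.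
Qed.

Lemma W_mO w : mO (size w)%:Z (wordmx w).
Proof.
elim: w => [|n w IH] /=; first exact: mO_const.
have -> : (size w).+1%:Z = 1 + (size w)%:Z by lia.
exact: mOM (mO_shift _ (E_mO E_br E_0 E_m1 n)) IH.
Qed.

Lemma T_bO m a b w : bO (2 - m%:Z + (size w)%:Z) (fun k => nm (T m a b w k)).
Proof.
have := mOM (mO_shift (dgw w) (OmE_mO E_br E_0 E_m1 m a b)) (W_mO w).
by apply: bO_eq => k; rewrite T_OmE; apply: nm_trace.
Qed.

Lemma T_periodic m a b w (N : int) : (size w < m - 2)%N -> N != 0 ->
  ev (fun k => T m a b w (k + N) = T m a b w k) -> ev (fun k => T m a b w k = 0).
Proof.
move=> wm N0 per.
have : ev (fun k => nm (T m a b w k) = 0); last first.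
  by apply: ev_imp => k /ComplexField.Normc.eq0_normc.
apply: (@bO_periodic _ (2 - m%:Z + (size w)%:Z) _ `|N|); [lia|lia|by move=> k; apply: nm_ge0| |exact: T_bO].
have [N1|N1] := leP 0 N; first by apply: ev_imp per => k <-; rewrite ger0_norm.
apply: ev_imp (ev_shift (- N) per) => k; rewrite subrK => ->; congr (nm (T _ _ _ _ _)); lia.
Qed.

(** Without further letters, traces of [e_g e_(-g)] are computed up to a
    [g]-periodic function, and the explicit part is linear in [g]. *)
Lemma T_nil m a b : (3 <= m)%N -> a + b = 0 -> ev (fun k => T m a b [::] k = 0).
Proof.
move=> m3 ab0; pose N : int := ((`|a| + m)`!)%:Z.
apply: (@T_periodic _ _ _ _ N) => //=; first by lia.
  by rewrite /N; have := fact_gt0 (`|a| + m); lia.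
pose t (g : int) k := pw [:: g; - g] k.
pose u g k := t g k - D%:R * (kap k ^+ 2 - g%:~R * kap k).
have ug g : ev (fun k => u g (k + g) = u g k).
  have := W_comm g [:: - g]; apply: ev_imp2 E_0 => k E0 Wc.
  rewrite /u /t -[[:: g; - g]]/(g :: [:: - g]) -(@pw_rot g [:: - g] k); last first.
    by rewrite dgw_cons /dgw big_nil addr0 addrN.
  rewrite {2}/pw Wc mxtraceD big_seq1 mxtraceZ /= /pw /= /dgw big_nil !addr0 addNr E0 !mulmx1.
  rewrite mxtrace_scalar -mulr_natl; set X := \tr _.
  by rewrite !intrD !mulrNz; ring.
have u0 : ev (fun k => u 0 k = 0).
  apply: ev_imp E_0 => k E0; rewrite /u /t /pw /= oppr0 dgw_cons /dgw big_nil !addr0 E0 mulmx1.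
  by rewrite -scalar_mxM mxtrace_scalar -mulr_natl; ring.
have per g : `|g| <= (`|a| + m)%:Z -> ev (fun k => u g (k + N) = u g k).
  move=> gN; have [->|g0] := eqVneq g 0.
    by apply: ev_imp2 u0 (ev_shift N u0) => k -> ->.
  have iter (j : nat) : ev (fun k => u g (k + j%:Z * `|g|) = u g k).
    elim: j => [|j IH]; first by apply: ev_true => k; rewrite mul0r addr0.
    have u1 : ev (fun k => u g (k + `|g|) = u g k).
      have [N1|N1] := leP 0 g; first by apply: ev_imp (ug g) => k <-; rewrite ger0_norm.
      by apply: ev_imp (ev_shift (- g) (ug g)) => k; rewrite subrK => ->; congr u; lia.
    apply: ev_imp2 IH (ev_shift (j%:Z * `|g|) u1) => k <- <-; congr u; lia.
  have gd : (`|g| %| (`|a| + m)`!)%N by apply: dvdn_fact; lia.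
  have := iter ((`|a| + m)`! %/ `|g|)%N; apply: ev_imp => k <-; congr (u g (_ + _)).
  by rewrite /N -[in LHS](divnK gd) PoszM abszE.
have Tu k : T m a b [::] k = wd m (fun i => u (a - i) k) 0.
  rewrite /T; case: m m3 {per N} => [//|[//|m]] _.
  have -> : wd m.+2 (fun i : int => pw [:: a - i; b + i] k) 0 =
     wd m.+2 (fun i => u (a - i) k) 0 + wd m.+2 (fun i : int => D%:R * (kap k ^+ 2 - (a - i)%:~R * kap k)) 0.
    rewrite -wdD; apply: eq_wd => i; rewrite /u subrK /t; congr (pw [:: _; _] _); lia.
  rewrite [X in _ + X](_ : _ = 0) ?addr0 // wdSr.
  rewrite (@eq_wd _ _ _ (fun _ => - D%:R * kap k)) ?wd_const // => i.
  by rewrite !intrD !mulrNz intrD; ring.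
suff : ev (fun k => wd m (fun i => u (a - i) (k + N)) 0 = wd m (fun i => u (a - i) k) 0).
  by apply: ev_imp => k; rewrite !Tu.
suff H (j : nat) : forall i : int, 0 <= i -> i + j%:Z <= m%:Z ->
    ev (fun k => wd j (fun i => u (a - i) (k + N)) i = wd j (fun i => u (a - i) k) i).
  by apply: H; lia.
elim: j => [|j IH] i i0 ij; first by apply: per; lia.
by apply: ev_imp2 (IH i _ _) (IH (i + 1) _ _) => [k /= -> ->||||] //; lia.
Qed.

(** Traces of words containing a high difference vanish far out: rotating a
    letter shows that they are periodic, and they decay. *)
Lemma T_eq0 r : forall m a b w, size w = r -> (r + 3 <= m)%N -> a + b + dgw w = 0 ->
  ev (fun k => T m a b w k = 0).
Proof.
elim: r => [|r IH] m a b w.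
  move=> /size0nil-> m3; rewrite /dgw big_nil addr0; exact: T_nil.
case/lastP: w => // w n; rewrite size_rcons => -[wr] rm.
have -> : dgw (rcons w n) = dgw w + n by rewrite -cats1 dgw_cat dgw_cons /dgw big_nil addr0.
move=> abw.
have [n0|n0] := eqVneq n 0.
  have IHw := IH m a b w wr _ _; apply: ev_imp2 E_0 (IHw _ _) => [k E0 Tw||]; try lia.
  rewrite T_OmE -cats1 dgw_cat W_cat /= n0 dgw_cons /dgw big_nil !addr0 E0 mulmx1.
  by rewrite mul_mx_scalar -scalemxAr linearZ /= -T_OmE Tw mulr0.
apply: (@T_periodic _ _ _ _ n) => //; first by rewrite size_rcons wr; lia.
pose C (i : int) := fun k => (a - n - i)%:~R *: (pw ((a + n - i) :: (b + i) :: w) k : K^o)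
   + ((b - n + i)%:~R *: (pw ((a - i) :: (b + n + i) :: w) k : K^o)
   + \sum_(p <- bumps n w) p.1%:~R *: (pw ((a - i) :: (b + i) :: p.2) k : K^o)).
have rot : ev (fun k => T m a b (rcons w n) k = T m a b (rcons w n) (k + n) + wd m (C^~ (k + n)) 0).
  rewrite /T; have := @wd_ev K^o m (fun i k => pw [:: a - i, b + i & rcons w n] k)
     (fun i k => pw [:: a - i, b + i & rcons w n] (k + n) + C i (k + n)) _ 0.
  move=> H; apply: ev_imp (H _) => [k ->|i]; first by rewrite wdD.
  apply: ev_imp (ev_shift n (W_comm n [:: a - i, b + i & w])) => k Wc.
  rewrite -!rcons_cons pw_rot; last by rewrite !dgw_cons; lia.
  rewrite {1}/pw Wc raddfD /=; congr (_ + _).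
  rewrite raddf_sum /= !big_cons !big_map /= !linearZ /= /C /pw.
  have -> : a - i + n = a + n - i by lia.
  have -> : b + i + n = b + n + i by lia.
  have -> : a - i - n = a - n - i by lia.
  have -> : b + i - n = b - n + i by lia.
  congr (_ + (_ + _)).
  by apply: eq_bigr => p _; rewrite linearZ.
suff C0 : ev (fun k => wd m (C^~ k) 0 = 0).
  by apply: ev_imp2 rot (ev_shift n C0) => k -> ->; rewrite addr0.
have m1 : (r + 3 <= m.-1)%N by lia.
have h1 := IH m (a + n) b w wr _ _; have h2 := IH m.-1 (a + n - 1) (b + 1) w wr m1 _.
have h3 := IH m a (b + n) w wr _ _; have h4 := IH m.-1 (a - 1) (b + n + 1) w wr m1 _.
have h5 : ev (fun k => forall p, p \in bumps n w -> T m a b p.2 k = 0).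
  apply: ev_seq => p /bumpsP[p1 p2]; apply: IH; rewrite ?p1 ?p2 //; lia.
apply: ev_imp2 (ev_and (ev_and (h1 _ _) (h2 _)) (ev_and (h3 _ _) (h4 _))) h5 => [k||||||]; try lia.
case=> [[{}h1 {}h2] [{}h3 {}h4]] {}h5.
rewrite /C !wdD.
have -> := @wd_linN K K^o m (a - n) (fun i => pw ((a + n - i) :: (b + i) :: w) k).
have -> := @wd_linD K K^o m (b - n) (fun i => pw ((a - i) :: (b + n + i) :: w) k).
rewrite !T_shift h2 h4.
have -> := @wd_sum _ K^o m (bumps n w) (fun p (i : int) => p.1%:~R *: (pw [:: a - i, b + i & p.2] k : K^o)) 0.
have -> : \sum_(p <- bumps n w) wd m (fun i : int => p.1%:~R *: (pw [:: a - i, b + i & p.2] k : K^o)) 0 = 0.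
  by rewrite big_seq; apply: big1 => p pb; rewrite wdZ [wd _ _ _](h5 p pb) scaler0.
have -> : wd m (fun i : int => pw [:: a + n - i, b + i & w] k) 0 = 0 := h1.
have -> : wd m (fun i : int => pw [:: a - i, b + n + i & w] k) 0 = 0 := h3.
by rewrite !scaler0 subr0 !addr0.
Qed.

End FarWords.

(** * Products of windows *)

Section FarNil.
Variables (R : realType) (D : nat).
Local Notation K := R[i].
Local Notation mx := 'M[K]_D.
Local Notation nm := (@ComplexField.Normc.normc R).
Variables (s : K) (E : int -> int -> mx).
Local Notation kap k := (s + k%:~R).
Hypothesis E_br : forall n m, ev (fun k =>
  E n (k + m) *m E m k - E m (k + n) *m E n k = (m - n)%:~R *: E (n + m) k).
Hypothesis E_0 : ev (fun k => E 0 k = (kap k)%:M).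
Hypothesis E_m1 : ev (fun k => E (-1) k = (kap k)%:M).
Local Notation OmE := (OmE E).
Local Notation wordmx := (wordmx E).

(** Up to the factor [kap], the operators [e_n] tend to the identity and are
    therefore invertible far out. *)
Lemma near_scalar_unit (f : int -> mx) : mO 0 (fun k => f k - (kap k)%:M) ->
  ev (fun k => f k \in unitmx).
Proof.
move=> /mO0_bound[C [C0 H]]; apply: ev_imp2 H (ev_kap_big s C) => k fk Ck.
rewrite unitmxE unitfE; apply/det0P => -[v v0 vf].
have : (kap k) *: v = - (v *m (f k - (kap k)%:M)).
  by rewrite mulmxBr vf sub0r opprK mul_mx_scalar.
move=> /(congr1 (@mnorm _ _ _)); rewrite mnormZ mnormN => e.
have : nm (kap k) * mnorm v <= C * mnorm v.
  by rewrite e mulrC; apply: le_trans (mnormM _ _) _; apply: ler_wpM2l (mnorm_ge0 _) _ _ _.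
have vpos : 0 < mnorm v.
  by rewrite lt_def mnorm_ge0 andbT; apply: contra_neq v0 => /mnorm0_eq.
by rewrite ler_pM2r // leNgt Ck.
Qed.

Lemma E_near n : mO 0 (fun k => E n k - (kap k)%:M).
Proof.
have [I [X [_ X0 _ _ H]]] := E_expand E_br E_0 E_m1 `|n| 0.
have h1 := H n (lexx _); have h2 := @trunc_head _ _ s X 1 I n isT.
have {}h2 : mO 0 (fun k => trunc s X I n k - (kap k)%:M).
  apply: mO_ev h2; apply: ev_true => k; rewrite big_ord1 psi0 X0 scale1r.
  by rewrite scale_scalar_mx mulr1.
by apply: mO_ev (mOD h1 h2); apply: ev_true => k; rewrite addrA subrK.
Qed.

Lemma E_unit n : ev (fun k => E n k \in unitmx).
Proof. exact: near_scalar_unit (E_near n). Qed.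

Definition Comb L (d : int) (Y : int -> mx) := exists2 c : seq (K * seq int),
  (forall p, p \in c -> (size p.2 <= L)%N /\ dgw p.2 = d) &
  ev (fun k => Y k = \sum_(p <- c) p.1 *: wordmx p.2 k).

Lemma Comb_word w : Comb (size w) (dgw w) (wordmx w).
Proof.
exists [:: (1, w)] => [p|]; first by rewrite inE => /eqP->.
by apply: ev_true => k; rewrite big_seq1 scale1r.
Qed.

Lemma CombD L d Y Y' : Comb L d Y -> Comb L d Y' -> Comb L d (fun k => Y k + Y' k).
Proof.
move=> [c Hc Yc] [c' Hc' Yc']; exists (c ++ c') => [p|].
  by rewrite mem_cat => /orP[/Hc|/Hc'].
by apply: ev_imp2 Yc Yc' => k -> ->; rewrite big_cat.
Qed.

Lemma CombZ L d a Y : Comb L d Y -> Comb L d (fun k => a *: Y k).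
Proof.
move=> [c Hc Yc]; exists [seq (a * p.1, p.2) | p <- c] => [p /mapP[q /Hc qP ->] //|].
apply: ev_imp Yc => k ->; rewrite big_map scaler_sumr.
by apply: eq_bigr => p _; rewrite scalerA.
Qed.

Lemma CombM L d L' d' Y Y' : Comb L d Y -> Comb L' d' Y' ->
  Comb (L + L') (d + d') (fun k => Y (k + d') *m Y' k).
Proof.
move=> [c Hc Yc] [c' Hc' Yc'].
exists [seq (p.1 * p'.1, p.2 ++ p'.2) | p <- c, p' <- c'] => [p|].
  case/allpairsP => [[q q'] /= [/Hc[q1 q2] /Hc'[q1' q2'] ->]] /=.
  by rewrite size_cat dgw_cat q2 q2' leq_add.
apply: ev_imp2 (ev_shift d' Yc) Yc' => k -> ->.
rewrite big_allpairs_dep mulmx_suml; apply: eq_bigr => p _.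
rewrite mulmx_sumr; apply: eq_big_seq => p' /Hc'[_ dp'] /=.
by rewrite W_cat dp' -scalemxAl -scalemxAr scalerA.
Qed.

Lemma Comb_eq L d d' Y Y' : d = d' -> (forall k, Y k = Y' k) -> Comb L d Y -> Comb L d' Y'.
Proof. by move=> <- E1 [c Hc Yc]; exists c => //; apply: ev_imp Yc => k <-. Qed.

Lemma Comb_le L L' d Y : (L <= L')%N -> Comb L d Y -> Comb L' d Y.
Proof. by move=> LL [c Hc Yc]; exists c => // p /Hc[h1 h2]; split=> //; apply: leq_trans LL. Qed.

Lemma Comb_E n : Comb 1 n (E n).
Proof.
apply: Comb_eq (Comb_word [:: n]) => [|k]; first by rewrite dgw_cons /dgw big_nil addr0.
by rewrite /= mulmx1 /dgw big_nil addr0.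
Qed.

Lemma Comb_OmE m a b : Comb 2 (a + b) (OmE m a b).
Proof.
rewrite /OmE; elim: m (0 : int) => [|m IH] n /=; last first.
  by apply: Comb_eq (CombD (IH n) (CombZ (-1) (IH (n + 1)))) => // k; rewrite scaleN1r.
by apply: Comb_eq (CombM (Comb_E (a - n)) (Comb_E (b + n))) => //; lia.
Qed.

Lemma tr_OmE_Comb m a b L Y : (L + 3 <= m)%N -> Comb L (- (a + b)) Y ->
  ev (fun k => \tr (OmE m a b (k - (a + b)) *m Y k) = 0).
Proof.
move=> Lm [c Hc Yc].
have H : ev (fun k => forall p, p \in c -> T E m a b p.2 k = 0).
  apply: ev_seq => p /Hc[p1 p2]; apply: (T_eq0 E_br E_0 E_m1 (erefl (size p.2))).
    by apply: leq_trans (leq_add p1 (leqnn 3)) Lm.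
  by rewrite p2 addrN.
apply: ev_imp2 Yc H => k -> H; rewrite mulmx_sumr raddf_sum /= big_seq big1 // => p pc.
have := H p pc; rewrite T_OmE (Hc p pc).2 => e.
by rewrite -scalemxAr linearZ /= e mulr0.
Qed.

Definition dgl (l : seq (int * int)) : int := \sum_(p <- l) (p.1 + p.2).

Fixpoint PO m (l : seq (int * int)) k : mx :=
  if l is p :: l' then OmE m p.1 p.2 (k + dgl l') *m PO m l' k else 1%:M.

End FarNil.

(** By the theorem of Cayley and Hamilton an invertible matrix has the
    identity in the span of its positive powers. *)
Lemma inv_span (K : fieldType) n (c : 'M[K]_n.+1) : c \in unitmx ->
  exists g : 'I_n.+1 -> K, invmx c = \sum_(i < n.+1) g i *: c ^+ i.
Proof.
move=> cu; pose p := char_poly c; have p0 : p`_0 != 0.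
  by rewrite char_poly_det mulf_neq0 ?signr_eq0 // -unitfE -unitmxE.
exists (fun i => - (p`_0)^-1 * p`_i.+1).
have := Cayley_Hamilton c.
rewrite -[char_poly c]coefK poly_def size_char_poly rmorph_sum big_ord_recl /=.
rewrite linearZ /= rmorphXn /= horner_mx_X expr0 => /eqP; rewrite addr_eq0 => /eqP h.
have h2 : p`_0 *: (1 : 'M_n.+1) = - (c * \sum_(i < n.+1) p`_i.+1 *: c ^+ i).
  rewrite h mulr_sumr; congr (- _); apply: eq_bigr => i _.
  by rewrite linearZ /= rmorphXn /= horner_mx_X -scalerAr -exprS.
have -> : \sum_(i < n.+1) (- (p`_0)^-1 * p`_i.+1) *: c ^+ i = - (p`_0)^-1 *: \sum_(i < n.+1) p`_i.+1 *: c ^+ i.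
  by rewrite scaler_sumr; apply: eq_bigr => i _; rewrite scalerA.
set S := \sum_(i < n.+1) _ in h2 *.
apply: (can_inj (mulKmx cu)); rewrite mulmxV // -scalemxAr.
apply: (scalerI p0); rewrite h2 scalerA mulrN mulfV // scaleN1r.
by [].
Qed.

Section WindowsNil.
Variables (R : realType) (D' : nat).
Local Notation K := R[i].
Local Notation D := D'.+1.
Local Notation mx := 'M[K]_D.
Variables (s : K) (E : int -> int -> mx).
Local Notation kap k := (s + k%:~R).
Hypothesis E_br : forall n m, ev (fun k =>
  E n (k + m) *m E m k - E m (k + n) *m E n k = (m - n)%:~R *: E (n + m) k).
Hypothesis E_0 : ev (fun k => E 0 k = (kap k)%:M).
Hypothesis E_m1 : ev (fun k => E (-1) k = (kap k)%:M).
Local Notation OmE := (OmE E).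
Local Notation Comb := (Comb E).

Lemma Comb_1 L : Comb L 0 (fun _ => 1%:M).
Proof.
apply: (@Comb_le _ _ E 0) => //; apply: Comb_eq (@Comb_word _ _ E [::]) => //.
by rewrite /dgw big_nil.
Qed.

Lemma Comb_prod (T : Type) (Z : T -> int -> mx) L (w : seq T) :
  (forall t, Comb L 0 (Z t)) -> Comb (size w * L)%N 0 (fun k => \prod_(t <- w) Z t k).
Proof.
move=> HZ; elim: w => [|t w IH].
  by apply: Comb_eq (Comb_1 _) => // k; rewrite big_nil.
apply: Comb_eq (CombM (HZ t) IH) => [|k]; first by rewrite addr0.
by rewrite addr0 big_cons.
Qed.

Lemma Comb_exp (c : int -> mx) L i : Comb L 0 c -> Comb (i * L)%N 0 (fun k => c k ^+ i).
Proof.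
move=> Hc; elim: i => [|i IH]; first exact: Comb_1.
apply: Comb_eq (CombM Hc IH) => [|k]; first by rewrite addr0.
by rewrite addr0 exprS.
Qed.

(** Inserting words between the factors, the traces of all products vanish by
    [T_eq0]; the matrices that occur therefore generate an algebra of nilpotent
    elements, and long products in it are zero. *)
Lemma PO_eq0 (m : nat) (l : seq (int * int)) : ((D * D) * (2 * D + 2) + 3 <= m)%N ->
  size l = (D * D).+1 -> ev (fun k => PO E m l k = 0).
Proof.
move=> mD sl; pose q := (D * D).+1; pose H j := dgl (drop j l).
pose p j := nth (0, 0) l j; pose Om j := OmE m (p j).1 (p j).2.
have HS j : (j < q)%N -> H j = (p j).1 + (p j).2 + H j.+1.
  by move=> jq; rewrite /H (drop_nth (0, 0)) ?sl // /dgl big_cons.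
pose c j k := E (- H j) (k + H j) *m E (H j) k.
pose b j k := E (- H j) (k + H j) *m (Om j (k + H j.+1) *m E (H j.+1) k).
pose z (t : 'I_q * 'I_D) k := (c t.1 k ^+ t.2) *m b t.1 k.
have Cc j : Comb 2 0 (c j).
  by apply: Comb_eq (CombM (Comb_E E (- H j)) (Comb_E E (H j))) => //; rewrite addNr.
have Cb j : (j < q)%N -> Comb 4 0 (b j).
  move=> jq; have h := CombM (Comb_OmE E m (p j).1 (p j).2) (Comb_E E (H j.+1)).
  apply: Comb_eq (CombM (Comb_E E (- H j)) h) => [|k]; rewrite -?HS // ?addNr //.
have Cz t : Comb (2 * D + 2) 0 (z t).
  have h := CombM (Comb_exp t.2 (Cc t.1)) (Cb t.1 (ltn_ord t.1)).
  apply: Comb_le (_ : (t.2 * 2 + 4 <= _)%N) _; first by have := ltn_ord t.2; lia.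
  by apply: Comb_eq h => [|k]; rewrite ?addr0.
have trz n (w : n.-tuple ('I_q * 'I_D)) : (0 < n)%N -> (n <= D * D)%N ->
    ev (fun k => \tr (\prod_(t <- w) z t k) = 0).
  case: n w => // n; case/tupleP => t w _ nD.
  pose P k := \prod_(t <- w) z t k.
  have CP : Comb (n * (2 * D + 2)) 0 P.
    by have := Comb_prod w Cz; rewrite size_tuple.
  pose a := (p t.1).1; pose b' := (p t.1).2.
  have h1 := CombM (Comb_exp t.2 (Cc t.1)) (Comb_E E (- H t.1)).
  have h2 := CombM (Comb_E E (H t.1.+1)) (CombM CP h1).
  have {h1 h2}hY := Comb_eq (d' := - (a + b')) _ (fun _ => erefl) h2.
  have {}hY := hY _; rewrite !add0r in hY.
  have {}hY := tr_OmE_Comb E_br E_0 E_m1 (m := m) _ (hY _).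
  apply: ev_imp (ev_shift (H t.1) (hY _ _)) => [k||].
  - rewrite /= big_cons -/(P k) /z /b /Om => <-.
    rewrite -/a -/b' !addrK.
    have -> : k + H t.1 - (a + b') = k + H t.1.+1 by rewrite HS ?ltn_ord // -/a -/b'; lia.
    set A := OmE _ _ _ _; set F := E (- _) _; set G := E _ k; set c' := _ ^+ _.
    have -> : c' *m (F *m (A *m G)) * P k = (c' *m F) *m (A *m (G *m P k)).
      by rewrite -mulmxE !mulmxA.
    by rewrite mxtrace_mulC !mulmxA.
  - by apply: leq_trans mD; have := ltn_ord t.2; nia.
  by rewrite (HS t.1) ?ltn_ord // -/a -/b'; lia.
pose y j k := invmx (c j k) *m b j k.
have unit n : ev (fun k => E n k \in unitmx) := E_unit E_br E_0 E_m1 n.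
have u1 : ev (fun k => forall j, (j < q.+1)%N -> E (H j) k \in unitmx /\ E (- H j) (k + H j) \in unitmx).
  by apply: ev_nat => j _; apply: ev_and (unit _) (ev_shift _ (unit _)).
have trz' : ev (fun k => forall n : 'I_(D * D).+1, forall w : n.-tuple ('I_q * 'I_D), (0 < n)%N ->
    \tr (\prod_(t <- w) z t k) = 0).
  apply: (@ev_fin 'I_(D * D).+1) => n; apply: (@ev_fin (n.-tuple ('I_q * 'I_D))) => w.
  have [n0|n0] := boolP (0 < n)%N; last by apply: ev_true => k h; case/negP: n0.
  by apply: ev_imp (trz n w n0 _) => // ; rewrite -ltnS.
apply: ev_imp2 (ev_and u1 trz') E_0 => k [{}u1 {}trz'] E0.
have uc j : (j < q.+1)%N -> c j k \in unitmx.
  by move=> jq; rewrite unitmx_mul; have [-> ->] := u1 j jq.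
have y0 : \prod_(j < q) y j k = 0.
  apply: (@trace_nil_power _ _ _ (fun t => z t k)) => [n w n0 nD|j].
    exact: (trz' (Ordinal (nD : (n < (D * D).+1)%N)) w).
  have [g gE] := inv_span (uc j (leqW (ltn_ord j))).
  exists (fun t => if t.1 == j then g t.2 else 0).
  rewrite /y gE mulmx_suml -(pair_bigA _ (fun j' i => (if j' == j then g i else 0) *: z (j', i) k)) /=.
  rewrite (bigD1 j) //= eqxx [X in _ + X]big1 ?addr0 => [|j' /negPf j'j].
    by apply: eq_bigr => i _; rewrite -scalemxAl.
  by rewrite j'j big1 // => i _; rewrite scale0r.
have yE j : (j < q)%N -> y j k = invmx (E (H j) k) *m (Om j (k + H j.+1) *m E (H j.+1) k).
  move=> jq; have [uE uE'] := u1 j (leqW jq).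
  rewrite /y /b /c; apply: (can_inj (mulKmx uE)); apply: (can_inj (mulKmx uE')).
  rewrite mulKVmx // [in LHS]mulmxA [in LHS]mulmxA mulmxV ?mul1mx //; last exact: uc (leqW jq).
have tele i : (i <= q)%N -> \prod_(q - i <= j < q) y j k =
    invmx (E (H (q - i)%N) k) *m (PO E m (drop (q - i) l) k *m E (H q) k).
  elim: i => [|i IH] iq.
    have [uE _] := u1 q (leqnn _).
    by rewrite subn0 big_geq // drop_oversize ?sl //= mul1mx mulVmx.
  have iq' : (q - i.+1 < q)%N by lia.
  rewrite big_ltn // (_ : (q - i.+1).+1 = (q - i)%N); last by lia.
  rewrite IH ?(ltnW iq) // yE // (_ : (q - i.+1).+1 = (q - i)%N); last by lia.
  rewrite -mulmxE -!mulmxA; congr (_ *m _).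
  rewrite mulKVmx; last by have [] := u1 (q - i)%N _; first lia.
  rewrite (drop_nth (0, 0) (n := q - i.+1)) ?sl // (_ : (q - i.+1).+1 = (q - i)%N); last by lia.
  by rewrite /= mulmxA.
have := tele q (leqnn _); rewrite subnn drop0 big_mkord y0 => /esym.
have [uE _] := u1 0%N isT; have [uE' _] := u1 q (leqnn _).
move=> /(congr1 (mulmx (E (H 0%N) k))); rewrite mulKVmx // mulmx0.
by move=> /(congr1 (mulmx^~ (invmx (E (H q) k)))); rewrite mulmxK // mul0mx.
Qed.

End WindowsNil.

(** * A Jacobi identity for windows *)

Section Differencing.
Variables (X : zmodType) (K : fieldType) (V : lmodType K).
Implicit Types (f g : X -> V).

Definition dd u f : X -> V := fun x => f x - f (x + u).

Lemma ddC u v f : dd u (dd v f) = dd v (dd u f).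
Proof.
apply/funext => x; rewrite /dd [x + v + u]addrAC.
modring K V.
Qed.

Lemma iter_ddC m n u v f : iter m (dd u) (iter n (dd v) f) = iter n (dd v) (iter m (dd u) f).
Proof.
elim: m => //= m ->; elim: n => //= n <-; exact: ddC.
Qed.

Lemma iter_ddB m u f g :
  iter m (dd u) (fun x => f x - g x) = fun x => iter m (dd u) f x - iter m (dd u) g x.
Proof. by elim: m => //= m ->; apply/funext => x; rewrite /dd; modring K V. Qed.

Lemma iter_ddZ m u a f : iter m (dd u) (fun x => a *: f x) = fun x => a *: iter m (dd u) f x.
Proof. by elim: m => //= m ->; apply/funext => x; rewrite /dd; modring K V. Qed.

Lemma iter_dd0 m u : iter m (dd u) (fun _ => 0 : V) = fun _ => 0.
Proof. by elim: m => //= m ->; apply/funext => x; rewrite /dd subrr. Qed.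

Lemma iter_ddN m u f x : iter m (dd (- u)) f x = (-1) ^+ m *: iter m (dd u) f (x - u *+ m).
Proof.
elim: m x => [|m IH] x /=; first by rewrite scale1r subr0.
rewrite {1}/dd !IH /dd exprS !mulrS opprD addrA.
have -> : x - u - u *+ m + u = x - u *+ m by rewrite addrAC subrK.
by modring K V.
Qed.

Variable P : V -> Prop.
Hypothesis P_lin : forall a (u v : V), P u -> P v -> P (a *: u + v).
Hypothesis P_0 : P 0.

Lemma PZ a v : P v -> P (a *: v).
Proof. by move=> Pv; rewrite -[_ *: _]addr0; apply: P_lin. Qed.

Lemma PB u v : P u -> P v -> P (u - v).
Proof. by move=> Pu Pv; rewrite addrC -scaleN1r; apply: P_lin. Qed.

Lemma PZ_inv a v : a != 0 -> P (a *: v) -> P v.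
Proof. by move=> a0 /(PZ a^-1); rewrite scalerA mulVf // scale1r. Qed.

Lemma P_iter m u f : (forall x, P (f x)) -> forall x, P (iter m (dd u) f x).
Proof. by move=> Pf; elim: m => //= m IH x; apply: PB. Qed.

Lemma P_iterN m u f : (forall x, P (iter m (dd u) f x)) -> forall x, P (iter m (dd (- u)) f x).
Proof. by move=> Pf x; rewrite iter_ddN; apply: PZ. Qed.

End Differencing.

Lemma iter_dd_comp (X Y : zmodType) (K : fieldType) (V : lmodType K) (h : X -> Y)
  m u (f : Y -> V) : {morph h : x y / x + y} ->
  iter m (dd u) (fun x => f (h x)) = fun x => iter m (dd (h u)) f (h x).
Proof. by move=> hD; elim: m => //= m ->; apply/funext => x; rewrite /dd hD. Qed.

Lemma iter_twice (T : Type) (g : T -> T) k t : iter k (fun t => g (g t)) t = iter (2 * k) g t.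
Proof. by elim: k => // k IH; rewrite mulnS iterS IH. Qed.

Lemma iter_dd_pair (X : zmodType) (K : fieldType) (V : lmodType K) (T : Type)
    (F : T -> X -> V) (phi : T -> T) u v :
  (forall t, dd u (dd v (F t)) = F (phi t)) ->
  forall k t, iter k (dd u) (iter k (dd v) (F t)) = F (iter k phi t).
Proof.
move=> H; elim=> //= k IH t.
have -> : iter k (dd u) (dd v (iter k (dd v) (F t))) = dd v (iter k (dd u) (iter k (dd v) (F t))).
  exact: (iter_ddC k 1 u v).
by rewrite IH H.
Qed.

(** A high difference of [e_x e_y] is a combination of products of two
    differences, because commuting the middle letters of four letters
    produces a linear coefficient that differences cannot kill. *)
Section WittJacobi.
Variables (K : numFieldType) (V : lmodType K) (e : int -> V -> V).
Hypothesis e_lin : forall n, linear (e n).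
Hypothesis e_br : forall n m v, e n (e m v) - e m (e n v) = (m - n)%:~R *: e (n + m) v.
Variable P : V -> Prop.
Hypothesis P_lin : forall a u v, P u -> P v -> P (a *: u + v).
Hypothesis P_0 : P 0.
Variable v : V.

Definition Q2 (p : int * int) : V := e p.1 (e p.2 v).
Let T3 (p : int * int * int) : V := e p.1.1 (e p.1.2 (e p.2 v)).
Let G4 (p : int * int * (int * int)) : V := e p.1.1 (e p.1.2 (e p.2.1 (e p.2.2 v))).

Local Notation u4 a b c d := (((a : int), (b : int)), ((c : int), (d : int))).
Local Notation u3 a b c := (((a : int), (b : int)), (c : int)).

Variable m : nat.
Hypothesis m_gt0 : (0 < m)%N.
Hypothesis PG : forall x, P (iter m (dd (u4 (-1) 1 0 0)) (iter m (dd (u4 0 0 (-1) 1)) G4) x).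

Let swap23 (p : int * int * (int * int)) : int * int * (int * int) :=
  u4 p.1.1 p.2.1 p.1.2 p.2.2.
Let swap23_add : {morph swap23 : x y / x + y}. Proof. by []. Qed.

Let rev3 (p : int * int * int) : int * int * int := u3 p.2 p.1.2 p.1.1.

Let F4 (t : int * int * int -> V) (p : int * int * (int * int)) : V :=
  (p.2.1 - p.1.2)%:~R *: t (u3 p.1.1 (p.1.2 + p.2.1) p.2.2).

Let pair3D (a b c x y z : int) : u3 a b c + u3 x y z = u3 (a + x) (b + y) (c + z).
Proof. by []. Qed.

Lemma F4_12 t : dd (u4 (-1) 1 0 0) (dd (u4 (-1) 0 1 0) (F4 t)) =
  F4 (dd (u3 (-1) 1 0) (dd (u3 (-1) 1 0) t)).
Proof.
apply/funext => -[[a b] [c d]]; rewrite /dd /F4 /= !pair3D !addr0.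
have -> : b + 1 + c = b + c + 1 by lia.
have -> : b + (c + 1) = b + c + 1 by lia.
have -> : b + 1 + (c + 1) = b + c + 1 + 1 by lia.
by modred K V; rewrite ?(intrD, mulrNz); ring.
Qed.

Lemma F4_34 t : dd (u4 0 0 (-1) 1) (dd (u4 0 (-1) 0 1) (F4 t)) =
  F4 (dd (u3 0 (-1) 1) (dd (u3 0 (-1) 1) t)).
Proof.
apply/funext => -[[a b] [c d]]; rewrite /dd /F4 /= !pair3D !addr0.
have -> : b - 1 + c = b + c - 1 by lia.
have -> : b + (c - 1) = b + c - 1 by lia.
have -> : b - 1 + (c - 1) = b + c - 1 - 1 by lia.
by modred K V; rewrite ?(intrD, mulrNz); ring.
Qed.

Let e0 n : e n 0 = 0. Proof. exact: linear_fun0 (e_lin n). Qed.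
Let eB n x y : e n (x - y) = e n x - e n y.
Proof. by rewrite (linear_funD (e_lin n)) (linear_funN (e_lin n)). Qed.
Let eZ n a x : e n (a *: x) = a *: e n x.
Proof. exact: linear_funZ (e_lin n) a x. Qed.

Lemma jacobi_T x : P (iter (2 * m) (dd (u3 (-1) 1 0)) (iter (2 * m) (dd (u3 0 (-1) 1)) T3) x).
Proof.
pose XX (f : int * int * (int * int) -> V) := iter m (dd (u4 (-1) 1 0 0)) (iter m (dd (u4 (-1) 0 1 0))
  (iter m (dd (u4 0 0 (-1) 1)) (iter m (dd (u4 0 (-1) 0 1)) f))).
have XG y : P (XX G4 y).
  rewrite /XX (iter_ddC m m (u4 0 0 (-1) 1) (u4 0 (-1) 0 1)) (iter_ddC m m (u4 (-1) 0 1 0) (u4 0 (-1) 0 1)).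
  rewrite (iter_ddC m m (u4 (-1) 1 0 0) (u4 0 (-1) 0 1)) (iter_ddC m m (u4 (-1) 1 0 0) (u4 (-1) 0 1 0)).
  by do 2?apply: P_iter => // {}y; apply: PG.
have XGs y : P (XX (fun p => G4 (swap23 p)) y).
  rewrite /XX !(iter_dd_comp _ _ _ swap23_add) /swap23 /=.
  have := XG (swap23 y); congr P; rewrite /XX.
  rewrite (iter_ddC m m (u4 (-1) 1 0 0) (u4 (-1) 0 1 0)); congr (iter m (dd _) (iter m (dd _) _) _).
  by rewrite (iter_ddC m m).
have XF y : P (XX (F4 T3) y).
  have -> : F4 T3 = fun p => G4 p - G4 (swap23 p).
    apply/funext => -[[a b] [c d]]; rewrite /F4 /G4 /T3 /swap23 /=.
    by rewrite -eB e_br eZ.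
  by rewrite /XX !iter_ddB; apply: (PB P_lin); [exact: XG | exact: XGs].
have XFE : XX (F4 T3) = F4 (iter (2 * m) (dd (u3 (-1) 1 0)) (iter (2 * m) (dd (u3 0 (-1) 1)) T3)).
  by rewrite /XX (iter_dd_pair F4_34) (iter_dd_pair F4_12) !iter_twice.
case: x => [[a B] d]; have [B1|B1] := eqVneq B 0.
  have := XF (u4 a (B - 1) 1 d); rewrite XFE /F4 /= subrK; apply: PZ_inv => //.
  by rewrite intr_eq0 B1.
have := XF (u4 a B 0 d); rewrite XFE /F4 /= addr0 sub0r; apply: PZ_inv => //.
by rewrite intr_eq0 oppr_eq0.
Qed.

Let F3 (g : int * int -> V) (k : nat) (p : int * int * int) : V :=
  (p.2 - p.1.1 + k%:Z)%:~R *: g (p.1.1 + p.2 + k%:Z, p.1.2 - k%:Z).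

Lemma F3_step g k : dd (u3 (-1) 1 0) (dd (u3 0 (-1) 1) (F3 g k)) =
  fun p => (-1) *: F3 (dd (-1, 1) (dd (-1, 1) g)) k.+1 p.
Proof.
apply/funext => -[[a b] c]; rewrite /dd /F3 /=.
have pD (x y z w : int) : (x, y) + (z, w) = (x + z, y + w) by [].
rewrite !pD !addr0.
set s := a + c + k%:Z; set y := b - k%:Z.
have -> : a + (c + 1) + k%:Z = s + 1 by rewrite /s; lia.
have -> : a - 1 + c + k%:Z = s - 1 by rewrite /s; lia.
have -> : a - 1 + (c + 1) + k%:Z = s by rewrite /s; lia.
have -> : a + c + k.+1%:Z = s + 1 by rewrite /s; lia.
have -> : b - 1 - k%:Z = y - 1 by rewrite /y; lia.
have -> : b + 1 - k%:Z = y + 1 by rewrite /y; lia.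
have -> : b - k.+1%:Z = y - 1 by rewrite /y; lia.
have -> : b + 1 - 1 - k%:Z = y by rewrite /y; lia.
rewrite ?addrK ?subrK; have -> : k.+1%:Z = k%:Z + 1 by lia.
by modred K V; rewrite ?(intrD, mulrNz); ring.
Qed.

Lemma F3_iter n : forall g k, iter n (dd (u3 (-1) 1 0)) (iter n (dd (u3 0 (-1) 1)) (F3 g k)) =
  fun p => (-1) ^+ n *: F3 (iter (2 * n) (dd (-1, 1)) g) (k + n) p.
Proof.
elim: n => [|n IH] g k; first by apply/funext => p; rewrite scale1r addn0.
have -> : iter n.+1 (dd (u3 (-1) 1 0)) (iter n.+1 (dd (u3 0 (-1) 1)) (F3 g k)) =
    iter n (dd (u3 (-1) 1 0)) (iter n (dd (u3 0 (-1) 1)) (dd (u3 (-1) 1 0) (dd (u3 0 (-1) 1) (F3 g k)))).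
  rewrite !iterSr; congr (iter n _ _); exact: (iter_ddC 1 n).
rewrite F3_step !iter_ddZ IH; apply/funext => p.
by rewrite scalerA -exprS addSnnS mulnS add2n !iterSr.
Qed.

Lemma jacobi_Q x : P (iter (4 * m) (dd (-1, 1)) Q2 x).
Proof.
pose Y (f : int * int * int -> V) := iter (2 * m) (dd (u3 (-1) 1 0)) (iter (2 * m) (dd (u3 0 (-1) 1)) f).
have YB f g : Y (fun p => f p - g p) = fun p => Y f p - Y g p by rewrite /Y !iter_ddB.
have YT y : P (Y T3 y) by apply: jacobi_T.
have YTr y : P (Y (fun p => T3 (rev3 p)) y).
  have rD : {morph rev3 : x y / x + y} by [].
  rewrite /Y !(iter_dd_comp _ _ _ rD) /rev3 /=.
  move: (u3 y.2 _ _) => {}y.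
  have -> : u3 0 1 (-1) = - u3 0 (-1) 1 by [].
  have -> : u3 1 (-1) 0 = - u3 (-1) 1 0 by [].
  move: y; apply: P_iterN => // y; rewrite iter_ddC.
  by move: y; apply: P_iterN => // y; rewrite iter_ddC; apply: YT.
have m2 : (2 * m = (2 * m.-1).+2)%N by lia.
have Y1 : Y (fun p => (p.2 - p.1.2)%:~R *: Q2 (p.1.1, p.1.2 + p.2)) = fun _ => 0.
  rewrite /Y {2}m2 !iterSr (_ : dd _ (dd _ _) = fun _ => 0) ?iter_dd0 //.
  apply/funext => -[[a b] c]; rewrite /dd /= !addr0.
  have -> : b - 1 + (c + 1) = b + c by lia.
  have -> : b - 1 - 1 + (c + 1 + 1) = b + c by lia.
  by modred K V; rewrite ?(intrD, mulrNz); ring.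
have Y2 : Y (fun p => (p.1.2 - p.1.1)%:~R *: Q2 (p.2, p.1.1 + p.1.2)) = fun _ => 0.
  rewrite /Y iter_ddC {2}m2 !iterSr (_ : dd _ (dd _ _) = fun _ => 0) ?iter_dd0 //.
  apply/funext => -[[a b] c]; rewrite /dd /= !addr0.
  have -> : a - 1 + (b + 1) = a + b by lia.
  have -> : a - 1 - 1 + (b + 1 + 1) = a + b by lia.
  by modred K V; rewrite ?(intrD, mulrNz); ring.
have YF y : P (Y (F3 Q2 0) y).
  have -> : F3 Q2 0 = fun p => (T3 p - T3 (rev3 p)) - (p.2 - p.1.2)%:~R *: Q2 (p.1.1, p.1.2 + p.2) -
      (p.1.2 - p.1.1)%:~R *: Q2 (p.2, p.1.1 + p.1.2).
    apply/funext => -[[a b] c]; rewrite /F3 /T3 /rev3 /Q2 /= ?addr0 ?subr0.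
    have h1 := e_br b c v; have h2 := e_br a c (e b v); have h3 := e_br a b v.
    have {}h1 : e a (e b (e c v)) - e a (e c (e b v)) = (c - b)%:~R *: e a (e (b + c) v).
      by rewrite -eB h1 eZ.
    have {}h3 : e c (e a (e b v)) - e c (e b (e a v)) = (b - a)%:~R *: e c (e (a + b) v).
      by rewrite -eB h3 eZ.
    by rewrite -h1 -h2 -h3; modring K V.
  by rewrite !YB Y1 Y2 !subr0; apply: (PB P_lin); [exact: YT | exact: YTr].
case: x => x y.
have YF' a b c : P ((-1) ^+ (2 * m) *: F3 (iter (4 * m) (dd (-1, 1)) Q2) (2 * m) (u3 a b c)).
  by have := YF (u3 a b c); rewrite /Y F3_iter add0n mulnA.
have sn : (-1) ^+ (2 * m) != 0 :> K by rewrite signr_eq0.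
have {}YF' a b c := PZ_inv P_lin P_0 sn (YF' a b c).
have [E|NE] := eqVneq x (4 * m)%N%:Z.
  have e1 : (x : int) - (2 * m)%N%:Z - 1 + 1 + (2 * m)%N%:Z = x by lia.
  have := YF' (x - (2 * m)%N%:Z - 1) (y + (2 * m)%N%:Z) 1; rewrite /F3 /= e1 addrK.
  by apply: PZ_inv => //; rewrite intr_eq0; lia.
have := YF' (x - (2 * m)%N%:Z) (y + (2 * m)%N%:Z) 0; rewrite /F3 /= addrK addr0 subrK.
by apply: PZ_inv => //; rewrite intr_eq0; lia.
Qed.

End WittJacobi.

(** * Modules over the Witt algebra with bounded weight spaces *)

Section Bases.
Variables (K : fieldType) (V : lmodType K).
Implicit Types P Q : set V.

Definition lin n (b : 'I_n -> V) (c : 'cV[K]_n) : V := \sum_i c i 0 *: b i.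

Lemma lin_linear n (b : 'I_n -> V) : linear (lin b).
Proof.
move=> a u v; rewrite /lin scaler_sumr -big_split; apply: eq_bigr => i _.
by rewrite !mxE scalerDl scalerA.
Qed.

Lemma lin_delta n (b : 'I_n -> V) j : lin b (delta_mx j 0) = b j.
Proof.
rewrite /lin (bigD1 j) //= !mxE !eqxx scale1r big1 ?addr0 // => i ij.
by rewrite !mxE (negPf ij) scale0r.
Qed.

Definition subspace P := P 0 /\ forall a u v, P u -> P v -> P (a *: u + v).

Lemma subspace_sum P (I : finType) (c : I -> K) (f : I -> V) : subspace P ->
  (forall i, P (f i)) -> P (\sum_i c i *: f i).
Proof.
move=> [P0 PD] Pf; have : P (\sum_i c i *: f i + 0); last by rewrite addr0.
elim/big_rec: _ => [|i x _ Px]; first by rewrite addr0.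
by rewrite -addrA; apply: PD.
Qed.

Record isbasis P n (b : 'I_n -> V) : Prop := IsBasis {
  basis_mem : forall c, P (lin b c);
  basis_inj : forall c, lin b c = 0 -> c = 0;
  basis_onto : forall v, P v -> exists c, v = lin b c }.

Lemma basis_inj2 P n (b : 'I_n -> V) c c' : isbasis P b -> lin b c = lin b c' -> c = c'.
Proof.
move=> B e; apply/eqP; rewrite -subr_eq0; apply/eqP; apply: (basis_inj B).
by rewrite (linear_funD (lin_linear b)) (linear_funN (lin_linear b)) e subrr.
Qed.

Lemma exists_basis P d : subspace P -> dim_le P d -> exists n (b : 'I_n -> V), (n <= d)%N /\ isbasis P b.
Proof.
move=> sP; elim: d => [|d IH] [b Pb gen].
  exists 0%N, b; split=> //; split=> [c|c _|v /gen[c ->]].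
  - by rewrite /lin big_ord0; case: sP.
  - by apply/matrixP => -[].
  - by exists 0; rewrite /lin !big_ord0.
have [inj|] := pselect (forall c, lin b c = 0 -> c = 0).
  exists d.+1, b; split=> //; split=> // [c|v /gen[c ->]]; first exact: subspace_sum.
  by exists (\col_i c i); rewrite /lin; apply: eq_bigr => i _; rewrite mxE.
move=> /existsNP[c /not_implyP[c0 /eqP cn]].
have [i ci] : exists i, c i 0 != 0.
  apply/existsP; apply: contra_neqT cn => /existsPn H; apply/matrixP => i j.
  by rewrite mxE (ord1 j); have := H i; rewrite negbK => /eqP.
have bi : b i = \sum_(j < d) (- (c i 0)^-1 * c (lift i j) 0) *: b (lift i j).
  move: c0; rewrite /lin (bigD1_ord i) //= => /eqP; rewrite addr_eq0 => /eqP.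
  move=> /(congr1 ( *:%R (c i 0)^-1)); rewrite scalerA mulVf // scale1r => ->.
  rewrite -scaleN1r !scaler_sumr; apply: eq_bigr => j _; rewrite !scalerA.
  by congr (_ *: _); rewrite mulrN1.
have [|n [b' [nd B']]] := IH; last by exists n, b'; split=> //; apply: leqW.
exists (fun j => b (lift i j)) => [//|v /gen[g ->]].
exists (fun j => g (lift i j) - g i * (c i 0)^-1 * c (lift i j) 0).
rewrite (bigD1_ord i) //= bi scaler_sumr -big_split; apply: eq_bigr => j _ /=.
by rewrite scalerA -scalerDl; congr (_ *: _); rewrite addrC mulNr mulrN mulrA.
Qed.

Lemma basis_matrix P Q n m (b : 'I_n -> V) (b' : 'I_m -> V) (f : V -> V) :
  linear f -> isbasis P b -> isbasis Q b' -> (forall v, P v -> Q (f v)) ->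
  exists A : 'M[K]_(m, n), forall c, f (lin b c) = lin b' (A *m c).
Proof.
move=> fl B B' fPQ.
have H j : exists c, f (b j) = lin b' c.
  by apply: (basis_onto B'); apply: fPQ; rewrite -lin_delta; apply: (basis_mem B).
have [g gP] := choice H.
exists (\matrix_(i, j) g j i 0) => c.
have -> : f (lin b c) = \sum_j c j 0 *: f (b j).
  rewrite /lin; elim: (index_enum _) => [|j r IH]; first by rewrite !big_nil (linear_fun0 fl).
  by rewrite !big_cons fl IH.
rewrite /lin (eq_bigr (fun j => \sum_i (c j 0 * g j i 0) *: b' i)); last first.
  by move=> j _; rewrite gP /lin scaler_sumr; apply: eq_bigr => i _; rewrite scalerA.
rewrite exchange_big; apply: eq_bigr => i _; rewrite mxE scaler_suml.
by apply: eq_bigr => j _; rewrite mxE mulrC.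
Qed.

Lemma basis_inj_leq P Q n m (b : 'I_n -> V) (b' : 'I_m -> V) (f : V -> V) :
  linear f -> isbasis P b -> isbasis Q b' -> (forall v, P v -> Q (f v)) ->
  (forall v, P v -> f v = 0 -> v = 0) -> (n <= m)%N.
Proof.
move=> fl B B' fPQ fi; have [A HA] := basis_matrix fl B B' fPQ.
have Ar : row_free A^T.
  apply: inj_row_free => v vA; apply: trmx_inj; rewrite trmx0.
  apply: (basis_inj B); apply: fi; first exact: (basis_mem B).
  rewrite HA -[A]trmxK -trmx_mul vA trmx0; exact: linear_fun0 (lin_linear b').
by move: Ar; rewrite /row_free => /eqP <-; apply: rank_leq_col.
Qed.

Lemma basis_inj_onto P Q n (b : 'I_n -> V) (b' : 'I_n -> V) (f : V -> V) :
  linear f -> isbasis P b -> isbasis Q b' -> (forall v, P v -> Q (f v)) ->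
  (forall v, P v -> f v = 0 -> v = 0) -> forall w, Q w -> exists2 v, P v & f v = w.
Proof.
move=> fl B B' fPQ fi w Qw; have [A HA] := basis_matrix fl B B' fPQ.
have Ar : A \in unitmx.
  rewrite -unitmx_tr -row_free_unit.
  apply: inj_row_free => v vA; apply: trmx_inj; rewrite trmx0.
  apply: (basis_inj B); apply: fi; first exact: (basis_mem B).
  rewrite HA -[A]trmxK -trmx_mul vA trmx0; exact: linear_fun0 (lin_linear b').
have [c ->] := basis_onto B' Qw.
by exists (lin b (invmx A *m c)); [exact: (basis_mem B) | rewrite HA mulKVmx].
Qed.

(** Eigenvectors for distinct eigenvalues are independent. *)
Lemma eigen_count P d (T : V -> V) n (v : 'I_n -> V) (l : 'I_n -> K) :
  linear T -> dim_le P d -> (forall i, P (v i)) -> (forall i, v i != 0) ->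
  (forall i, T (v i) = l i *: v i) -> injective l -> (n <= d)%N.
Proof.
move=> Tl [b Pb gen] Pv vn0 Tv linj; rewrite leqNgt; apply/negP => dn.
have [A HA] := choice (fun i => gen (v i) (Pv i)).
pose M := \matrix_(i < n, j < d) A i j.
have : ~~ row_free M.
  by rewrite /row_free neq_ltn (leq_ltn_trans (rank_leq_col M) dn).
rewrite -kermx_eq0 => /rowV0Pn[u /sub_kermxP uM /negP un0]; apply: un0.
have rel0 : \sum_i u 0 i *: v i = 0.
  rewrite (eq_bigr (fun i => \sum_j (u 0 i * A i j) *: b j)); last first.
    by move=> i _; rewrite HA scaler_sumr; apply: eq_bigr => j _; rewrite scalerA.
  rewrite exchange_big big1 // => j _; rewrite -scaler_suml.
  have := congr1 (fun X : 'rV_d => X 0 j) uM; rewrite !mxE => e.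
  rewrite (_ : \sum_i _ = 0) ?scale0r // -[RHS]e; apply: eq_bigr => i _.
  by rewrite mxE.
have T0 := linear_fun0 Tl.
have TS (c : 'I_n -> K) : T (\sum_i c i *: v i) = \sum_i (c i * l i) *: v i.
  elim: (index_enum _) => [|j r IH]; first by rewrite !big_nil.
  by rewrite !big_cons Tl IH Tv scalerA.
have rel (p : {poly K}) : \sum_i (u 0 i * p.[l i]) *: v i = 0.
  elim/poly_ind: p => [|p c IH].
    by rewrite big1 // => i _; rewrite horner0 mulr0 scale0r.
  rewrite (eq_bigr (fun i => (u 0 i * p.[l i] * l i) *: v i + c *: (u 0 i *: v i))); last first.
    by move=> i _; rewrite !hornerE scalerA -scalerDl; congr (_ *: _); ring.
  by rewrite big_split -scaler_sumr /= rel0 scaler0 addr0 -TS IH T0.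
apply/eqP/matrixP => z i; rewrite mxE (ord1 z).
have := rel (\prod_(j | j != i) ('X - (l j)%:P)); rewrite (bigD1 i) //= [X in _ + X]big1 ?addr0.
  move/eqP; rewrite scaler_eq0 (negPf (vn0 i)) orbF mulf_eq0 => /orP[/eqP //|].
  rewrite horner_prod => /prodf_eq0[j ji].
  by rewrite !hornerE subr_eq0 => /eqP/linj e; rewrite e eqxx in ji.
move=> j ji; rewrite horner_prod (bigD1 j) //= !hornerE subrr /= ?(mul0r, mulr0).
by rewrite scale0r.
Qed.

End Bases.

Lemma nat_eventually (n : int -> nat) : ev (fun k => (n k <= n (k - 1)%R)%N) ->
  exists D, ev (fun k => n k = D).
Proof.
move=> [K0 H].
pose P D := `[< exists2 k, K0 <= k & n k = D >].
have ex : exists D, P D by exists (n K0); apply/asboolP; exists K0.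
case: (ex_minnP ex) => D /asboolP[k1 k01 nk1] Dmin; exists D, k1 => k k1k.
apply/eqP; rewrite eqn_leq; apply/andP; split; last first.
  by apply: Dmin; apply/asboolP; exists k => //; apply: le_trans k1k.
have -> : k = k1 + `|k - k1|%N%:Z by lia.
elim: `|k - k1|%N => [|p IH]; first by rewrite addr0 nk1.
apply: leq_trans (H _ _) _; first by lia.
by have -> : k1 + p.+1%:Z - 1 = k1 + p%:Z by lia.
Qed.

Section WittModule.
Variables (R : realType).
Local Notation K := R[i].
Variables (V : lmodType K) (e : int -> V -> V) (s : K) (d : nat).
Hypothesis e_lin : forall n, linear (e n).
Hypothesis e_br : forall n m v, e n (e m v) - e m (e n v) = (m - n)%:~R *: e (n + m) v.
Definition wt (k : int) : set V := [set v | e 0 v = (s + k%:~R) *: v].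
Hypothesis wt_dim : forall k, dim_le (wt k) d.

Let e0 n : e n 0 = 0 := linear_fun0 (e_lin n).
Let eD n u v : e n (u + v) = e n u + e n v := linear_funD (e_lin n) u v.
Let eZ n a v : e n (a *: v) = a *: e n v := linear_funZ (e_lin n) a v.

Lemma wt_subspace k : subspace (wt k).
Proof.
split=> [|a u v]; rewrite /wt /= ?e0 ?scaler0 // e_lin => -> ->.
by rewrite scalerDr !scalerA mulrC.
Qed.

Lemma e_wt n k v : wt k v -> wt (k + n) (e n v).
Proof.
rewrite /wt /= => wv; have := e_br 0 n v; rewrite add0r subr0 wv eZ => /eqP.
rewrite subr_eq => /eqP ->; rewrite -scalerDl intrD; congr (_ *: _); ring.
Qed.

Lemma iter_wt q k v i : wt k v -> wt (k + q * i%:Z) (iter i (e q) v).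
Proof.
move=> wv; elim: i => [|i IH]; first by rewrite mulr0 addr0.
have -> : k + q * i.+1%:Z = k + q * i%:Z + q by lia.
exact: e_wt.
Qed.

(** The lowering operator [e (- q)] and the raising operator [e q] generate a
    string as in the representation theory of sl2. *)
Lemma sl2_string q k v i : wt k v -> e (- q) v = 0 ->
  e (- q) (iter i.+1 (e q) v) =
  (q%:~R * i.+1%:R * (2 * (s + k%:~R) + i%:R * q%:~R)) *: iter i (e q) v.
Proof.
move=> wv ev0; elim: i => [|i IH].
  have := e_br (- q) q v; rewrite ev0 e0 subr0 /= addNr opprK => ->.
  rewrite [e 0 v]wv scalerA; congr (_ *: _); rewrite intrD; ring.
have := e_br (- q) q (iter i.+1 (e q) v); rewrite IH eZ addNr opprK => /eqP.
rewrite subr_eq => /eqP; rewrite -iterS => ->.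
rewrite [e 0 _](iter_wt q i.+1 wv) scalerA -[e q (iter i _ _)]/(iter i.+1 (e q) v) -scalerDl.
congr (_ *: _); rewrite !intrD intrM -!pmulrn -!natr1; ring.
Qed.

Lemma sl2_nonzero q k v : q != 0 -> wt k v -> e (- q) v = 0 -> v != 0 ->
  (forall i : nat, 2 * (s + k%:~R) + i%:R * q%:~R != 0) -> forall i, iter i (e q) v != 0.
Proof.
move=> q0 wv ev0 vn0 nz; elim=> [//|i IH]; apply/eqP => vi.
have := sl2_string i wv ev0; rewrite vi e0 => /esym/eqP; rewrite scaler_eq0 (negPf IH) orbF.
by rewrite !mulf_eq0 intr_eq0 (negPf q0) pnatr_eq0 (negPf (nz i)).
Qed.

(** Kernel vectors in infinitely many weight spaces would give, inside a
    single weight space, eigenvectors for more eigenvalues of [e (-1) (e 1 _)]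
    than the dimension allows. *)
Lemma e_m1_inj : ev (fun k => forall v, wt k v -> e (-1) v = 0 -> v = 0).
Proof.
have [K0 HK] := ev_kap_neq0 (2 * s).
apply: contrapT => /forallNP nev.
pose bad k := exists2 v, wt k v & e (-1) v = 0 /\ v != 0.
have ex k0 : exists k, k0 <= k /\ bad k.
  have /existsNP[k /not_implyP[k0k /existsNP[v /not_implyP[wv /not_implyP[ev0 /eqP vn]]]]] := nev k0.
  by exists k; split=> //; exists v.
have [f fP] := choice ex.
pose B := Num.max K0 1.
pose ks := fix ks n := if n is n'.+1 then f (ks n' + 1) else f B.
have ksB n : B <= ks n by elim: n => [|n IH] /=; [have := fP B | have := fP (ks n + 1)]; lia.
have ksinc n m : (n < m)%N -> ks n < ks m.
  elim: m => // m IH; rewrite ltnS leq_eqVlt => /orP[/eqP->|/IH h] /=.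
    by have [h _] := fP (ks m + 1); lia.
  by have [h' _] := fP (ks m + 1); lia.
have ksle n m : (n <= m)%N -> ks n <= ks m.
  by rewrite leq_eqVlt => /orP[/eqP->//|/ksinc/ltW].
have badk n : bad (ks n) by case: n => [|n] /=; [case: (fP B) | case: (fP (ks n + 1))].
have [w wP] := choice (fun n => let: ex_intro2 v a b := badk n in ex_intro (fun v => wt (ks n) v /\ e (-1) v = 0 /\ v != 0) v (conj a b)).
pose l := ks d; pose g (i : 'I_d.+1) := `|l - ks i|%N.
have gE (i : 'I_d.+1) : (g i)%:Z = l - ks i by rewrite /g /l; have := ksle i d (leq_ord i); lia.
pose lam (i : 'I_d.+1) : K := (g i).+1%:R * (2 * (s + (ks i)%:~R) + (g i)%:R).
have : (d.+1 <= d)%N; last by rewrite ltnn.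
apply: (@eigen_count _ _ (wt l) d (fun v => e (-1) (e 1 v)) _ (fun i : 'I_d.+1 => iter (g i) (e 1) (w i)) lam) => //.
- by move=> a u v; rewrite !e_lin.
- move=> i; have [wv _] := wP i; have := iter_wt 1 (g i) wv.
  by rewrite mul1r gE addrC subrK.
- move=> i; have [wv [ev0 vn]] := wP i; apply: (sl2_nonzero (q := 1) _ wv) => // j.
  have := HK (2 * ks i + j%:Z); have := ksB i; rewrite ge_max => /andP[h1 h2].
  by move=> /(_ ltac:(lia)); rewrite intrD intrM -pmulrn; congr (_ != 0); rewrite -?pmulrn; ring.
- move=> i; have [wv [ev0 vn]] := wP i; have := sl2_string (q := 1) (g i) wv ev0.
  by rewrite /= => ->; rewrite /lam; congr (_ *: _); ring.
move=> i j /eqP; rewrite -subr_eq0 /lam.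
have gK (i' : 'I_d.+1) : (g i')%:R = l%:~R - (ks i')%:~R :> K by rewrite -intrB -gE pmulrn.
rewrite -[(g i).+1%:R]natr1 -[(g j).+1%:R]natr1 !gK => H; apply: val_inj; apply/eqP; move: H; apply: contraTT => ij.
have nzk : ks i != ks j.
  case: (ltngtP i j) ij => // h _; first by have := ksinc _ _ h; lia.
  by have := ksinc _ _ h; lia.
have -> : (l%:~R - (ks i)%:~R + 1) * (2 * (s + (ks i)%:~R) + (l%:~R - (ks i)%:~R)) -
   (l%:~R - (ks j)%:~R + 1) * (2 * (s + (ks j)%:~R) + (l%:~R - (ks j)%:~R)) =
  ((ks i)%:~R - (ks j)%:~R) * - (2 * s + (ks i + ks j - 1)%:~R) :> K.
  by rewrite !intrD mulrNz; ring.
rewrite mulf_eq0 negb_or subr_eq0 eqr_int nzk oppr_eq0 /=; apply: HK.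
by have := ksB i; have := ksB j; lia.
Qed.

End WittModule.

Section FarWindows.
Variables (R : realType).
Local Notation K := R[i].
Variables (V : lmodType K) (e : int -> V -> V) (s : K) (d : nat).
Hypothesis e_lin : forall n, linear (e n).
Hypothesis e_br : forall n m v, e n (e m v) - e m (e n v) = (m - n)%:~R *: e (n + m) v.
Local Notation wt := (wt e s).
Hypothesis wt_dim : forall k, dim_le (wt k) d.
Local Notation kap k := (s + k%:~R).

Let e0 n : e n 0 = 0 := linear_fun0 (e_lin n).
Let eB n u v : e n (u - v) = e n u - e n v.
Proof. by rewrite (linear_funD (e_lin n)) (linear_funN (e_lin n)). Qed.
Let eZ n a v : e n (a *: v) = a *: e n v := linear_funZ (e_lin n) a v.

Definition OmV m (v : V) (p : int * int) : V := iter m (dd (-1, 1)) (Q2 e v) p.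

Lemma OmVS m v a b : OmV m.+1 v (a, b) = OmV m v (a, b) - OmV m v (a - 1, b + 1).
Proof. by []. Qed.

Lemma OmV_lin m p : linear (OmV m ^~ p).
Proof.
elim: m p => [|m IH] [a b] c u v; first by rewrite /OmV /= /Q2 !e_lin.
by rewrite !OmVS !IH; modring R[i] V.
Qed.

Lemma lin_e n D (b : 'I_D -> V) c : e n (lin b c) = lin (fun j => e n (b j)) c.
Proof.
rewrite /lin; elim: (index_enum _) => [|j r IH]; first by rewrite !big_nil e0.
by rewrite !big_cons e_lin IH.
Qed.

(** Far out all weight spaces are identified by means of [e (-1)]. *)
Lemma far_charts : exists D k0 (b : int -> 'I_D -> V) (E : int -> int -> 'M[K]_D),
  [/\ (D <= d)%N, forall k, k0 <= k -> isbasis (wt k) (b k),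
   forall n k, k0 <= k -> k0 <= k + n -> forall c, e n (lin (b k) c) = lin (b (k + n)) (E n k *m c) &
   forall k, k0 < k -> forall c, e (-1) (lin (b k) c) = lin (b (k - 1)) (kap k *: c)].
Proof.
have [bs bsP] := choice (fun k => exists_basis (wt_subspace s e_lin k) (wt_dim k)).
have [bb bbP] : exists bb : forall k, 'I_(bs k) -> V, forall k, (bs k <= d)%N /\ isbasis (wt k) (bb k).
  have H k : {b : 'I_(bs k) -> V | (bs k <= d)%N /\ isbasis (wt k) b} by apply: cid; apply: bsP.
  by exists (fun k => projT1 (H k)) => k; apply: (projT2 (H k)).
have [Ki HKi] := e_m1_inj e_lin e_br wt_dim.
have [Kn HKn] := ev_kap_neq0 s.
have wtm1 k v : wt k v -> wt (k - 1) (e (-1) v) by apply: e_wt.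
have [D [KD HD]] : exists D, ev (fun k => bs k = D).
  apply: nat_eventually; exists Ki => k /HKi inj.
  have [_ B] := bbP k; have [_ B'] := bbP (k - 1).
  exact: (basis_inj_leq (e_lin (-1)) B B' (@wtm1 k) inj).
pose k0 := Num.max Ki (Num.max Kn KD).
have bbD k : k0 <= k -> exists b : 'I_D -> V, isbasis (wt k) b.
  move=> k0k; have [_ B] := bbP k; have e1 : bs k = D by apply: HD; rewrite /k0 in k0k; lia.
  by move: (bb k) B; rewrite e1 => b B; exists b.
have Dd : (D <= d)%N by have [h _] := bbP KD; rewrite HD in h.
have onto k : k0 < k -> forall w, wt (k - 1) w -> exists2 v, wt k v & e (-1) v = w.
  move=> k0k; have [b B] := bbD k (ltW k0k); have [|b' B'] := bbD (k - 1); first by lia.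
  by apply: (basis_inj_onto (e_lin (-1)) B B' (@wtm1 k)); apply: HKi; rewrite /k0 in k0k; lia.
have [cb0 cb0P] := bbD k0 (lexx _).
pose T (n : nat) := {b : 'I_D -> V | isbasis (wt (k0 + n%:Z)) b}.
have step n (b : T n) : {b' : T n.+1 | forall j, e (-1) (sval b' j) = kap (k0 + n.+1%:Z) *: sval b j}.
  case: b => b B; apply: cid => /=.
  have kn0 : kap (k0 + n.+1%:Z) != 0 by apply: HKn; rewrite /k0; lia.
  have k1 : k0 + n.+1%:Z - 1 = k0 + n%:Z by lia.
  have wtb j : wt (k0 + n%:Z) (b j) by rewrite -lin_delta; apply: (basis_mem B).
  have H j : exists v, wt (k0 + n.+1%:Z) v /\ e (-1) v = kap (k0 + n.+1%:Z) *: b j.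
    have [||v wv ev] := onto (k0 + n.+1%:Z) _ (kap (k0 + n.+1%:Z) *: b j); first by lia.
      by rewrite k1; apply: (PZ (wt_subspace s e_lin _).2 (wt_subspace s e_lin _).1); apply: wtb.
    by exists v.
  have [b' b'P] := choice H.
  have eb' c : e (-1) (lin b' c) = kap (k0 + n.+1%:Z) *: lin b c.
    rewrite lin_e /lin scaler_sumr; apply: eq_bigr => j _.
    by rewrite (b'P j).2 !scalerA mulrC.
  suff B' : isbasis (wt (k0 + n.+1%:Z)) b' by exists (exist _ b' B') => j /=; apply: (b'P j).2.
  split=> [c|c c0|v wv].
  - by apply: subspace_sum; [exact: wt_subspace | move=> j; apply: (b'P j).1].
  - apply: (basis_inj B); have := eb' c; rewrite c0 e0 => /esym/eqP.
    by rewrite scaler_eq0 (negPf kn0) => /eqP.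
  have [c ec] : exists c, e (-1) v = lin b c.
    by apply: (basis_onto B); rewrite -k1; apply: wtm1.
  exists ((kap (k0 + n.+1%:Z))^-1 *: c); apply/eqP; rewrite -subr_eq0; apply/eqP.
  have wl c' : wt (k0 + n.+1%:Z) (lin b' c').
    by apply: subspace_sum; [exact: wt_subspace | move=> j; apply: (b'P j).1].
  apply: (HKi (k0 + n.+1%:Z)); first by rewrite /k0; lia.
    exact: (PB (wt_subspace s e_lin _).2 wv (wl _)).
  rewrite eB eb' ec (linear_funZ (lin_linear b)) scalerA mulfV // scale1r subrr //.
pose cb := fix cb n : T n := if n is n'.+1 then sval (step n' (cb n')) else exist _ cb0 (eq_ind_r (fun k => isbasis (wt k) cb0) cb0P (addr0 k0)).
pose b k := sval (cb `|(k - k0)%R|%N).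
have bB k : k0 <= k -> isbasis (wt k) (b k).
  move=> k0k; have := svalP (cb `|(k - k0)%R|%N); rewrite -/(b k).
  by have -> : k0 + `|(k - k0)%R|%N%:Z = k by lia.
have bm k j : k0 < k -> e (-1) (b k j) = kap k *: b (k - 1) j.
  move=> k0k; rewrite /b; have -> : `|(k - k0)%R|%N = `|(k - 1 - k0)%R|%N.+1 by lia.
  have -> : kap k = kap (k0 + `|(k - 1 - k0)%R|%N.+1%:Z) by congr (_ + _%:~R); lia.
  exact: (svalP (step _ _)).
have EH (nk : int * int) : exists A : 'M[K]_D, k0 <= nk.2 -> k0 <= nk.2 + nk.1 ->
    forall c, e nk.1 (lin (b nk.2) c) = lin (b (nk.2 + nk.1)) (A *m c).
  case: nk => n k /=; have [h1|h1] := boolP (k0 <= k); last by exists 0.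
  have [h2|h2] := boolP (k0 <= k + n); last by exists 0.
  have [A HA] := basis_matrix (e_lin n) (bB k h1) (bB _ h2) (fun v => @e_wt _ _ _ s e_lin e_br n k v).
  by exists A.
have [E EP] := choice EH.
exists D, k0, b, (fun n k => E (n, k)); split=> // [n k h1 h2 c|k k0k c].
  exact: (EP (n, k)).
rewrite lin_e (linear_funZ (lin_linear _)) /lin scaler_sumr; apply: eq_bigr => j _.
by rewrite bm // !scalerA mulrC.
Qed.

Lemma far_model : exists D k0 (b : int -> 'I_D -> V) (E : int -> int -> 'M[K]_D),
  [/\ (D <= d)%N, forall k, k0 <= k -> isbasis (wt k) (b k),
   forall n k, k0 <= k -> k0 <= k + n -> forall c, e n (lin (b k) c) = lin (b (k + n)) (E n k *m c) &
   [/\ forall n m, ev (fun k => E n (k + m) *m E m k - E m (k + n) *m E n k = (m - n)%:~R *: E (n + m) k),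
    ev (fun k => E 0 k = (kap k)%:M) & ev (fun k => E (-1) k = (kap k)%:M)]].
Proof.
have [D [k0 [b [E [Dd bB bE bm]]]]] := far_charts.
have inj k : k0 <= k -> forall n (A A' : 'M[K]_(D, n)), (forall c : 'cV_n, lin (b k) (A *m c) = lin (b k) (A' *m c)) -> A = A'.
  move=> k0k n A A' H; apply/matrixP => i j.
  have := basis_inj2 (bB k k0k) (H (delta_mx j 0)); rewrite -!colE => /(congr1 (fun X : 'cV_D => X i 0)).
  by rewrite !mxE.
have evk (c : int) : ev (fun k => k0 <= k + c) by exists (k0 - c) => k; lia.
have E_br n m' : ev (fun k => E n (k + m') *m E m' k - E m' (k + n) *m E n k = (m' - n)%:~R *: E (n + m') k).
  have h := ev_and (ev_and (ev_ge k0) (evk n)) (ev_and (evk m') (evk (n + m'))).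
  apply: ev_imp h => k [[h0 h1] [h2 h3]]; apply: (inj (k + (n + m'))) => // c.
  have h4 : k0 <= k + m' + n by lia.
  have h5 : k0 <= k + n + m' by lia.
  have := e_br n m' (lin (b k) c); rewrite !bE //.
  have -> : k + m' + n = k + (n + m') by lia.
  have -> : k + n + m' = k + (n + m') by lia.
  rewrite mulmxBl -!mulmxA -scalemxAl (linear_funD (lin_linear _)) (linear_funN (lin_linear _)) => ->.
  by rewrite (linear_funZ (lin_linear _)).
have E_0 : ev (fun k => E 0 k = (kap k)%:M).
  exists k0 => k k0k; apply: (inj k) => // c.
  have w := basis_mem (bB k k0k) c.
  have := bE 0 k k0k; rewrite addr0 => /(_ k0k) <-; rewrite w.
  by rewrite mul_scalar_mx (linear_funZ (lin_linear _)).
have E_m1 : ev (fun k => E (-1) k = (kap k)%:M).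
  exists (k0 + 1) => k k0k; apply: (inj (k - 1)); first by lia.
  move=> c; rewrite mul_scalar_mx -bm; last by lia.
  by rewrite bE //; lia.
by exists D, k0, b, E.
Qed.

Fixpoint POV m (l : seq (int * int)) (v : V) : V :=
  if l is p :: l' then OmV m (POV m l' v) p else v.

Lemma POV_lin m l : linear (POV m l).
Proof.
elim: l => [|p l IH] a u v //=; rewrite IH; exact: OmV_lin.
Qed.

Lemma POV_cat m l l' v : POV m (l ++ l') v = POV m l (POV m l' v).
Proof. by elim: l => //= p l ->. Qed.

(** Transports [PO_eq0] through the charts. *)
Lemma far_POV m l : (d * d * (2 * d + 2) + 3 <= m)%N -> (d * d < size l)%N ->
  ev (fun k => forall v, wt k v -> POV m l v = 0).
Proof.
move=> md sl; have [D [k0 [b [E [Dd bB bE [E_br E_0 E_m1]]]]]] := far_model.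
have evk (c : int) : ev (fun k => k0 <= k + c) by exists (k0 - c) => k; lia.
have OmM m' a b' : ev (fun k => forall c, OmV m' (lin (b k) c) (a, b') = lin (b (k + (a + b'))) (OmE E m' a b' k *m c)).
  elim: m' a b' => [|m' IH] a b'.
    have h := ev_and (ev_ge k0) (ev_and (evk b') (evk (a + b'))).
    apply: ev_imp h => k [h0 [h1 h2]] c; rewrite /OmV /= /Q2 /= bE // bE //; last by lia.
    rewrite /OmE /= subr0 addr0 mulmxA; congr (lin (b _) _); lia.
  apply: ev_imp2 (IH a b') (IH (a - 1) (b' + 1)) => k h1 h2 c.
  rewrite OmVS h1 h2; have -> : a - 1 + (b' + 1) = a + b' by lia.
  have -> : OmE E m'.+1 a b' k = OmE E m' a b' k - OmE E m' (a - 1) (b' + 1) k.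
    rewrite /OmE /=; congr (_ - _); rewrite -[0 + 1]/(0 + 1) -wd_shift; apply: eq_wd => i.
    have -> : a - (i + 1) = a - 1 - i by lia.
    by have -> : b' + (i + 1) = b' + 1 + i by lia.
  by rewrite mulmxBl (linear_funD (lin_linear _)) (linear_funN (lin_linear _)).
have POM l' : ev (fun k => forall c, POV m l' (lin (b k) c) = lin (b (k + dgl l')) (PO E m l' k *m c)).
  elim: l' => [|[a b'] l' IH].
    by apply: ev_true => k c; rewrite /= mul1mx /dgl big_nil addr0.
  apply: ev_imp2 IH (ev_shift (dgl l') (OmM m a b')) => k h1 h2 c.
  rewrite /= h1 h2 mulmxA /dgl big_cons /=; congr (lin (b _) _); lia.
pose l1 := take (size l - (D * D).+1) l; pose l2 := drop (size l - (D * D).+1) l.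
have DD : (D * D <= d * d)%N by apply: leq_mul.
have sl2 : size l2 = (D * D).+1 by rewrite size_drop; lia.
have PO2 : ev (fun k => PO E m l2 k = 0).
  case: D Dd b E bB bE E_br E_0 E_m1 OmM POM l1 l2 DD sl2 => [|D'] Dd b E bB bE E_br E_0 E_m1 OmM POM l1 l2 DD sl2.
    by apply: ev_true => k; apply/matrixP => -[].
  apply: (PO_eq0 E_br E_0 E_m1) => //; apply: leq_trans md; rewrite leq_add2r.
  by apply: leq_mul => //; rewrite leq_add2r leq_mul2l Dd.
apply: ev_imp2 (ev_and (ev_ge k0) (POM l2)) PO2 => k [k0k h2] h3 v wv.
have [c ->] := basis_onto (bB k k0k) wv.
rewrite -[l](cat_take_drop (size l - (D * D).+1)) POV_cat h2 h3 mul0mx.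
by rewrite (linear_fun0 (lin_linear _)) (linear_fun0 (POV_lin _ _)).
Qed.

Definition farzero (f : V -> V) := ev (fun k => forall v, wt k v -> f v = 0).

Lemma farzero_lin a f g : farzero f -> farzero g -> farzero (a *: f + g).
Proof.
move=> F G; apply: ev_imp2 F G => k hf hg v wv.
by rewrite addrfctE scalrfctE hf // hg // scaler0 addr0.
Qed.

Let e' n (f : V -> V) : V -> V := fun v => e n (f v).

Lemma farzero_refine m l' : (0 < m)%N -> forall l,
  (forall l'', size l'' = (2 * size l + size l')%N -> farzero (POV m l'')) ->
  farzero (fun v => POV (4 * m) l (POV m l' v)).
Proof.
move=> m0 l; elim/last_ind: l l' => [|l [a b] IH] l' H.
  exact: (H l').
pose P (f : V -> V) := farzero (fun v => POV (4 * m) l (f v)).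
have e'_lin n : linear (e' n) by move=> c f g; apply/funext => v; apply: e_lin.
have e'_br n p f : e' n (e' p f) - e' p (e' n f) = (p - n)%:~R *: e' (n + p) f.
  by apply/funext => v; apply: e_br.
have e'B n f g : e' n (f - g) = e' n f - e' n g by apply/funext => v; apply: eB.
have P_lin c f g : P f -> P g -> P (c *: f + g).
  move=> Pf Pg; rewrite /P (_ : (fun v => _) = c *: (fun v => POV (4 * m) l (f v)) + (fun v => POV (4 * m) l (g v))).
    exact: farzero_lin.
  by apply/funext => v; apply: POV_lin.
have P0 : P 0 by apply: ev_true => k v _; rewrite (linear_fun0 (POV_lin _ _)).
have H1 := @jacobi_Q K _ e' e'_lin e'_br P P_lin P0 (POV m l') m m0.
have evalE q f p v : iter q (dd (-1, 1)) (Q2 e' f) p v = OmV q (f v) p.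
  by elim: q p => [|q IHq] p //=; rewrite /dd /= -!IHq.
have -> : (fun v => POV (4 * m) (rcons l (a, b)) (POV m l' v)) =
    (fun v => POV (4 * m) l (iter (4 * m) (dd (-1, 1)) (Q2 e' (POV m l')) (a, b) v)).
  by apply/funext => v; rewrite -cats1 POV_cat /= evalE.
apply: H1 => -[p p'].
have inner q f : iter q (dd (0, 0, (-1, 1))) (fun x : int * int * (int * int) =>
     e' x.1.1 (e' x.1.2 (e' x.2.1 (e' x.2.2 f)))) =
   fun x => e' x.1.1 (e' x.1.2 (iter q (dd (-1, 1)) (Q2 e' f) x.2)).
  elim: q => [|q IHq] //; rewrite iterS IHq; apply/funext => -[[x y] z]; rewrite /dd /= !addr0.
  by rewrite !e'B.
have outer q (g : int * int -> V -> V) : iter q (dd (-1, 1, (0, 0))) (fun x : int * int * (int * int) =>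
     e' x.1.1 (e' x.1.2 (g x.2))) =
   fun x => iter q (dd (-1, 1)) (Q2 e' (g x.2)) x.1.
  elim: q => [|q IHq] //; rewrite iterS IHq; apply/funext => -[x [y z]]; rewrite /dd /=.
  by rewrite ?addr0.
rewrite inner outer /=.
have := IH [:: p, p' & l'] _; rewrite /P.
have -> : (fun v => POV (4 * m) l (POV m [:: p, p' & l'] v)) =
   (fun v => POV (4 * m) l (iter m (dd (-1, 1)) (Q2 e' (iter m (dd (-1, 1)) (Q2 e' (POV m l')) p')) p v)).
  by apply/funext => v; rewrite /= !evalE.
by apply => l'' sl''; apply: H; rewrite size_rcons sl'' /=; lia.
Qed.

(** Each application of [jacobi_Q] halves the number of factors in a product
    of windows and multiplies the order by four. *)
Definition window_order (d : nat) : nat := 4 ^ (d * d).+1 * (d * d * (2 * d + 2) + 3).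

(** Starting from products of [2 ^ t] windows, which vanish far out,
    [jacobi_Q] is applied [t] times. *)
Theorem far_windows a b : farzero (fun v => OmV (window_order d) v (a, b)).
Proof.
pose m0 := (d * d * (2 * d + 2) + 3)%N; pose t := (d * d).+1.
suff H i : (i <= t)%N -> forall l, size l = (2 ^ (t - i))%N -> farzero (POV (4 ^ i * m0) l).
  by have := H t (leqnn _) [:: (a, b)]; rewrite subnn => /(_ erefl).
elim: i => [|i IH] it l sl.
  rewrite expn0 mul1n; apply: far_POV => //; rewrite sl subn0 /t.
  by apply: leq_trans (ltn_expl _ (ltnSn 1)); lia.
have m0' : (0 < 4 ^ i * m0)%N by rewrite muln_gt0 expn_gt0 /m0; lia.
have := @farzero_refine (4 ^ i * m0) [::] m0' l; rewrite expnS -mulnA; apply=> l'' sl''.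
by apply: IH; [lia | rewrite sl'' sl addn0 -expnS; congr (_ ^ _)%N; lia].
Qed.

End FarWindows.

(** * Windows in the whole module *)

Section Casimir.
Variables (R : realType) (D : nat).
Local Notation K := R[i].
Local Notation mx := 'M[K]_D.
Local Notation nm := (@ComplexField.Normc.normc R).
Variables (s : K) (E : int -> int -> mx).
Local Notation kap k := (s + k%:~R).
Hypothesis E_br : forall n m, ev (fun k =>
  E n (k + m) *m E m k - E m (k + n) *m E n k = (m - n)%:~R *: E (n + m) k).
Hypothesis E_0 : ev (fun k => E 0 k = (kap k)%:M).
Hypothesis E_m1 : ev (fun k => E (-1) k = (kap k)%:M).

Lemma psi2 n k : psi s 2 n k = (n%:~R + 1) * n%:~R * ((kap k + n%:~R)^-1 * (kap k + n%:~R - 1)^-1).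
Proof. by rewrite !psiS psi0 !subr0 mul1r addrK mulrACA. Qed.

Lemma near_const_unit (C : mx) (f : int -> mx) : C \in unitmx -> mO (-1) (fun k => f k - C) ->
  ev (fun k => f k \in unitmx).
Proof.
move=> Cu fC; have h := mOM (mO_kap D s) (mOM fC (mO_const (invmx C))).
have : mO 0 (fun k => (kap k *: (f k *m invmx C)) - (kap k)%:M).
  apply: mO_ev h; apply: ev_true => k.
  by rewrite mulmxBl mulmxV // mulmxBr mulmx1 mul_scalar_mx.
move=> /near_scalar_unit; apply: ev_imp => k.
rewrite -mul_scalar_mx !unitmx_mul unitmx_inv Cu andbT => /andP[_ //].
Qed.

Lemma casimir_expand (A B X : mx) (x y a b c : K) :
  (A - y%:M - a *: X) *m B + y%:M *m (B - x%:M - b *: X) +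
  (a%:M *m X *m (B - x%:M - b *: X) + a%:M *m X *m (b%:M *m X)) + (a * x + y * b - c) *: X =
  A *m B - (x * y)%:M - c *: X.
Proof.
rewrite !mulmxBl !mulmxBr !mul_scalar_mx mul_mx_scalar -!scalemxAl -!scalemxAr.
rewrite scale_scalar_mx [y * x]mulrC; move: ((x * y)%:M) (A *m B) (X *m B) (X *m X) => U P Q S.
modring R[i] 'M[R[i]]_D.
Qed.

(** The Casimir operator of the copy of sl2 spanned by [e_(-q)], [e_0] and
    [e_q] is proportional to [q ^ 2] at infinity. *)
Lemma E_casimir : exists G : mx, forall q : int,
  mO (-1) (fun k => E (- q) (k + q) *m E q k - (kap k * (kap k + q%:~R))%:M - q%:~R ^+ 2 *: G).
Proof.
have [I1 [X1 [I12 X10 X11 eX1 _]]] := E_expand E_br E_0 E_m1 0 0.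
exists (2 *: X1 2) => q.
have [I [X [I2 X0 X11' eX HX]]] := E_expand E_br E_0 E_m1 `|q| 2.
have tr1 (Y : nat -> mx) L k : (2 < L)%N -> Y 0%N = 1%:M -> Y 1%N = 0 ->
    trunc s Y L 1 k = (kap k)%:M + (kap k * psi s 2 1 k) *: Y 2.
  move=> L2 Y0 Y1; rewrite /trunc (bigD1 (Ordinal (ltn0Sn L))) //= psi0 scale1r Y0.
  have i2 : (2 < L.+1)%N by lia.
  rewrite (bigD1 (Ordinal i2)) //= big1 ?addr0 => [|i].
    by rewrite scalerDr scalerA scale_scalar_mx mulr1.
  have [->|] := eqVneq (i : nat) 1%N; first by rewrite Y1 scaler0.
  move=> i1 /andP[i0 i2']; rewrite (_ : psi s i 1 k = 0) ?scale0r //.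
  have : (2 < i)%N by move: i0 i2' i1; rewrite -!val_eqE /=; lia.
  exact: (@psi_eq0 _ s i 2).
have X2E : X 2 = X1 2.
  have [k0 H] := ev_and (ev_and (eX 1 isT) (eX1 1 isT)) (ev_nz s 1 2).
  have [[h1 h2] nz] := H k0 (lexx _); move: h2; rewrite h1 !tr1 // => /addrI.
  apply: scalerI; rewrite psi2; have n0 := nz 0%N isT; have n1 := nz 1%N isT.
  rewrite subr0 in n0; rewrite addrK in n1.
  rewrite addrK; apply: mulf_neq0 => //; apply: mulf_neq0; last by apply: mulf_neq0; rewrite invr_eq0.
  by rewrite mulr1 -(intrD _ 1 1) intr_eq0.
have near (n : int) : `|n| <= `|q| -> mO (-2) (fun k => E n k - (kap k)%:M - (kap k * psi s 2 n k) *: X 2).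
  move=> nq; have h1 := HX n nq; have h2 := @trunc_head _ _ s X 3 I n (leqW I2).
  apply: mO_ev (mOD h1 h2); apply: ev_true => k.
  rewrite !big_ord_recl big_ord0 /= X0 X11' psi0 scaler0 scale1r addr0 add0r scalerDr.
  by rewrite scalerA scale_scalar_mx mulr1 addrA subrK opprD addrA.
pose a k := (kap k + q%:~R) * psi s 2 (- q) (k + q); pose b k := kap k * psi s 2 q k.
have N1 : mO (-2) (fun k => E (- q) (k + q) - (kap k + q%:~R)%:M - a k *: X 2).
  apply: mO_ev (mO_shift q (near (- q) _)); last by rewrite normrN.
  by apply: ev_true => k; rewrite /a intrD addrA.
have N2 : mO (-2) (fun k => E q k - (kap k)%:M - b k *: X 2) by apply: near.
have ba : mO (-1) (fun k => (b k)%:M : mx).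
  by apply: mO_ev (mOM (mO_kap D s) (psi_mO D s 2 q)); apply: ev_true => k; rewrite -scalar_mxM.
have aa : mO (-1) (fun k => (a k)%:M : mx).
  apply: mO_ev (mO_shift q (mOM (mO_kap D s) (psi_mO D s 2 (- q)))).
  by apply: ev_true => k; rewrite -scalar_mxM /a intrD addrA.
pose e1 k := E (- q) (k + q) - (kap k + q%:~R)%:M - a k *: X 2.
pose e2 k := E q k - (kap k)%:M - b k *: X 2.
(* the product expands into the scalar part, the part linear in [X 2] and
   terms that tend to zero *)
have T1 : mO (-1) (fun k => e1 k *m E q k).
  by apply: mO_le (mOM N1 (E_mO E_br E_0 E_m1 q)).
have kq1 : mO 1 (fun k => (kap k + q%:~R)%:M : mx).
  by apply: mO_ev (mO_shift q (mO_kap D s)); apply: ev_true => k; rewrite intrD addrA.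
have T2 : mO (-1) (fun k => (kap k + q%:~R)%:M *m e2 k).
  by apply: mO_le (mOM kq1 N2).
have T3 : mO (-1) (fun k => ((a k)%:M *m X 2) *m e2 k).
  by have := mOM (mOM aa (mO_const (X 2))) N2; apply: mO_le.
have T4 : mO (-1) (fun k => ((a k)%:M *m X 2) *m ((b k)%:M *m X 2)).
  by have := mOM (mOM aa (mO_const (X 2))) (mOM ba (mO_const (X 2))); apply: mO_le.
have T5 : mO (-1) (fun k => (a k * kap k + (kap k + q%:~R) * b k - 2 * q%:~R ^+ 2) *: X 2).
  have h1 := mO_kapV D (s - 1); have h2 := mO_kapV D (s + q%:~R - 1).
  have h := mOM (mOD (mOZ (q%:~R * (q%:~R - 1) * (q%:~R + 1)) h1) (mOZ (q%:~R * (q%:~R + 1) * (1 - q%:~R)) h2)) (mO_const (X 2)).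
  rewrite addr0 in h; apply: mO_ev h.
  apply: ev_imp2 (ev_and (ev_nz s q 2) (ev_kap_neq0 (s - 1))) (ev_kap_neq0 s) => k [nz n1] n0.
  have nq0 := nz 0%N isT; have nq1 := nz 1%N isT; rewrite subr0 in nq0.
  rewrite mulmxDl -!scalemxAl !mul_scalar_mx !scalerA -scalerDl; congr (_ *: _).
  rewrite /a /b !psi2 !intrD !mulrNz.
  have -> : s + (k%:~R + q%:~R) - q%:~R = kap k by ring.
  have -> : s - 1 + k%:~R = kap k - 1 by ring.
  have {}n1 : kap k - 1 != 0 by move: n1; congr (_ != 0); ring.
  have -> : s + q%:~R - 1 + k%:~R = kap k + q%:~R - 1 by ring.
  move: nq1; rewrite -[1%:R]/1.
  set x := kap k in n0 n1 nq0 *; set y := x + q%:~R in nq0 *; move=> nq1.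
  have -> : q%:~R = y - x by rewrite /y; ring.
  by clearbody y; field; rewrite n0 n1 nq0 nq1.
apply: mO_ev (mOD (mOD (mOD T1 T2) (mOD T3 T4)) T5); apply: ev_true => k.
rewrite /e1 /e2 X2E casimir_expand scalerA; congr (_ - _ *: _); ring.
Qed.

End Casimir.

(** A nonzero [s] and its negative are far from all integer multiples of a
    large [q]. *)
Lemma big_multiples (R : realType) (s : R[i]) : s != 0 ->
  exists Q : int, 0 < Q /\ forall q, Q <= q -> forall m : int, 2 * s + q%:~R * m%:~R != 0.
Proof.
move=> s0; have [K1 H1] := ev_kap_neq0 (2 * s); have [K2 H2] := ev_kap_neq0 (- (2 * s)).
exists (1 + `|K1| + `|K2|); split; first by lia.
move=> q qQ m; have [->|m0] := eqVneq m 0.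
  by rewrite mulr0 addr0 mulf_neq0 // pnatr_eq0.
have [mp|mn] := ltrP 0 m; first by rewrite -intrM; apply: H1; nia.
have := H2 (q * - m) ltac:(nia); rewrite intrM mulrNz mulrN -opprD oppr_eq0 //.
Qed.

Lemma eigenvalue_nonunit (F : fieldType) n (A : 'M[F]_n) a :
  (A - a%:M) \notin unitmx -> root (char_poly A) a.
Proof. by rewrite -eigenvalue_root_char /eigenvalue /eigenspace kermx_eq0 row_free_unit. Qed.

(** Division by distinct large integers gives numbers that differ modulo 1. *)
Lemma quotients_distinct (R : realType) (s : R[i]) : s != 0 ->
  exists B : int, 0 < B /\ forall q q' (j j' : int), B <= q -> q < q' ->
    s / q%:~R + j%:~R != s / q'%:~R + j'%:~R.
Proof.
move=> s0; have [K1 H1] := ev_kap_big 0 (@ComplexField.Normc.normc R s).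
exists (1 + `|K1|); split; first by lia.
move=> q q' j j' Bq qq'; apply/eqP => e.
have q0 : (q%:~R : R[i]) != 0 by rewrite intr_eq0; lia.
have q0' : (q'%:~R : R[i]) != 0 by rewrite intr_eq0; lia.
have {}e : s * (q' - q)%:~R = (q * q' * (j' - j))%:~R.
  have : (s / q%:~R + j%:~R) * (q%:~R * q'%:~R) = (s / q'%:~R + j'%:~R) * (q%:~R * q'%:~R) by rewrite e.
  rewrite !mulrDl => h; rewrite !(intrB, intrM, mulrBr).
  have -> : s * q'%:~R = s / q%:~R * (q%:~R * q'%:~R) by field.
  have -> : s * q%:~R = s / q'%:~R * (q%:~R * q'%:~R) by field.
  by apply/eqP; rewrite subr_eq -(inj_eq (addIr (j%:~R * (q%:~R * q'%:~R)))) h; apply/eqP; ring.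
have jj : j' - j != 0.
  apply: contra_neq s0 => jj; move: e; rewrite jj mulr0 => /eqP.
  by rewrite mulf_eq0 intr_eq0 => /orP[/eqP //|/eqP]; lia.
have := congr1 (@ComplexField.Normc.normc R) e; rewrite nmM !nm_int => {}e.
have : @ComplexField.Normc.normc R s < `|q%:~R|.
  by have := H1 q ltac:(lia); rewrite add0r nm_int.
rewrite -!intr_norm in e *; move: (ComplexField.Normc.normc s) (nm_ge0 s) e => x x0 e xq.
have h1 : x * `|q' - q|%:~R <= x * q'%:~R by rewrite ler_wpM2l // ler_int; lia.
have h2 : x * q'%:~R < `|q|%:~R * q'%:~R by rewrite ltr_pM2r // ltr0z; lia.
have := le_lt_trans h1 h2; rewrite e -intrM ltr_int => h; nia.
Qed.

Section Near.
Variables (R : realType).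
Local Notation K := R[i].
Variables (V : lmodType K) (e : int -> V -> V) (s : K) (d : nat).
Hypothesis e_lin : forall n, linear (e n).
Hypothesis e_br : forall n m v, e n (e m v) - e m (e n v) = (m - n)%:~R *: e (n + m) v.
Local Notation wt := (wt e s).
Hypothesis wt_dim : forall k, dim_le (wt k) d.
Hypothesis s0 : s != 0.
Local Notation kap k := (s + k%:~R).

(** A vector killed by [e (-q)] generates eigenvectors of the Casimir operator
    in the far part, where this operator is constant up to the factor
    [q ^ 2]; hence [s / q + j] is a root of a fixed polynomial. *)
Lemma near_root : exists2 P : {poly K}, P != 0 &
  exists Q : int, 0 < Q /\ forall q, Q <= q -> forall (j : int) v,
    wt (q * j) v -> e (- q) v = 0 -> v != 0 -> root P (s / q%:~R + j%:~R).
Proof.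
have [D [k0 [b [E [Dd bB bE [E_br E_0 E_m1]]]]]] := far_model e_lin e_br wt_dim.
have [G HG] := E_casimir E_br E_0 E_m1.
have [Q [Q0 HQ]] := big_multiples s0.
exists (char_poly G \Po (- ('X * ('X - 1%:P)))).
  rewrite comp_poly_eq0; first exact: monic_neq0 (char_poly_monic G).
  by rewrite size_polyN size_Mmonic ?monicXsubC ?polyX_eq0 // size_polyX size_XsubC.
exists Q; split=> // q Qq j v wv ev0 vn0.
have q0 : (q%:~R : K) != 0 by rewrite intr_eq0; lia.
rewrite root_comp !hornerE; apply: eigenvalue_nonunit; apply/negP => Gu.
pose mu : K := - (kap (q * j) * (kap (q * j) - q%:~R)).
have Cu : q%:~R ^+ 2 *: G - mu%:M \in unitmx.
  have qu : (q%:~R ^+ 2 : K) \is a GRing.unit by rewrite unitfE expf_neq0.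
  rewrite -(unitmxZ _ qu) in Gu; move: Gu; rewrite scalerBr scale_scalar_mx; congr (_ - _%:M \in unitmx).
  by rewrite /mu intrM; field.
have h : mO (-1) (fun k => (E (- q) (k + q) *m E q k - (kap k * (kap k + q%:~R))%:M - mu%:M) - (q%:~R ^+ 2 *: G - mu%:M)).
  by apply: mO_ev (HG q); apply: ev_true => k; rewrite opprB addrA subrK.
have [k1 Hk1] := near_const_unit s Cu h.
have evn i : iter i (e q) v != 0.
  apply: (sl2_nonzero e_lin e_br _ wv) => //; first by rewrite -(intr_eq0 K).
  move=> i'; have := HQ q Qq (2 * j + i'%:Z); rewrite intrD !intrM -pmulrn; congr (_ != 0); ring.
pose i := `|k0|%N + `|k1|%N + (`|j|)%N.
pose k := q * j + q * i%:Z.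
have kk0 : k0 <= k by rewrite /k /i; nia.
have kk1 : k1 <= k by rewrite /k /i; nia.
have [c wc] := basis_onto (bB k kk0) (iter_wt e_lin e_br q i wv).
have := sl2_string e_lin e_br i wv ev0; rewrite /= wc bE //; last by lia.
have kq : k + q + - q = k by lia.
rewrite bE ?kq //; last by lia.
rewrite mulmxA -(linear_funZ (lin_linear _)) => /(basis_inj2 (bB k kk0)) ec.
have /negP := evn i; apply; rewrite wc.
suff -> : c = 0 by rewrite (linear_fun0 (lin_linear _)).
rewrite -(mulKmx (Hk1 k kk1) c) !mulmxBl ec !mul_scalar_mx -!scalerBl.
rewrite (_ : _ - _ - mu = 0) ?scale0r ?mulmx0 // /mu /k intrD -natr1 !intrM -pmulrn; ring.
Qed.

(** By [near_root] and [quotients_distinct] a fixed polynomial would have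
    infinitely many roots if injectivity failed for infinitely many steps. *)
Lemma near_inj : exists Q : int, 0 < Q /\ forall q, Q <= q -> forall (j : int) v,
  wt (q * j) v -> e (- q) v = 0 -> v = 0.
Proof.
have [P P0 [Q [Q0 HQ]]] := near_root.
have [B [B0 HB]] := quotients_distinct s0.
apply: contrapT => /forallNP nex.
pose root_at q x := exists2 j : int, x = s / q%:~R + j%:~R & root P x.
have ex Q' : exists q, [/\ Q' <= q, B <= q & exists x, root_at q x].
  have /not_andP[|] := nex (Num.max (Num.max Q B) Q').
    by move=> h; exfalso; apply: h; lia.
  move=> /existsNP[q /not_implyP[qQ /existsNP[j /existsNP[v]]]].
  move=> /not_implyP[wv /not_implyP[ev0 /eqP vn0]]; exists q; split; [by lia..|].
  by exists (s / q%:~R + j%:~R), j => //; apply: HQ wv ev0 vn0; lia.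
suff [l [C [sl ul lP lR]]] : exists (l : seq K) C, [/\ size l = size P, uniq l, all (root P) l &
    forall x, x \in l -> exists q j : int, [/\ B <= q, q <= C & x = s / q%:~R + j%:~R]].
  by have := max_poly_roots P0 lP ul; rewrite sl ltnn.
elim: (size P) => [|n [l [C [sl ul lP lR]]]]; first by exists [::], 0.
have [q [Cq Bq [x [j xE rx]]]] := ex (C + 1).
exists (x :: l), q; split=> /=; rewrite ?sl ?rx ?ul ?andbT //.
  apply/negP => /lR[q' [j' [Bq' q'C xE']]].
  by have := HB q' q j' j Bq' ltac:(lia); rewrite -xE -xE' eqxx.
move=> y; rewrite inE => /orP[/eqP ->|/lR[q' [j' [Bq' q'C yE]]]]; first by exists q, j.
by exists q', j'; split=> //; lia.
Qed.

End Near.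

Section WindowComm.
Variables (R : realType).
Local Notation K := R[i].
Variables (V : lmodType K) (e : int -> V -> V) (s : K) (d : nat).
Hypothesis e_lin : forall n, linear (e n).
Hypothesis e_br : forall n m v, e n (e m v) - e m (e n v) = (m - n)%:~R *: e (n + m) v.
Hypothesis wt_dim : forall k, dim_le (wt e s k) d.

Let e0 n : e n 0 = 0 := linear_fun0 (e_lin n).
Let eN n v : e n (- v) = - e n v := linear_funN (e_lin n) v.
Let eD n u v : e n (u + v) = e n u + e n v := linear_funD (e_lin n) u v.
Let eZ n a v : e n (a *: v) = a *: e n v := linear_funZ (e_lin n) a v.

Lemma OmV_comm m v a b : e (-1) (OmV e m v (a, b)) = OmV e m (e (-1) v) (a, b) +
  ((a + 1 - m%:Z)%:~R *: OmV e m v (a - 1, b) + (b + 1)%:~R *: OmV e m v (a, b - 1)).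
Proof.
elim: m a b => [|m IH] a b.
  rewrite /OmV /= /Q2 /= subr0.
  have h1 := e_br (-1) a (e b v); have h2 := e_br (-1) b v.
  have -> : e (-1) (e a (e b v)) = e a (e (-1) (e b v)) + (a + 1)%:~R *: e (a - 1) (e b v).
    by rewrite -[a - 1]addrC -[a + 1]/(a - -1) -h1 addrC subrK.
  have -> : e (-1) (e b v) = e b (e (-1) v) + (b + 1)%:~R *: e (b - 1) v.
    by rewrite -[b - 1]addrC -[b + 1]/(b - -1) -h2 addrC subrK.
  by rewrite eD eZ; modring R[i] V.
have b1 : b + 1 - 1 = b by rewrite addrK.
have b2 : b - 1 + 1 = b by rewrite subrK.
rewrite !OmVS eD eN !IH b1 b2.
modred R[i] V; rewrite ?(intrD, mulrNz, intrM) -?pmulrn -?natr1; ring.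
Qed.

(** A vanishing window on one weight space is propagated downwards by
    [e (-1)]. *)
Lemma windows_down M : (forall j w, wt e s (j - 1) w -> exists2 v, wt e s j v & e (-1) v = w) ->
  (forall a b, farzero e s (fun v => OmV e M v (a, b))) ->
  forall a b j v, M%:Z - 1 <= a -> -1 <= b -> wt e s j v -> OmV e M v (a, b) = 0.
Proof.
move=> onto far a b j v; have [n] := ubnP (`|(a + b - M%:Z + 2)%R|)%N.
elim: n a b j v => // n IH a b j v nab aM bM.
have step v' j' : wt e s j' v' -> e (-1) (OmV e M v' (a, b)) = OmV e M (e (-1) v') (a, b).
  move=> wv'; rewrite OmV_comm.
  have -> : (a + 1 - M%:Z)%:~R *: OmV e M v' (a - 1, b) = 0.
    have [->|aM'] := eqVneq a (M%:Z - 1); first by rewrite subrK subrr scale0r.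
    by rewrite (IH _ _ j') ?scaler0 //; lia.
  have -> : (b + 1)%:~R *: OmV e M v' (a, b - 1) = 0.
    have [->|bM'] := eqVneq b (-1); first by rewrite addNr scale0r.
    by rewrite (IH _ _ j') ?scaler0 //; lia.
  by rewrite !addr0.
have [k0 Hk] := far a b.
suff H i j' v' : k0 - i%:Z <= j' -> wt e s j' v' -> OmV e M v' (a, b) = 0.
  by apply: (H (`|(k0 - j)%R|)%N); lia.
elim: i j' v' => [|i IHi] j' v' ij wv'; first by apply: Hk wv'; lia.
have [|w ww <-] := onto (j' + 1) v'; first by rewrite addrK.
rewrite -(step w (j' + 1) ww) (IHi (j' + 1)) ?e0 //; lia.
Qed.

Lemma minus_inj : s != 0 -> exists Q : int, 0 < Q /\ forall q, Q <= q -> forall (j : int) v,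
  wt e s (q * j) v -> e q v = 0 -> v = 0.
Proof.
move=> s0; pose f n v := - e (- n) v.
have f_lin n : linear (f n) by move=> a u v; rewrite /f e_lin opprD scalerN.
have f_br n m v : f n (f m v) - f m (f n v) = (m - n)%:~R *: f (n + m) v.
  rewrite /f !eN !opprK e_br scalerN -scaleNr -mulrNz; have -> : - (n + m) = - n + - m by lia.
  by congr (_%:~R *: _); lia.
have wtE k v : wt f (- s) k v <-> wt e s (- k) v.
  rewrite /wt /f /= oppr0 mulrNz; split=> [/eqP|->]; last first.
    by rewrite -scaleNr opprD opprK.
  by rewrite eqr_oppLR -scaleNr opprD opprK => /eqP.
have wd k : dim_le (wt f (- s) k) d.
  have [b Pb gen] := wt_dim (- k); exists b => [i|v /wtE]; last exact: gen.
  exact/wtE/Pb.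
have ns0 : - s != 0 by rewrite oppr_eq0.
have [Q [Q0 HQ]] := near_inj f_lin f_br wd ns0.
exists Q; split=> // q Qq j v wv ev0; apply: (HQ q Qq (- j)).
  by apply/wtE; rewrite mulrN opprK.
by rewrite /f opprK ev0 oppr0.
Qed.

Lemma e_onto : s != 0 -> exists Q : int, 0 < Q /\ forall q, Q <= q -> forall (j : int) w,
  wt e s (q * (j - 1)) w -> exists2 v, wt e s (q * j) v & e (- q) v = w.
Proof.
move=> s0; have [Q1 [Q10 H1]] := near_inj e_lin e_br wt_dim s0; have [Q2' [Q20 H2]] := minus_inj s0.
exists (Q1 + Q2'); split; first by lia.
move=> q Qq j w ww.
have [n [b [_ B]]] := exists_basis (wt_subspace s e_lin (q * j)) (wt_dim _).
have [m [b' [_ B']]] := exists_basis (wt_subspace s e_lin (q * (j - 1))) (wt_dim _).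
have f1 v : wt e s (q * j) v -> wt e s (q * (j - 1)) (e (- q) v).
  by move=> /(e_wt e_lin e_br (- q)); have -> : q * j + - q = q * (j - 1) by lia.
have f2 v : wt e s (q * (j - 1)) v -> wt e s (q * j) (e q v).
  by move=> /(e_wt e_lin e_br q); have -> : q * (j - 1) + q = q * j by lia.
have i1 v : wt e s (q * j) v -> e (- q) v = 0 -> v = 0 by apply: H1; lia.
have i2 v : wt e s (q * (j - 1)) v -> e q v = 0 -> v = 0 by apply: H2; lia.
have nm : n = m.
  apply/eqP; rewrite eqn_leq (basis_inj_leq (e_lin (- q)) B B' f1 i1).
  exact: (basis_inj_leq (e_lin q) B' B f2 i2).
by rewrite -nm in b' B'; apply: (basis_inj_onto (e_lin (- q)) B B' f1 i1).
Qed.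

End WindowComm.

(** For large [q] the operators [e (q n)], divided by [q], form a module with
    the same relations in which [e (-1)] acts bijectively on all weight spaces, so
    that windows vanishing far out vanish everywhere. *)
Theorem good_windows (R : realType) (V : lmodType R[i]) (e : int -> V -> V) (s : R[i]) (d : nat) :
  (forall n, linear (e n)) ->
  (forall n m v, e n (e m v) - e m (e n v) = (m - n)%:~R *: e (n + m) v) ->
  (forall k, dim_le (wt e s k) d) -> s != 0 -> exists Q : int, 0 < Q /\ forall q, Q <= q -> forall (j : int) v,
  wt e s (q * j) v -> forall a b : int, (window_order d)%:Z - 1 <= a -> -1 <= b ->
  iter (window_order d) (dd (-1, 1)) (fun p : int * int => e (q * p.1) (e (q * p.2) v)) (a, b) = 0.
Proof.
move=> e_lin e_br wt_dim s0; have [Q [Q0 onto]] := e_onto e_lin e_br wt_dim s0.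
have eZ n a v : e n (a *: v) = a *: e n v := linear_funZ (e_lin n) a v.
exists Q; split=> // q Qq j v wv a b aM bM.
have q0 : (q%:~R : R[i]) != 0 by rewrite intr_eq0; lia.
pose f n v := q%:~R^-1 *: e (q * n) v.
have f_lin n : linear (f n) by move=> c u w; rewrite /f e_lin; modring R[i] V.
have f_br n m w : f n (f m w) - f m (f n w) = (m - n)%:~R *: f (n + m) w.
  rewrite /f !eZ -!scalerBr e_br -mulrDr !scalerA; congr (_ *: _).
  by rewrite -mulrBr intrM; field.
have wtE k w : wt f (s / q%:~R) k w <-> wt e s (q * k) w.
  rewrite /wt /f /= mulr0 intrM; split=> [/(congr1 ( *:%R q%:~R))|->].
    by rewrite !scalerA mulfV // scale1r => ->; congr (_ *: _); field.
  by rewrite scalerA; congr (_ *: _); field.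
have wd k : dim_le (wt f (s / q%:~R) k) d.
  have [b' Pb gen] := wt_dim (q * k); exists b' => [i|w /wtE]; last exact: gen.
  exact/wtE/Pb.
have E m p w : OmV f m w p = q%:~R ^- 2 *: iter m (dd (-1, 1)) (fun p : int * int => e (q * p.1) (e (q * p.2) w)) p.
  elim: m p => [|m IH] p; first by rewrite /OmV /= /Q2 /f eZ scalerA -invfM.
  by rewrite /OmV /= {1 3}/dd scalerBr -!IH.
have ontof k w : wt f (s / q%:~R) (k - 1) w -> exists2 v, wt f (s / q%:~R) k v & f (-1) v = w.
  move=> /wtE ww; have [|u wu eu] := onto q Qq k (q%:~R *: w).
    by rewrite /wt /= eZ [e 0 w]ww !scalerA mulrC.
  exists u; first exact/wtE.
  by rewrite /f mulrN1 eu scalerA mulVf // scale1r.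
have := windows_down f_lin f_br ontof (far_windows f_lin f_br wd) aM bM.
move/(_ j v); rewrite E => H; have /H/eqP : wt f (s / q%:~R) j v by apply/wtE.
by rewrite scaler_eq0 invr_eq0 expf_eq0 (negPf q0) andbF => /eqP.

Qed.

(** * Polynomials on progressions *)

Section LineDifferences.
Variables (K : numFieldType) (V : lmodType K).
Implicit Types f g : int -> V.
Local Notation ddm := (@dd int K V (-1)).

Lemma iter_dd_local m f g (a : int) : (forall i : nat, (i <= m)%N -> f (a - i%:Z) = g (a - i%:Z)) ->
  iter m ddm f a = iter m ddm g a.
Proof.
elim: m a => [|m IH] a H; first by have := H 0%N isT; rewrite subr0.
rewrite !iterS /dd (IH a) ?(IH (a - 1)) // => i im; last exact: H (leqW im).
by have := H i.+1 im; rewrite (_ : a - 1 - i%:Z = a - i.+1%:Z) //; lia.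
Qed.

Lemma iter_dd_shift m f (c a : int) : iter m ddm (fun t => f (t + c)) a = iter m ddm f (a + c).
Proof.
elim: m a => [//|m IH] a; by rewrite !iterS {1 3}/dd !IH addrAC.
Qed.

Lemma iter_ddD m f g a : iter m ddm (fun t => f t + g t) a = iter m ddm f a + iter m ddm g a.
Proof. by elim: m a => [//|m IH] a; rewrite !iterS /dd !IH opprD addrACA. Qed.

(** Multiplication by a linear function raises the degree by one. *)
Lemma iter_dd_linear (B : int) m g (x y : K) : (forall p : int, p <= B -> iter m ddm g p = 0) ->
  forall p : int, p <= B -> iter m.+1 ddm (fun t => (x + t%:~R * y) *: g t) p = 0.
Proof.
elim: m g => [|m IH] g H p pB.
  have g0 u : u <= B -> g u = 0 := H u.
  by rewrite /= /dd !g0 ?scaler0 ?subr0 //; lia.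
rewrite iterSr.
rewrite (_ : ddm _ = fun t => (x + t%:~R * y) *: ddm g t + y *: (fun t => g (t - 1)) t).
  rewrite iter_ddD IH // => [|p' p'B]; last by have := H p' p'B; rewrite iterSr.
  by rewrite iter_ddZ iter_dd_shift H ?scaler0 ?addr0 //; lia.
by apply/funext => t; rewrite /dd intrB; modring K V.
Qed.

(** Taking a second difference in [j] removes the terms [K0] and [K1], which
    depend on [j] linearly. *)
Lemma line_elim (H G K0 K1 : int -> V) (z : K) (A B : int) : z != 0 ->
  (forall a j : int, A <= a -> a + j <= B ->
    H (a + j) + (j%:~R * z) *: G (a + j) + K0 a + (j%:~R * z) *: K1 a = 0) ->
  forall p : int, p <= B -> iter 2 ddm G p = 0.
Proof.
move=> z0 E p pB; have [j jE] : exists j, j = p - A by exists (p - A).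
have e1 := E A j (lexx _); have e2 := E A (j - 1) (lexx _); have e3 := E A (j - 2) (lexx _).
have f1 := E (A + 1) (j - 1); have f2 := E (A + 1) (j - 2); have f3 := E (A + 1) (j - 3).
have p1 : A + j = p by lia.
have p2 : A + (j - 1) = p - 1 by lia.
have p3 : A + (j - 2) = p - 1 - 1 by lia.
have p1' : A + 1 + (j - 1) = p by lia.
have p2' : A + 1 + (j - 2) = p - 1 by lia.
have p3' : A + 1 + (j - 3) = p - 1 - 1 by lia.
rewrite p1 in e1; rewrite p2 in e2; rewrite p3 in e3; rewrite p1' in f1; rewrite p2' in f2; rewrite p3' in f3.
move: {e1}(e1 pB) {e2}(e2 ltac:(lia)) {e3}(e3 ltac:(lia)) {f1}(f1 ltac:(lia) pB)
  {f2}(f2 ltac:(lia) ltac:(lia)) {f3}(f3 ltac:(lia) ltac:(lia)).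
rewrite !intrB; set jj : K := j%:~R => e1 e2 e3 f1 f2 f3.
apply: (scalerI z0); rewrite /= /dd scaler0.
have -> : z *: (G p - G (p - 1) - (G (p - 1) - G (p - 1 - 1))) =
  (H p + (jj * z) *: G p + K0 A + (jj * z) *: K1 A)
  - 2 *: (H (p - 1) + ((jj - 1%:~R) * z) *: G (p - 1) + K0 A + ((jj - 1%:~R) * z) *: K1 A)
  + (H (p - 1 - 1) + ((jj - 2%:~R) * z) *: G (p - 1 - 1) + K0 A + ((jj - 2%:~R) * z) *: K1 A)
  - (H p + ((jj - 1%:~R) * z) *: G p + K0 (A + 1) + ((jj - 1%:~R) * z) *: K1 (A + 1))
  + 2 *: (H (p - 1) + ((jj - 2%:~R) * z) *: G (p - 1) + K0 (A + 1) + ((jj - 2%:~R) * z) *: K1 (A + 1))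
  - (H (p - 1 - 1) + ((jj - 3%:~R) * z) *: G (p - 1 - 1) + K0 (A + 1) + ((jj - 3%:~R) * z) *: K1 (A + 1)).
  by modring K V.
by rewrite e1 e2 e3 f1 f2 f3 !scaler0 !(subr0, addr0).
Qed.

End LineDifferences.

Section Progressions.
Variable K : numFieldType.
Local Notation ddm := (@dd int K K^o (-1)).
Implicit Types f : int -> K^o.

Lemma dd_poly m (p : {poly K}) : (size p <= m)%N -> forall t, iter m ddm (fun t => p.[t%:~R]) t = 0.
Proof.
elim/poly_ind: p m => [|p c IH] m; first by move=> _ t; rewrite (_ : (fun _ => _) = fun _ => 0) ?iter_dd0 //; apply/funext => u; rewrite horner0.
case: m => [|m] sp t.
  move: sp; rewrite leqn0 size_poly_eq0 => /eqP e; rewrite (_ : (fun _ => _) = fun _ => 0) ?iter_dd0 //.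
  by apply/funext => u; rewrite e horner0.
have sp' : (size p <= m)%N by move: sp; rewrite size_MXaddC; case: ifP => [/andP[/eqP-> _] _|_]; rewrite ?size_poly0.
rewrite (_ : (fun _ => _) = fun t : int => (0 + t%:~R * 1) *: (p.[t%:~R] : K^o) + (c : K^o)); last first.
  by apply/funext => u; rewrite !hornerE; congr (_ + c); rewrite mulrC.
rewrite iter_ddD (iter_dd_linear 0 1 (fun q _ => IH m sp' q) (lexx t)) add0r.
rewrite iterSr (_ : ddm _ = fun _ => 0) ?iter_dd0 //; by apply/funext => u; rewrite /dd subrr.
Qed.

Lemma interpolation m f : exists2 p : {poly K}, (size p <= m)%N & forall i : nat, (i < m)%N -> p.[i%:R] = f i.
Proof.
elim: m => [|m [p sp pE]]; first by exists 0; rewrite ?size_poly0.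
pose w : {poly K} := \prod_(i < m) ('X - (i%:R)%:P).
have w0 : w.[m%:R] != 0.
  rewrite /w horner_prod; apply/prodf_neq0 => i _; rewrite !hornerE subr_eq0 eqr_nat.
  by rewrite neq_ltn ltn_ord orbT.
exists (p + ((f m - p.[m%:R]) / w.[m%:R]) *: w).
  rewrite (leq_trans (size_polyD _ _)) // geq_max (leq_trans sp) //.
  rewrite (leq_trans (size_scale_leq _ _)) // /w size_prod_XsubC.
  by rewrite /index_enum -enumT size_enum_ord.
move=> i; rewrite ltnS leq_eqVlt => /orP[/eqP->|im].
  by rewrite !hornerE mulfVK // addrC subrK.
rewrite !hornerE pE //; have -> : w.[i%:R] = 0; last by rewrite mulr0 addr0.
by rewrite /w horner_prod (bigD1 (Ordinal im)) //= !hornerE subrr mul0r.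
Qed.

Lemma dd_eq0 m f : (forall t, iter m ddm f t = 0) -> (forall i : nat, (i < m)%N -> f i = 0) ->
  forall t, f t = 0.
Proof.
elim: m f => [|m IH] f H f0; first by move=> t; exact: H.
have df t : ddm f t = 0.
  have := IH (fun t => ddm f (t + 1)) _ _ (t - 1); rewrite subrK; apply.
    by move=> u; rewrite (iter_dd_shift m (ddm f)) -iterSr.
  move=> i im; rewrite /dd addrK (f0 i (leqW im)) subr0.
  by rewrite -(f0 i.+1 im); congr f; lia.
have st t : f t = f (t - 1) by apply/eqP; rewrite -subr_eq0; apply/eqP; exact: df.
move=> t; have f00 : f 0 = 0 by exact: (f0 0%N).
have [tp|tn] := lerP 0 t.
  have -> : t = (`|t|)%N%:Z by lia.
  by elim: (`|t|)%N => [|n IHn] //; rewrite st (_ : n.+1%:Z - 1 = n) //; lia.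
have -> : t = - (`|t|)%N%:Z by lia.
by elim: (`|t|)%N => [|n IHn] //; rewrite -IHn [RHS]st; congr f; lia.
Qed.

Lemma dd_polyP m f : (forall t, iter m ddm f t = 0) ->
  exists2 p : {poly K}, (size p <= m)%N & forall t, f t = p.[t%:~R].
Proof.
move=> H; have [p sp pE] := interpolation m f; exists p => // t; apply/eqP; rewrite -subr_eq0; apply/eqP.
apply: (@dd_eq0 m (fun t => f t - p.[t%:~R])) => [u|i im]; last by rewrite -pmulrn pE // subrr.
by rewrite iter_ddB H dd_poly // subrr.
Qed.

Lemma poly_roots_eq (p q : {poly K}) (a b : int) : b != 0 ->
  (forall z : int, p.[(a + b * z)%:~R] = q.[(a + b * z)%:~R]) -> p = q.
Proof.
move=> b0 H; apply/eqP; rewrite -subr_eq0; apply/negPn/negP => pq.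
pose rs := [seq (a + b * i%:Z)%:~R : K | i <- iota 0 (size (p - q))].
have ar : all (root (p - q)) rs.
  by apply/allP => x /mapP[i _ ->]; rewrite rootE !hornerE H subrr.
have ur : uniq rs.
  rewrite map_inj_uniq ?iota_uniq // => i j /eqP; rewrite eqr_int => /eqP/addrI/(mulfI b0).
  by case.
by have := max_poly_roots pq ar ur; rewrite size_map size_iota ltnn.
Qed.

(** Progressions of coprime steps meet infinitely often, so that the
    polynomials found on the progressions through the points off [T] coincide. *)
Lemma progression_poly m f (T : int -> Prop) :
  (forall t0, ~ T t0 -> exists Q : int, 0 < Q /\ forall q, Q <= q -> forall j : int,
     iter m ddm (fun t : int => f (t0 + q * t)) j = 0) ->
  forall a : int, (forall i : nat, (i <= m)%N -> ~ T (a - i%:Z)) -> iter m ddm f a = 0.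
Proof.
move=> H a aT.
have prog t0 q : q != 0 -> (forall j : int, iter m ddm (fun t : int => f (t0 + q * t)) j = 0) ->
    exists2 p : {poly K}, (size p <= m)%N & forall z : int, f (t0 + q * z) = p.[(t0 + q * z)%:~R].
  move=> q0 /dd_polyP[p sp pE].
  have qK : (q%:~R : K) != 0 by rewrite intr_eq0.
  exists (p \Po (q%:~R^-1 *: ('X - (t0%:~R)%:P))).
    by rewrite size_comp_poly2 // size_scale ?invr_eq0 // size_XsubC.
  by move=> z; rewrite horner_comp pE !hornerE intrD intrM [t0%:~R + _]addrC addrK mulKf.
have a0 : ~ T a by have := aT 0%N isT; rewrite subr0.
have [Q0 [Q00 HQ0]] := H a a0.
have [P sP PE] := prog a Q0 (lt0r_neq0 Q00) (HQ0 Q0 (lexx _)).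
have fP t1 : ~ T t1 -> f t1 = P.[t1%:~R].
  move=> /H[Q1 [Q10 HQ1]]; pose q := Q0 * Q1 + 1.
  have q0 : q != 0 by rewrite /q; nia.
  have [P1 sP1 P1E] := prog t1 q q0 (HQ1 q ltac:(rewrite /q; nia)).
  have -> : P = P1.
    apply: (@poly_roots_eq _ _ (t1 + q * (a - t1)) (q * Q0)) => [|z]; first by apply: mulf_neq0 => //; apply: lt0r_neq0.
    have -> : t1 + q * (a - t1) + q * Q0 * z = t1 + q * (a - t1 + Q0 * z) by ring.
    rewrite -P1E; have -> : t1 + q * (a - t1 + Q0 * z) = a + Q0 * (Q1 * (a - t1) + q * z) by rewrite /q; ring.
    by rewrite PE.
  by have := P1E 0; rewrite mulr0 addr0.
by rewrite (@iter_dd_local _ K^o _ _ (fun t => P.[t%:~R])) ?dd_poly // => i im; apply: fP; apply: aT.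
Qed.

End Progressions.

(** The same for functions with values in a space of finite dimension,
    coordinate by coordinate. *)
Lemma progression_poly_vec (K : numFieldType) (V : lmodType K) (S : set V) d m (f : int -> V) (T : int -> Prop) :
  subspace S -> dim_le S d -> (forall t, S (f t)) ->
  (forall t0, ~ T t0 -> exists Q : int, 0 < Q /\ forall q, Q <= q -> forall j : int,
     iter m (dd (-1)) (fun t : int => f (t0 + q * t)) j = 0) ->
  forall a : int, (forall i : nat, (i <= m)%N -> ~ T (a - i%:Z)) -> iter m (dd (-1)) f a = 0.
Proof.
move=> sS dS Sf H a aT; have [n [b [_ B]]] := exists_basis sS dS.
have [c cE] := choice (fun t => basis_onto B (Sf t)).
have dE k (g : int -> 'cV[K]_n) t : iter k (dd (-1)) (fun t => lin b (g t)) t = lin b (iter k (dd (-1)) g t).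
  elim: k t => [|k IH] t //; rewrite !iterS /dd !IH.
  by rewrite (linear_funD (lin_linear b)) (linear_funN (lin_linear b)).
have dcE k (g : int -> 'cV[K]_n) t i : iter k (dd (-1)) g t i 0 = iter k (dd (-1)) (fun t => g t i 0 : K^o) t.
  by elim: k t => [|k IH] t //; rewrite !iterS /dd -!IH !mxE.
rewrite (_ : f = fun t => lin b (c t)); last exact/funext.
rewrite dE (_ : iter _ _ _ _ = 0) ?(linear_fun0 (lin_linear b)) //.
apply/matrixP => i z; rewrite (ord1 z) dcE mxE.
apply: (@progression_poly _ _ _ T) aT => t0 /H[Q [Q0 HQ]]; exists Q; split=> // q Qq j.
have := HQ q Qq j; rewrite (_ : (fun t => _) = fun t => lin b (c (t0 + q * t))); last by apply/funext => t; rewrite cE.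
by rewrite (dE _ (fun t => c (t0 + q * t))) -(dcE _ (fun t => c (t0 + q * t))) => /(basis_inj B) ->; rewrite mxE.
Qed.

Ltac z_atoms X env t :=
  lazymatch t with
  | (?a + ?b)%R => let env' := z_atoms X env a in z_atoms X env' b
  | (- ?a)%R => z_atoms X env a
  | (?a *~ ?c)%R => z_atoms X env a
  | (?a *+ ?c)%R => z_atoms X env a
  | 0%R => env
  | _ => mod_add t env
  end.

Ltac z_reify env t :=
  lazymatch t with
  | (?a + ?b)%R => let a' := z_reify env a in let b' := z_reify env b in
      constr:(@MAdd int a' b')
  | (- ?a)%R => let a' := z_reify env a in constr:(@MOpp int a')
  | (?a *~ ?c)%R => let a' := z_reify env a in constr:(@MScale int c a')
  | (?a *+ ?c)%R => let a' := z_reify env a in constr:(@MScale int (Posz c) a')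
  | 0%R => constr:(@MZero int)
  | _ => let n := mod_index t env in constr:(@MVar int n)
  end.

(** Identities in a commutative group. *)
Ltac zmodring X :=
  lazymatch goal with
  | |- ?a = ?b =>
    let env := z_atoms X (@nil X) a in
    let env := z_atoms X env b in
    let a' := z_reify env a in
    let b' := z_reify env b in
    refine (@mod_eq int (zmodule X) env a' b' _); cbn [mcoefs_eq mcoef size eqn]; do ?[split] => //; ring
  end.

Lemma ddE (X : zmodType) (K : fieldType) (V : lmodType K) (u : X) (f : X -> V) x : dd u f x = f x - f (x + u).
Proof. by []. Qed.

(** * Products of two generators along a line *)

Section AdditiveFunctions.
Variables (X : zmodType) (K : pzRingType) (h : X -> K).
Hypothesis hD : forall x y, h (x + y) = h x + h y.

Lemma addfun0 : h 0 = 0.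
Proof. by apply: (addIr (h 0)); rewrite -hD !add0r. Qed.

Lemma addfunN x : h (- x) = - h x.
Proof. by apply/eqP; rewrite -addr_eq0 -hD addNr addfun0. Qed.

Lemma addfunMz x n : h (x *~ n) = n%:~R * h x.
Proof.
have nat k : h (x *+ k) = k%:R * h x.
  by elim: k => [|k IH]; rewrite ?mul0r ?addfun0 // mulrS hD IH -[k.+1]add1n natrD mulrDl mul1r.
by case: n => n; rewrite ?NegzE -?pmulrn ?mulrNz ?addfunN -?pmulrn nat // mulNr.
Qed.

End AdditiveFunctions.

Section LatticeModule.
Variables (R : realType).
Local Notation K := R[i].
Variables (X : zmodType) (om : X -> X -> K) (r : X -> K).
Hypothesis omDl : forall x y z, om (x + y) z = om x z + om y z.
Hypothesis omDr : forall z x y, om z (x + y) = om z x + om z y.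
Hypothesis omxx : forall x, om x x = 0.
Hypothesis rD : forall x y, r (x + y) = r x + r y.
Hypothesis generic : forall a b, b != 0 -> om a b + 2 * r b != 0.

Definition brc x y := om x y + r y - r x.

Variables (V : lmodType K) (L : X -> V -> V) (s : K) (d : nat).
Hypothesis L_lin : forall x, linear (L x).
Hypothesis L_br : forall x y v, L x (L y v) - L y (L x v) = brc x y *: L (x + y) v.
Definition lwt x : set V := [set v | L 0 v = (s + r x) *: v].
Hypothesis lwt_dim : forall x, dim_le (lwt x) d.

Let L0 x : L x 0 = 0 := linear_fun0 (L_lin x).
Let LD x u v : L x (u + v) = L x u + L x v := linear_funD (L_lin x) u v.
Let LN x v : L x (- v) = - L x v := linear_funN (L_lin x) v.
Let LZ x a v : L x (a *: v) = a *: L x v := linear_funZ (L_lin x) a v.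

Lemma om0l x : om 0 x = 0. Proof. exact: (addfun0 (h := om^~ x)). Qed.
Lemma om0r x : om x 0 = 0. Proof. exact: addfun0 (omDr x). Qed.
Lemma omNl x y : om (- x) y = - om x y.
Proof. exact: (addfunN (h := om^~ y)). Qed.
Lemma omNr x y : om x (- y) = - om x y.
Proof. exact: addfunN (omDr x) y. Qed.
Lemma omMl x y n : om (x *~ n) y = n%:~R * om x y.
Proof. exact: (addfunMz (h := om^~ y)). Qed.
Lemma omMr x y n : om x (y *~ n) = n%:~R * om x y.
Proof. exact: addfunMz (omDr x) y n. Qed.
Lemma r0 : r 0 = 0. Proof. exact: addfun0 rD. Qed.
Lemma rN x : r (- x) = - r x. Proof. exact: addfunN rD x. Qed.
Lemma rM x n : r (x *~ n) = n%:~R * r x. Proof. exact: addfunMz rD x n. Qed.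

Definition lat_rules := (omDl, omDr, om0l, om0r, omNl, omNr, omMl, omMr, rD, r0, rN, rM, omxx).

Lemma r_neq0 b : b != 0 -> r b != 0.
Proof.
by move=> /(generic 0); rewrite om0l add0r mulf_eq0 negb_or => /andP[].
Qed.

Lemma lwt_subspace x : subspace (lwt x).
Proof.
split=> [|a u v]; rewrite /lwt /= ?L0 ?scaler0 // L_lin => -> ->.
by rewrite scalerDr !scalerA mulrC.
Qed.

Lemma L_lwt x y v : lwt x v -> lwt (x + y) (L y v).
Proof.
rewrite /lwt /= => wv; have := L_br 0 y v; rewrite add0r wv LZ => /eqP.
rewrite subr_eq => /eqP ->; rewrite -scalerDl /brc !lat_rules; congr (_ *: _); ring.
Qed.

Lemma iter_dd_L m x (f : int -> V) a : iter m (dd (-1)) (fun t => L x (f t)) a = L x (iter m (dd (-1)) f a).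
Proof. by elim: m a => [|m IH] a //; rewrite !iterS /dd !IH LD LN. Qed.

Lemma iter_dd_scale m a (f : int -> V) b : iter m (dd (-1)) (fun t => a *: f t) b = a *: iter m (dd (-1)) f b.
Proof. by rewrite iter_ddZ. Qed.

Lemma iter_dd_sub m (f g : int -> V) b :
  iter m (dd (-1)) (fun t => f t - g t) b = iter m (dd (-1)) f b - iter m (dd (-1)) g b.
Proof. by rewrite iter_ddB. Qed.

Lemma commutator2 z x y v : L z (L x (L y v)) - L x (L y (L z v)) =
  brc z x *: L (z + x) (L y v) + brc z y *: L x (L (z + y) v).
Proof.
have e : L x (L z (L y v)) - L x (L y (L z v)) = brc z y *: L x (L (z + y) v).
  by rewrite -LZ -L_br LD LN.
by rewrite -L_br -e addrA subrK.
Qed.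

Section Windows.
Variables (eta : X) (m : nat) (A : int).
Hypothesis eta0 : eta != 0.

Definition good x := forall (j : int) v, lwt (x + eta *~ j) v ->
  forall S a : int, A <= a -> a <= S + 1 ->
  iter m (dd (-1)) (fun t : int => L (eta *~ t) (L (eta *~ (S - t)) v)) a = 0.

(** Commuting the windows with [L (l + eta j)] gives combinations of two
    families of windows, with coefficients linear in [j]; differences in [j]
    separate them. *)
Lemma good_half x l : good x -> good (x + l) -> forall (j : int) v, lwt (x + eta *~ j) v ->
  forall S p : int, p <= S + 1 ->
  iter m.+2 (dd (-1)) (fun t : int => L (eta *~ t + l) (L (eta *~ (S - t)) v)) p = 0.
Proof.
move=> g1 g2 j0 v wv S p pS.
pose g (t : int) := L (eta *~ t + l) (L (eta *~ (S - t)) v).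
pose k (t : int) := L (eta *~ t) (L (eta *~ (S - t) + l) v).
have nz : - (om l eta + 2 * r eta) != 0 by rewrite oppr_eq0 generic.
pose lc (t : int) : K := t%:~R * (om l eta + r eta) - r l.
rewrite -[m.+2]/(2 + m)%N iterD -/g.
apply: (@line_elim _ _ (fun p => iter m (dd (-1)) (fun t => lc t *: g t) p) _
  (fun p => iter m (dd (-1)) (fun t => lc (S - t) *: k t) p)
  (fun p => iter m (dd (-1)) k p) _ A (S + 1) nz) => // a j Aa ajS.
have h1 : iter m (dd (-1)) (fun t : int => L (l + eta *~ j) (L (eta *~ t) (L (eta *~ (S - j - t)) v))) a = 0.
  by rewrite iter_dd_L (g1 _ _ wv) ?L0 //; lia.
have h2 : iter m (dd (-1)) (fun t : int => L (eta *~ t) (L (eta *~ (S - j - t)) (L (l + eta *~ j) v))) a = 0.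
  apply: (g2 (j0 + j)) => //; last by lia.
  have -> : x + l + eta *~ (j0 + j) = x + eta *~ j0 + (l + eta *~ j) by zmodring X.
  exact: L_lwt.
have := congr2 (fun u w => u - w) h1 h2; rewrite -iter_dd_sub subrr => <-.
rewrite -!iter_dd_scale -!(iter_dd_shift m _ j) -!iter_ddD; congr (iter m _ _ a).
apply/funext => t; rewrite commutator2.
have e1 : l + eta *~ j + eta *~ t = eta *~ (t + j) + l by zmodring X.
have e2 : l + eta *~ j + eta *~ (S - j - t) = eta *~ (S - t) + l by zmodring X.
have e3 : S - j - t = S - (t + j) by lia.
rewrite e1 e2 e3 -/(g (t + j)) -/(k t) /brc /lc !lat_rules !(intrB, intrD).
modring R[i] V.
Qed.

Lemma good_windows_pair x l l' : good x -> good (x + l) -> good (x + l') -> good (x + l + l') ->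
  forall (j : int) v, lwt (x + eta *~ j) v -> forall S p : int,
  iter m.+3 (dd (-1)) (fun t : int => L (eta *~ t + l) (L (eta *~ (S - t) + l') v)) p = 0.
Proof.
move=> g1 g2 g3 g4 j0 v wv S p.
have nz : - (om l' eta + 2 * r eta) != 0 by rewrite oppr_eq0 generic.
pose h (t : int) := L (eta *~ t + l) (L (eta *~ (S - t) + l') v).
pose h0 := fun t : int => ((S - t)%:~R * (om l' eta + r eta) - r l') *: h t.
have E (j : int) : p <= S - j + 1 ->
    iter m.+3 (dd (-1)) h0 p - (j%:~R * (om l' eta + 2 * r eta)) *: iter m.+3 (dd (-1)) h p = 0.
  move=> pj.
  have h1 : iter m.+3 (dd (-1)) (fun t : int => L (l' + eta *~ j) (L (eta *~ t + l) (L (eta *~ (S - j - t)) v))) p = 0.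
    by rewrite iter_dd_L iterS /dd !(good_half g1 g2 wv) ?subrr ?L0 //; lia.
  have wv' : lwt (x + l' + eta *~ (j0 + j)) (L (l' + eta *~ j) v).
    have -> : x + l' + eta *~ (j0 + j) = x + eta *~ j0 + (l' + eta *~ j) by zmodring X.
    exact: L_lwt.
  have h2 : iter m.+3 (dd (-1)) (fun t : int => L (eta *~ t + l) (L (eta *~ (S - j - t)) (L (l' + eta *~ j) v))) p = 0.
    have g4' : good (x + l' + l) by rewrite addrAC.
    by rewrite iterS /dd !(good_half g3 g4' wv') ?subrr //; lia.
  have g4' : good (x + (l + l')) by rewrite addrA.
  pose y0 := om (l' + eta *~ j) l + r l - r (l' + eta *~ j); pose y1 := om l' eta + r eta.
  have h3 : iter m.+3 (dd (-1)) (fun t : int => (y0 + t%:~R * y1) *: (L (eta *~ (t + j) + (l + l')) (L (eta *~ (S - (t + j))) v))) p = 0.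
    apply: (@iter_dd_linear _ _ (S - j + 1)) pj => p' p'S.
    rewrite (iter_dd_shift _ (fun t => L (eta *~ t + (l + l')) (L (eta *~ (S - t)) v))).
    by apply: (good_half g1 g4' wv); lia.
  rewrite -iter_dd_scale -iter_dd_sub.
  have := congr2 (fun u w => u - w) (congr2 (fun u w => u - w) h1 h2) h3; rewrite -!iter_dd_sub !subrr => <-.
  congr (iter _ _ _ p); apply/funext => t; rewrite commutator2.
  have e1 : l' + eta *~ j + (eta *~ t + l) = eta *~ (t + j) + (l + l') by zmodring X.
  have e2 : l' + eta *~ j + eta *~ (S - j - t) = eta *~ (S - t) + l' by zmodring X.
  have e3 : S - j - t = S - (t + j) by lia.
  rewrite e1 e2 e3 -/(h t) /h0 /brc /y0 /y1 !lat_rules !(intrB, intrD).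
  modring R[i] V.
have := congr2 (fun u w => u - w) (E (S - p) ltac:(lia)) (E (S - p - 1) ltac:(lia)).
rewrite subrr (intrB _ (S - p)) => e; apply: (scalerI nz); rewrite scaler0 -[RHS]e.
modring R[i] V.
Qed.

End Windows.

Definition nz x := s + r x != 0.

Lemma nz_good eta x : eta != 0 -> nz x -> exists Q : int, 0 < Q /\ forall q, Q <= q ->
  good (eta *~ q) (window_order d) ((window_order d)%:Z - 1) x.
Proof.
move=> eta0 nx; have re := r_neq0 eta0.
pose e n v := (r eta)^-1 *: L (eta *~ n) v.
have e_lin n : linear (e n) by move=> a u v; rewrite /e L_lin; modring R[i] V.
have e_br n m v : e n (e m v) - e m (e n v) = (m - n)%:~R *: e (n + m) v.
  rewrite /e !LZ -!scalerBr L_br -mulrzDr !scalerA; congr (_ *: _).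
  by rewrite /brc !lat_rules intrB; field.
pose s' := (s + r x) / r eta.
have wtE k v : wt e s' k v <-> lwt (x + eta *~ k) v.
  rewrite /wt /lwt /e /s' /= mulr0z !lat_rules; split=> [/(congr1 ( *:%R (r eta)))|->].
    by rewrite !scalerA mulfV // scale1r => ->; congr (_ *: _); field.
  by rewrite scalerA; congr (_ *: _); field.
have wd k : dim_le (wt e s' k) d.
  have [b Pb gen] := lwt_dim (x + eta *~ k); exists b => [i|v /wtE]; last exact: gen.
  exact/wtE/Pb.
have s0 : s' != 0 by rewrite mulf_neq0 // invr_eq0.
have [Q [Q0 HQ]] := good_windows e_lin e_br wd s0.
exists Q; split=> // q Qq j v wv S a Aa aS.
have := HQ q Qq j v _ a (S - a) Aa ltac:(lia).
rewrite wtE mulrzA => /(_ wv).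
pose G (S' t : int) := L (eta *~ q *~ t) (L (eta *~ q *~ (S' - t)) v).
have E k (p : int * int) : iter k (dd (-1, 1)) (fun p : int * int => e (q * p.1) (e (q * p.2) v)) p =
    (r eta) ^- 2 *: iter k (dd (-1)) (G (p.1 + p.2)) p.1.
  elim: k p => [|k IH] [p1 p2].
    by rewrite /= /G [p1 + _]addrC addrK /e LZ scalerA -invfM -!mulrzA.
  rewrite iterS ddE !IH iterS ddE scalerBr.
  by have -> : ((p1, p2) + (-1, 1)).1 + ((p1, p2) + (-1, 1)).2 = p1 + p2 :> int by rewrite /=; lia.
rewrite E /= [a + _]addrC subrK => /eqP.
by rewrite scaler_eq0 invr_eq0 expf_eq0 (negPf re) andbF /= => /eqP.
Qed.

Definition lwindow := (window_order d).+3.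

(** All large multiples of [al] are good steps, so that the product has
    vanishing windows on sparse progressions through each point; this is what
    [progression_poly_vec] asks for. *)
Theorem lattice_windows al x l l' v : lwt x v -> nz x -> nz (x + l + l') ->
  (forall i : nat, (i <= lwindow)%N -> nz (x + l' + al *+ i) /\ nz (x + l - al *+ i)) ->
  iter lwindow (dd (-1)) (fun t : int => L (l + al *~ t) (L (l' - al *~ t) v)) 0 = 0.
Proof.
move=> wv nx nll nl; have [->|al0] := eqVneq al 0.
  rewrite /lwindow iterSr (_ : dd (-1) _ = fun _ => 0) ?iter_dd0 //.
  by apply/funext => t; rewrite /dd !mul0rz subrr.
apply: (@progression_poly_vec _ _ (lwt (x + l + l')) d _ _ (fun t => ~ (nz (x + l' - al *~ t) /\ nz (x + l + al *~ t)))).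
- exact: lwt_subspace.
- exact: lwt_dim.
- move=> t; have := L_lwt (l + al *~ t) (L_lwt (l' - al *~ t) wv).
  by have -> : x + (l' - al *~ t) + (l + al *~ t) = x + l + l' by zmodring X.
- move=> t0 /contrapT[n1 n2].
  have [Q1 [Q10 H1]] := nz_good al0 nx; have [Q2' [Q20 H2]] := nz_good al0 nll.
  have [Q3 [Q30 H3]] := nz_good al0 n1; have [Q4 [Q40 H4]] := nz_good al0 n2.
  exists (Q1 + Q2' + Q3 + Q4); split; first by lia.
  move=> q Qq j; have aq : al *~ q != 0.
    by apply: contraNneq (r_neq0 al0) => /(congr1 r)/eqP; rewrite !lat_rules mulf_eq0 intr_eq0 => /orP[|//]; lia.
  have wv' : lwt (x + al *~ q *~ 0) v by rewrite mulr0z addr0.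
  have h4 : x + (l + al *~ t0) + (l' - al *~ t0) = x + l + l'.
    by zmodring X.
  have := @good_windows_pair (al *~ q) _ _ aq x (l + al *~ t0) (l' - al *~ t0)
    (H1 q _) _ _ _ 0 v wv' 0 j.
  rewrite h4 !addrA => /(_ ltac:(lia) (H4 q ltac:(lia)) (H3 q ltac:(lia)) (H2 q ltac:(lia))) <-.
  congr (iter _ _ _ j); apply/funext => t; rewrite sub0r -!mulrzA.
  by congr (L _ (L _ v)); zmodring X.
move=> i im; rewrite sub0r mulrNz opprK -pmulrn => -[]; exact: nl.
Qed.

End LatticeModule.

(** * Germs at infinity *)

Section Spans.
Variables (K : fieldType) (F : lmodType K).
Implicit Types (Z G S : set F).

Lemma iter_dd_subspace (X : zmodType) S (f : X -> F) al m k : subspace S ->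
  (forall i : nat, (0 < i <= m)%N -> S (f (k + al *+ i))) -> S (iter m (dd al) f k - f k).
Proof.
move=> [S0 SP]; have SB u v : S u -> S v -> S (u - v).
  by move=> Su Sv; rewrite addrC -scaleN1r; apply: SP.
elim: m k => [|m IH] k H; first by rewrite subrr.
have h1 : S (iter m (dd al) f k - f k).
  by apply: IH => i /andP[i0 im]; apply: H; rewrite i0 leqW.
have h2 : S (iter m (dd al) f (k + al)).
  have -> : iter m (dd al) f (k + al) = 1 *: (iter m (dd al) f (k + al) - f (k + al)) + f (k + al).
    by rewrite scale1r subrK.
  apply: SP; last by have := H 1%N isT; rewrite mulr1n.
  by apply: IH => i /andP[i0 im]; have := H i.+1; rewrite mulrS addrA; apply.
by rewrite iterS ddE addrAC; apply: SB.
Qed.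

(** A finite family spanning modulo [Z] contains a basis modulo [Z]. *)
Lemma basis_mod Z n (g : 'I_n -> F) : subspace Z ->
  exists m (b : 'I_m -> F), [/\ forall i, exists j, b i = g j,
    forall c, Z (lin b c) -> c = 0 &
    forall c, exists c', Z (lin g c - lin b c')].
Proof.
move=> sZ; have [Z0 ZP] := sZ.
elim: n g => [|n IH] g.
  exists 0%N, g; split=> [i|c _|c]; [by exists i|by apply/matrixP => -[]|].
  by exists c; rewrite subrr.
have [inj|] := pselect (forall c, Z (lin g c) -> c = 0).
  by exists n.+1, g; split=> [i||c] //; [exists i | exists c; rewrite subrr].
move=> /existsNP[c /not_implyP[c0 /eqP cn]].
have [i ci] : exists i, c i 0 != 0.
  apply/existsP; apply: contra_neqT cn => /existsPn H; apply/matrixP => i j.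
  by rewrite mxE (ord1 j); have := H i; rewrite negbK => /eqP.
have [m [b [bg bi bs]]] := IH (fun j => g (lift i j)).
exists m, b; split=> // [j|a]; first by have [k ->] := bg j; exists (lift i k).
pose t := a i 0 / c i 0.
have [c' Hc'] := bs (\col_j (a (lift i j) 0 - t * c (lift i j) 0)).
exists c'; have -> : lin g a = t *: lin g c + lin (fun j => g (lift i j)) (\col_j (a (lift i j) 0 - t * c (lift i j) 0)).
  rewrite /lin (bigD1_ord i) //= [in X in t *: X](bigD1_ord i) //= scalerDr scalerA /t mulfVK // -addrA.
  congr (_ + _); rewrite scaler_sumr -big_split; apply: eq_bigr => j _ /=.
  by rewrite mxE scalerA -scalerDl addrC subrK.
by rewrite -addrA; apply: ZP.
Qed.

End Spans.

Section SymplRules.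
Variable K : numFieldType.
Local Notation vec := 'rV[K]_2.

Lemma symplDl (u v w : vec) : sympl (u + v) w = sympl u w + sympl v w.
Proof. rewrite /sympl !mxE; ring. Qed.
Lemma symplDr (u v w : vec) : sympl w (u + v) = sympl w u + sympl w v.
Proof. rewrite /sympl !mxE; ring. Qed.
Lemma symplZl (c : K) (u v : vec) : sympl (c *: u) v = c * sympl u v.
Proof. rewrite /sympl !mxE; ring. Qed.
Lemma symplZr (c : K) (u v : vec) : sympl v (c *: u) = c * sympl v u.
Proof. rewrite /sympl !mxE; ring. Qed.
Lemma symplxx (u : vec) : sympl u u = 0.
Proof. rewrite /sympl; ring. Qed.

End SymplRules.

Section Germs.
Variables (R : realType) (N : nat).
Local Notation K := R[i].
Local Notation X := 'rV[int]_N.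
Local Notation vec := 'rV[K]_2.
Variable pi : {additive X -> vec}.
Hypothesis hN : (1 < N)%N.
Hypothesis hnz : forall a b : X, b != 0 -> sympl (pi a + 2 *: rho) (pi b) != 0.

Variables (V : lmodType K) (L : X -> V -> V) (nu : vec) (d : nat).
Hypothesis L_lin : forall x, linear (L x).
Hypothesis L_br : forall x y v,
  L x (L y v) - L y (L x v) = sympl (pi x + rho) (pi y + rho) *: L (x + y) v.
Definition wsp x : set V := [set v | L 0 v = sympl rho (nu + pi x) *: v].
Hypothesis wsp_dim : forall x, dim_le (wsp x) d.
Variable b0 : X.
Hypothesis nzb : forall x, x != b0 -> sympl rho (nu + pi x) != 0.

Let L0 x : L x 0 = 0 := linear_fun0 (L_lin x).

Let om x y := sympl (pi x) (pi y).
Let r x := sympl rho (pi x).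

Let omDl x y z : om (x + y) z = om x z + om y z.
Proof. by rewrite /om raddfD symplDl. Qed.
Let omDr z x y : om z (x + y) = om z x + om z y.
Proof. by rewrite /om raddfD symplDr. Qed.
Let omxx x : om x x = 0.
Proof. exact: symplxx. Qed.
Let rD x y : r (x + y) = r x + r y.
Proof. by rewrite /r raddfD symplDr. Qed.
Let generic a b : b != 0 -> om a b + 2 * r b != 0.
Proof. by move=> /(hnz a); rewrite symplDl symplZl. Qed.
Let brcE x y : brc om r x y = sympl (pi x + rho) (pi y + rho).
Proof. by rewrite /brc /om /r /sympl !mxE; ring. Qed.
Let L_br' x y v : L x (L y v) - L y (L x v) = brc om r x y *: L (x + y) v.
Proof. by rewrite brcE. Qed.
Let lwtE x : lwt r L (sympl rho nu) x = wsp x.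
Proof. by rewrite /lwt /wsp /r symplDr. Qed.
Let dim' x : dim_le (lwt r L (sympl rho nu) x) d.
Proof. by rewrite lwtE. Qed.

Lemma L_wsp x y v : wsp x v -> wsp (x + y) (L y v).
Proof. by rewrite -!lwtE; apply: (L_lwt omDl rD L_lin L_br'). Qed.

(** Germs at infinity of functions on the lattice are functions modulo those
    satisfying [fsup]. *)
Definition fsup (f : X -> V) := exists l : seq X, forall x, x \notin l -> f x = 0.

Lemma fsup_subspace : subspace fsup.
Proof.
split=> [|a f g [l Hl] [l' Hl']]; first by exists [::].
exists (l ++ l') => x; rewrite mem_cat negb_or => /andP[xl xl'].
by rewrite addrfctE scalrfctE Hl // Hl' // scaler0 addr0.
Qed.

(** Seen from far away a vector [v] of weight [x] is the family of its
    translates into all weights. *)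
Definition orb x (v : V) : X -> V := fun y => L (y - x) v.

Lemma orb_linear x : linear (orb x).
Proof. by move=> a u v; apply/funext => y; rewrite addrfctE scalrfctE /orb L_lin. Qed.

Definition wlen := lwindow d.

Lemma iter_dd_line (F : lmodType K) m al (f : X -> F) (k : X) (a : int) :
  iter m (dd al) f (k - al *~ a) = iter m (dd (-1)) (fun t : int => f (k - al *~ t)) a.
Proof.
elim: m a => [|m IH] a //; rewrite !iterS !ddE -!IH; congr (_ - _).
by congr (iter m (dd al) f _); zmodring 'rV[int]_N.
Qed.

Lemma iter_dd_at (F : zmodType) (G : lmodType K) m al (f : X -> F -> G) k y :
  iter m (dd al) f k y = iter m (dd al) (fun k => f k y) k.
Proof. by elim: m k => [|m IH] k //; rewrite !iterS !ddE -!IH. Qed.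

Lemma iter_dd_subE (Y : zmodType) (F : lmodType K) m (u : Y) (f g : Y -> F) x :
  iter m (dd u) (fun t => f t - g t) x = iter m (dd u) f x - iter m (dd u) g x.
Proof. by rewrite iter_ddB. Qed.

Lemma orb_window al k x v : wsp x v -> x != b0 ->
  (forall i : nat, (i <= wlen)%N -> x + k + al *+ i != b0) ->
  fsup (iter wlen (dd al) (fun k' => orb (x + k') (L k' v)) k).
Proof.
move=> wv xb kb.
exists (b0 :: [seq b0 + k + al *+ i | i <- iota 0 wlen.+1]) => y.
rewrite inE negb_or => /andP[yb yl].
rewrite iter_dd_at -[k]subr0 -(mulr0z al) iter_dd_line.
have nzP z : z != b0 -> nz r (sympl rho nu) z by move=> /nzb; rewrite /nz /r symplDr.
rewrite -lwtE in wv.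
rewrite -(lattice_windows omDl omDr omxx rD generic L_lin L_br' dim' (al := al) (l := y - x - k) (l' := k) wv (nzP _ xb)).
- congr (iter _ _ _ 0); apply/funext => t; rewrite /orb; congr (L _ (L _ v)); zmodring 'rV[int]_N.
- by have -> : x + (y - x - k) + k = y; [zmodring 'rV[int]_N | exact: nzP].
move=> i iw; split; first exact/nzP/kb.
apply: nzP; have -> : x + (y - x - k) - al *+ i = y - k - al *+ i by zmodring 'rV[int]_N.
apply: contra yl => /eqP e; apply/mapP; exists i; first by rewrite mem_iota ltnS.
rewrite -e; zmodring 'rV[int]_N.
Qed.

Section Closure.
Variable S : set (X -> V).
Hypothesis sS : subspace S.
Hypothesis fS : forall f, fsup f -> S f.
(** All vectors of weight [x] have germs in the space [S]. *)
Definition has_orb x := forall v, wsp x v -> S (orb x v).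

Lemma has_orb_step x be : x != b0 ->
  (forall i : nat, (0 < i <= wlen)%N -> x + be *+ i != b0 /\ has_orb (x + be *+ i)) -> has_orb x.
Proof.
move=> xb H v wv; have [S0 SP] := sS.
pose f k' := orb (x + k') (L k' v).
have h1 : S (iter wlen (dd be) f 0).
  apply/fS/orb_window => // i iw; rewrite addr0; case: i iw => [|i] iw; first by rewrite addr0.
  by case: (H i.+1 iw).
have h2 : S (iter wlen (dd be) f 0 - f 0).
  apply: iter_dd_subspace => // i iw; rewrite add0r /f; have [_ h] := H i iw.
  by apply: h; apply: L_wsp.
have h3 : S (f 0).
  have -> : f 0 = (-1) *: (iter wlen (dd be) f 0 - f 0) + iter wlen (dd be) f 0.
    by rewrite scaleN1r opprB subrK.
  exact: SP.
have := SP (sympl rho (nu + pi x))^-1 _ 0 h3 S0.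
by rewrite addr0 /f addr0 [L 0 v]wv (linear_funZ (orb_linear x)) scalerA mulVf ?scale1r // nzb.
Qed.

Let ej (j : 'I_N) : X := delta_mx 0 j.
Let inr (j : 'I_N) (x : X) := (b0 0 j < x 0 j) && (x 0 j <= b0 0 j + wlen%:Z).

Lemma has_orb_line (j : 'I_N) x : (forall t : int, x + ej j *~ t != b0) ->
  (forall t : int, inr j (x + ej j *~ t) -> has_orb (x + ej j *~ t)) -> has_orb x.
Proof.
move=> xb H; pose pt (c : int) := x + ej j *~ (c - x 0 j).
have mulE (c : int) (z : X) i : (z *~ c) 0 i = z 0 i *~ c.
  by case: c => n; rewrite ?NegzE ?mulrNz ?mxE -?pmulrn ?mulmxnE.
have ptE c : pt c 0 j = c by rewrite !mxE mulE !mxE !eqxx intz addrC subrK.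
have xE : x = pt (x 0 j) by rewrite /pt subrr mulr0z addr0.
have up n : forall c : int, b0 0 j < c <= b0 0 j + wlen%:Z + n%:Z -> has_orb (pt c).
  elim: n => [|n IH] c /andP[c1 c2].
    by apply: H; rewrite /inr ptE c1 /=; lia.
  have [c3|c3] := lerP c (b0 0 j + wlen%:Z + n%:Z); first by apply: IH; rewrite c1.
  apply: (@has_orb_step _ (- ej j)); first exact: xb.
  move=> i /andP[i0 iw]; have -> : pt c + - ej j *+ i = pt (c - i%:Z) by rewrite /pt; zmodring 'rV[int]_N.
  by split; [exact: xb | apply: IH; lia].
have down n : forall c : int, b0 0 j - n%:Z < c -> has_orb (pt c).
  elim: n => [|n IH] c c1.
    have h : b0 0 j < c <= b0 0 j + wlen%:Z + (absz c + absz (b0 0%R j))%N%:Z by lia.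
    exact: up h.
  have [c3|c3] := lerP c (b0 0 j - n%:Z); last exact: IH.
  apply: (@has_orb_step _ (ej j)); first exact: xb.
  move=> i /andP[i0 iw]; have -> : pt c + ej j *+ i = pt (c + i%:Z) by rewrite /pt; zmodring 'rV[int]_N.
  by split; [exact: xb | apply: IH; lia].
by rewrite xE; apply: (down (`|(b0 0 j - x 0 j)%R|%N).+1); lia.
Qed.

(** The functions attached to the points of a box generate all others; lines
    through the point [b0] are avoided by moving off them first. *)
Lemma has_orb_box : (forall x, (forall j, inr j x) -> has_orb x) -> forall x, x != b0 -> has_orb x.
Proof.
move=> box; pose j0 : 'I_N := Ordinal (ltnW hN); pose j1 : 'I_N := Ordinal hN.
have mulE (c : int) (z : X) i : (z *~ c) 0 i = z 0 i *~ c.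
  by case: c => n; rewrite ?NegzE ?mulrNz ?mxE -?pmulrn ?mulmxnE.
have line j i (x : X) (t : int) : i != j -> (x + ej j *~ t) 0 i = x 0 i.
  by move=> ij; rewrite !mxE mulE !mxE (negPf ij) mul0rz addr0.
have off (x : X) i : x 0 i != b0 0 i -> x != b0 by apply: contraNneq => ->.
have inr_off i (x : X) : inr i x -> x 0 i != b0 0 i by move=> /andP[h _]; rewrite neq_lt h orbT.
have step1 k x : inr j0 x -> (forall j : 'I_N, (k <= j)%N -> inr j x) -> has_orb x.
  elim: k x => [|k IH] x x0 H; first by apply: box => j; apply: H.
  have [kN|Nk] := ltnP k N; last first.
    by apply: IH => // j kj; have := leq_trans Nk kj; rewrite leqNgt ltn_ord.
  pose j := Ordinal kN; have [jj0|jj0] := eqVneq j j0.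
    apply: IH => // i; rewrite leq_eqVlt => /orP[/eqP ki|]; last exact: H.
    by have -> : i = j0; [rewrite -jj0; apply: val_inj | ].
  have keep (t : int) i : i != j -> inr i x -> inr i (x + ej j *~ t) by move=> ij; rewrite /inr line.
  apply: (@has_orb_line j) => [t|t xj].
    by apply: (off _ j0); apply: inr_off; apply: keep; rewrite // eq_sym.
  apply: IH => [|i]; first by apply: keep; rewrite // eq_sym.
  rewrite leq_eqVlt => /orP[/eqP ki|ki]; first by have -> : i = j by apply: val_inj.
  apply: keep; last exact: H.
  by apply: contraTneq ki => ->; rewrite ltnn.
have step2 x : inr j0 x -> has_orb x.
  by move=> x0; apply: (step1 N) => // j Nj; have := ltn_ord j; rewrite ltnNge Nj.
have step3 (x : X) : x 0 j1 != b0 0 j1 -> has_orb x.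
  move=> x1; apply: (@has_orb_line j0) => t; last exact: step2.
  by apply: (off _ j1); rewrite line.
move=> x xb; have [x1|/step3//] := eqVneq (x 0 j1) (b0 0 j1).
have [j xj] : exists j, x 0 j != b0 0 j.
  apply/existsP; apply: contraR xb => /existsPn H; apply/eqP/matrixP => z j.
  by rewrite (ord1 z); have := H j; rewrite negbK => /eqP.
have jj1 : j != j1 by apply: contraNneq xj => ->; rewrite x1.
apply: (@has_orb_line j1) => t; first by apply: (off _ j); rewrite line.
by move=> /inr_off; apply: step3.
Qed.

End Closure.

(** The span of the germs of the vectors of nonzero weight; the weight [b0] is
    left out because windows through it need not vanish. *)
Definition Cset : set (X -> V) := [set f | forall S, subspace S ->
  (forall f, fsup f -> S f) -> (forall x, x != b0 -> has_orb S x) -> S f].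

Lemma Cset_subspace : subspace Cset.
Proof.
split=> [S [S0 _] //|a f g Cf Cg S sS fS oS]; have [_ SP] := sS.
by apply: SP; [exact: Cf | exact: Cg].
Qed.

Lemma Cset_fsup f : fsup f -> Cset f.
Proof. by move=> ff S _ + _; apply. Qed.

Lemma Cset_orb x v : x != b0 -> wsp x v -> Cset (orb x v).
Proof. by move=> xb wv S _ _ H; apply: H. Qed.

(** The windows express the germs of a weight by those of the weights next to
    it on a line, so that finitely many weights suffice. *)
Lemma Cset_finite : exists n (g : 'I_n -> X -> V),
  (forall i, exists x v, [/\ x != b0, wsp x v & g i = orb x v]) /\
  forall f, Cset f -> exists c, fsup (f - lin g c).
Proof.
have dimE x : exists b : 'I_d -> V, (forall i, wsp x (b i)) /\
    forall v, wsp x v -> exists c : 'I_d -> K, v = \sum_(i < d) c i *: b i.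
  by have [b h1 h2] := wsp_dim x; exists b.
have [bs Hbs] := choice dimE.
pose yb (f : {ffun 'I_N -> 'I_wlen}) : X := b0 + \row_j (f j).+1%:Z.
pose T := ({ffun 'I_N -> 'I_wlen} * 'I_d)%type.
pose g (i : 'I_#|{: T}|) := orb (yb (enum_val i).1) (bs (yb (enum_val i).1) (enum_val i).2).
have ybn f : yb f != b0.
  apply/eqP => /matrixP/(_ 0 (Ordinal hN)); rewrite !mxE => /eqP.
  by rewrite -subr_eq0 addrAC subrr add0r.
exists #|{: T}|, g; split=> [i|f Cf].
  exists (yb (enum_val i).1), (bs (yb (enum_val i).1) (enum_val i).2); split=> //.
  exact: (Hbs _).1.
pose S := [set f | exists c, fsup (f - lin g c)].
have [Z0 ZP] := fsup_subspace.
have sS : subspace S.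
  split=> [|a f1 f2 [c1 H1] [c2 H2]]; first by exists 0; rewrite (linear_fun0 (lin_linear g)) subrr.
  exists (a *: c1 + c2); rewrite (lin_linear g).
  have -> : a *: f1 + f2 - (a *: lin g c1 + lin g c2) = a *: (f1 - lin g c1) + (f2 - lin g c2).
    by rewrite scalerBr opprD addrACA.
  exact: ZP.
have fS f' : fsup f' -> S f' by move=> h; exists 0; rewrite (linear_fun0 (lin_linear g)) subr0.
apply: (Cf S sS fS); apply: has_orb_box => // x xin v wv.
pose h : {ffun 'I_N -> 'I_wlen} := [ffun j => inord `|(x 0 j - b0 0 j - 1)%R|%N].
have xE : x = yb h.
  apply/matrixP => z j; rewrite (ord1 z) !mxE ffunE; have /andP[h1 h2] := xin j.
  have we : wlen = (window_order d).+3 by [].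
  by rewrite we in h2; rewrite inordK; move: (x 0 j) (b0 0 j) h1 h2 => a b h1 h2; lia.
have [_ gen] := Hbs x; have [c ->] := gen v wv.
have -> : orb x (\sum_(i < d) c i *: bs x i) = \sum_(i < d) c i *: orb x (bs x i).
  by elim: (index_enum _) => [|i s IH]; rewrite ?big_nil ?(linear_fun0 (orb_linear x)) // !big_cons (orb_linear x) IH.
apply: subspace_sum => // i; exists (delta_mx (enum_rank (h, i)) 0).
by rewrite lin_delta /g enum_rankK /= -xE subrr.
Qed.

Lemma orb_avoid (l : seq X) x v : x != b0 -> wsp x v -> forall S, subspace S ->
  (forall f, fsup f -> S f) -> (forall y, y != b0 -> y \notin l -> has_orb S y) -> S (orb x v).
Proof.
move=> xb wv S sS fS H; pose j : 'I_N := Ordinal hN.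
pose e : X := delta_mx 0 j.
have mulE (c : int) (z : X) i : (z *~ c) 0 i = z 0 i *~ c.
  by case: c => n; rewrite ?NegzE ?mulrNz ?mxE -?pmulrn ?mulmxnE.
have [n Hn] : ev (fun n => forall y, y \in b0 :: l -> forall i, (i < wlen)%N -> x + e *~ n *+ i.+1 != y).
  apply: ev_seq => y _; apply: ev_nat => i _; exists (`|y 0 j - x 0 j| + 1) => n nb.
  apply/eqP => /matrixP/(_ 0 j); rewrite !mxE mulmxnE mulE !mxE !eqxx /= intz => e'.
  have : n *+ i.+1 = y 0 j - x 0 j by rewrite -e' addrAC subrr add0r.
  by rewrite -mulr_natr => h; nia.
apply: (has_orb_step (be := e *~ n) sS fS xb) => // i /andP[i0 iw].
case: i i0 iw => // i _ iw; have h := Hn n (lexx _) _ _ i iw.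
have hb : x + e *~ n *+ i.+1 != b0 by apply: h; rewrite mem_head.
split=> //; apply: H => //; apply/negP => yl.
by have := h _ (mem_behead (s := b0 :: l) yl); rewrite eqxx.
Qed.

(** The operator on germs that corresponds to [L k] on vectors, up to a scalar
    depending on the label; see [Dop_orb]. *)
Definition Dop k (f : X -> V) : X -> V :=
  fun y => L k (f (y - k)) + sympl (nu + pi (y - k) + rho) (pi k + rho) *: f y.

Lemma Dop_linear k : linear (Dop k).
Proof.
move=> a f g; apply/funext => y; rewrite /Dop !(addrfctE, scalrfctE) L_lin.
modring R[i] V.
Qed.

Lemma Dop_orb k x v : orb (x + k) (L k v) = Dop k (orb x v) + sympl (pi k + rho) (nu + pi x) *: orb x v.
Proof.
apply/funext => y; rewrite addrfctE scalrfctE /Dop /orb.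
have -> : y - (x + k) = y - k - x by zmodring 'rV[int]_N.
have := L_br (y - k - x) k v; have -> : y - k - x + k = y - x by zmodring 'rV[int]_N.
move=> /eqP; rewrite subr_eq => /eqP ->.
have -> : sympl (pi (y - k - x) + rho) (pi k + rho) =
    sympl (nu + pi (y - k) + rho) (pi k + rho) + sympl (pi k + rho) (nu + pi x).
  by rewrite !raddfB /sympl !mxE; ring.
modring R[i] V.
Qed.

Lemma Dop_fsup k f : fsup f -> fsup (Dop k f).
Proof.
move=> [l Hl]; exists (l ++ [seq y + k | y <- l]) => y; rewrite mem_cat negb_or => /andP[yl yk].
rewrite /Dop Hl ?Hl ?L0 ?scaler0 ?addr0 //.
by apply: contra yk => yk; apply/mapP; exists (y - k); rewrite // subrK.
Qed.

Lemma Cset_Dop k f : Cset f -> Cset (Dop k f).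
Proof.
move=> Cf; have [C0 CP] := Cset_subspace.
pose S := [set f | Cset (Dop k f)].
have sS : subspace S.
  by split=> [|a f1 f2 h1 h2]; rewrite /S /= ?(linear_fun0 (Dop_linear k)) // Dop_linear; apply: CP.
have fS f' : fsup f' -> S f' by move=> /(Dop_fsup k)/Cset_fsup.
apply: (Cf S sS fS) => x xb v wv; apply: (orb_avoid (l := [:: b0 - k]) xb wv sS fS).
move=> y yb; rewrite inE => yk u wu; rewrite /S /=.
have -> : Dop k (orb y u) = - sympl (pi k + rho) (nu + pi y) *: orb y u + orb (y + k) (L k u).
  by rewrite Dop_orb scaleNr addrC addrK.
apply: CP; apply: Cset_orb => //; last exact: L_wsp.
by apply: contra yk => /eqP <-; rewrite addrK.
Qed.

Lemma Dop_window al k f : Cset f -> fsup (iter wlen (dd al) (fun k' => Dop k' f) k).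
Proof.
move=> Cf; have [Z0 ZP] := fsup_subspace.
pose S := [set f | fsup (iter wlen (dd al) (fun k' => Dop k' f) k)].
have dlin a f1 f2 m k0 : iter m (dd al) (fun k' => Dop k' (a *: f1 + f2)) k0 =
    a *: iter m (dd al) (fun k' => Dop k' f1) k0 + iter m (dd al) (fun k' => Dop k' f2) k0.
  elim: m k0 => [|m IH] k0; first by rewrite /= Dop_linear.
  by rewrite !iterS !ddE !IH scalerBr opprD addrACA.
have Dfs m k0 f' : fsup f' -> fsup (iter m (dd al) (fun k' => Dop k' f') k0).
  move=> ff; elim: m k0 => [|m IH] k0; first exact: Dop_fsup.
  by rewrite iterS ddE addrC -scaleN1r; apply: ZP.
have sS : subspace S.
  split=> [|a f1 f2 h1 h2]; first exact: Dfs.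
  by have := ZP a _ _ h1 h2; rewrite -dlin.
have fS f' : fsup f' -> S f' by apply: Dfs.
apply: (Cf S sS fS) => x xb v wv.
apply: (orb_avoid (l := [seq b0 - k - al *+ i | i <- iota 0 wlen.+1]) xb wv sS fS).
move=> y yb yl u wu; rewrite /S /mkset.
have -> : (fun k' => Dop k' (orb y u)) = (fun k' => orb (y + k') (L k' u) - sympl (pi k' + rho) (nu + pi y) *: orb y u).
  by apply/funext => k'; rewrite Dop_orb addrK.
rewrite iter_dd_subE [X in _ - X](_ : _ = 0) ?subr0; last first.
  rewrite /wlen /lwindow 2!iterSr (_ : dd al (dd al _) = fun _ => 0) ?iter_dd0 //.
  apply/funext => k'; transitivity (0 *: orb y u); last by rewrite scale0r.
  have e t : pi (t + al) = pi t + pi al := raddfD pi t al.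
  by rewrite !ddE -!scalerBl; congr (_ *: _); rewrite !e /sympl !mxE; ring.
apply: orb_window => // i iw; apply: contra yl => /eqP e; apply/mapP; exists i.
  by rewrite mem_iota ltnS.
by rewrite -e; zmodring 'rV[int]_N.
Qed.

(** The finite-dimensional model: all weight spaces are realised in one
    space, on which the generators act by matrices that are polynomial
    functions on the lattice. *)
Record lmodel n (D : X -> 'M[K]_n) (T : X -> V -> 'cV[K]_n) : Prop := LModel {
  mod_lin : forall x a u v, wsp x u -> wsp x v -> T x (a *: u + v) = a *: T x u + T x v;
  mod_act : forall x k v, wsp x v ->
    T (x + k) (L k v) = D k *m T x v + sympl (pi k + rho) (nu + pi x) *: T x v;
  mod_poly : exists m, forall al k, iter m (dd al) D k = 0;
  mod_span : forall phi : 'rV[K]_n, (forall x v, wsp x v -> phi *m T x v = 0) -> phi = 0 }.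

Hypothesis L_inj : forall v, (exists l : seq X, forall x, x \notin l -> L x v = 0) -> v = 0.
Hypothesis gen0 : forall v, wsp b0 v -> forall S, subspace S ->
  (forall x u, x != b0 -> wsp x u -> S (L (b0 - x) u)) -> S v.

Lemma Cset_orb_all x v : wsp x v -> Cset (orb x v).
Proof.
have [->|xb] := eqVneq x b0; last exact: Cset_orb.
have [C0 CP] := Cset_subspace.
move=> wv; apply: (gen0 wv (S := [set v | Cset (orb b0 v)])) => [|y u yb wu].
  by split=> [|a u1 u2 h1 h2]; rewrite /= ?(linear_fun0 (orb_linear b0)) // (orb_linear b0); apply: CP.
have := Dop_orb (b0 - y) y u; have -> : y + (b0 - y) = b0 by zmodring 'rV[int]_N.
move=> e; suff: Cset (orb b0 (L (b0 - y) u)) by [].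
rewrite e; rewrite addrC; exact: (CP _ _ _ (Cset_orb yb wu) (Cset_Dop _ (Cset_orb yb wu))).
Qed.

(** The model is the space of germs of finite dimension; [Dop] acts on it by
    matrices, and these are polynomial in [k] because their windows vanish. *)
Theorem exists_lmodel : exists n (D : X -> 'M[K]_n) (T : X -> V -> 'cV[K]_n),
  lmodel D T /\ forall x v, wsp x v -> T x v = 0 -> v = 0.
Proof.
have [n' [g [gE gen]]] := Cset_finite; have [Z0 ZP] := fsup_subspace.
have [C0 CP] := Cset_subspace.
have [n [b [bg bi bs]]] := basis_mod g fsup_subspace.
have bE j : exists x v, [/\ x != b0, wsp x v & b j = orb x v] by have [i ->] := bg j; apply: gE.
have Cb j : Cset (b j) by have [x [v [xb wv ->]]] := bE j; apply: Cset_orb.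
have ZB f1 f2 : fsup f1 -> fsup f2 -> fsup (f1 - f2).
  by move=> h1 h2; rewrite addrC -scaleN1r; apply: ZP.
have ZD f1 f2 : fsup f1 -> fsup f2 -> fsup (f1 + f2).
  by move=> h1 h2; rewrite -[f1]scale1r; apply: ZP.
have Z4 (A B C E : X -> V) : fsup (A - B - (C - E)) -> fsup (A - C - (B - E)).
  by have -> : A - B - (C - E) = A - C - (B - E) by modring R[i] ('rV[int]_N -> V).
have coex f : exists c, Cset f -> fsup (f - lin b c).
  have [Cf|nCf] := pselect (Cset f); last by exists 0.
  have [c Hc] := gen f Cf; have [c' Hc'] := bs c; exists c' => _.
  by have := ZD _ _ Hc Hc'; rewrite addrA subrK.
have [co coP] := choice coex.
have linB c c' : lin b (c - c') = lin b c - lin b c'.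
  by rewrite (linear_funD (lin_linear b)) (linear_funN (lin_linear b)).
have co_eq f c : Cset f -> fsup (f - lin b c) -> co f = c.
  move=> Cf h; apply/eqP; rewrite -subr_eq0; apply/eqP/bi; rewrite linB.
  have -> : lin b (co f) - lin b c = (f - lin b c) - (f - lin b (co f)) by modring R[i] ('rV[int]_N -> V).
  exact: ZB h (coP f Cf).
have co_lin a f1 f2 : Cset f1 -> Cset f2 -> co (a *: f1 + f2) = a *: co f1 + co f2.
  move=> h1 h2; apply: co_eq; first exact: CP.
  rewrite (lin_linear b) opprD addrACA -scalerBr; apply: ZP; exact: coP.
pose D k := \matrix_(i, j) co (Dop k (b j)) i 0.
have DE m al k c : fsup (iter m (dd al) (fun k' => Dop k' (lin b c)) k - lin b (iter m (dd al) D k *m c)).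
  elim: m k => [|m IH] k.
    rewrite [iter 0 _ _ _]/= [iter 0 _ _ _]/=.
    have -> : Dop k (lin b c) = lin (fun j => Dop k (b j)) c.
      rewrite /lin; elim: (index_enum _) => [|j s IHs]; rewrite ?big_nil ?(linear_fun0 (Dop_linear k)) //.
      by rewrite !big_cons Dop_linear IHs.
    have -> : lin (fun j => Dop k (b j)) c - lin b (D k *m c) = \sum_j c j 0 *: (Dop k (b j) - lin b (co (Dop k (b j)))).
      rewrite (eq_bigr (fun j => c j 0 *: Dop k (b j) - c j 0 *: lin b (co (Dop k (b j))))); last by move=> j _; rewrite scalerBr.
      rewrite sumrB; congr (_ - _); have -> : D k *m c = \sum_j c j 0 *: co (Dop k (b j)).
        apply/matrixP => i z; rewrite (ord1 z) mxE summxE; apply: eq_bigr => j _.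
        by rewrite !mxE mulrC.
      elim: (index_enum _) => [|j s IHs]; rewrite ?big_nil ?(linear_fun0 (lin_linear b)) //.
      by rewrite !big_cons (lin_linear b) IHs.
    apply: (subspace_sum (P := fsup)) => [|j]; first exact: fsup_subspace.
    by apply: coP; apply: Cset_Dop.
  rewrite !iterS !ddE mulmxBl linB; have := ZB _ _ (IH k) (IH (k + al)).
  exact: Z4.
exists n, D, (fun x v => co (orb x v)); split; last first.
  move=> x v wv e; apply: L_inj; have := coP _ (Cset_orb_all wv).
  rewrite e (linear_fun0 (lin_linear b)) subr0 => -[l Hl].
  exists [seq y - x | y <- l] => y yl; have := Hl (y + x); rewrite /orb addrK; apply.
  by apply: contra yl => h; apply/mapP; exists (y + x); rewrite // addrK.
have Clin c : Cset (lin b c) by apply: subspace_sum => //; exact: Cset_subspace.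
have coD k f : Cset f -> co (Dop k f) = D k *m co f.
  move=> Cf; apply: co_eq; first exact: Cset_Dop.
  have h := DE 0%N 0 k (co f); have := ZD _ _ (Dop_fsup k (coP f Cf)) h.
  by rewrite (linear_funD (Dop_linear k)) (linear_funN (Dop_linear k)) /= addrA subrK.
split.
- by move=> x a u v wu wv; rewrite orb_linear co_lin //; apply: Cset_orb_all.
- move=> x k v wv; have Cv := Cset_orb_all wv.
  rewrite -(coD k _ Cv) [RHS]addrC -(co_lin _ _ _ Cv (Cset_Dop k Cv)).
  by rewrite Dop_orb; congr co; apply: addrC.
- exists wlen => al k; apply/matrixP => i j; have := DE wlen al k (delta_mx j 0).
  move=> /(ZB _ _ (Dop_window al k (Clin (delta_mx j 0)))); rewrite opprB addrCA subrr addr0 => /bi.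
  by rewrite -colE => /(congr1 (fun A : 'cV_n => A i 0)); rewrite !mxE.
move=> phi H; apply/matrixP => z j; rewrite (ord1 z) [RHS]mxE.
have [x [v [xb wv e]]] := bE j; have := H x v wv; rewrite -e.
rewrite (co_eq _ (delta_mx j 0)) // ?lin_delta ?subrr //.
by rewrite -colE => /(congr1 (fun A : 'cV_1 => A 0 0)); rewrite !mxE.
Qed.

End Germs.

(** * Irreducible models *)

Section Irreducible.
Variables (F : fieldType) (n : nat).
Local Notation mx := 'M[F]_n.+1.
Implicit Types (G I : set mx) (S : set 'rV[F]_n.+1).

(** Row vectors are linear forms on the columns of a model: a space of forms
    stable under [G] is a quotient of the model, and quotients of models are
    models again. *)
Definition irr G := forall S, subspace S ->
  (forall g v, G g -> S v -> S (v *m g)) -> (exists2 v, S v & v != 0) -> forall v, S v.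

Lemma subspace_mx m (S : set 'rV[F]_m) : subspace S -> exists A : 'M[F]_m, forall v, S v <-> (v <= A)%MS.
Proof.
move=> [S0 SP].
pose good r := `[< exists2 A : 'M[F]_m, (forall v, (v <= A)%MS -> S v) & \rank A = r >].
have g0 : exists r, good r.
  exists 0%N; apply/asboolP; exists 0; last exact: mxrank0.
  by move=> v; rewrite submx0 => /eqP ->.
have gm r : good r -> (r <= m)%N by move=> /asboolP[A _ <-]; apply: rank_leq_row.
case: (ex_maxnP g0 gm) => r /asboolP[A AS rA] rmax; exists A => v; split; last exact: AS.
move=> Sv; apply/negPn/negP => vA.
have : (\rank (A + v)%MS <= r)%N.
  apply: rmax; apply/asboolP; exists (A + v)%MS => // w /sub_addsmxP[[a b] /= ->].
  rewrite (mx11_scalar b) mul_scalar_mx addrC; apply: SP => //; apply: AS; exact: submxMl.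
apply/negP; rewrite -ltnNge -rA; apply: rank_ltmx; rewrite /ltmx addsmxSl /=.
by apply: contra vA; apply: submx_trans; apply: addsmxSr.
Qed.

(** A nonzero invariant space of least dimension is killed by every member of
    a commuting family of nilpotent matrices. *)
Lemma common_kernel I : (forall x y, I x -> I y -> x *m y = y *m x) ->
  (forall x, I x -> exists k, x ^+ k = 0) ->
  exists2 v : 'rV[F]_n.+1, v != 0 & forall x, I x -> v *m x = 0.
Proof.
move=> comm nil.
pose good r := `[< exists A : mx, [/\ A != 0, forall x, I x -> (A *m x <= A)%MS & \rank A = r] >].
have g0 : exists r, good r.
  exists n.+1; apply/asboolP; exists 1%:M; split; [exact: oner_neq0 | | exact: mxrank1].
  by move=> x _; apply: submx1.
case: (ex_minnP g0) => r /asboolP[A [A0 stA rA]] rmin.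
have Az x : I x -> A *m x = 0.
  move=> Ix; apply/eqP/negPn/negP => Ax0.
  have : (r <= \rank (A *m x))%N.
    apply: rmin; apply/asboolP; exists (A *m x); split=> // y Iy.
    by rewrite -mulmxA (comm x y Ix Iy) mulmxA submxMr //; apply: stA.
  rewrite -rA => rk; have AAx : (A <= A *m x)%MS by rewrite -(mxrank_leqif_sup (stA x Ix)) eqn_leq rk mxrankS ?stA.
  have H k : (A <= A *m x ^+ k)%MS.
    elim: k => [|k IH]; first by rewrite expr0 mulmx1.
    by apply: (submx_trans IH); rewrite exprS mulmxA; apply: submxMr.
  have [k xk] := nil x Ix; have := H k; rewrite xk mulmx0 submx0 (negPf A0) //.
have [i Ai] : exists i, row i A != 0.
  apply/existsP; apply: contraR A0 => /existsPn H; apply/eqP/row_matrixP => i.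
  by have := H i; rewrite negbK row0 => /eqP.
by exists (row i A) => // x Ix; rewrite -row_mul Az // row0.
Qed.

End Irreducible.

Section AbelianIdeal.
Variables (F : numFieldType) (n : nat).
Local Notation mx := 'M[F]_n.+1.
Implicit Types (G I : set mx).

(** If [[y, x]] commutes with [x], its powers are brackets with [x]. *)
Lemma trace_bracket (y x : mx) k : (y *m x - x *m y) *m x = x *m (y *m x - x *m y) ->
  \tr ((y *m x - x *m y) ^+ k.+1) = 0.
Proof.
set z := y *m x - x *m y => zx; rewrite exprSr -[_ * z]/(_ *m z) /z mulmxBr raddfB /=.
rewrite -/z; have zkx : z ^+ k *m x = x *m z ^+ k.
  by apply/esym/commrX/esym; exact: zx.
by rewrite mulmxA mxtrace_mulC mulmxA -zkx -mulmxA subrr.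
Qed.

(** An abelian ideal acts by central elements on an irreducible module:
    its brackets are nilpotent, commute and have an invariant common kernel. *)
Lemma abelian_ideal G I : irr G -> (forall x y, I x -> I y -> x *m y = y *m x) ->
  (forall g x, G g -> I x -> I (g *m x - x *m g)) ->
  forall g x, G g -> I x -> g *m x = x *m g.
Proof.
move=> irrG comm ideal.
pose Z := [set z | exists g x, [/\ G g, I x & z = g *m x - x *m g]].
have ZI z : Z z -> I z by move=> [g [x [Gg Ix ->]]]; apply: ideal.
have [v v0 vZ] : exists2 v : 'rV[F]_n.+1, v != 0 & forall z, Z z -> v *m z = 0.
  apply: common_kernel => [x y /ZI Ix /ZI Iy|z Zz]; first exact: comm.
  apply: trace_nilpotent => k; have := ZI z Zz; case: Zz => g [x [Gg Ix ->]] Iz.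
  by apply: trace_bracket; apply: comm.
have sS : subspace [set v : 'rV[F]_n.+1 | forall z, Z z -> v *m z = 0].
  split=> [z _|a u w Hu Hw z Zz]; first exact: mul0mx.
  by rewrite mulmxDl -scalemxAl Hu // Hw // scaler0 addr0.
have all (v' : 'rV[F]_n.+1) : forall z, Z z -> v' *m z = 0.
  apply: (irrG _ sS) => [g u Gg Hu z Zz|]; last by exists v.
  have Zz' : Z (g *m z - z *m g) by exists g, z; split=> //; exact: ZI.
  have := Hu _ Zz'; rewrite mulmxBr !mulmxA (Hu z Zz) mul0mx subr0 //.
move=> g x Gg Ix; apply/eqP; rewrite -subr_eq0; apply/eqP/row_matrixP => i.
by rewrite -[g *m x - _]mul1mx row_mul row0; apply: all; exists g, x.
Qed.

End AbelianIdeal.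

(** A matrix commuting with an irreducible set has an eigenvalue, and the
    eigenspace is stable. *)
Lemma schur (F : closedFieldType) n (G : set 'M[F]_n.+1) (z : 'M[F]_n.+1) : irr G ->
  (forall g, G g -> g *m z = z *m g) -> exists c, z = c%:M.
Proof.
move=> irrG comm.
have [c cz] : exists c, root (char_poly z) c.
  by apply/closed_rootP; rewrite size_char_poly.
exists c; move: cz; rewrite -eigenvalue_root_char => /eigenvalueP[v vz v0].
have sS : subspace [set v : 'rV[F]_n.+1 | v *m z = c *: v].
  by split=> [|a u w /= Hu Hw]; rewrite /= ?mul0mx ?scaler0 // mulmxDl -scalemxAl Hu Hw scalerDr !scalerA mulrC.
have all (v' : 'rV[F]_n.+1) : v' *m z = c *: v'.
  apply: (irrG _ sS) => [g u Gg /= Hu|]; last by exists v.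
  by rewrite -mulmxA comm // mulmxA Hu -scalemxAl.
apply/row_matrixP => i; rewrite -[z]mul1mx row_mul all -[c%:M]mul1mx mul_mx_scalar.
by rewrite linearZ.
Qed.

Section MinimalModel.
Variables (R : realType) (N : nat).
Local Notation K := R[i].
Local Notation X := 'rV[int]_N.
Local Notation vec := 'rV[K]_2.
Variable pi : {additive X -> vec}.
Variables (V : lmodType K) (L : X -> V -> V) (nu : vec).
Local Notation wsp := (wsp pi L nu).

Lemma iter_dd_morph (X' : zmodType) (U W : lmodType K) (h : U -> W) m al (f : X' -> U) k : linear h ->
  iter m (dd al) (fun k => h (f k)) k = h (iter m (dd al) f k).
Proof.
by move=> hl; elim: m k => [|m IH] k //; rewrite !iterS !ddE !IH (linear_funD hl) (linear_funN hl).
Qed.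

Lemma sub_lmodel n (D : X -> 'M[K]_n) (T : X -> V -> 'cV[K]_n) k (A : 'M[K]_(k, n)) : lmodel pi L nu D T -> row_free A ->
  (forall x, (A *m D x <= A)%MS) -> exists D', lmodel pi L nu D' (fun x v => A *m T x v : 'cV_k).
Proof.
move=> [Tl Ta [m Dp] Ts] Af stA; exists (fun x => A *m D x *m pinvmx A); split.
- by move=> x a u v wu wv; rewrite Tl // mulmxDr -scalemxAr.
- move=> x y v wv; rewrite Ta // mulmxDr -scalemxAr; congr (_ + _).
  by rewrite [A *m _ *m _ *m _]mulmxA mulmxKpV ?stA // mulmxA.
- exists m => al x; rewrite (iter_dd_morph (h := fun B => A *m B *m pinvmx A)) ?Dp ?mulmx0 ?mul0mx //.
  by move=> a u v; rewrite mulmxDr mulmxDl -scalemxAr -scalemxAl.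
move=> phi H; have phiA : phi *m A = 0 by apply: Ts => x v wv; rewrite -mulmxA H.
by apply: (row_free_inj Af); rewrite phiA mul0mx.
Qed.

(** A stable space of linear forms gives a smaller model, so that a model of
    least positive dimension is irreducible. *)
Lemma irreducible_lmodel n (D : X -> 'M[K]_n) (T : X -> V -> 'cV[K]_n) : lmodel pi L nu D T -> (0 < n)%N ->
  exists n' (D' : X -> 'M[K]_n'.+1) (T' : X -> V -> 'cV[K]_n'.+1),
    lmodel pi L nu D' T' /\ irr (range D') :> Prop.
Proof.
move=> DT n0; have {n0 DT D T}: exists n, `[< (0 < n)%N /\ exists D (T : X -> V -> 'cV[K]_n), lmodel pi L nu D T >].
  by exists n; apply/asboolP; split=> //; exists D, T.
move=> ex; case: (ex_minnP ex) => -[|m] /asboolP[// _ [D' [T' M]]] mmin.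
exists m, D', T'; split=> // S sS stS [v Sv v0] w.
have [A AS] := subspace_mx sS.
have A0 : (0 < \rank A)%N.
  rewrite lt0n mxrank_eq0; apply: contraNneq v0 => A0.
  by have /AS := Sv; rewrite A0 submx0.
have [|D2 M2] := sub_lmodel M (row_base_free A).
  move=> x; rewrite (eqmxMr _ (eq_row_base A)) (eq_row_base A).
  apply/row_subP => i; rewrite row_mul; apply/AS/stS; first by exists x.
  by apply/AS; exact: row_sub.
have : (m.+1 <= \rank A)%N by apply: mmin; apply/asboolP; split=> //; exists D2, (fun x v => row_base A *m T' x v).
move=> rk; apply/AS; apply: submx_full; rewrite /row_full eqn_leq rk andbT; exact: rank_leq_row.
Qed.

End MinimalModel.

(** * The degree of the structure matrices *)

Section MixedDifferences.
Variables (K : fieldType) (X : zmodType) (A : lmodType K).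
Implicit Types (f g : X -> A) (l : seq X) (h : seq X -> A) (w : X -> K).

(** Iterated difference in varying directions. *)
Definition mdd l f := foldl (fun f u => dd u f) f l.

Lemma dd_mdd u l f : dd u (mdd l f) = mdd l (dd u f).
Proof. by elim: l f => [|v l IH] f //=; rewrite IH ddC. Qed.

Lemma mddS u l f x : mdd (u :: l) f x = mdd l f x - mdd l f (x + u).
Proof. by rewrite /= -dd_mdd. Qed.

Lemma mdd_lin a l f g x : mdd l (fun y => a *: f y + g y) x = a *: mdd l f x + mdd l g x.
Proof.
elim: l x => [|u l IH] x //; rewrite !mddS !IH scalerBr opprD; exact: addrACA.
Qed.

Lemma mddD l f g x : mdd l (fun y => f y + g y) x = mdd l f x + mdd l g x.
Proof. by have := mdd_lin 1 l f g x; rewrite scale1r => <-; congr mdd; apply/funext => y; rewrite scale1r. Qed.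

Lemma mdd0 l x : mdd l (fun _ => 0) x = 0.
Proof. by elim: l x => [|u l IH] x //; rewrite mddS !IH subrr. Qed.

Lemma mddZ a l f x : mdd l (fun y => a *: f y) x = a *: mdd l f x.
Proof.
by have := mdd_lin a l f (fun _ => 0) x; rewrite mdd0 addr0 => <-; congr mdd; apply/funext => y; rewrite addr0.
Qed.

Lemma mddN l f x : mdd l (fun y => - f y) x = - mdd l f x.
Proof. by rewrite -scaleN1r -mddZ; congr mdd; apply/funext => y; rewrite scaleN1r. Qed.

Lemma mdd_shift l f c x : mdd l (fun y => f (y + c)) x = mdd l f (x + c).
Proof. by elim: l x => [|u l IH] x //; rewrite !mddS !IH addrAC. Qed.

Lemma mdd_const l c x : (0 < size l)%N -> mdd l (fun _ => c) x = 0.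
Proof.
by case: l => [//|u l] _ /=; rewrite (_ : dd u _ = fun _ => 0) ?mdd0 //; apply/funext => y; rewrite ddE subrr.
Qed.

Lemma mdd_le j k f : (forall l, size l = j -> forall x, mdd l f x = 0) -> (j <= k)%N ->
  forall l, size l = k -> forall x, mdd l f x = 0.
Proof.
move=> H jk; elim: k jk => [|k IH]; first by rewrite leqn0 => /eqP <-.
rewrite leq_eqVlt => /orP[/eqP <- //|jk] [//|u l] [sl] x.
by rewrite mddS !(IH jk) ?subrr.
Qed.

(** The bracket of a generator with a mixed difference is a sum in which each
    entry of the difference is merged with the generator in turn; [top_bracket] is
    the case of top degree. *)
Fixpoint removals w l h : A :=
  if l is u :: l' then w u *: h l' + removals w l' (fun t => h (u :: t)) else 0.

Lemma removals_cat w l l' h : removals w (l ++ l') h =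
  removals w l (fun t => h (t ++ l')) + removals w l' (fun t => h (l ++ t)).
Proof. by elim: l h => [|u l IH] h; rewrite /= ?add0r // IH addrA. Qed.

Lemma removals_nseq w k u h : removals w (nseq k u) h = (k%:R * w u) *: h (nseq k.-1 u).
Proof.
elim: k h => [|k IH] h; first by rewrite mul0r scale0r.
rewrite /= IH; case: k IH => [|k] _ /=; first by rewrite mul0r scale0r addr0 mul1r.
by rewrite -scalerDl -[k.+2%:R]natr1; congr (_ *: _); ring.
Qed.

Lemma removals_eq0 w l h : (forall t, (size t).+1 = size l -> h t = 0) -> removals w l h = 0.
Proof.
elim: l h => [|u l IH] h H //=; rewrite H // scaler0 add0r; apply: IH => t st; apply: H.
by rewrite /= st.
Qed.

Lemma removals_subspace (S : set A) w l h : subspace S ->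
  (forall t, (size t).+1 = size l -> S (h t)) -> S (removals w l h).
Proof.
move=> [S0 SP]; elim: l h => [|u l IH] h H //=; apply: SP; first exact: H.
by apply: IH => t st; apply: H; rewrite /= st.
Qed.

Lemma removals_lin a w l h h' :
  removals w l (fun t => a *: h t + h' t) = a *: removals w l h + removals w l h'.
Proof.
elim: l h h' => [|u l IH] h h' /=; first by rewrite scaler0 addr0.
by rewrite IH; modring K A.
Qed.

Lemma removalsDw w w' l h : removals (fun u => w u + w' u) l h = removals w l h + removals w' l h.
Proof.
elim: l h => [|u l IH] h /=; first by rewrite addr0.
by rewrite IH; modring K A.
Qed.

Lemma removalsNw w l h : removals (fun u => - w u) l h = - removals w l h.
Proof.
elim: l h => [|u l IH] h /=; first by rewrite oppr0.
by rewrite IH; modring K A.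
Qed.

(** Leibniz rule for the product with an additive function. *)
Lemma mdd_leibniz w l g h : (forall x y, w (x + y) = w x + w y) ->
  (forall t, (size t).+1 = size l -> forall x, mdd t g x = h t) ->
  forall x, mdd l (fun y => w y *: g y) x = w x *: mdd l g x - removals w l h.
Proof.
move=> wD; elim: l g h => [|u l IH] g h H x; first by rewrite /= subr0.
rewrite [mdd _ _ _]/= (_ : dd u _ = fun y => (- w u) *: g (y + u) + w y *: dd u g y); last first.
  by apply/funext => y; rewrite !ddE wD; modring K A.
rewrite mdd_lin mdd_shift (IH _ (fun t => h (u :: t))) => [|t st y]; last first.
  by rewrite -(H (u :: t) _ y) //= st.
have e : mdd l g (x + u) = h l by apply: H.
by rewrite [mdd (u :: l) g]/= [removals _ (u :: l) _]/= e; modring K A.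
Qed.

Lemma mdd_additive g l x : (forall x y, g (x + y) = g x + g y) -> (1 < size l)%N -> mdd l g x = 0.
Proof.
move=> gD; case: l => [//|u [//|v t]] _ /=.
have -> : dd u g = fun _ => - g u by apply/funext => z; rewrite ddE gD opprD addNKr.
by have := @mdd_const (v :: t) (- g u) x; apply.
Qed.

Lemma mdd_quadratic w g l : (forall x y, w (x + y) = w x + w y) ->
  (forall x y, g (x + y) = g x + g y) -> (2 < size l)%N ->
  forall x, mdd l (fun y => w y *: g y) x = 0.
Proof.
move=> wD gD sl x.
rewrite (@mdd_leibniz _ _ _ (fun _ => 0)) // => [|t st y]; last by apply: mdd_additive => //; lia.
by rewrite mdd_additive ?scaler0 ?sub0r ?removals_eq0 ?oppr0 //; lia.
Qed.

End MixedDifferences.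

Lemma row_int_ind N (P : 'rV[int]_N -> Prop) : P 0 -> (forall u v, P u -> P v -> P (u + v)) ->
  (forall u, P u -> P (- u)) -> (forall j, P (delta_mx 0 j)) -> forall x, P x.
Proof.
move=> P0 PD PN PE x; rewrite [x]row_sum_delta.
have Pn (u : 'rV[int]_N) k : P u -> P (u *+ k).
  by move=> Pu; elim: k => [|k IH]; rewrite ?mulr0n // mulrS; apply: PD.
elim/big_ind: _ => // j _; case: (x 0 j) => k.
  have -> : Posz k *: delta_mx 0 j = delta_mx 0 j *+ k :> 'rV[int]_N by rewrite -scaler_nat natz.
  exact: Pn.
have -> : Negz k *: delta_mx 0 j = - (delta_mx 0 j *+ k.+1) :> 'rV[int]_N.
  by rewrite NegzE scaleNr -scaler_nat natz.
exact/PN/Pn.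
Qed.

(** The entries of a mixed difference can be expanded in the coordinate
    directions, each of which can occur fewer than [m] times. *)
Lemma mixed_vanish (K : fieldType) (A : lmodType K) N m (f : 'rV[int]_N -> A) : (0 < N)%N ->
  (forall al k, iter m (dd al) f k = 0) -> forall l, size l = (N * m)%N -> forall x, mdd l f x = 0.
Proof.
move=> N0; have H s : forall (f : 'rV[int]_N -> A) (a : 'I_N -> nat), (\sum_j a j)%N = s ->
    (forall j k, iter (a j) (dd (delta_mx 0 j)) f k = 0) ->
    forall l, size l = s -> forall x, mdd l f x = 0.
  elim: s => [|s IH] g a sa Hg l sl.
    move=> x; case: l sl => // _; have a0 : a (Ordinal N0) = 0%N.
      have : (a (Ordinal N0) <= \sum_j a j)%N by rewrite (bigD1 (Ordinal N0)) //= leq_addr.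
      by rewrite sa leqn0 => /eqP.
    by have := Hg (Ordinal N0) x; rewrite a0.
  case: l sl => [//|u l] [sl] /=.
  have [g0|gn] := pselect (forall x, g x = 0).
    have -> : dd u g = fun _ => 0 by apply/funext => y; rewrite ddE !g0 subrr.
    by move=> x; rewrite mdd0.
  elim/row_int_ind: u => [x|u v Hu Hv x|u Hu x|j x].
  - by have -> : dd 0 g = fun _ => 0; [apply/funext => y; rewrite ddE addr0 subrr | rewrite mdd0].
  - have -> : dd (u + v) g = fun y => dd u g y + dd v g (y + u).
      by apply/funext => y; rewrite !ddE addrA addrA subrK.
    by rewrite mddD Hu mdd_shift Hv addr0.
  - have -> : dd (- u) g = fun y => - dd u g (y - u).
      by apply/funext => y; rewrite !ddE subrK opprB.
    by rewrite mddN mdd_shift Hu oppr0.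
  have aj : (0 < a j)%N.
    by rewrite lt0n; apply/eqP => aj; apply: gn => y; have := Hg j y; rewrite aj.
  apply: (IH (dd (delta_mx 0 j) g) (fun i => (a i - (i == j))%N)) => //.
    move: sa; rewrite (bigD1 j) //= => sa; rewrite (bigD1 j) //= eqxx.
    rewrite (eq_bigr a) => [|i /negPf ij]; [by lia | by rewrite ij subn0].
  move=> i k; have [->|ij] := eqVneq i j.
    by rewrite -iterSr subn1 prednK // Hg.
  by rewrite subn0 -[dd (delta_mx 0 j) g]/(iter 1 (dd (delta_mx 0 j)) g) (iter_ddC (a i) 1) /= ddE !Hg subrr.
move=> Hf l sl; apply: (H _ f (fun _ => m)) sl => //.
by rewrite sum_nat_const card_ord.
Qed.

Section DegreeTwo.
Variables (K : numFieldType) (X : zmodType) (om : X -> X -> K) (r : X -> K).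
Hypothesis omDl : forall x y z, om (x + y) z = om x z + om y z.
Hypothesis omDr : forall z x y, om z (x + y) = om z x + om z y.
Hypothesis rD : forall x y, r (x + y) = r x + r y.
Variables (n : nat) (D : X -> 'M[K]_n.+1).
Local Notation mx := 'M[K]_n.+1.
Hypothesis D_br : forall x y, D x *m D y - D y *m D x =
  (om x y + r y) *: (D (x + y) - D y) - r x *: D (x + y) + (r x - om x y) *: D x.
Hypothesis D_irr : irr (range D).

Section TopForm.
Variable k : nat.
Hypothesis k2 : (1 < k)%N.
Hypothesis top : forall l, size l = k.+1 -> forall x, mdd l D x = 0.

Let Df l := mdd l D 0.

Lemma top_const l x : size l = k -> mdd l D x = Df l.
Proof.
move=> sl; have := @top (x :: l) _ 0; rewrite mddS add0r /= sl => /(_ erefl) /eqP.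
by rewrite subr_eq0 => /eqP.
Qed.

Lemma top_add u v l : (size l).+1 = k -> Df (u + v :: l) = Df (u :: l) + Df (v :: l).
Proof.
move=> sl; rewrite /Df /=; have -> : dd (u + v) D = fun y => dd u D y + dd v D (y + u).
  by apply/funext => y; rewrite !ddE addrA addrA subrK.
by rewrite mddD mdd_shift; have := @top_const (v :: l) (0 + u) sl; rewrite /Df /= => ->.
Qed.

Lemma top_bracket x l : size l = k -> D x *m Df l - Df l *m D x =
  removals (fun u => om x u + r u) l (fun t => Df (x :: t)) - r x *: Df l.
Proof.
move=> sl.
have mmorph (h : mx -> mx) (f : X -> mx) l' y : linear h -> mdd l' (fun z => h (f z)) y = h (mdd l' f y).
  by move=> hl; elim: l' y => [|u l' IH] y //; rewrite !mddS !IH (linear_funD hl) (linear_funN hl).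
have hl : linear (fun B : mx => D x *m B - B *m D x).
  by move=> a u v; rewrite mulmxDr mulmxDl -scalemxAr -scalemxAl; modring K 'M[K]_n.+1.
have := mmorph _ D l 0 hl; rewrite /= -/(Df l) => <-.
rewrite (_ : (fun z => _) = fun y => (om x y + r y) *: (- dd x D y) +
   ((- r x) *: D (y + x) + ((- (om x y)) *: D x + r x *: D x))); last first.
  apply/funext => y; rewrite D_br ddE [y + x]addrC; modring K 'M[K]_n.+1.
rewrite mddD mdd_lin mdd_shift (@top_const l) // mddD mdd_const ?addr0; last by rewrite sl; lia.
have wD u v : om x (u + v) + r (u + v) = om x u + r u + (om x v + r v) by rewrite omDr rD; ring.
have wD' u v : - om x (u + v) = - om x u + - om x v by rewrite omDr opprD.
rewrite (@mdd_leibniz _ _ _ (fun y => om x y + r y) l _ (fun t => - Df (x :: t)) wD); last first.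
  move=> t st y; have e : size (x :: t) = k by rewrite /= st.
  by rewrite mddN; congr (- _); exact: (top_const y e).
rewrite (@mdd_leibniz _ _ _ (fun y => - om x y) l (fun _ => D x) (fun _ => 0) wD'); last first.
  by move=> t st y; rewrite mdd_const //; lia.
rewrite mdd_const; last by lia.
rewrite (removals_eq0 (fun y => - om x y) (h := fun=> 0)) // scaler0 subr0 addr0 mddN /= (_ : mdd l (dd x D) 0 = 0); last first.
  by have := @top (x :: l) _ 0; rewrite /= sl; apply.
have := removals_lin (-1) (fun u => om x u + r u) l (fun t => Df (x :: t)) (fun _ => 0).
rewrite [X in _ + X]removals_eq0 // addr0 (_ : (fun t => _) = fun t => - Df (x :: t)) => [->|]; last first.
  by apply/funext => t; rewrite scaleN1r addr0.
by modring K 'M[K]_n.+1.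
Qed.

Let I : set mx := [set z | forall S : set mx, subspace S -> (forall l, size l = k -> S (Df l)) -> S z].

Let I_sub : subspace I.
Proof.
split=> [S [S0 _] //|a u v Iu Iv S sS H]; have [_ SP] := sS.
by apply: SP; [apply: Iu | apply: Iv].
Qed.

Let I_Df l : size l = k -> I (Df l). Proof. by move=> sl S _; apply. Qed.

(** The bracket of two mixed differences of top degree would be a mixed
    difference of twice the degree minus one or two, which is zero. *)
Lemma top_commute l l' : (2 < k)%N -> size l = k -> size l' = k -> Df l *m Df l' = Df l' *m Df l.
Proof.
move=> k3 sl sl'.
have mmorph (h : mx -> mx) (f : X -> mx) t y : linear h -> mdd t (fun z => h (f z)) y = h (mdd t f y).
  by move=> hl; elim: t y => [|u t IH] y //; rewrite !mddS !IH (linear_funD hl) (linear_funN hl).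
have hl : linear (fun B : mx => B *m Df l' - Df l' *m B).
  by move=> a u v; rewrite mulmxDr mulmxDl -scalemxAr -scalemxAl; modring K 'M[K]_n.+1.
have := mmorph _ D l 0 hl; rewrite /= -/(Df l) => e.
apply/eqP; rewrite -subr_eq0 -e; apply/eqP.
rewrite (_ : (fun z => _) = fun x => removals (fun u => om x u + r u) l' (fun t => Df (x :: t)) + (- r x) *: Df l'); last first.
  by apply/funext => x; rewrite top_bracket // scaleNr.
have rN' u v : - r (u + v) = - r u + - r v by rewrite rD opprD.
rewrite mddD (@mdd_leibniz _ _ _ (fun x => - r x) l (fun _ => Df l') (fun _ => 0) rN'); last first.
  by move=> t st y; rewrite mdd_const //; lia.
rewrite mdd_const ?removals_eq0 //; last by lia.
rewrite scaler0 subr0 addr0.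
have H l1 (h : X -> seq X -> mx) : (forall t u v, (size t).+1 = size l1 -> h (u + v) t = h u t + h v t) ->
    mdd l (fun x => removals (fun u => om x u + r u) l1 (h x)) 0 = 0.
  elim: l1 h => [|u l1 IH] h hD; first by rewrite /= mdd0.
  rewrite [X in mdd _ X](_ : _ = fun x => om x u *: h x l1 + (r u *: h x l1 +
     removals (fun u => om x u + r u) l1 (fun t => h x (u :: t)))); last first.
    by apply/funext => x /=; rewrite scalerDl addrA.
  rewrite mddD mdd_quadratic ?add0r; [|by move=> a b; apply: omDl|by move=> a b; apply: hD|by lia].
  rewrite mddD IH => [|t a b st]; last by apply: hD; rewrite /= st.
  rewrite mddZ addr0.
  by rewrite mdd_additive ?scaler0 //; [move=> a b; apply: hD | rewrite sl; lia].
by apply: H => t u v st; apply: top_add; rewrite st.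
Qed.

(** The mixed differences of top degree span an abelian ideal, whose elements
    are central by [abelian_ideal]; compare [top_bracket]. *)
Lemma top_central x l : (2 < k)%N -> size l = k ->
  removals r l (fun t => Df (x :: t)) = r x *: Df l.
Proof.
move=> k3 sl.
have Icomm u v : I u -> I v -> u *m v = v *m u.
  move=> Iu Iv.
  have C1 l1 : size l1 = k -> forall v, I v -> Df l1 *m v = v *m Df l1.
    move=> sl1 {Iu Iv u}v Iv; apply: (Iv [set v | Df l1 *m v = v *m Df l1]); last by move=> t st; apply: top_commute.
    by split=> [|a p q /= hp hq]; rewrite /= ?mulmx0 ?mul0mx // mulmxDr mulmxDl hp' || rewrite mulmxDr mulmxDl -scalemxAr -scalemxAl hp hq.
  apply: (Iu [set u | u *m v = v *m u]); last by move=> t st /=; apply: C1.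
  by split=> [|a p q /= hp hq]; rewrite /= ?mulmx0 ?mul0mx // mulmxDr mulmxDl -scalemxAr -scalemxAl hp hq.
have Iideal g z : range D g -> I z -> I (g *m z - z *m g).
  move=> [y _ <-] Iz; have [I0 IP] := I_sub.
  apply: (Iz [set z | I (D y *m z - z *m D y)]) => [|t st].
    split=> [|a p q /= hp hq]; rewrite /= ?mulmx0 ?mul0mx ?subrr //.
    rewrite mulmxDr mulmxDl -scalemxAr -scalemxAl opprD addrACA -scalerBr; exact: IP.
  rewrite /= top_bracket // addrC -scaleNr; apply: IP; first exact: I_Df.
  by apply: removals_subspace => // t' st'; apply: I_Df; rewrite /= st' st.
have cen y : removals (fun u => om y u + r u) l (fun t => Df (y :: t)) = r y *: Df l.
  apply/eqP; rewrite -subr_eq0 -top_bracket // subr_eq0; apply/eqP.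
  by apply: (abelian_ideal D_irr Icomm Iideal); [exists y | exact: I_Df].
have DfN t : (size t).+1 = k -> Df (- x :: t) = - Df (x :: t).
  move=> st; apply/eqP; rewrite -addr_eq0 -top_add // addNr; apply/eqP.
  by apply: (addIr (Df (0 :: t))); rewrite -top_add // !add0r.
have h1 := cen x; have h2 := cen (- x).
have remN w l1 (h : seq X -> mx) : removals w l1 (fun t => - h t) = - removals w l1 h.
  elim: l1 h => [|u l1 IH] h /=; rewrite ?oppr0 //.
  by rewrite (IH (fun t => h (u :: t))) scalerN opprD.
have remeq w l1 (h h' : seq X -> mx) : (forall t, (size t).+1 = size l1 -> h t = h' t) -> removals w l1 h = removals w l1 h'.
  elim: l1 h h' => [|u l1 IH] h h' H //=; rewrite H // (IH _ (fun t => h' (u :: t))) // => t st.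
  by apply: H; rewrite /= st.
have rNx : r (- x) = - r x by apply: addfunN rD x.
have h3 : removals (fun u => om x u) l (fun t => Df (x :: t)) - removals r l (fun t => Df (x :: t)) = - (r x *: Df l).
  rewrite rNx scaleNr in h2; rewrite -h2.
  rewrite (remeq _ l (fun t => Df (- x :: t)) (fun t => - Df (x :: t))); last by move=> t st; apply: DfN; rewrite st.
  rewrite remN -[in LHS](removalsNw r) -removalsDw -removalsNw.
  congr (removals _ l _); apply/funext => u; rewrite (addfunN (h := om^~ u)) //; ring.
have two : (2 : K) != 0 by rewrite pnatr_eq0.
rewrite removalsDw in h1.
apply: (scalerI two); move: h1 h3; set P := removals _ _ _; set Q := removals _ _ _; set S := r x *: Df l.
move=> h1 h3; have -> : 2 *: Q = (P + Q) - (P - Q) by modring K 'M[K]_n.+1.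
by rewrite h1 h3 opprK; modring K 'M[K]_n.+1.
Qed.

Lemma top_eq0 mu : r mu != 0 -> (2 < k)%N -> forall l, size l = k -> forall x, mdd l D x = 0.
Proof.
move=> rmu k3 l sl x; rewrite top_const //.
have H j : (j <= k)%N -> forall l', size l' = j -> Df (l' ++ nseq (k - j) mu) = 0.
  elim: j => [_ [|//] _|j IH jk [//|y l'] [sl']].
    rewrite subn0 cat0s; have := @top_central mu (nseq k mu) k3 (size_nseq _ _).
    rewrite removals_nseq.
    have -> : mu :: nseq k.-1 mu = nseq k mu by rewrite -[in RHS](ltn_predK k2).
    move=> /eqP; rewrite -subr_eq0 -scalerBl -{2}[r mu]mul1r -mulrBl scaler_eq0 mulf_eq0 (negPf rmu) orbF.
    by rewrite subr_eq0 -[1]/(1%:R) eqr_nat => /orP[/eqP|/eqP //]; lia.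
  have IH' := IH (ltnW jk).
  have sz : size (l' ++ nseq (k - j) mu) = k by rewrite size_cat size_nseq sl'; lia.
  have := @top_central y _ k3 sz; rewrite IH' // scaler0 removals_cat removals_eq0 ?add0r; last first.
    by move=> t st; rewrite -cat_cons IH' //= st.
  rewrite removals_nseq => /eqP; rewrite scaler_eq0 mulf_eq0 (negPf rmu) orbF pnatr_eq0.
  have -> : (k - j).-1 = (k - j.+1)%N by lia.
  by move=> /orP[/eqP|/eqP //]; lia.
by have := H k (leqnn _) l sl; rewrite subnn cats0.
Qed.

End TopForm.

(** A homogeneous part of degree three or more spans an abelian ideal, hence
    is central; the relation that its brackets satisfy then makes it zero. *)
Theorem degree_two mu K0 : r mu != 0 -> (forall l, size l = K0 -> forall x, mdd l D x = 0) ->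
  forall l, size l = 3 -> forall x, mdd l D x = 0.
Proof.
move=> rmu H; have {H} := mdd_le H (leq_addr 3 K0).
elim: K0 => [//|K0 IH] H; apply: IH; apply: (top_eq0 _ _ rmu) => //; lia.
Qed.

End DegreeTwo.

(** * The action of sl2 *)

Section ComplexExtension.
Variables (K : numFieldType) (N : nat).
Local Notation X := 'rV[int]_N.
Local Notation Y := 'rV[K]_N.

Definition iota_row (x : X) : Y := map_mx intr x.

(** The linear extension of an additive function on the lattice. *)
Definition ext (A : lmodType K) (f : X -> A) (z : Y) : A := \sum_j z 0 j *: f (delta_mx 0 j).

Lemma ext_linear (A : lmodType K) (f : X -> A) : linear (ext f).
Proof.
move=> a u v; rewrite /ext scaler_sumr -big_split; apply: eq_bigr => j _.
by rewrite !mxE scalerDl scalerA.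
Qed.

Lemma row_int_eq (A : zmodType) (f g : X -> A) : (forall x y, f (x + y) = f x + f y) ->
  (forall x y, g (x + y) = g x + g y) -> (forall j, f (delta_mx 0 j) = g (delta_mx 0 j)) -> forall x, f x = g x.
Proof.
move=> fD gD H; have z0 (h : X -> A) : (forall x y, h (x + y) = h x + h y) -> h 0 = 0.
  by move=> hD; apply: (addIr (h 0)); rewrite -hD !add0r.
apply: row_int_ind => //; first by rewrite !z0.
  by move=> u v; rewrite fD gD => -> ->.
move=> u e; apply: (addIr (f u)); rewrite {2}e -fD -gD !addNr !z0 //.
Qed.

Lemma ext_iota (A : lmodType K) (f : X -> A) : (forall x y, f (x + y) = f x + f y) ->
  forall x, ext f (iota_row x) = f x.
Proof.
move=> fD; apply: row_int_eq => // [x y|j].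
  rewrite /ext -big_split; apply: eq_bigr => j _ /=.
  by rewrite !mxE intrD scalerDl.
rewrite /ext (bigD1 j) //= !mxE !eqxx scale1r big1 ?addr0 // => i ij.
by rewrite !mxE (negPf ij) andbF scale0r.
Qed.

Lemma ext_eq0 (A : lmodType K) (F : Y -> A) : linear F -> (forall x, F (iota_row x) = 0) -> forall z, F z = 0.
Proof.
move=> Fl H z; rewrite [z]row_sum_delta.
elim: (index_enum _) => [|j s IH]; first by rewrite big_nil (linear_fun0 Fl).
rewrite big_cons Fl IH addr0; have := H (delta_mx 0 j); rewrite (_ : iota_row _ = delta_mx 0 j).
  by move=> ->; rewrite scaler0.
by apply/matrixP => a b; rewrite !mxE; case: (_ && _).
Qed.

End ComplexExtension.

Section Commutators.
Variables (K : fieldType) (n : nat).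
Local Notation mx := 'M[K]_n.+1.
Definition com (x y : mx) : mx := x *m y - y *m x.

Lemma com_linl a x x' y : com (a *: x + x') y = a *: com x y + com x' y.
Proof. by rewrite /com mulmxDr mulmxDl -scalemxAr -scalemxAl; modring K 'M[K]_n.+1. Qed.

Lemma com_linr a x y y' : com x (a *: y + y') = a *: com x y + com x y'.
Proof. by rewrite /com mulmxDr mulmxDl -scalemxAr -scalemxAl; modring K 'M[K]_n.+1. Qed.

Lemma comC x y : com x y = - com y x. Proof. by rewrite /com opprB. Qed.
Lemma comxx x : com x x = 0. Proof. by rewrite /com subrr. Qed.
Lemma com0l x : com 0 x = 0. Proof. by rewrite /com mul0mx mulmx0 subrr. Qed.
Lemma com0r x : com x 0 = 0. Proof. by rewrite /com mul0mx mulmx0 subrr. Qed.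
Lemma comDl x x' y : com (x + x') y = com x y + com x' y.
Proof. by rewrite -[x]scale1r com_linl !scale1r. Qed.
Lemma comDr x y y' : com x (y + y') = com x y + com x y'.
Proof. by rewrite -[y]scale1r com_linr !scale1r. Qed.
Lemma comZl a x y : com (a *: x) y = a *: com x y.
Proof. by rewrite -[a *: x]addr0 com_linl com0l !addr0. Qed.
Lemma comZr a x y : com x (a *: y) = a *: com x y.
Proof. by rewrite -[a *: y]addr0 com_linr com0r !addr0. Qed.
Lemma comNl x y : com (- x) y = - com x y.
Proof. by rewrite -scaleN1r comZl scaleN1r. Qed.
Lemma comNr x y : com x (- y) = - com x y.
Proof. by rewrite -scaleN1r comZr scaleN1r. Qed.
Definition com_rules := (comDl, comDr, comZl, comZr, comNl, comNr, com0l, com0r, comxx).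
End Commutators.

Section QuadraticParts.
Variables (K : numFieldType) (X : zmodType) (om : X -> X -> K) (r : X -> K).
Hypothesis omDl : forall x y z, om (x + y) z = om x z + om y z.
Hypothesis omDr : forall z x y, om z (x + y) = om z x + om z y.
Hypothesis rD : forall x y, r (x + y) = r x + r y.
Variables (n : nat).
Local Notation mx := 'M[K]_n.+1.

(** A function of degree two that vanishes at the origin is the sum of an
    additive function and the diagonal of a symmetric biadditive one. *)
Lemma quadratic_parts (D : X -> mx) : D 0 = 0 ->
  (forall x y, com (D x) (D y) =
    (om x y + r y) *: (D (x + y) - D y) - r x *: D (x + y) + (r x - om x y) *: D x) ->
  (forall l, size l = 3 -> forall x, mdd l D x = 0) ->
  exists (D1 : X -> mx) (B : X -> X -> mx),
  [/\ forall x y, D1 (x + y) = D1 x + D1 y, forall x x' y, B (x + x') y = B x y + B x' y,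
      forall x y, B x y = B y x, forall x, D x = D1 x + 2^-1 *: B x x &
      (forall x y, com (D x) (D y) = r y *: D x - r x *: D y + (om x y - r x + r y) *: B x y) /\
      (forall x y z, com (D x) (B y z) =
         (om x y + r y) *: B x z + (om x z + r z) *: B x y - r x *: B y z)].
Proof.
move=> D_0 D_br D_deg; pose B x y := mdd [:: x; y] D 0.
have BE x y : B x y = D (x + y) - D x - D y.
  by rewrite /B /= !ddE !add0r D_0 [y + x]addrC; modring K 'M[K]_n.+1.
have BC x y : B x y = B y x by rewrite !BE [y + x]addrC addrAC.
have BDl x x' y : B (x + x') y = B x y + B x' y := top_add D_deg (k := 2) x x' (l := [:: y]) erefl.
have BDr x y y' : B x (y + y') = B x y + B x y' by rewrite BC BDl ![B _ x]BC.
have brB x y z : com (D x) (B y z) =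
    (om x y + r y) *: B x z + (om x z + r z) *: B x y - r x *: B y z.
  have k2 : (1 < 2)%N by [].
  rewrite /com (top_bracket omDr rD D_br k2 D_deg x (l := [:: y; z]) erefl) [removals _ _ _]/=.
  by rewrite addr0.
have DE x y : D (x + y) = B x y + D x + D y by rewrite BE; modring K 'M[K]_n.+1.
have brD x y : com (D x) (D y) = r y *: D x - r x *: D y + (om x y - r x + r y) *: B x y.
  by rewrite D_br DE; modring K 'M[K]_n.+1.
clearbody B; exists (fun x => D x - 2^-1 *: B x x), B; split=> // [x y|x]; last by rewrite subrK.
by rewrite DE BDl !BDr [B y x]BC; modred K 'M[K]_n.+1; field.
Qed.

Variables (D D1 : X -> mx) (B : X -> X -> mx).
Hypothesis D1D : forall x y, D1 (x + y) = D1 x + D1 y.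
Hypothesis BDl : forall x x' y, B (x + x') y = B x y + B x' y.
Hypothesis BC : forall x y, B x y = B y x.
Hypothesis DE : forall x, D x = D1 x + 2^-1 *: B x x.
Hypothesis brD : forall x y, com (D x) (D y) = r y *: D x - r x *: D y + (om x y - r x + r y) *: B x y.
Hypothesis brB : forall x y z, com (D x) (B y z) =
  (om x y + r y) *: B x z + (om x z + r z) *: B x y - r x *: B y z.

Let omNl x y : om (- x) y = - om x y. Proof. exact: (addfunN (h := om^~ y)). Qed.
Let omNr x y : om x (- y) = - om x y. Proof. exact: addfunN (omDr x) y. Qed.
Let rN x : r (- x) = - r x. Proof. exact: addfunN rD x. Qed.
Let vN (f : X -> mx) : (forall x y, f (x + y) = f x + f y) -> forall x, f (- x) = - f x.
Proof.
move=> fD x; apply/eqP; rewrite -addr_eq0 -fD addNr; apply/eqP; apply: (addIr (f 0)).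
by rewrite -fD !add0r.
Qed.
Let BNl x y : B (- x) y = - B x y. Proof. exact: (vN (f := B^~ y)). Qed.
Let BNr x y : B x (- y) = - B x y. Proof. by rewrite BC BNl BC. Qed.
Let D1N x : D1 (- x) = - D1 x. Proof. exact: vN. Qed.
Let D1E x : D1 x = 2^-1 *: (D x - D (- x)).
Proof. by rewrite !DE BNl BNr D1N; modred K 'M[K]_n.+1; field. Qed.
Let two : (2 : K) != 0. Proof. by rewrite pnatr_eq0. Qed.

(** Parity in each variable separates the components of the brackets. *)
Lemma bracket11 x y : com (D1 x) (D1 y) = r y *: D1 x - r x *: D1 y.
Proof.
rewrite (D1E x) (D1E y) !com_rules !brD !DE !(BNl, BNr, D1N, rN, omNl, omNr).
by modred K 'M[K]_n.+1; field.
Qed.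

Lemma bracket12 x y z : com (D1 x) (B y z) = r y *: B x z + r z *: B x y - r x *: B y z.
Proof.
rewrite D1E !com_rules !brB !(BNl, BNr, rN, omNl).
by modred K 'M[K]_n.+1; field.
Qed.

Lemma bracket22 x x' y z : com (B x x') (B y z) =
  om x y *: B x' z + om x z *: B x' y + om x' y *: B x z + om x' z *: B x y.
Proof.
have E w : com (B w w) (B y z) = 2 *: (om w y *: B w z + om w z *: B w y).
  have -> : B w w = 2 *: (D w - D1 w) by rewrite DE addrC addKr scalerA mulfV ?scale1r.
  by rewrite comZl comDl comNl brB bracket12; modring K 'M[K]_n.+1.
have BDr u v v' : B u (v + v') = B u v + B u v' by rewrite BC BDl ![B _ u]BC.
have e : B x x' = 2^-1 *: (B (x + x') (x + x') - B x x - B x' x').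
  by rewrite !BDl !BDr [B x' x]BC; modred K 'M[K]_n.+1; field.
rewrite e comZl !comDl !comNl !E !omDl !BDl.
by modred K 'M[K]_n.+1; field.
Qed.

End QuadraticParts.

Section Complexify.
Variables (K : numFieldType) (N : nat).
Local Notation X := 'rV[int]_N.
Local Notation Y := 'rV[K]_N.
Variable pi : {additive X -> 'rV[K]_2}.
Variables (n : nat) (D1 : X -> 'M[K]_n.+1) (B : X -> X -> 'M[K]_n.+1).
Local Notation mx := 'M[K]_n.+1.
Local Notation om x y := (sympl (pi x) (pi y)).
Local Notation r x := (sympl rho (pi x)).
Hypothesis D1D : forall x y, D1 (x + y) = D1 x + D1 y.
Hypothesis BDl : forall x x' y, B (x + x') y = B x y + B x' y.
Hypothesis BC : forall x y, B x y = B y x.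
Hypothesis br11 : forall x y, com (D1 x) (D1 y) = r y *: D1 x - r x *: D1 y.
Hypothesis br12 : forall x y z, com (D1 x) (B y z) = r y *: B x z + r z *: B x y - r x *: B y z.
Hypothesis br22 : forall x x' y z, com (B x x') (B y z) =
  om x y *: B x' z + om x z *: B x' y + om x' y *: B x z + om x' z *: B x y.

Lemma bilinear_extension : exists b : Y -> Y -> mx,
  [/\ forall w, linear (b^~ w), forall z, linear (b z) & forall x y, b (iota_row K x) (iota_row K y) = B x y].
Proof.
have BDr x y y' : B x (y + y') = B x y + B x y' by rewrite BC BDl ![B _ x]BC.
exists (fun z w => ext (fun x => ext (B x) w) z); split=> [w|z c u v|x y]; first exact: ext_linear.
  rewrite {1}/ext scaler_sumr -big_split; apply: eq_bigr => j _ /=.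
  by rewrite ext_linear scalerDr !scalerA mulrC.
have eD u v : ext (B (u + v)) (iota_row K y) = ext (B u) (iota_row K y) + ext (B v) (iota_row K y).
  by rewrite /ext -big_split; apply: eq_bigr => j _ /=; rewrite BDl scalerDr.
by rewrite (ext_iota (f := fun x => ext (B x) (iota_row K y)) eD) ext_iota.
Qed.

(** An additive function on the lattice extends linearly, while the plane sees
    only a quotient of the complexified lattice; the relations extend because they
    are polynomial. *)
Lemma complexification : exists (p : Y -> 'rV[K]_2) (d1 : Y -> mx) (b : Y -> Y -> mx),
  let omz z w := sympl (p z) (p w) in let rz z := sympl rho (p z) in
  [/\ linear p /\ linear d1, (forall w, linear (b^~ w)) /\ (forall z, linear (b z)),
      [/\ forall x, p (iota_row K x) = pi x, forall x, d1 (iota_row K x) = D1 x &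
          forall x y, b (iota_row K x) (iota_row K y) = B x y],
      forall z w, b z w = b w z &
   [/\ forall z w, com (d1 z) (d1 w) = rz w *: d1 z - rz z *: d1 w,
       forall z w w', com (d1 z) (b w w') = rz w *: b z w' + rz w' *: b z w - rz z *: b w w' &
       forall z z' w w', com (b z z') (b w w') =
         omz z w *: b z' w' + omz z w' *: b z' w + omz z' w *: b z w' + omz z' w' *: b z w]].
Proof.
have [b [bl br bE]] := bilinear_extension.
have [p [pl pE]] : exists p : Y -> 'rV[K]_2, linear p /\ forall x, p (iota_row K x) = pi x.
  exists (ext pi); split; first exact: ext_linear.
  by move=> x; apply: ext_iota => u v; rewrite raddfD.
have [d1 [dl dE]] : exists d1 : Y -> mx, linear d1 /\ forall x, d1 (iota_row K x) = D1 x.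
  by exists (ext D1); split; [exact: ext_linear | move=> x; apply: ext_iota].
exists p, d1, b => omz rz.
have omzl c u v w : omz (c *: u + v) w = c * omz u w + omz v w by rewrite /omz pl /sympl !mxE; ring.
have omzr c u v w : omz w (c *: u + v) = c * omz w u + omz w v by rewrite /omz pl /sympl !mxE; ring.
have rzP c u v : rz (c *: u + v) = c * rz u + rz v by rewrite /rz pl /sympl !mxE; ring.
have omzE x y : omz (iota_row K x) (iota_row K y) = om x y by rewrite /omz !pE.
have rzE x : rz (iota_row K x) = r x by rewrite /rz pE.
have bzl c u v w : b (c *: u + v) w = c *: b u w + b v w by apply: bl.
have bzr c u v w : b w (c *: u + v) = c *: b w u + b w v by apply: br.
clearbody omz rz.
pose linE := (bzl, bzr, dl, omzl, omzr, rzP).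
split=> //.
  move=> z w; apply/eqP; rewrite -subr_eq0; apply/eqP.
  apply: (@ext_eq0 _ _ _ (fun z => b z w - b w z)) z => [c u v|x].
    by rewrite !linE; modring K 'M[K]_n.+1.
  apply: (@ext_eq0 _ _ _ (fun w => b _ w - b w _)) w => [c u v|y].
    by rewrite !linE; modring K 'M[K]_n.+1.
  by rewrite !bE BC subrr.
split.
- move=> z w; apply/eqP; rewrite -subr_eq0; apply/eqP.
  apply: (@ext_eq0 _ _ _ (fun z => com (d1 z) (d1 w) - (rz w *: d1 z - rz z *: d1 w))) z => [c u v|x].
    by rewrite !linE com_linl; modring K 'M[K]_n.+1.
  apply: (@ext_eq0 _ _ _ (fun w => com (d1 _) (d1 w) - (rz w *: d1 _ - rz _ *: d1 w))) w => [c u v|y].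
    by rewrite !linE com_linr; modring K 'M[K]_n.+1.
  by rewrite !dE !rzE br11 subrr.
- move=> z w w'; apply/eqP; rewrite -subr_eq0; apply/eqP.
  pose E z w w' := com (d1 z) (b w w') - (rz w *: b z w' + rz w' *: b z w - rz z *: b w w').
  apply: (@ext_eq0 _ _ _ (fun z => E z w w')) z => [c u v|x]; rewrite /E.
    by rewrite !linE com_linl; modring K 'M[K]_n.+1.
  apply: (@ext_eq0 _ _ _ (fun w => E _ w w')) w => [c u v|y]; rewrite /E.
    by rewrite !linE com_linr; modring K 'M[K]_n.+1.
  apply: (@ext_eq0 _ _ _ (fun w' => E _ _ w')) w' => [c u v|y']; rewrite /E.
    by rewrite !linE com_linr; modring K 'M[K]_n.+1.
  by rewrite !dE !rzE !bE br12 subrr.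
move=> z z' w w'; apply/eqP; rewrite -subr_eq0; apply/eqP.
pose E z z' w w' := com (b z z') (b w w') -
  (omz z w *: b z' w' + omz z w' *: b z' w + omz z' w *: b z w' + omz z' w' *: b z w).
apply: (@ext_eq0 _ _ _ (fun z => E z z' w w')) z => [c u v|x]; rewrite /E.
  by rewrite !linE com_linl; modring K 'M[K]_n.+1.
apply: (@ext_eq0 _ _ _ (fun z' => E _ z' w w')) z' => [c u v|x']; rewrite /E.
  by rewrite !linE com_linl; modring K 'M[K]_n.+1.
apply: (@ext_eq0 _ _ _ (fun w => E _ _ w w')) w => [c u v|y]; rewrite /E.
  by rewrite !linE com_linr; modring K 'M[K]_n.+1.
apply: (@ext_eq0 _ _ _ (fun w' => E _ _ _ w')) w' => [c u v|y']; rewrite /E.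
  by rewrite !linE com_linr; modring K 'M[K]_n.+1.
by rewrite !omzE !bE br22 subrr.
Qed.

End Complexify.

Section Sl2.
Variables (K : numClosedFieldType) (Y : lmodType K) (n : nat).
Local Notation mx := 'M[K]_n.+1.
Variables (p : Y -> 'rV[K]_2) (d1 : Y -> mx) (b : Y -> Y -> mx) (sec : 'rV[K]_2 -> Y).
Local Notation omz z w := (sympl (p z) (p w)).
Local Notation rz z := (sympl rho (p z)).
Hypothesis pl : linear p.
Hypothesis dl : linear d1.
Hypothesis bl : forall w, linear (b^~ w).
Hypothesis br : forall z, linear (b z).
Hypothesis bC : forall z w, b z w = b w z.
Hypothesis z11 : forall z w, com (d1 z) (d1 w) = rz w *: d1 z - rz z *: d1 w.
Hypothesis z12 : forall z w w',
  com (d1 z) (b w w') = rz w *: b z w' + rz w' *: b z w - rz z *: b w w'.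
Hypothesis z22 : forall z z' w w', com (b z z') (b w w') =
  omz z w *: b z' w' + omz z w' *: b z' w + omz z' w *: b z w' + omz z' w' *: b z w.
Hypothesis sec_p : forall u, p (sec u) = u.

Definition gens : set mx := [set g | (exists z, g = d1 z) \/ exists z w, g = b z w].
Hypothesis G_irr : irr gens.

Let two : (2 : K) != 0. Proof. by rewrite pnatr_eq0. Qed.
Let kernel z := p z = 0.
Let kom z w : kernel z -> omz z w = 0.
Proof. by move=> kz; rewrite kz /sympl !mxE !mul0r subrr. Qed.
Let kom' z w : kernel z -> omz w z = 0.
Proof. by move=> kz; rewrite kz /sympl !mxE !mulr0 subrr. Qed.
Let kr z : kernel z -> rz z = 0.
Proof. by move=> kz; rewrite kz /sympl !mxE !mulr0 subrr. Qed.
Let bzl c u v w : b (c *: u + v) w = c *: b u w + b v w. Proof. exact: bl. Qed.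
Let bZl c u w : b (c *: u) w = c *: b u w. Proof. exact: (linear_funZ (bl w)). Qed.
Let bZr c u w : b w (c *: u) = c *: b w u. Proof. exact: (linear_funZ (br w)). Qed.
Let bDl u v w : b (u + v) w = b u w + b v w. Proof. exact: (linear_funD (bl w)). Qed.
Let bDr u v w : b w (u + v) = b w u + b w v. Proof. exact: (linear_funD (br w)). Qed.

Let emu : 'rV[K]_2 := \row_j (j != 0)%:R.
Let zr := sec rho.
Let zm := sec emu.
Let rzr : rz zr = 0. Proof. by rewrite sec_p /sympl mulrC subrr. Qed.
Let rzm : rz zm = 1. Proof. by rewrite sec_p /sympl !mxE /= mul1r mulr0 subr0. Qed.
Let omrm : omz zr zm = 1. Proof. by rewrite !sec_p /sympl !mxE /= mul1r mulr0 subr0. Qed.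
Let ommr : omz zm zr = -1. Proof. by rewrite !sec_p /sympl !mxE /= mul0r sub0r mul1r. Qed.
Let omrr : omz zr zr = 0. Proof. by rewrite /sympl mulrC subrr. Qed.
Let ommm : omz zm zm = 0. Proof. by rewrite /sympl mulrC subrr. Qed.

Let Gd z : gens (d1 z). Proof. by left; exists z. Qed.
Let Gb z w : gens (b z w). Proof. by right; exists z, w. Qed.

Let line_ideal x : (forall g, gens g -> exists c, com g x = c *: x) -> forall g, gens g -> com g x = 0.
Proof.
move=> H g Gg; apply/eqP; rewrite /com subr_eq0; apply/eqP.
apply: (abelian_ideal (I := [set y | exists c, y = c *: x]) G_irr) => //; last by exists 1; rewrite scale1r.
  by move=> y y' [c ->] [c' ->]; rewrite -!scalemxAl -!scalemxAr !scalerA mulrC.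
move=> h y Gh [c ->]; have [c' e] := H h Gh; exists (c * c').
by rewrite -/(com h _) comZr e scalerA.
Qed.

(* Directions killed by the projection to the plane act by zero. *)
Let ker_bb z z' : kernel z -> kernel z' -> b z z' = 0.
Proof.
move=> kz kz'; have : com (d1 zm) (b z z') = 0.
  apply: line_ideal (Gd zm) => g [[w ->]|[w [w' ->]]].
    by exists (- rz w); rewrite z12 (kr kz) (kr kz') !scale0r add0r sub0r scaleNr.
  by exists 0; rewrite z22 !(kom' _ kz) !(kom' _ kz') !scale0r !addr0.
rewrite z12 (kr kz) (kr kz') rzm !scale0r add0r scale1r sub0r => /eqP.
by rewrite oppr_eq0 => /eqP.
Qed.

Let ker_b z w : kernel z -> b z w = 0.
Proof.
move=> kz; have bzz := ker_bb kz kz.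
have H g x : gens g -> com g (b z x) = 0.
  move=> Gg; apply/eqP; rewrite /com subr_eq0; apply/eqP.
  apply: (abelian_ideal (I := [set y | exists x, y = b z x]) G_irr) => //; last by exists x.
    move=> y y' [v ->] [v' ->]; apply/eqP; rewrite -subr_eq0 -/(com _ _) z22.
    by rewrite !(kom _ kz) (kom' _ kz) bzz !scale0r scaler0 !addr0.
  move=> h y Gh [v ->]; rewrite -/(com _ _); case: Gh => [[v' ->]|[v' [v'' ->]]].
    exists (rz v *: v' + - rz v' *: v); rewrite z12 (kr kz) bDr !bZr [b v' z]bC.
    by rewrite scale0r add0r scaleNr.
  exists (omz v' v *: v'' + omz v'' v *: v'); rewrite z22 !(kom' _ kz) bDr !bZr.
  by rewrite [b v'' z]bC [b v' z]bC !scale0r add0r addr0.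
have [kw|nkw] := pselect (kernel w); first exact: ker_bb.
have [v vw] : exists v, omz w v != 0.
  apply: contrapT => /forallNP nv; apply: nkw.
  have h u : sympl (p w) u = 0 by have /negP := nv (sec u); rewrite negbK sec_p => /eqP.
  have h1 := h emu; have h2 := h (rho - emu); rewrite /sympl !mxE /= in h1 h2.
  rewrite mulr1 mulr0 subr0 in h1; rewrite h1 mul0r subr0 mulr1 sub0r in h2.
  apply/matrixP => i j; rewrite (ord1 i) mxE; case: j => -[|[|//]] q.
    by have -> : Ordinal q = 0 by exact: val_inj.
  have -> : Ordinal q = 1 by exact: val_inj.
  by move/eqP: h2; rewrite oppr_eq0 => /eqP.
have := H (b w w) v (Gb w w); rewrite z22 !(kom' _ kz) [b w z]bC !scale0r add0r addr0 => e.
apply: (scalerI vw); rewrite scaler0; apply: (scalerI two).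
by rewrite scaler0 -[RHS]e; modring K 'M[K]_n.+1.
Qed.

Let ker_d1 z : kernel z -> d1 z = 0.
Proof.
move=> kz; have : com (d1 zm) (d1 z) = 0.
  apply: line_ideal (Gd zm) => g [[w ->]|[w [w' ->]]].
    by exists (- rz w); rewrite z11 (kr kz) scale0r sub0r scaleNr.
  exists 0; rewrite comC z12 (ker_b w kz) (ker_b w' kz) (kr kz) !scaler0 !scale0r.
  by rewrite subr0 addr0 oppr0.
rewrite z11 (kr kz) rzm scale0r scale1r sub0r => /eqP.
by rewrite oppr_eq0 => /eqP.
Qed.

Let zcoord z : exists2 k, kernel k & z = (p z 0 0) *: zr + (rz z *: zm + k).
Proof.
exists (z - ((p z 0 0) *: zr + rz z *: zm)); last by rewrite addrA addrC subrK.
rewrite /kernel addrC -scaleN1r !pl (linear_funZ pl) !sec_p.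
apply/matrixP => i j; rewrite (ord1 i) !mxE /sympl !mxE.
case: j => -[|[|//]] q.
  by have -> : Ordinal q = 0 by [exact: val_inj]; rewrite /=; ring.
by have -> : Ordinal q = 1 by [exact: val_inj]; rewrite /=; ring.
Qed.

Let d1_coord z : d1 z = p z 0 0 *: d1 zr + rz z *: d1 zm.
Proof.
have [k kk e] := zcoord z; move: (p z 0 0) (rz z) e => x t ->.
by rewrite !dl (ker_d1 kk) addr0.
Qed.

Let b_coord z w : b z w = (p z 0 0 * p w 0 0) *: b zr zr
  + (p z 0 0 * rz w + rz z * p w 0 0) *: b zr zm + (rz z * rz w) *: b zm zm.
Proof.
have [k kk e] := zcoord z; have [k' kk' e'] := zcoord w.
move: (p z 0 0) (rz z) (p w 0 0) (rz w) e e' => x t x' t' -> ->.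
rewrite !(bDl, bZl, bDr, bZr) ![b _ k']bC !(ker_b _ kk) !(ker_b _ kk') [b zm zr]bC.
by modring K 'M[K]_n.+1.
Qed.

Let H0 := b zr zm.
Let E0 := b zm zm.
Let F0 := b zr zr.
Let cHE : com H0 E0 = 2 *: E0.
Proof. by rewrite /H0 /E0 z22 !(omrm, ommm); modring K 'M[K]_n.+1. Qed.
Let cHF : com H0 F0 = - 2 *: F0.
Proof. by rewrite /H0 /F0 z22 !(omrr, ommr); modring K 'M[K]_n.+1. Qed.
Let cFE : com F0 E0 = 4 *: H0.
Proof. by rewrite /F0 /E0 z22 !omrm -/H0; modring K 'M[K]_n.+1. Qed.
Let cmE : com (d1 zm) E0 = E0.
Proof. by rewrite /E0 z12 !rzm; modring K 'M[K]_n.+1. Qed.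
Let cmF : com (d1 zm) F0 = - F0.
Proof. by rewrite /F0 z12 !rzm !rzr; modring K 'M[K]_n.+1. Qed.
Let cmH : com (d1 zm) H0 = 0.
Proof. by rewrite /H0 z12 !rzm !rzr [b zm zr]bC; modring K 'M[K]_n.+1. Qed.
Let crE : com (d1 zr) E0 = 2 *: H0.
Proof. by rewrite /E0 z12 !rzm !rzr -/H0; modring K 'M[K]_n.+1. Qed.
Let crF : com (d1 zr) F0 = 0.
Proof. by rewrite /F0 z12 !rzr; modring K 'M[K]_n.+1. Qed.
Let crH : com (d1 zr) H0 = F0.
Proof. by rewrite /H0 z12 !rzm !rzr -/F0; modring K 'M[K]_n.+1. Qed.
Let cmr : com (d1 zm) (d1 zr) = - d1 zr.
Proof. by rewrite z11 !rzm !rzr; modring K 'M[K]_n.+1. Qed.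

Let d1r : d1 zr = 2^-1 *: F0.
Proof.
pose y := d1 zr - 2^-1 *: F0.
have yF : com y F0 = 0 by rewrite /y !com_rules crF scaler0 subr0.
have yE : com y E0 = 0 by rewrite /y !com_rules crE cFE; modred K 'M[K]_n.+1; field.
have yH : com y H0 = 0.
  by rewrite /y !com_rules crH comC cHF; modred K 'M[K]_n.+1; field.
have my : com (d1 zm) y = - y by rewrite /y !com_rules cmr cmF; modring K 'M[K]_n.+1.
have ry : com (d1 zr) y = 0 by rewrite /y !com_rules crF; modring K 'M[K]_n.+1.
have Gy g : gens g -> com g y = 0.
  apply: line_ideal => {}g [[z ->]|[z [w ->]]].
    exists (- rz z); rewrite d1_coord comDl !comZl my ry; modring K 'M[K]_n.+1.
  exists 0; rewrite b_coord -/F0 -/H0 -/E0 comC !comDr !comZr yF yE yH; modring K 'M[K]_n.+1.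
by have := Gy _ (Gd zm); rewrite my /y opprB => /eqP; rewrite subr_eq0 => /eqP.
Qed.

Let d1m : exists c, d1 zm - 2^-1 *: H0 = c%:M.
Proof.
pose y := d1 zm - 2^-1 *: H0.
have yF : com y F0 = 0 by rewrite /y !com_rules cmF cHF; modred K 'M[K]_n.+1; field.
have yE : com y E0 = 0 by rewrite /y !com_rules cmE cHE; modred K 'M[K]_n.+1; field.
have yH : com y H0 = 0 by rewrite /y !com_rules cmH; modring K 'M[K]_n.+1.
have ym : com y (d1 zm) = 0 by rewrite /y !com_rules comC cmH; modring K 'M[K]_n.+1.
apply: (schur G_irr) => g Gg; apply/eqP; rewrite -subr_eq0 -/(com g y) comC oppr_eq0; apply/eqP.
case: Gg => [[z ->]|[z [w ->]]].
  by rewrite d1_coord d1r !comDr !comZr yF ym; modring K 'M[K]_n.+1.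
by rewrite b_coord -/F0 -/H0 -/E0 !comDr !comZr yF yE yH; modring K 'M[K]_n.+1.
Qed.

(** The irreducible module is a module over sl2, and the remaining generators
    act through it. *)
Lemma sl2_of_gens : exists (e h f : mx) (c : K),
  [/\ com h e = 2 *: e, com h f = - 2 *: f, com f e = h &
   forall z, let u := p z 0 0 in let t := rz z in
   d1 z + 2^-1 *: b z z = (u * (u + 1)) *: f + ((u + 2^-1) * t) *: h + t ^+ 2 *: e + (c * t)%:M].
Proof.
have [c cE] := d1m; exists (2^-1 *: E0), H0, (2^-1 *: F0), c; split.
- by rewrite comZr cHE !scalerA mulrC.
- by rewrite comZr cHF !scalerA mulrC.
- by rewrite comZr comZl cFE; modred K 'M[K]_n.+1; field.
move=> z u t; rewrite d1_coord b_coord -/F0 -/H0 -/E0 d1r.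
have -> : d1 zm = c%:M + 2^-1 *: H0 by rewrite -cE subrK.
have -> : (c * t)%:M = t *: c%:M :> mx by rewrite scale_scalar_mx mulrC.
rewrite -/u -/t; move: (c%:M) => C; modred K 'M[K]_n.+1; by field.
Qed.

End Sl2.

Section Sl2Structure.
Variables (K : numClosedFieldType) (N : nat).
Local Notation X := 'rV[int]_N.
Variable pi : {additive X -> 'rV[K]_2}.
Local Notation om x y := (sympl (pi x) (pi y)).
Local Notation r x := (sympl rho (pi x)).

(** The directions of the complexified lattice that die in the plane act by
    zero, so that the quadratic part is a quadratic form on the plane, with three
    coefficients forming an sl2-triple, and the linear part differs from a
    combination of them by a scalar. *)
Theorem sl2_structure (a b : X) n (D : X -> 'M[K]_n.+1) : sympl (pi a) (pi b) != 0 ->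
  D 0 = 0 ->
  (forall x y, com (D x) (D y) =
    (om x y + r y) *: (D (x + y) - D y) - r x *: D (x + y) + (r x - om x y) *: D x) ->
  irr (range D) -> (forall l, size l = 3 -> forall x, mdd l D x = 0) ->
  exists (e h f : 'M[K]_n.+1) (c : K),
  [/\ com h e = 2 *: e, com h f = - 2 *: f, com f e = h &
   forall x, let u := pi x 0 0 in let t := r x in
   D x = (u * (u + 1)) *: f + ((u + 2^-1) * t) *: h + t ^+ 2 *: e + (c * t)%:M].
Proof.
move=> ab D0 D_br D_irr D_deg.
have omDl x y z : om (x + y) z = om x z + om y z by rewrite raddfD /sympl !mxE; ring.
have omDr z x y : om z (x + y) = om z x + om z y by rewrite raddfD /sympl !mxE; ring.
have rD x y : r (x + y) = r x + r y by rewrite raddfD /sympl !mxE; ring.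
have [D1 [B [D1D BDl BC DE [brD brB]]]] := quadratic_parts omDr rD D0 D_br D_deg.
have b11 := bracket11 omDl omDr rD D1D BDl BC DE brD.
have b12 := bracket12 omDl rD D1D BDl BC DE brB.
have b22 := bracket22 omDl rD D1D BDl BC DE brB.
have [p [d1 [bb [[pl dl] [bl br] [pE dE bE] bC [z11 z12 z22]]]]] := complexification D1D BDl BC b11 b12 b22.
pose sec u := (sympl u (pi b) / sympl (pi a) (pi b)) *: iota_row K a
  + (sympl (pi a) u / sympl (pi a) (pi b)) *: iota_row K b.
have sec_p u : p (sec u) = u.
  rewrite /sec pl (linear_funZ pl) !pE; apply/matrixP => i j; rewrite (ord1 i).
  move: ab; rewrite /sympl !mxE => h; case: j => -[|[|//]] q.
    by have -> : Ordinal q = 0 by [exact: val_inj]; field.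
  by have -> : Ordinal q = 1 by [exact: val_inj]; field.
have G_irr : irr (gens d1 bb).
  move=> S sS stS; apply: D_irr => // g v [x _ <-] Sv; have [_ SP] := sS.
  rewrite DE mulmxDr -scalemxAr addrC; apply: SP; apply: stS => //.
    by right; exists (iota_row K x), (iota_row K x); rewrite bE.
  by left; exists (iota_row K x); rewrite dE.
have [e [h [f [c [he hf fe E]]]]] := sl2_of_gens pl dl bl br bC z11 z12 z22 sec_p G_irr.
exists e, h, f, c; split=> // x u t; have := E (iota_row K x).
by rewrite /= dE bE pE -DE.
Qed.

End Sl2Structure.

(** * Binary forms *)

Section LowestRow.
Variables (K : numClosedFieldType) (n : nat).
Local Notation mx := 'M[K]_n.+1.
Variables (e h f : mx).
Hypothesis he : com h e = 2 *: e.
Hypothesis hf : com h f = - 2 *: f.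
Hypothesis fe : com f e = h.

Lemma eigen_nilpotent (y x : mx) c : c != 0 -> com y x = c *: x -> exists m, x ^+ m = 0.
Proof.
move=> c0 yx; apply: trace_nilpotent => j.
have t : (c *: x) *m x = x *m (c *: x) by rewrite -scalemxAl -scalemxAr.
have := @trace_bracket _ _ y x j; rewrite -/(com y x) yx => /(_ t)/eqP.
rewrite exprZn linearZ /= mulf_eq0 expf_eq0 (negPf c0) andbF => /eqP //.
Qed.

(** A row that is an eigenvector of [h] killed by [f]; its images under powers
    of [e] behave like the coefficients of a binary form of degree [k]. *)
Lemma lowest_rows : exists (k : nat) (v : nat -> 'rV[K]_n.+1),
  [/\ v 0%N != 0, v k.+1 = 0, forall j, v j *m e = v j.+1, v 0%N *m f = 0 &
   (forall j, v j *m h = (k%:R - 2 * j%:R) *: v j) /\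
   forall j, v j.+1 *m f = - (j.+1%:R * (k%:R - j%:R)) *: v j].
Proof.
have two : (2 : K) != 0 by rewrite pnatr_eq0.
have [a /eigenvalueP[w0 wa w00]] : exists a, eigenvalue h a.
  have [a] : exists a, root (char_poly h) a by apply/closed_rootP; rewrite size_char_poly.
  by rewrite -eigenvalue_root_char; exists a.
have [m fm] : exists m, f ^+ m = 0 by apply: (eigen_nilpotent (y := h) _ hf); rewrite oppr_eq0.
have [m' em] : exists m, e ^+ m = 0 by apply: (eigen_nilpotent (y := h) _ he).
have fh : f *m h = h *m f + 2 *: f by move: hf; rewrite /com => /eqP; rewrite subr_eq => /eqP ->; modring K 'M[K]_n.+1.
have eh : e *m h = h *m e - 2 *: e by rewrite -he /com opprB addrC subrK.
have ef : e *m f = f *m e - h by rewrite -fe /com opprB addrC subrK.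
have up j : w0 *m f ^+ j *m h = (a + 2 * j%:R) *: (w0 *m f ^+ j).
  elim: j => [|j IH]; first by rewrite expr0 mulmx1 wa mulr0 addr0.
  rewrite exprSr mulmxA -mulmxA fh mulmxDr mulmxA IH -scalemxAl -scalemxAr -scalerDl.
  by congr (_ *: _); rewrite -natr1; ring.
have ex1 : exists j, w0 *m f ^+ j == 0 by exists m; rewrite fm mulmx0.
case: (ex_minnP ex1) => -[|i] wi imin; first by rewrite expr0 mulmx1 (negPf w00) in wi.
set w := w0 *m f ^+ i; set l := a + 2 * i%:R.
have w_neq0 : w != 0 by apply/eqP => w0'; have := imin i; rewrite -/w w0' eqxx ltnn => /(_ isT).
have wf : w *m f = 0 by apply/eqP; rewrite /w -mulmxA -[f ^+ i *m f]/(f ^+ i * f) -exprSr.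
have wh : w *m h = l *: w by apply: up.
pose v j := w *m e ^+ j.
have ve j : v j *m e = v j.+1 by rewrite /v -mulmxA -[e ^+ j *m e]/(e ^+ j * e) -exprSr.
have v0 : v 0%N = w by rewrite /v expr0 mulmx1.
have vh j : v j *m h = (l - 2 * j%:R) *: v j.
  elim: j => [|j IH]; first by rewrite v0 wh mulr0 subr0.
  rewrite -ve -mulmxA eh mulmxBr mulmxA IH -scalemxAl -scalemxAr -scalerBl.
  by congr (_ *: _); rewrite -natr1; ring.
have vf j : v j.+1 *m f = - (j.+1%:R * (l - j%:R)) *: v j.
  elim: j => [|j IH].
    rewrite -ve -mulmxA ef mulmxBr mulmxA v0 wf mul0mx sub0r wh -scaleNr.
    by congr (_ *: _); ring.
  rewrite -ve -mulmxA ef mulmxBr mulmxA IH -scalemxAl ve vh -scalerBl.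
  by congr (_ *: _); rewrite -!natr1; ring.
have ex2 : exists j, v j == 0 by exists m'; rewrite /v em mulmx0.
case: (ex_minnP ex2) => -[|k] vk kmin; first by rewrite v0 (negPf w_neq0) in vk.
have vk0 : v k != 0 by apply/eqP => vk0; have := kmin k; rewrite vk0 eqxx ltnn => /(_ isT).
have lk : l = k%:R.
  have := vf k; rewrite (eqP vk) mul0mx => /esym/eqP; rewrite scaler_eq0 (negPf vk0) orbF.
  by rewrite oppr_eq0 mulf_eq0 pnatr_eq0 /= subr_eq0 => /eqP.
exists k, v; rewrite -lk; split=> //; [by rewrite v0 | exact/eqP | by rewrite v0].
Qed.

End LowestRow.

Section BinaryForms.
Variables (K : numFieldType).
Local Notation SV := {mpoly K[2]}.
Local Notation vec := 'rV[K]_2.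

(** Together with [rho] a basis in which the symplectic form is standard. *)
Definition emu : vec := \row_j (j != 0)%:R.

Definition fR : SV := sym_lin rho.
Definition fM : SV := sym_lin emu.

Lemma br_RM : sym_br fR fM = 1.
Proof. by rewrite sym_br_lin /sympl !mxE /= mul1r mulr0 subr0. Qed.
Lemma br_xx (p : SV) : sym_br p p = 0.
Proof. by rewrite /sym_br mulrC subrr. Qed.
Lemma br_MR : sym_br fM fR = -1. Proof. by rewrite sym_brC br_RM. Qed.

Lemma br_exp (q p : SV) j : sym_br q (p ^+ j) = (p ^+ j.-1 * sym_br q p) *+ j.
Proof.
elim: j => [|j IH].
  have := sym_brMr q 1 1; rewrite !mulr1 mul1r => /esym/eqP.
  by rewrite -subr_eq0 addrK expr0 mulr0n => /eqP.
rewrite exprS sym_brMr IH; case: j {IH} => [|j]; first by rewrite mulr0n mulr0 add0r expr0 mulr1n mul1r mulr1.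
by rewrite /= -mulrnAr mulrA -exprS [RHS]mulrS addrC -mulrnAr [sym_br q p * _]mulrC.
Qed.

(** The action of the three generators of sl2 on the monomials in two
    coordinates with bracket one. *)
Lemma br_R2 j m : 2^-1 *: sym_br (fR * fR) (fR ^+ j * fM ^+ m) = m%:R *: (fR ^+ j.+1 * fM ^+ m.-1).
Proof.
rewrite sym_brM sym_brMr !br_exp br_xx br_RM mulr0 mul0rn mul0r addr0 mulr1 exprS scaler_nat -!mulrnAr.
rewrite [in X in _ + X]mulrC -mulr2n -scaler_nat scalerA mulVf ?pnatr_eq0 // scale1r.
by rewrite mulrA.
Qed.

Lemma br_M2 j m : 2^-1 *: sym_br (fM * fM) (fR ^+ j * fM ^+ m) = - j%:R *: (fR ^+ j.-1 * fM ^+ m.+1).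
Proof.
rewrite sym_brM sym_brMr !br_exp br_xx br_MR mulr0 mul0rn mulr0 add0r mulrN1 exprS.
rewrite [in X in _ + X]mulrC -mulr2n -scaler_nat scalerA mulVf ?pnatr_eq0 // scale1r.
by rewrite scaleNr scaler_nat -!mulNrn mulrnAl mulrnAr mulNr mulrN mulrCA.
Qed.

Lemma br_RMm j m : sym_br (fR * fM) (fR ^+ j * fM ^+ m) = (m%:R - j%:R) *: (fR ^+ j * fM ^+ m).
Proof.
rewrite sym_brM !sym_brMr !br_exp !br_xx br_RM br_MR !mulr0 !mul0rn !mulr0 mul0r addr0 add0r mulr1 mulrN1.
rewrite scalerBl !scaler_nat addrC; congr (_ + _).
  case: m => [|m]; first by rewrite !mulr0n mulr0 mul0r.
  by rewrite !mulrnAr mulrnAl -mulrA -exprSr.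
case: j => [|j]; first by rewrite !mulr0n mul0r mulr0 oppr0.
by rewrite mulNrn mulNr mulrN mulrnAl mulrnAr mulrA -exprS.
Qed.

End BinaryForms.

Section CoefficientMap.
Variables (K : numFieldType) (n : nat).
Local Notation SV := {mpoly K[2]}.
Local Notation cV := 'cV[K]_n.+1.
Local Notation mx := 'M[K]_n.+1.
Variables (e h f : mx) (k : nat) (v : nat -> 'rV[K]_n.+1).
Hypothesis ve : forall j, v j *m e = v j.+1.
Hypothesis vk : v k.+1 = 0.
Hypothesis vf0 : v 0%N *m f = 0.
Hypothesis vh : forall j, v j *m h = (k%:R - 2 * j%:R) *: v j.
Hypothesis vf : forall j, v j.+1 *m f = - (j.+1%:R * (k%:R - j%:R)) *: v j.

Lemma sym_lin_coord (a : 'rV[K]_2) : sym_lin a = a 0 0 *: fR K + sympl rho a *: fM K.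
Proof.
rewrite /fR /fM /sym_lin /emu /sympl !mxE /= !scale1r scale0r add0r !mul1r.
modring K {mpoly K[2]}.
Qed.

(** The coefficients of an exponential series, which make the raising operator
    of a row match the derivation of binary forms. *)
Definition bcoef (j : nat) : K := (-1) ^+ j / j`!%:R.

Lemma bcoefS j : bcoef j.+1 * j.+1%:R = - bcoef j.
Proof.
have h1 : (j.+1%:R : K) != 0 by rewrite pnatr_eq0.
have h2 : (j`!%:R : K) != 0 by rewrite pnatr_eq0 -lt0n fact_gt0.
rewrite /bcoef factS natrM exprS; move: (j.+1%:R : K) (j`!%:R : K) h1 h2 => a b h1 h2.
by field; rewrite h1 h2.
Qed.

(** The coefficients of the binary form are the values of the rows of the
    string on the vector. *)
Definition form (u : cV) : SV :=
  \sum_(j < k.+1) (bcoef j * (v j *m u) 0 0) *: (fR K ^+ j * fM K ^+ (k - j)).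

Lemma form_homog u : form u \is k.-homog for mdeg.
Proof.
apply: rpred_sum => j _; apply: rpredZ.
have eqk : (1 * j + 1 * (k - j))%N = k by have := ltn_ord j; lia.
have := dhomogM (dhomogMn j (sym_lin_homog (rho : 'rV[K]_2))) (dhomogMn (k - j) (sym_lin_homog (emu K))).
by rewrite eqk.
Qed.

Lemma form_linear : linear form.
Proof.
move=> a x y; rewrite /form scaler_sumr -big_split; apply: eq_bigr => j _ /=.
by rewrite mulmxDr -scalemxAr !mxE scalerA -scalerDl; congr (_ *: _); ring.
Qed.

Let half_scale c (p : SV) : 2^-1 *: (c *: p) = c *: (2^-1 *: p).
Proof. by rewrite !scalerA mulrC. Qed.

Lemma form_e u : 2^-1 *: sym_br (fM K * fM K) (form u) = form (e *m u).
Proof.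
have bl := sym_br_linr (fM K * fM K).
have -> : 2^-1 *: sym_br (fM K * fM K) (form u) =
    \sum_(j < k.+1) (bcoef j * (v j *m u) 0 0 * - j%:R) *: (fR K ^+ j.-1 * fM K ^+ (k - j).+1).
  rewrite /form; elim: (index_enum _) => [|j s IH]; first by rewrite !big_nil (linear_fun0 bl) scaler0.
  by rewrite !big_cons bl scalerDr IH; congr (_ + _); rewrite half_scale br_M2 scalerA.
rewrite big_ord_recl mulr0n || rewrite big_ord_recl /=.
rewrite oppr0 mulr0 scale0r add0r /form big_ord_recr /= mulmxA ve vk mul0mx mxE mulr0 scale0r addr0.
apply: eq_bigr => j _; rewrite /bump leq0n add1n mulmxA ve /=.
have -> : (k - j.+1).+1 = (k - j)%N by have := ltn_ord j; lia.
by congr (_ *: _); rewrite -[bcoef j]opprK -bcoefS; ring.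
Qed.

Lemma form_f u : 2^-1 *: sym_br (fR K * fR K) (form u) = form (f *m u).
Proof.
have bl := sym_br_linr (fR K * fR K).
have -> : 2^-1 *: sym_br (fR K * fR K) (form u) =
    \sum_(j < k.+1) (bcoef j * (v j *m u) 0 0 * (k - j)%:R) *: (fR K ^+ j.+1 * fM K ^+ (k - j).-1).
  rewrite /form; elim: (index_enum _) => [|j s IH]; first by rewrite !big_nil (linear_fun0 bl) scaler0.
  by rewrite !big_cons bl scalerDr IH; congr (_ + _); rewrite half_scale br_R2 scalerA.
rewrite big_ord_recr /= subnn mulr0 scale0r addr0 /form big_ord_recl /= mulmxA vf0 mul0mx mxE mulr0 scale0r add0r.
apply: eq_bigr => j _; rewrite /bump leq0n add1n mulmxA vf -scalemxAl (_ : forall (z : K) (A : 'M[K]_1), (z *: A) 0 0 = z * A 0 0); last by move=> z A; rewrite mxE.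
have -> : (k - j).-1 = (k - j.+1)%N by lia.
congr (_ *: _); rewrite natrB; last exact: ltnW.
by rewrite -[bcoef j]opprK -bcoefS; ring.
Qed.

Lemma form_h u : sym_br (fR K * fM K) (form u) = form (h *m u).
Proof.
have bl := sym_br_linr (fR K * fM K).
rewrite /form; have -> : forall s : seq 'I_k.+1, sym_br (fR K * fM K) (\sum_(j <- s) (bcoef j * (v j *m u) 0 0) *: (fR K ^+ j * fM K ^+ (k - j))) =
    \sum_(j <- s) (bcoef j * (v j *m (h *m u)) 0 0) *: (fR K ^+ j * fM K ^+ (k - j)).
  elim=> [|j s IH]; first by rewrite !big_nil (linear_fun0 bl).
  rewrite !big_cons bl IH; congr (_ + _); rewrite br_RMm scalerA mulmxA vh -scalemxAl [in RHS]mxE.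
  by congr (_ *: _); rewrite natrB; [ring | have := ltn_ord j; lia].
by [].
Qed.

Definition cform (u : cV) : dhomog 2 K k := DHomog (form_homog u).

Lemma cform_linear : linear cform.
Proof. by move=> a x y; apply: val_inj; apply: form_linear. Qed.

Lemma quad_expand (P Q : SV) (x t : K) : (x *: P + t *: Q) * ((x + 1) *: P + t *: Q) =
  (x * (x + 1)) *: (P * P) + ((2 * (x + 2^-1) * t) *: (P * Q) + t ^+ 2 *: (Q * Q)).
Proof.
rewrite mulrDl !mulrDr -!scalerAl -!scalerAr !scalerA [Q * P]mulrC.
by modred K {mpoly K[2]}; field.
Qed.

(** The coefficient map intertwines the quadratic expression in the sl2 triple
    with the action on binary forms. *)
Lemma cform_act (a : 'rV[K]_2) u : let x := a 0 0 in let t := sympl rho a in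
  2^-1 *: sym_act a (a + rho) (cform u) =
  cform ((x * (x + 1)) *: (f *m u) + (((x + 2^-1) * t) *: (h *m u) + t ^+ 2 *: (e *m u))).
Proof.
move=> x t; apply: val_inj => /=; rewrite !form_linear (linear_funZ form_linear) -form_f -form_h -form_e.
have -> : sym_lin a * sym_lin (a + rho) = (x * (x + 1)) *: (fR K * fR K) +
    ((2 * (x + 2^-1) * t) *: (fR K * fM K) + t ^+ 2 *: (fM K * fM K)).
  rewrite !sym_lin_coord mxE [rho 0 0]mxE (_ : sympl rho (a + rho) = t); last by rewrite /t /sympl !mxE; ring.
  exact: quad_expand.
have bl := sym_br_linl (form u).
rewrite !bl (linear_funZ bl); modred K {mpoly K[2]}; by field.
Qed.

(** Evaluation at a zero of [fR] leaves only the coefficient of the power of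
    [fM]. *)
Lemma cform_eq0 u : cform u = 0 -> v 0%N *m u = 0.
Proof.
move=> u0; have {u0} : form u = 0 by have := congr1 (@mpoly_of_dhomog _ _ _) u0.
pose pt (i : 'I_2) : K := if i == 0 then -1 else 1.
move=> /(congr1 (meval pt)); rewrite /form raddf_sum /= raddf0 big_ord_recl big1 ?addr0.
  rewrite mevalZ /= subn0 expr0 mul1r rmorphXn /= /fM /sym_lin mevalD !mevalZ !mevalXU /pt /emu !mxE /=.
  rewrite mul0r add0r mul1r expr1n mulr1 /bcoef expr0 fact0 divr1 mul1r => H.
  by apply/matrixP => i j; rewrite (ord1 i) (ord1 j) !mxE.
move=> j _; rewrite mevalZ rmorphM rmorphXn /= /fR /sym_lin mevalD !mevalZ !mevalXU /pt !mxE /=.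
by rewrite !mulr1 mul1r addNr /bump leq0n add1n exprS mul0r mul0r mulr0.
Qed.

End CoefficientMap.

(** * Graded modules *)

Section LatticeOperators.
Variables (R : realType) (N : nat).
Local Notation K := R[i].
Local Notation X := 'rV[int]_N.
Local Notation vec := 'rV[K]_2.
Variable pi : {additive X -> vec}.
Implicit Types M : lieModule (W pi).

Definition lat (x : X) : lattice pi (pi x) := imageT pi x.

Definition Lop M (x : X) : M -> M := lact (L_ (lat x)).

Lemma L_eq a b (la : lattice pi a) (lb : lattice pi b) : a = b -> L_ la = L_ lb.
Proof. by move=> ab; apply: dsum_inj; rewrite /= ab. Qed.

Lemma Lop_lin M x : linear (Lop (M := M) x).
Proof. exact: lact_linr. Qed.

Lemma Lop_br M x y (v : M) : Lop x (Lop y v) - Lop y (Lop x v) = sympl (pi x + rho) (pi y + rho) *: Lop (x + y) v.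
Proof.
rewrite /Lop -lact_br -(linear_funZ (lact_linl v)); congr (lact _ v).
rewrite /= /W_br bilin_dsum_single; apply: dsum_inj => /=.
rewrite scale1r /poisson_rule raddfD.
exact: (linear_funZ (@single_linear _ _ _ (pi x + pi y))).
Qed.

Lemma act_ind (P : W pi -> Prop) : P 0 -> (forall u v, P u -> P v -> P (u + v)) ->
  (forall c x, P (c *: L_ (lat x))) -> forall w, P w.
Proof.
move=> P0 PD PL; elim/dsum_ind => // a la c.
have [x _ xa] := la; have -> : dsum_single la c = (c : K) *: L_ (lat x).
  apply: dsum_inj; rewrite /= xa -(linear_funZ (@single_linear _ _ _ a)).
  by congr single; exact/esym/mulr1.
exact: PL.
Qed.

Lemma equivariant_ext M1 M2 (f : M1 -> M2) : linear f -> (forall x m, f (Lop x m) = Lop x (f m)) ->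
  forall w m, f (lact w m) = lact w (f m).
Proof.
move=> fl fL; elim/act_ind => [m|u v IHu IHv m|c x m].
- by rewrite !(linear_fun0 (lact_linl _)) (linear_fun0 fl).
- by rewrite !(linear_funD (lact_linl _)) (linear_funD fl) IHu IHv.
- by rewrite !(linear_funZ (lact_linl _)) (linear_funZ fl); congr (_ *: _); apply: fL.
Qed.

(** The generators span the algebra, so that stability under them suffices. *)
Lemma simple_stable M (S : set M) : lmod_simple M -> subspace S ->
  (forall x m, S m -> S (Lop x m)) -> (exists2 m, S m & m != 0) -> forall m, S m.
Proof.
move=> [_ sM] sS stS [m Sm m0]; have [S0 SP] := sS.
have act w v : S v -> S (lact w v).
  move: w v; elim/act_ind => [v|u w IHu IHw v|c x v] Sv.
  - by rewrite (linear_fun0 (lact_linl _)).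
  - by rewrite (linear_funD (lact_linl _)) -[lact u v]scale1r; apply: SP; [apply: IHu|apply: IHw].
  - rewrite (linear_funZ (lact_linl _)) -[_ *: _]addr0; apply: SP => //; exact: stS.
have [e|e] := sM (LieSubmodule S0 SP act); move: e => /= e; last by rewrite e.
by move: Sm m0; rewrite e /= => ->; rewrite eqxx.
Qed.

Lemma wsp_weight M g x : wsp pi (Lop (M := M)) g x = weight_space M (g + pi x).
Proof.
rewrite /wsp /weight_space /Lop (L_eq (lat 0) (lattice0 pi)) //; exact: raddf0.
Qed.

End LatticeOperators.

Lemma dsum_sumE (K : fieldType) (I : choiceType) (A : set I) (V : lmodType K) (J : Type) (s : seq J) (F : J -> dsum A V) i :
  (\sum_(j <- s) F j : dsum A V) i = \sum_(j <- s) F j i.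
Proof. by elim: s => [|j s IH]; rewrite ?big_nil // !big_cons -IH. Qed.

Lemma big_uniq_supp (X : eqType) (A : nmodType) (F : X -> A) (s t : seq X) : uniq s -> uniq t ->
  (forall x, x \notin s -> F x = 0) -> (forall x, x \notin t -> F x = 0) ->
  \sum_(x <- s) F x = \sum_(x <- t) F x.
Proof.
have E r z : uniq r -> uniq z -> {subset r <= z} -> (forall x, x \notin r -> F x = 0) ->
    \sum_(x <- r) F x = \sum_(x <- z) F x.
  move=> ur uz rz hr; rewrite -[RHS](@big_rmcond_in _ _ _ _ _ (fun x => x \in r)); last by move=> x _; apply: hr.
  rewrite -big_filter; apply: perm_big; apply: uniq_perm; rewrite ?filter_uniq // => x.
  by rewrite mem_filter; case: (boolP (x \in r)) => [xr|//]; rewrite rz.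
move=> us ut hs ht; pose z := undup (s ++ t).
have uz : uniq z by exact: undup_uniq.
by rewrite (E s z) // ?(E t z) // => x xs; rewrite mem_undup mem_cat xs ?orbT.
Qed.

Section Components.
Variables (R : realType) (N : nat).
Local Notation K := R[i].
Local Notation X := 'rV[int]_N.
Local Notation vec := 'rV[K]_2.
Variable pi : {additive X -> vec}.
Hypothesis hinj : injective pi.
Variables (M : lieModule (W pi)) (g : vec).
Hypothesis grM : graded_by M (coset_at pi g).
Local Notation ws := (wsp pi (Lop (M := M)) g).

Lemma in_coset x : coset_set (coset_at pi g) (g + pi x).
Proof. by exists (pi x) => //; exists x. Qed.

Let shift_inj : injective (fun x => g + pi x).
Proof. by move=> x y /addrI/hinj. Qed.

Let ws_sub x : subspace (ws x).
Proof.
split=> [|a u v]; rewrite /wsp /= ?(linear_fun0 (Lop_lin _)) ?scaler0 // Lop_lin => -> ->.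
by rewrite scalerDr !scalerA mulrC.
Qed.

(** The component at the label [g + pi x]; indexing by the lattice rather than
    by labels avoids transports. *)
Definition wcomp (x : X) (m : M) : M := proj1_sig (cid (grM m)) (g + pi x).

Let tot (f : dsum (coset_at pi g) M) s : uniq s -> (forall x, x \notin s -> f (g + pi x) = 0) ->
  \sum_(mu \in coset_set (coset_at pi g)) f mu = \sum_(x <- s) f (g + pi x).
Proof.
move=> us fs; rewrite (@fsbigE _ _ _ _ _ [seq g + pi x | x <- s]).
- rewrite -big_filter (_ : [seq _ <- _ | _] = [seq g + pi x | x <- s]) ?big_map //.
  by apply/all_filterP/allP => _ /mapP[x _ ->]; apply/mem_set/in_coset.
- by rewrite map_inj_uniq.
- by move=> mu /= /mapP[x _ ->]; apply: in_coset.
- move=> mu [_ [x _ <-] <-] h; apply: fs; apply: contra h => xs; apply/mapP; by exists x.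
Qed.

Lemma wcomp_fin m : exists s : seq X, uniq s /\ forall x, x \notin s -> wcomp x m = 0.
Proof.
rewrite /wcomp; case: cid => f /= _.
have [/finite_seqP[s sE] _] := dsum_supp f.
exists (undup [seq xget 0 [set x | g + pi x = mu] | mu <- s]); split; first exact: undup_uniq.
move=> x; rewrite mem_undup => h; apply/eqP/negPn/negP => fx; case/negP: h.
have : supp f (g + pi x) by [].
rewrite sE /= => xs; apply/mapP; exists (g + pi x) => //.
by case: xgetP => [y _ /= /shift_inj ->//|/(_ x)]; case.
Qed.

Lemma wcomp_wsp x m : ws x (wcomp x m).
Proof.
rewrite wsp_weight /wcomp; case: cid => f /= [[h _] _]; apply: h; exact: in_coset.
Qed.

Lemma wcomp_sum m s : uniq s -> (forall x, x \notin s -> wcomp x m = 0) -> m = \sum_(x <- s) wcomp x m.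
Proof.
rewrite /wcomp; case: cid => f /= [[_ mE] _] us fs; rewrite [LHS]mE; exact: tot.
Qed.

Lemma wcomp_uniq m s (F : X -> M) : uniq s -> (forall x, ws x (F x)) ->
  (forall x, x \notin s -> F x = 0) -> m = \sum_(x <- s) F x -> forall x, wcomp x m = F x.
Proof.
move=> us wF Fs mE x; rewrite /wcomp; case: cid => f /= [[fw fE] fu].
pose f' := \sum_(y <- s) dsum_single (in_coset y) (F y).
have f'E y : f' (g + pi y) = F y.
  rewrite /f' dsum_sumE /= /single; have [ys|ys] := boolP (y \in s).
    rewrite (bigD1_seq y) //= eqxx big1 ?addr0 // => z zy.
    by rewrite (inj_eq shift_inj) eq_sym (negPf zy).
  rewrite Fs // big1_seq // => z /andP[_ zs]; rewrite (inj_eq shift_inj).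
  by case: eqP => // e; move: ys; rewrite e zs.
rewrite -f'E (fu f') //; split.
  by move=> mu [_ [y _ <-] <-]; rewrite f'E -wsp_weight.
rewrite (tot us) => [|y ys]; last by rewrite f'E Fs.
by rewrite mE; apply: eq_bigr => y _; rewrite f'E.
Qed.

Lemma wcomp_lin x : linear (wcomp x).
Proof.
move=> a u v; have [s [us hs]] := wcomp_fin u; have [t [ut ht]] := wcomp_fin v.
pose z := undup (s ++ t).
have uz : uniq z by exact: undup_uniq.
have hs' y : y \notin z -> wcomp y u = 0 by rewrite mem_undup mem_cat negb_or => /andP[/hs].
have ht' y : y \notin z -> wcomp y v = 0 by rewrite mem_undup mem_cat negb_or => /andP[_ /ht].
apply: (wcomp_uniq (s := z) (F := fun y => a *: wcomp y u + wcomp y v)) => // [y|y yz|].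
- have [_ SP] := ws_sub y; apply: SP; exact: wcomp_wsp.
- by rewrite hs' // ht' // scaler0 addr0.
- by rewrite big_split /= -scaler_sumr -!wcomp_sum.
Qed.

Lemma wcomp_homog x v : ws x v -> forall y, wcomp y v = if y == x then v else 0.
Proof.
move=> wv; apply: (wcomp_uniq (s := [:: x])) => //.
- by move=> y; case: eqP => [->|_] //; have [] := ws_sub y.
- by move=> y; rewrite inE => /negPf ->.
- by rewrite big_seq1 eqxx.
Qed.

Lemma graded_ind (P : M -> Prop) : P 0 -> (forall u v, P u -> P v -> P (u + v)) ->
  (forall x v, ws x v -> P v) -> forall m, P m.
Proof.
move=> P0 PD Pw m; have [s [us hs]] := wcomp_fin m; rewrite (wcomp_sum us hs).
elim: s {us hs} => [|x s IH]; rewrite ?big_nil // big_cons; apply: PD => //; apply: (Pw x); exact: wcomp_wsp.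
Qed.

Lemma Lop_wsp x k v : ws x v -> ws (x + k) (Lop k v).
Proof.
rewrite !wsp_weight => /(weight_space_L (lat pi k)).
by have -> : g + pi (x + k) = pi k + (g + pi x) by rewrite raddfD [RHS]addrC addrA.
Qed.

Lemma wcomp_Lop x k m : wcomp (x + k) (Lop k m) = Lop k (wcomp x m).
Proof.
elim/graded_ind: m => [|u v IHu IHv|y v wv].
- by rewrite (linear_fun0 (Lop_lin _)) !(linear_fun0 (wcomp_lin _)) (linear_fun0 (Lop_lin _)).
- by rewrite (linear_funD (Lop_lin _)) !(linear_funD (wcomp_lin _)) (linear_funD (Lop_lin _)) IHu IHv.
rewrite (wcomp_homog wv) (wcomp_homog (Lop_wsp k wv)) (inj_eq (addIr k)).
by case: eqP => // _; rewrite (linear_fun0 (Lop_lin _)).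
Qed.

(** A vector is the finite sum of its components, so that a homomorphism out
    of a graded module is prescribed on weight vectors. *)
Lemma graded_hom (M' : lieModule (W pi)) (h : X -> M -> M') :
  (forall x a u v, ws x u -> ws x v -> h x (a *: u + v) = a *: h x u + h x v) ->
  (forall x k v, ws x v -> h (x + k) (Lop k v) = Lop k (h x v)) ->
  exists Phi : M -> M', [/\ linear Phi, forall w m, Phi (lact w m) = lact w (Phi m) &
    forall x v, ws x v -> Phi v = h x v].
Proof.
move=> hl hL.
have h0 x : h x 0 = 0.
  have [w0 _] := ws_sub x; have := hl x (-1) 0 0 w0 w0.
  by rewrite scaler0 addr0 scaleN1r addNr.
pose Phi m := \sum_(x <- proj1_sig (cid (wcomp_fin m))) h x (wcomp x m).
have PhiE m s : uniq s -> (forall x, x \notin s -> wcomp x m = 0) -> Phi m = \sum_(x <- s) h x (wcomp x m).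
  move=> us hs; rewrite /Phi; case: cid => t /= [ut ht].
  by apply: big_uniq_supp => // x xn; [rewrite (ht x xn)|rewrite (hs x xn)].
have Phi_lin : linear Phi.
  move=> a u v; have [s [us hs]] := wcomp_fin u; have [t [ut ht]] := wcomp_fin v.
  pose z := undup (s ++ t).
  have uz : uniq z by exact: undup_uniq.
  have hs' y : y \notin z -> wcomp y u = 0 by rewrite mem_undup mem_cat negb_or => /andP[/hs].
  have ht' y : y \notin z -> wcomp y v = 0 by rewrite mem_undup mem_cat negb_or => /andP[_ /ht].
  rewrite !(PhiE _ z uz) // => [|y yz]; last by rewrite wcomp_lin hs' // ht' // scaler0 addr0.
  rewrite scaler_sumr -big_split; apply: eq_bigr => x _ /=.
  by rewrite wcomp_lin hl //; apply: wcomp_wsp.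
have Phiw x v : ws x v -> Phi v = h x v.
  move=> wv; rewrite (PhiE v [:: x]) // => [|y]; first by rewrite big_seq1 (wcomp_homog wv) eqxx.
  by rewrite inE (wcomp_homog wv) => /negPf ->.
exists Phi; split=> //; apply: equivariant_ext => // k; elim/graded_ind => [|u v IHu IHv|x v wv].
- by rewrite !(linear_fun0 (Lop_lin _)) (linear_fun0 Phi_lin) (linear_fun0 (Lop_lin _)).
- by rewrite (linear_funD (Lop_lin _)) !(linear_funD Phi_lin) (linear_funD (Lop_lin _)) IHu IHv.
by rewrite (Phiw _ _ wv) (Phiw _ _ (Lop_wsp k wv)) hL.
Qed.

End Components.

(** * Models of simple modules *)

Section SimpleModule.
Variables (R : realType) (N : nat).
Local Notation K := R[i].
Local Notation X := 'rV[int]_N.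
Local Notation vec := 'rV[K]_2.
Variable pi : {additive X -> vec}.
Hypothesis hN : (1 < N)%N.
Hypothesis hinj : injective pi.
Hypothesis hnz : forall a b : X, b != 0 -> sympl (pi a + 2 *: rho) (pi b) != 0.
Variables (M : lieModule (W pi)) (g : vec).
Hypothesis M_simple : lmod_simple M.
Hypothesis M_nontrivial : ~ lmod_trivial M.
Hypothesis grM : graded_by M (coset_at pi g).
Local Notation ws := (wsp pi (Lop (M := M)) g).

Lemma lattice_r_neq0 b : b != 0 -> sympl rho (pi b) != 0.
Proof.
move=> /(hnz 0); rewrite raddf0 add0r symplZl mulf_eq0 negb_or => /andP[] //.
Qed.

Lemma sum_bracket_neq0 a b : b != 0 -> sympl (pi a + rho) (pi b) != 0.
Proof.
move=> /(hnz (a + a)); apply: contraNneq => h.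
have -> : pi (a + a) + 2 *: rho = 2 *: (pi a + rho) by rewrite raddfD; apply/matrixP => i j; rewrite !mxE; ring.
by rewrite symplZl h mulr0.
Qed.

Lemma bracket_neq0 x y : x != y -> sympl (pi x + rho) (pi y + rho) != 0.
Proof.
rewrite eq_sym -subr_eq0 => /(sum_bracket_neq0 x); apply: contraNneq => h.
have -> : pi (y - x) = (pi y + rho) - (pi x + rho) by rewrite raddfB; apply/matrixP => i j; rewrite !mxE; ring.
by rewrite symplDr h add0r -scaleN1r symplZr symplxx mulr0.
Qed.

Let eN0 : exists a : X, a != 0.
Proof.
exists (delta_mx 0 (Ordinal (ltnW hN))); apply/eqP => /matrixP/(_ 0 (Ordinal (ltnW hN))).
by rewrite !mxE !eqxx.
Qed.

Lemma scaler_int_inj (a : X) (i j : nat) : a != 0 -> a *+ i = a *+ j -> i = j.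
Proof.
move=> a0 e; have ra := lattice_r_neq0 a0.
have rM n : sympl rho (pi (a *+ n)) = n%:R * sympl rho (pi a).
  by rewrite raddfMn -scaler_nat symplZr.
by have := rM i; rewrite e rM => /(mulIf ra)/eqP; rewrite eqr_nat => /eqP.
Qed.

Lemma exists_notin (l : seq X) : exists a : X, a \notin l.
Proof.
have [a a0] := eN0.
have /allPn[x _ xl] : ~~ all (mem l) [seq a *+ i | i <- iota 0 (size l).+1].
  apply/negP => /allP h; have := uniq_leq_size _ h; rewrite size_map size_iota ltnn => H.
  suff // : false by []; apply: H; rewrite map_inj_uniq ?iota_uniq // => i j; exact: scaler_int_inj.
by exists x.
Qed.

Lemma invariant_eq0 (v : M) : (forall x, Lop x v = 0) -> v = 0.
Proof.
move=> h; apply/eqP/negPn/negP => v0.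
have H := simple_stable (S := [set m | forall x, Lop x m = 0]) M_simple.
have {}H : forall m : M, forall x, Lop x m = 0.
  apply: H => [|x m hm y|]; last by exists v.
    split=> [x|a u w hu hw x]; first exact: linear_fun0 (Lop_lin x).
    by rewrite Lop_lin hu hw scaler0 addr0.
  by rewrite hm (linear_fun0 (Lop_lin y)).
apply: M_nontrivial; split.
  exists v => //.
  apply: (simple_stable (S := [set m | exists c : K, m = c *: v])) => //.
  - split=> [|a u w [c ->] [c' ->]]; first by exists 0; rewrite scale0r.
    by exists (a * c + c'); rewrite scalerDl scalerA.
  - by move=> x m _; exists 0; rewrite H scale0r.
  - by exists v => //; exists 1; rewrite scale1r.
move=> w m; elim/act_ind: w => [|w w' h1 h2|c x].
- exact: linear_fun0 (lact_linl m).
- by rewrite (linear_funD (lact_linl m)) h1 h2 addr0.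
- by rewrite (linear_funZ (lact_linl m)) -/(Lop x m) H scaler0.
Qed.

(** A vector killed by all but finitely many generators is killed by all of
    them, as every generator is a bracket of two others. *)
Lemma cofinite_eq0 (v : M) : (exists l : seq X, forall x, x \notin l -> Lop x v = 0) -> v = 0.
Proof.
move=> [l hl]; apply: invariant_eq0 => z; have [a a0] := eN0.
have : exists x : X, [/\ x \notin l, z - x \notin l & x != z - x].
  have [x' h] := exists_notin ((l ++ [seq z - y | y <- l])).
  have h2 : exists x : X, (x \notin l ++ [seq z - y | y <- l]) && (x != z - x).
    have [b0|b0] := eqVneq x' (z - x'); last by exists x'; rewrite h.
    have [y hy] := exists_notin (x' :: l ++ [seq z - y | y <- l]).
    exists y; move: hy; rewrite inE negb_or => /andP[yx ->] /=.
    apply: contra yx => /eqP e; rewrite -subr_eq0.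
    have : (y - x') *+ 2 = 0.
      rewrite mulr2n {1}e {1}b0; zmodring 'rV[int]_N.
    have [//|d0] := eqVneq (y - x') 0; move=> /(scaler_int_inj (j := 0) d0) //.
  have [y /andP[]] := h2; rewrite mem_cat negb_or => /andP[h3 h4] h5; exists y; split=> //.
  apply: contra h4 => h4; apply/mapP; exists (z - y) => //; zmodring 'rV[int]_N.
move=> [y [yl zl yz]]; have := Lop_br y (z - y) v.
rewrite (hl _ zl) (hl _ yl) (linear_fun0 (Lop_lin y)) (linear_fun0 (Lop_lin _)) subr0 => /esym/eqP.
by rewrite scaler_eq0 (negPf (bracket_neq0 yz)) /= addrC subrK => /eqP.
Qed.

Lemma exceptional_weight : exists b0 : X, forall x, x != b0 -> sympl rho (g + pi x) != 0.
Proof.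
have [[b rb]|h] := pselect (exists b, sympl rho (g + pi b) = 0); last first.
  by exists 0 => x _; apply/eqP => e; apply: h; exists x.
exists b => x xb; have d0 : x - b != 0 by rewrite subr_eq0.
have -> : g + pi x = g + pi b + pi (x - b) by rewrite raddfB -addrA [pi b + _]addrC subrK.
by rewrite symplDr rb add0r; apply: lattice_r_neq0.
Qed.

Lemma exists_homog : exists x, exists2 v, ws x v & v != 0.
Proof.
have [[m m0] _] := M_simple; apply: contrapT => h; move/eqP: m0; apply.
elim/(graded_ind hinj grM): m => [//|u v -> ->|x v wv]; first by rewrite addr0.
by apply/eqP/negPn/negP => v0; apply: h; exists x, v.
Qed.

(** The vectors whose component at [b] lies in [S] form a submodule, and it
    contains all other weights. *)
Lemma weight_generated b v : ws b v -> forall S, subspace S ->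
  (forall x u, x != b -> ws x u -> S (Lop (b - x) u)) -> S v.
Proof.
move=> wv S sS HS; have [S0 SP] := sS.
have hc := wcomp_homog hinj grM; have cl := wcomp_lin hinj grM.
have [[x [u wu u0]]|hx] := pselect (exists x, exists2 u, ws x u & x != b /\ u != 0); last first.
  have only x u : x != b -> ws x u -> u = 0.
    by move=> xb wu; apply/eqP/negPn/negP => u0; apply: hx; exists x, u.
  suff -> : v = 0 by [].
  apply: cofinite_eq0; exists [:: 0 : X] => k; rewrite inE => k0.
  apply: (only (b + k)); last exact: Lop_wsp.
  by rewrite -subr_eq0 addrC addKr.
have [xb u0'] := u0.
have := simple_stable (S := [set m | S (wcomp grM b m)]) M_simple.
move=> /(_ _ _ _ v) /=; rewrite (hc _ _ wv) eqxx; apply.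
- split=> [|a p q hp hq] /=; first by rewrite (linear_fun0 (cl b)).
  by rewrite cl; apply: SP.
- move=> k m hm /=; have -> : b = (b - k) + k by rewrite subrK.
  rewrite wcomp_Lop //; have [k0|k0] := eqVneq k 0.
    rewrite k0 subr0; have := wcomp_wsp grM b m; rewrite /wsp /= => ->.
    by rewrite -[_ *: _]addr0; apply: SP.
  have := HS (b - k) (wcomp grM (b - k) m); rewrite opprB addrCA subrr addr0; apply.
    by rewrite -subr_eq0 addrAC subrr add0r oppr_eq0.
  exact: wcomp_wsp.
- by exists u; rewrite //= (hc _ _ wu) eq_sym (negPf xb).
Qed.

Variable d : nat.
Hypothesis dimM : forall x, dim_le (ws x) d.

Lemma simple_lmodel : exists n (D : X -> 'M[K]_n.+1) (T : X -> M -> 'cV[K]_n.+1),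
  lmodel pi (Lop (M := M)) g D T /\ irr (range D).
Proof.
have [b0 nzb] := exceptional_weight.
have [n [D [T [DT Tinj]]]] := exists_lmodel hN hnz (@Lop_lin _ _ _ _) (@Lop_br _ _ _ _) dimM nzb
  cofinite_eq0 (@weight_generated b0).
apply: (irreducible_lmodel DT); have [x [v wv v0]] := exists_homog.
rewrite lt0n; apply: contraNneq v0 => n0; apply/eqP/(Tinj x) => //.
by apply/matrixP => i; have := ltn_ord i; rewrite {2}n0.
Qed.

Hypothesis hline : forall v : vec, v != 0 -> exists x, sympl v (pi x) != 0.

Section Model.
Variables (n : nat) (D : X -> 'M[K]_n.+1) (T : X -> M -> 'cV[K]_n.+1).
Hypothesis DT : lmodel pi (Lop (M := M)) g D T.

Let T_ext (A : 'M[K]_n.+1) : (forall x v, ws x v -> A *m T x v = 0) -> A = 0.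
Proof.
move=> h; apply/row_matrixP => i; rewrite row0; apply: (mod_span DT) => x v wv.
by rewrite -row_mul h // row0.
Qed.

Lemma model_zero : D 0 = 0.
Proof.
apply: T_ext => x v wv; have := mod_act DT 0 wv; rewrite addr0 raddf0 add0r.
have -> : Lop 0 v = sympl rho (g + pi x) *: v by exact: wv.
have w0 : ws x 0 by rewrite /wsp /= (linear_fun0 (Lop_lin _)) scaler0.
have T0 : T x 0 = 0.
  by have := mod_lin DT (-1) w0 w0; rewrite scaler0 addr0 scaleN1r addNr.
have := mod_lin DT (sympl rho (g + pi x)) wv w0; rewrite !addr0 T0 addr0 => ->.
by move=> /eqP; rewrite addrC -subr_eq subrr eq_sym => /eqP.
Qed.

Lemma model_bracket x y : let om := sympl (pi x) (pi y) in let r z := sympl rho (pi z) in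
  com (D x) (D y) = (om + r y) *: (D (x + y) - D y) - r x *: D (x + y) + (r x - om) *: D x.
Proof.
move=> om r; apply/eqP; rewrite -subr_eq0; apply/eqP/T_ext => z v wv.
have wL k u w : ws u w -> ws (u + k) (Lop k w) by exact: Lop_wsp.
have := congr1 (T (z + x + y)) (Lop_br x y v).
have zyx : z + x + y = z + y + x by rewrite addrAC.
have zxy : z + x + y = z + (x + y) by rewrite addrA.
have wA : ws (z + x + y) (Lop x (Lop y v)) by rewrite zyx; exact: wL (wL _ _ _ wv).
have wB : ws (z + x + y) (Lop y (Lop x v)) by exact: wL (wL _ _ _ wv).
have wC : ws (z + x + y) (Lop (x + y) v) by rewrite zxy; apply: wL.
have w0 : ws (z + x + y) 0 by rewrite /wsp /= (linear_fun0 (Lop_lin _)) scaler0.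
have T0 : T (z + x + y) 0 = 0.
  by have := mod_lin DT (-1) w0 w0; rewrite scaler0 addr0 scaleN1r addNr.
rewrite [Lop x _ - _]addrC -scaleN1r (mod_lin DT) // -[_ *: Lop (x + y) v]addr0 (mod_lin DT) // T0 addr0.
rewrite {1}(mod_act DT) ?(mod_act DT x wv); last exact: wL.
rewrite zyx (mod_act DT) ?(mod_act DT y wv); last exact: wL.
rewrite -zyx zxy (mod_act DT _ wv) !mulmxDr -!scalemxAr !mulmxA => E.
rewrite /com !(mulmxDl, mulmxBl, mulNmx) -!scalemxAl !(mulmxDl, mulNmx).
move: E; set t := T z v; set u1 := D x *m D y *m t; set u2 := D y *m D x *m t.
set a := D x *m t; set b := D y *m t; set c := D (x + y) *m t => E.
rewrite !(raddfD pi) in E.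
have -> : u1 = u2 + (u1 - u2) by rewrite addrCA subrr addr0.
have -> : u1 - u2 = (sympl (pi x + rho) (pi y + rho) *: (c + sympl (pi x + pi y + rho) (g + pi z) *: t)
  + sympl (pi y + rho) (g + pi z + pi x) *: a
  - sympl (pi x + rho) (g + pi z + pi y) *: b
  + sympl (pi y + rho) (g + pi z + pi x) * sympl (pi x + rho) (g + pi z) *: t
  - sympl (pi x + rho) (g + pi z + pi y) * sympl (pi y + rho) (g + pi z) *: t
  - sympl (pi y + rho) (g + pi z) *: a + sympl (pi x + rho) (g + pi z) *: b).
  rewrite !addrA in E; rewrite -E; clearbody u1 u2 a b t; clear.
  move: (sympl _ (g + pi z)) (sympl _ (g + pi z)) (sympl _ (g + pi z + pi y)) (sympl _ (g + pi z + pi x)) => s1 s2 s3 s4.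
  modring R[i] 'cV[R[i]]_n.+1.
clearbody u1 u2 a b c t; clear -u2 a b c t.
rewrite /om /r /sympl !mxE; move: (pi x 0 0) (pi x 0 1) (pi y 0 0) (pi y 0 1) (pi z 0 0) (pi z 0 1) (g 0 0) (g 0 1) => x0 x1 y0 y1 z0 z1 g0 g1.
modring R[i] 'cV[R[i]]_n.+1.
Qed.

End Model.

(** The matrices of an irreducible model come from an sl2-triple and a scalar;
    contraction with a lowest row turns its vectors into binary forms, and the
    scalar shifts the labels by a multiple of [rho]. *)
Theorem form_model : exists k (g' : vec) (T : X -> M -> dhomog 2 K k),
  [/\ forall x a u v, ws x u -> ws x v -> T x (a *: u + v) = a *: T x u + T x v,
      forall x j v, ws x v -> T (x + j) (Lop j v) = tensor_rule (pi j) (g' + pi x) (T x v) &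
      exists x, exists2 v, ws x v & T x v != 0].
Proof.
have [n [D [T [DT Dirr]]]] := simple_lmodel.
have D0 := model_zero DT; have Dbr := model_bracket DT.
have [e1 e10] := eN0.
have [a [b ab]] : exists a b, sympl (pi a) (pi b) != 0.
  have p0 : pi e1 != 0 by apply: contra e10 => /eqP; rewrite -(raddf0 pi) => /hinj ->.
  by have [b hb] := hline p0; exists e1, b.
have Ddeg : forall l, size l = 3 -> forall x, mdd l D x = 0.
  have [m Dm] := mod_poly DT.
  have H := mixed_vanish (ltnW hN) Dm.
  apply: (degree_two (om := fun x y => sympl (pi x) (pi y)) (r := fun x => sympl rho (pi x)) _ _ _ _ Dirr (lattice_r_neq0 e10) H).
  - by move=> x y z; rewrite raddfD symplDl.
  - by move=> x y z; rewrite raddfD symplDr.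
  - by move=> x y; rewrite raddfD symplDr.
  - by move=> x y; have := Dbr x y; rewrite /com.
have [e [h [f [c [he hf fe DE]]]]] := sl2_structure ab D0 Dbr Dirr Ddeg.
have [k [v [v0 vk ve vf0 [vh vf]]]] := lowest_rows he hf fe.
pose cf := cform k v.
exists k, (g - c *: rho - rho), (fun x w => cf (T x w)); split.
- by move=> x a' u w wu ww; rewrite (mod_lin DT) // /cf cform_linear.
- move=> x j w ww; rewrite (mod_act DT _ ww) DE /tensor_rule.
  have -> : 2^-1 *: sym_act (pi j) (pi j + rho) (cf (T x w)) = _ := cform_act ve vk vf0 vh vf (pi j) (T x w).
  rewrite -(linear_funZ (cform_linear k v)) -(linear_funD (cform_linear k v)); congr cform.
  rewrite !mulmxDl -!scalemxAl mul_scalar_mx.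
  have -> : sympl (pi j + rho) (g - c *: rho - rho + pi x + rho) = sympl (pi j + rho) (g + pi x) + c * sympl rho (pi j).
    by rewrite /sympl !mxE; ring.
  modring R[i] 'cV[R[i]]_n.+1.
apply: contrapT => hh; move/eqP: v0; apply; apply: (mod_span DT) => x w ww.
apply: (cform_eq0 (k := k)); apply/eqP/negPn/negP => h0; apply: hh; by exists x, w.
Qed.

End SimpleModule.

(** * Forms of degree at least two *)

Section FormsIrreducible.
Variables (K : numFieldType).
Local Notation SV := {mpoly K[2]}.
Local Notation vec := 'rV[K]_2.

Let span_RM k : set SV := [set p | exists c : nat -> K,
  p = \sum_(j < k.+1) c j *: (fR K ^+ j * fM K ^+ (k - j))].

Let span_sub k : subspace (span_RM k).
Proof.
split=> [|a p q [c ->] [c' ->]]; first by exists (fun=> 0); rewrite big1 // => j _; rewrite scale0r.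
exists (fun j => a * c j + c' j); rewrite scaler_sumr -big_split; apply: eq_bigr => j _ /=.
by rewrite scalerDl scalerA.
Qed.

Let span_M k p : span_RM k p -> span_RM k.+1 (fM K * p).
Proof.
move=> [c ->]; exists (fun j => if (j <= k)%N then c j else 0).
rewrite [RHS]big_ord_recr /= ltnn scale0r addr0 mulr_sumr; apply: eq_bigr => j _.
rewrite -ltnS ltn_ord -scalerAr mulrCA subSn; last by rewrite -ltnS.
by rewrite exprS.
Qed.

Let span_R k p : span_RM k p -> span_RM k.+1 (fR K * p).
Proof.
move=> [c ->]; exists (fun j => if j is i.+1 then c i else 0).
rewrite [RHS]big_ord_recl /= scale0r add0r mulr_sumr; apply: eq_bigr => j _.
by rewrite /bump leq0n add1n -scalerAr mulrA -exprS subSS.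
Qed.

Lemma fM_X : fM K = 'X_1.
Proof. by rewrite /fM /sym_lin /emu !mxE /= scale0r add0r scale1r. Qed.

Lemma fR_X : fR K - fM K = 'X_0.
Proof. by rewrite fM_X /fR /sym_lin !mxE /= !scale1r addrK. Qed.

Lemma form_coords k (p : SV) : p \is k.-homog for mdeg -> exists c : nat -> K,
  p = \sum_(j < k.+1) c j *: (fR K ^+ j * fM K ^+ (k - j)).
Proof.
have sX k' i q : span_RM k' q -> span_RM k'.+1 ('X_i * q).
  move=> h; have [_ SP] := span_sub k'.+1; case: i => -[|[|//]] lt.
    have -> : Ordinal lt = 0 by exact: val_inj.
    rewrite -fR_X mulrBl addrC -scaleN1r; apply: SP; [exact: span_M | exact: span_R].
  have -> : Ordinal lt = 1 by exact: val_inj.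
  by rewrite -fM_X; apply: span_M.
have sXn k' i m q : span_RM k' q -> span_RM (m + k') ('X_i ^+ m * q).
  by elim: m => [|m IH] h; rewrite ?mul1r // exprS -mulrA addSn; apply/sX/IH.
move=> /dhomogP hp; change (span_RM k p); rewrite (mpolyE p) big_seq.
have [S0 SP] := span_sub k.
elim/big_ind: _ => [//|u v Su Sv|m mp]; first by rewrite -[u]scale1r; apply: SP.
rewrite -[_ *: _]addr0; apply: SP => //; have e : mdeg m = k := hp m mp.
rewrite -e mdegE !big_ord_recl big_ord0 mpolyXE_id !big_ord_recl big_ord0.
apply/sXn/sXn; exists (fun=> 1).
by rewrite big_ord1 !expr0 mulr1 scale1r.
Qed.

Let form_top k (J : set SV) : subspace J -> (forall p, J p -> J (2^-1 *: sym_br (fM K * fM K) p)) ->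
  forall m (c : nat -> K), (m <= k)%N -> c m != 0 ->
  J (\sum_(j < m.+1) c j *: (fR K ^+ j * fM K ^+ (k - j))) -> J (fM K ^+ k).
Proof.
move=> [J0 JP] JM; elim=> [|m IH] c mk cm Jc.
  move: Jc; rewrite big_ord1 expr0 mul1r subn0 => Jc.
  by have := JP (c 0%N)^-1 _ _ Jc J0; rewrite addr0 scalerA mulVf // scale1r.
apply: (IH (fun j => - (j.+1%:R * c j.+1))) => //; first exact: ltnW.
  by rewrite oppr_eq0 mulf_neq0 // pnatr_eq0.
move: (JM _ Jc); congr J.
have bl := sym_br_linr (fM K * fM K).
have hs (a : K) (p : SV) : 2^-1 *: (a *: p) = a *: (2^-1 *: p) by rewrite !scalerA mulrC.
have -> : forall s : seq 'I_m.+2, 2^-1 *: sym_br (fM K * fM K) (\sum_(j <- s) c j *: (fR K ^+ j * fM K ^+ (k - j))) =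
    \sum_(j <- s) (c j * - j%:R) *: (fR K ^+ j.-1 * fM K ^+ (k - j).+1).
  elim=> [|j s IHs]; first by rewrite !big_nil (linear_fun0 bl) scaler0.
  by rewrite !big_cons bl scalerDr IHs; congr (_ + _); rewrite hs br_M2 scalerA.
rewrite big_ord_recl /= oppr0 mulr0 scale0r add0r; apply: eq_bigr => j _; rewrite /bump leq0n add1n /=.
have -> : (k - j.+1).+1 = (k - j)%N by have := ltn_ord j; lia.
by congr (_ *: _); ring.
Qed.

(** Binary forms of degree [k] form an irreducible module: the lowering
    operator leads from any form to the power of [fM], the raising operator
    from there to all monomials. *)
Lemma lowest_form k (J : set SV) : subspace J ->
  (forall v p, J p -> J (sym_br (sym_lin v * sym_lin v) p)) ->
  forall u, u \is k.-homog for mdeg -> u != 0 -> J u -> J (fM K ^+ k).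
Proof.
move=> sJ JQ u uk u0 Ju; have [J0 JP] := sJ.
have JM p : J p -> J (2^-1 *: sym_br (fM K * fM K) p).
  by move=> Jp; rewrite -[_ *: _]addr0; apply: JP => //; apply: JQ.
have [c uE] := form_coords uk; move: Ju u0; rewrite {}uE.
suff H m : (m <= k)%N -> J (\sum_(j < m.+1) c j *: (fR K ^+ j * fM K ^+ (k - j))) ->
    \sum_(j < m.+1) c j *: (fR K ^+ j * fM K ^+ (k - j)) != 0 -> J (fM K ^+ k) by apply: (H k).
elim: m => [|m IH] mk Ju u0.
  apply: (form_top sJ JM mk _ Ju); apply: contraNneq u0 => c0.
  by rewrite big_ord1 c0 scale0r.
have [c0|c0] := eqVneq (c m.+1) 0; last exact: (form_top sJ JM mk c0 Ju).
by apply: IH; [exact: ltnW | move: Ju | move: u0]; rewrite big_ord_recr /= c0 scale0r addr0.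
Qed.

Lemma forms_irreducible k (J : set SV) : subspace J ->
  (forall v p, J p -> J (sym_br (sym_lin v * sym_lin v) p)) ->
  (exists2 u, J u & (u \is k.-homog for mdeg) && (u != 0)) -> forall p, p \is k.-homog for mdeg -> J p.
Proof.
move=> sJ JQ [u Ju /andP[uk u0]] p pk; have [J0 JP] := sJ.
have Jm j : (j <= k)%N -> J (fR K ^+ j * fM K ^+ (k - j)).
  elim: j => [|j IH] jk; first by rewrite expr0 mul1r subn0; apply: (lowest_form sJ JQ uk).
  have jk' : ((k - j)%:R : K) != 0 by rewrite pnatr_eq0; lia.
  have := JP ((k - j)%:R^-1 * 2^-1) _ _ (JQ rho _ (IH (ltnW jk))) J0.
  rewrite addr0 -scalerA br_R2 scalerA mulVf // scale1r.
  by have -> : (k - j).-1 = (k - j.+1)%N by lia.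
have [c ->] := form_coords pk.
elim/big_ind: _ => [//|x y Sx Sy|j _]; first by rewrite -[x]scale1r; apply: JP.
by rewrite -[_ *: _]addr0; apply: JP => //; apply: Jm; rewrite -ltnS.
Qed.

Lemma sym_lin_linear : linear (@sym_lin K).
Proof. by move=> a u v; rewrite /sym_lin !mxE; modring K {mpoly K[2]}. Qed.

Lemma sym_lin_br_comm (a b : vec) p :
  sym_br (sym_lin a) (sym_br (sym_lin b) p) = sym_br (sym_lin b) (sym_br (sym_lin a) p).
Proof.
apply/eqP; rewrite -subr_eq0 sym_br_jacobi sym_br_lin; apply/eqP.
have := sym_brMr p 1 1; rewrite !mulr1 mul1r => /esym/eqP; rewrite -subr_eq0 addrK => /eqP h.
have -> : ((sympl a b)%:MP : SV) = sympl a b *: 1 by rewrite -mul_mpolyC mulr1.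
by rewrite (linear_funZ (sym_br_linl p)) sym_brC h oppr0 scaler0.
Qed.

(** The forms all of whose second derivatives vanish are an invariant subspace
    that does not contain [fM ^+ k]. *)
Lemma second_derivative_neq0 k (u : SV) : (1 < k)%N -> u \is k.-homog for mdeg -> u != 0 ->
  exists a b : vec, sym_br (sym_lin a) (sym_br (sym_lin b) u) != 0.
Proof.
move=> k2 uk u0; apply: contrapT => h.
pose J : set SV := [set p | forall a b : vec, sym_br (sym_lin a) (sym_br (sym_lin b) p) = 0].
have Ju : J u by move=> a b; apply/eqP/negPn/negP => e; apply: h; exists a, b.
have sJ : subspace J.
  split=> [a b|c p q hp hq a b]; first by rewrite !(linear_fun0 (sym_br_linr _)).
  by rewrite !sym_br_linr hp hq scaler0 addr0.
have lin2 (a v : vec) : sym_br (sym_lin a) (sym_lin v * sym_lin v) = (2 * sympl a v) *: sym_lin v.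
  by rewrite sym_brMr !sym_br_lin mulrC mul_mpolyC -mulr2n -scaler_nat scalerA.
have JQ (v : vec) p : J p -> J (sym_br (sym_lin v * sym_lin v) p).
  move=> Jp a b.
  have D (x : vec) q : sym_br (sym_lin x) (sym_br (sym_lin v * sym_lin v) q) =
      sym_br (sym_lin v * sym_lin v) (sym_br (sym_lin x) q) + (2 * sympl x v) *: sym_br (sym_lin v) q.
    rewrite -(linear_funZ (sym_br_linl q)) -lin2 -sym_br_jacobi addrC subrK //.
  rewrite D (linear_funD (sym_br_linr _)) (linear_funZ (sym_br_linr _)) Jp scaler0 addr0.
  by rewrite D !Jp (linear_fun0 (sym_br_linr _)) scaler0 addr0.
have := lowest_form sJ JQ uk u0 Ju (rho : vec) (rho : vec); apply/eqP.
rewrite -/(fR K) br_exp br_RM mulr1 -scaler_nat (linear_funZ (sym_br_linr _)) br_exp br_RM mulr1 -scaler_nat !scaler_eq0 !pnatr_eq0.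
rewrite !negb_or expf_neq0 ?andbT; last by (apply/eqP => M0; have := br_RM K; rewrite M0 (linear_fun0 (sym_br_linr _)) => /esym/eqP; rewrite oner_eq0).
by apply/andP; split; lia.
Qed.

Lemma square_br2 (v : vec) p : sym_br (sym_lin v * sym_lin v) (sym_br (sym_lin v * sym_lin v) p) =
  4 *: (sym_lin v * sym_lin v * sym_br (sym_lin v) (sym_br (sym_lin v) p)).
Proof.
have xx := br_xx (sym_lin v); have E q : sym_br (sym_lin v * sym_lin v) q = 2 *: (sym_lin v * sym_br (sym_lin v) q).
  by rewrite sym_brM [in X in _ + X]mulrC -mulr2n scaler_nat.
rewrite !E (linear_funZ (sym_br_linr _)) sym_brMr xx mul0r addr0.
by rewrite -!scalerAr !mulrA scalerA -natrM.
Qed.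

End FormsIrreducible.

(** Only the leading coefficient of a polynomial of degree four survives the
    fourth difference. *)
Lemma quartic_difference (K : numFieldType) (V : lmodType K) (A B C E : V -> V) (p : V) (r s a0 a1 : K) :
  linear A -> linear C -> linear E ->
  let w t := (r + t * s) *: p + 2^-1 *: (t ^+ 2 *: A p + t *: B p) in
  let F t := (a0 + t * a1) *: w t + 2^-1 *: (C (w t) - t *: E (w t) + t ^+ 2 *: A (w t)) in
  F 0 - 4 *: F 1 + 6 *: F 2 - 4 *: F 3 + F 4 = 6 *: A (A p).
Proof.
move=> Al Cl El w F.
have lw (H : V -> V) t : linear H -> H (w t) = (r + t * s) *: H p + 2^-1 *: (t ^+ 2 *: H (A p) + t *: H (B p)).
  by move=> h; rewrite /w h !(linear_funZ h, linear_funD h).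
rewrite /F !(lw A _ Al) !(lw C _ Cl) !(lw E _ El) /w.
move: (A p) (B p) => Ap Bp; move: (A p) (A Ap) (A Bp) (C p) (C Ap) (C Bp) (E p) (E Ap) (E Bp) => x1 x2 x3 x4 x5 x6 x7 x8 x9.
by modred K V; field.
Qed.

Lemma rho_neq0 (K : numFieldType) : rho != 0 :> 'rV[K]_2.
Proof. by apply/eqP => /matrixP/(_ 0 0); rewrite !mxE => /eqP; rewrite oner_eq0. Qed.

Lemma sympl_basis (K : numFieldType) (v a b : 'rV[K]_2) : sympl a b != 0 ->
  v = (sympl v b / sympl a b) *: a + (sympl a v / sympl a b) *: b.
Proof.
rewrite /sympl => h; apply/matrixP => i j; rewrite (ord1 i) !mxE.
case: j => -[|[|//]] q.
  by have -> : Ordinal q = 0 by [exact: val_inj]; field.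
by have -> : Ordinal q = 1 by [exact: val_inj]; field.
Qed.

Lemma shifted_square (K : numFieldType) (t : K) (a b c : {mpoly K[2]}) :
  (b - t *: a) * (b - t *: a + c) = b * (b + c) + ((- t) *: (2 *: (a * b) + a * c) + t ^+ 2 *: (a * a)).
Proof. by rewrite -!mul_mpolyC !(rmorphN, rmorphXn, rmorph_nat) /=; ring. Qed.

Lemma square_from_shifts (K : numFieldType) (a c : {mpoly K[2]}) :
  a * a = 2^-1 *: ((2 *: a) * (2 *: a + c) + (- 2) *: (a * (a + c))).
Proof. by rewrite -!scalerAl !mulrDr -!scalerAr; modred K {mpoly K[2]}; field. Qed.

Lemma product_from_squares (K : numFieldType) (a b : {mpoly K[2]}) :
  a * b = 2^-1 *: ((a + b) * (a + b) + ((- 1) *: (a * a) + (- 1) *: (b * b))).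
Proof. by rewrite !mulrDr !mulrDl [b * a]mulrC; modred K {mpoly K[2]}; field. Qed.

Lemma scaler_neq0 (K : fieldType) (A : lmodType K) (c : K) (v : A) : c != 0 -> v != 0 -> c *: v != 0.
Proof. by move=> c0 v0; rewrite scaler_eq0 negb_or c0. Qed.

Section AbstractBracket.
Variables (K : numFieldType) (A : lmodType K) (B : A -> A -> A).
Hypothesis Bl : forall p, linear (B^~ p).
Hypothesis Br : forall q, linear (B q).

Let BDl a b p : B (a + b) p = B a p + B b p := linear_funD (Bl p) a b.
Let BZl c a p : B (c *: a) p = c *: B a p := linear_funZ (Bl p) c a.
Let BDr q a b : B q (a + b) = B q a + B q b := linear_funD (Br q) a b.
Let BZr q c a : B q (c *: a) = c *: B q a := linear_funZ (Br q) c a.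

Lemma polarized_eq0 a b p : B a (B a p) = 0 -> B b (B b p) = 0 -> B (a + b) (B (a + b) p) = 0 ->
  B a (B b p) = B b (B a p) -> B a (B b p) = 0.
Proof.
move=> ha hb; rewrite !BDl !BDr ha hb addr0 add0r => h e; apply/eqP; move/eqP: h.
by rewrite -e -mulr2n -scaler_nat scaler_eq0 pnatr_eq0.
Qed.

Lemma iterated_comb_eq0 a b p c1 c2 c3 c4 : B a (B a p) = 0 -> B a (B b p) = 0 -> B b (B a p) = 0 ->
  B b (B b p) = 0 -> B (c1 *: a + c2 *: b) (B (c3 *: a + c4 *: b) p) = 0.
Proof.
by move=> e1 e2 e3 e4; rewrite !BDl !BDr !BZl !BZr e1 e2 e3 e4 !scaler0 !addr0.
Qed.

Lemma quadratic_operator_linear q1 q2 q3 c :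
  linear (fun p => B q1 (B q1 p) + c *: (B q2 (B q3 p) + B q3 (B q2 p))).
Proof.
move=> a p p' /=; rewrite !(BDr, BZr); modring K A.
Qed.

Lemma fourth_difference_mem (J : set A) f0 f1 f2 f3 f4 : subspace J ->
  J f0 -> J f1 -> J f2 -> J f3 -> J f4 -> J (f0 - 4 *: f1 + 6 *: f2 - 4 *: f3 + f4).
Proof.
move=> [J0 JP] h0 h1 h2 h3 h4; rewrite -!scaleNr addrC -[f4]scale1r; apply: (JP) => //.
rewrite addrC; apply: (JP) => //; rewrite addrC; apply: (JP) => //; rewrite addrC; apply: (JP) => //.
Qed.

End AbstractBracket.

(** The action on the coefficient of one label in the module of binary forms. *)
Definition tstep (K : numFieldType) (a b : 'rV[K]_2) (p : {mpoly K[2]}) : {mpoly K[2]} :=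
  sympl (a + rho) (b + rho) *: p + 2^-1 *: sym_br (sym_lin a * sym_lin (a + rho)) p.

(** Two generators whose labels add up to a fixed one act by a polynomial of
    degree four in the splitting parameter; its leading coefficient does not
    see the label acted on. *)
Lemma tstep_fourth (K : numFieldType) (ka de b : 'rV[K]_2) (p : {mpoly K[2]}) :
  let G t := tstep (de - t *: ka) (b + t *: ka) (tstep (t *: ka) b p) in
  G 0 - 4 *: G 1 + 6 *: G 2 - 4 *: G 3 + G 4 =
  6 *: sym_br (sym_lin ka * sym_lin ka) (sym_br (sym_lin ka * sym_lin ka) p).
Proof.
set q := sym_lin ka; set qd := sym_lin de.
pose A := sym_br (q * q); pose B := sym_br (q * fR K).
pose C := sym_br (qd * (qd + fR K)); pose E := sym_br (2 *: (q * qd) + q * fR K).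
pose r := sympl rho (b + rho); pose s := sympl ka (b + rho).
pose a0 := sympl (de + rho) (b + rho).
pose a1 := sympl (de + rho) ka - sympl ka (b + rho).
have slin := @sym_lin_linear K.
have F t : tstep (de - t *: ka) (b + t *: ka) (tstep (t *: ka) b p) =
   (a0 + t * a1) *: ((r + t * s) *: p + 2^-1 *: (t ^+ 2 *: A p + t *: B p))
   + 2^-1 *: (C ((r + t * s) *: p + 2^-1 *: (t ^+ 2 *: A p + t *: B p))
     - t *: E ((r + t * s) *: p + 2^-1 *: (t ^+ 2 *: A p + t *: B p))
     + t ^+ 2 *: A ((r + t * s) *: p + 2^-1 *: (t ^+ 2 *: A p + t *: B p))).
  rewrite /tstep.
  have -> : sympl (t *: ka + rho) (b + rho) = r + t * s by rewrite /r /s /sympl !mxE; ring.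
  have -> : sym_br (sym_lin (t *: ka) * sym_lin (t *: ka + rho)) p = t ^+ 2 *: A p + t *: B p.
    rewrite (linear_funD slin) (linear_funZ slin) -/q -/(fR K) mulrDr -!scalerAr -!scalerAl scalerA -expr2.
    by rewrite (linear_funD (sym_br_linl p)) !(linear_funZ (sym_br_linl p)).
  set w := ((r + t * s) *: p + _).
  have -> : sympl (de - t *: ka + rho) (b + t *: ka + rho) = a0 + t * a1.
    by rewrite /a0 /a1 /sympl !mxE; ring.
  congr (_ + _ *: _).
  have -> : sym_lin (de - t *: ka) * sym_lin (de - t *: ka + rho) =
      qd * (qd + fR K) + ((- t) *: (2 *: (q * qd) + q * fR K) + t ^+ 2 *: (q * q)).
    have sl : sym_lin (de - t *: ka) = qd - t *: q.
      by rewrite (linear_funD slin) (linear_funN slin) (linear_funZ slin).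
    by rewrite (linear_funD slin _ rho) sl shifted_square.
  have bl := sym_br_linl w.
  by rewrite (linear_funD bl) (linear_funD bl) !(linear_funZ bl) scaleNr addrA.
move=> G; rewrite /G !F.
exact: (quartic_difference B p r s a0 a1 (sym_br_linr _) (sym_br_linr _) (sym_br_linr _)).
Qed.

Section LatticeForms.
Variables (K : numFieldType) (N : nat).
Local Notation X := 'rV[int]_N.
Local Notation vec := 'rV[K]_2.
Local Notation SV := {mpoly K[2]}.
Variable pi : {additive X -> vec}.
Hypothesis hline : forall v : vec, v != 0 -> exists x, sympl v (pi x) != 0.

Lemma lattice_orth (u : vec) : (forall j, sympl (pi j) u = 0) -> u = 0.
Proof.
move=> h; apply/eqP/negPn/negP => /hline[x].
have -> : sympl u (pi x) = - sympl (pi x) u by rewrite /sympl; ring.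
by rewrite h oppr0 eqxx.
Qed.

Lemma lattice_basis : exists a b, sympl (pi a) (pi b) != 0.
Proof.
have [x hx] := hline (v := rho) (rho_neq0 K).
have [|y hy] := hline (v := pi x); last by exists x, y.
by apply: contraNneq hx => ->; rewrite -(scale0r (0 : vec)) symplZr mul0r.
Qed.

Lemma lattice_squares_span (Y : set SV) : subspace Y ->
  (forall j, Y (sym_lin (pi j) * sym_lin (pi j))) -> forall u v : vec, Y (sym_lin u * sym_lin v).
Proof.
move=> sY J2 u v; have [J0 JP] := sY; have slin := @sym_lin_linear K.
have D p q : Y p -> Y q -> Y (p + q) by move=> hp hq; rewrite -[p]scale1r; apply: JP.
have Z c p : Y p -> Y (c *: p) by move=> hp; rewrite -[_ *: _]addr0; apply: JP.
have J3 i j : Y (sym_lin (pi i) * sym_lin (pi j)).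
  have := D _ _ (J2 (i + j)) (D _ _ (Z (- 1) _ (J2 i)) (Z (-1) _ (J2 j))) => /(Z 2^-1).
  by rewrite (raddfD pi) (linear_funD slin) -product_from_squares.
have [a [b ab]] := lattice_basis; rewrite (sympl_basis u ab) (sympl_basis v ab).
move: (sympl u _ / _) (sympl _ u / _) (sympl v _ / _) (sympl _ v / _) => c1 c2 c3 c4.
rewrite !(linear_funD slin) !(linear_funZ slin).
move: (sym_lin (pi a)) (sym_lin (pi b)) (J3 a a) (J3 a b) (J3 b a) (J3 b b) => p q h1 h2 h3 h4.
rewrite mulrDr !mulrDl -!scalerAl -!scalerAr.
by apply: (D); apply: (D); do 2 apply: (Z).
Qed.

(** The quadratic forms by which the generators act span all quadratic forms:
    comparing an element of the lattice with its double separates the square. *)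
Lemma squares_span (Y : set SV) : subspace Y ->
  (forall j, Y (sym_lin (pi j) * sym_lin (pi j + rho))) -> forall u v : vec, Y (sym_lin u * sym_lin v).
Proof.
move=> sY J1; have [J0 JP] := sY; have slin := @sym_lin_linear K.
have D p q : Y p -> Y q -> Y (p + q) by move=> hp hq; rewrite -[p]scale1r; apply: JP.
have Z c p : Y p -> Y (c *: p) by move=> hp; rewrite -[_ *: _]addr0; apply: JP.
apply: lattice_squares_span => // j.
have e2 : sym_lin (pi (j *+ 2)) = 2 *: sym_lin (pi j) by rewrite raddfMn -scaler_nat (linear_funZ slin).
have := D _ _ (J1 (j *+ 2)) (Z (- 2) _ (J1 j)); rewrite !(linear_funD slin _ rho) e2 => /(Z 2^-1).
by rewrite -square_from_shifts.
Qed.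

Lemma square_square_neq0 k (u : SV) : (1 < k)%N -> u \is k.-homog for mdeg -> u != 0 ->
  exists j, sym_br (sym_lin (pi j) * sym_lin (pi j)) (sym_br (sym_lin (pi j) * sym_lin (pi j)) u) != 0.
Proof.
move=> k2 uk u0; have [j hj] : exists j, sym_br (sym_lin (pi j)) (sym_br (sym_lin (pi j)) u) != 0.
  apply: contrapT => h.
  have slin := @sym_lin_linear K.
  have h1 j : sym_br (sym_lin (pi j)) (sym_br (sym_lin (pi j)) u) = 0.
    by apply/eqP/negPn/negP => e; apply: h; exists j.
  have h2 i j : sym_br (sym_lin (pi i)) (sym_br (sym_lin (pi j)) u) = 0.
    by apply: (polarized_eq0 (@sym_br_linl _) (@sym_br_linr _)) (sym_lin_br_comm _ _ _) => //; rewrite -(linear_funD slin) -(raddfD pi).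
  have [a [b /eqP[]]] := second_derivative_neq0 k2 uk u0.
  have [x1 [y1 hy]] := lattice_basis.
  rewrite (sympl_basis a hy) (sympl_basis b hy) !(linear_funD slin) !(linear_funZ slin).
  move: (h2 x1 x1) (h2 x1 y1) (h2 y1 x1) (h2 y1 y1).
  move: (sym_lin (pi x1)) (sym_lin (pi y1)) (sympl a _ / _) (sympl _ a / _) (sympl b _ / _) (sympl _ b / _).
  move=> q1 q2 c1 c2 c3 c4 e1 e2 e3 e4.
  exact: (@iterated_comb_eq0 _ _ (@sym_br _) (@sym_br_linl _) (@sym_br_linr _) _ _ _ _ _ _ _ e1 e2 e3 e4).
exists j; rewrite square_br2; apply: scaler_neq0; first by rewrite pnatr_eq0.
move: (sym_lin (pi j)) hj => q hj; apply: mulf_neq0 => //; apply: mulf_neq0.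
- apply: contraNneq hj => ->; exact/eqP/(linear_fun0 (sym_br_linl _)).
- apply: contraNneq hj => ->; exact/eqP/(linear_fun0 (sym_br_linl _)).
Qed.

End LatticeForms.

Section CaseForms.
Variables (R : realType) (N : nat).
Local Notation K := R[i].
Local Notation X := 'rV[int]_N.
Local Notation vec := 'rV[K]_2.
Local Notation SV := {mpoly K[2]}.
Variable pi : {additive X -> vec}.
Hypothesis hinj : injective pi.
Variables (M : lieModule (W pi)) (g : vec).
Hypothesis M_simple : lmod_simple M.
Hypothesis grM : graded_by M (coset_at pi g).
Local Notation ws := (wsp pi (Lop (M := M)) g).

Lemma hom_injective (M' : lieModule (W pi)) (Phi : M -> M') : linear Phi ->
  (forall w m, Phi (lact w m) = lact w (Phi m)) -> (exists v, Phi v != 0) -> injective Phi.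
Proof.
move=> Pl PL [v v0] x y xy; apply/eqP; rewrite -subr_eq0; apply/negPn/negP => d0.
move/eqP: v0; apply; apply: (simple_stable (S := [set m | Phi m = 0]) M_simple).
- split=> [|a u w hu hw]; first exact: linear_fun0 Pl.
  by rewrite /= Pl hu hw scaler0 addr0.
- by move=> z m /= hm; rewrite /Lop PL hm (linear_fun0 (lact_linr _)).
- by exists (x - y) => //=; rewrite (linear_funD Pl) (linear_funN Pl) xy subrr.
Qed.

(** The kernel is a submodule, so that only surjectivity has to be checked. *)
Lemma hom_iso (M' : lieModule (W pi)) (Phi : M -> M') : linear Phi ->
  (forall w m, Phi (lact w m) = lact w (Phi m)) -> (exists v, Phi v != 0) ->
  (forall y, exists m, Phi m = y) -> lmod_iso M M'.
Proof.
move=> Pl PL ne sj; exists Phi; split=> //.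
have Pi := hom_injective Pl PL ne.
exists (fun y => proj1_sig (cid (sj y))) => y; case: cid => m //= e; exact: Pi.
Qed.

Variables (k : nat) (g' : vec) (T : X -> M -> dhomog 2 K k).
Hypothesis T_lin : forall x a u v, ws x u -> ws x v -> T x (a *: u + v) = a *: T x u + T x v.
Hypothesis T_act : forall x j v, ws x v -> T (x + j) (Lop j v) = tensor_rule (pi j) (g' + pi x) (T x v).
Hypothesis T_neq0 : exists x, exists2 v, ws x v & T x v != 0.

Section Surjective.
Hypothesis k2 : (1 < k)%N.
Hypothesis hline : forall v : vec, v != 0 -> exists x, sympl v (pi x) != 0.

Let img x : set SV := [set p | exists2 v, ws x v & T x v = p :> SV].

Let img_sub x : subspace (img x).
Proof.
have w0 : ws x 0 by rewrite /wsp /= (linear_fun0 (Lop_lin _)) scaler0.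
split=> [|a p q [u wu <-] [v wv <-]].
  by exists 0 => //; have := T_lin (-1) w0 w0; rewrite scaler0 addr0 scaleN1r addNr => ->.
exists (a *: u + v); last by rewrite T_lin.
by rewrite /wsp /= Lop_lin wu wv scalerDr !scalerA mulrC.
Qed.

Let img_act x j p : img x p -> img (x + j) (tstep (pi j) (g' + pi x) p).
Proof. by move=> [v wv <-]; exists (Lop j v); [exact: Lop_wsp | rewrite T_act]. Qed.

Let img_square x y j p : img x p -> img y (sym_br (sym_lin (pi j) * sym_lin (pi j))
   (sym_br (sym_lin (pi j) * sym_lin (pi j)) p)).
Proof.
move=> xp; have [S0 SP] := img_sub y.
have F (t : nat) : img y (tstep (pi (y - x) - t%:R *: pi j) (g' + pi x + t%:R *: pi j) (tstep (t%:R *: pi j) (g' + pi x) p)).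
  have pt : pi (j *+ t) = t%:R *: pi j by rewrite raddfMn scaler_nat.
  have := img_act (y - x - j *+ t) (img_act (j *+ t) xp).
  have -> : x + j *+ t + (y - x - j *+ t) = y by zmodring 'rV[int]_N.
  by rewrite (raddfB pi) (raddfD pi) pt addrA.
have six : (6%:R : K) != 0 by rewrite pnatr_eq0.
rewrite -[sym_br _ _]scale1r -[1](mulVf six) -scalerA -[_ *: _]addr0; apply: SP => //.
rewrite -(tstep_fourth (pi j) (pi (y - x)) (g' + pi x) p).
exact: fourth_difference_mem (img_sub y) (F 0%N) (F 1%N) (F 2%N) (F 3%N) (F 4%N).
Qed.

Let J : set SV := [set p | forall y, img y p].

Let J_sub : subspace J.
Proof.
split=> [y|a p q Jp Jq y]; first by have [] := img_sub y.
by have [_ SP] := img_sub y; apply: SP.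
Qed.

Let J_square (v : vec) p : J p -> J (sym_br (sym_lin v * sym_lin v) p).
Proof.
pose Y : set SV := [set q | forall p, J p -> J (sym_br q p)].
have [J0 JP] := J_sub.
suff : Y (sym_lin v * sym_lin v) by apply.
apply: (squares_span hline) => [|j {}p Jp y].
  split=> [{}p _|c q q' hq hq' {}p Jp]; first by rewrite (linear_fun0 (sym_br_linl p)).
  by rewrite (sym_br_linl p); apply: JP; [exact: hq | exact: hq'].
have := img_act j (Jp (y - j)); rewrite subrK => h.
have [S0 SP] := img_sub y.
have := SP (- sympl (pi j + rho) (g' + pi (y - j) + rho)) _ _ (Jp y) h.
rewrite /tstep addrA scaleNr addNr add0r => h2; have := SP 2 _ _ h2 S0.
by rewrite addr0 scalerA mulfV ?pnatr_eq0 // scale1r.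
Qed.

(** The values of [T] at a label contain the values of the squares at every
    other label by [img_square]; the forms that are values at all labels are
    invariant under sl2, and they are not all zero. *)
Lemma form_surjective x p : exists2 v, ws x v & T x v = p.
Proof.
suff [v wv e] : img x p by exists v => //; apply: val_inj.
suff H : J p by apply: H.
apply: (forms_irreducible J_sub J_square); last exact: dhomog_is_dhomog.
have [y [v wv Tv0]] := T_neq0; have uk := dhomog_is_dhomog (T y v).
have u0 : (T y v : SV) != 0 by apply: contra Tv0 => /eqP e; apply/eqP/val_inj.
have [j hj] := square_square_neq0 hline k2 uk u0.
exists (sym_br (sym_lin (pi j) * sym_lin (pi j)) (sym_br (sym_lin (pi j) * sym_lin (pi j)) (T y v))).
  by move=> z; apply: (img_square (x := y)); exists v.
have q2 : sym_lin (pi j) * sym_lin (pi j) \is 2.-homog for mdeg.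
  exact: dhomogM (sym_lin_homog _) (sym_lin_homog _).
by rewrite hj andbT; exact: sym_br_homog q2 (sym_br_homog q2 uk).
Qed.

Lemma M_mod_single x j u : lact (L_ (lat pi j)) (dsum_single (in_coset pi g' x) u : M_mod k (coset_at pi g')) =
  dsum_single (in_coset pi g' (x + j)) (tensor_rule (pi j) (g' + pi x) u).
Proof.
rewrite /= bilin_dsum_single; apply: dsum_inj => /=; rewrite scale1r; congr single.
by rewrite raddfD addrCA [pi j + _]addrC.
Qed.

Theorem iso_forms : lmod_iso M (M_mod k (coset_at pi g')).
Proof.
have sl x : linear (dsum_single (in_coset pi g' x) : dhomog 2 K k -> _).
  by move=> a u v; apply: dsum_inj; exact: single_linear.
have [Phi [Pl PL PE]] := graded_hom hinj grM (h := fun x v => dsum_single (in_coset pi g' x) (T x v) : M_mod k (coset_at pi g'))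
  (fun x a u v wu wv => etrans (congr1 _ (T_lin a wu wv)) (sl x _ _ _))
  (fun x j v wv => etrans (congr1 _ (T_act j wv)) (esym (M_mod_single x j (T x v)))).
apply: (hom_iso Pl PL).
  have [x [v wv v0]] := T_neq0; exists v; rewrite (PE _ _ wv); apply: contra v0 => /eqP e.
  by have := congr1 (fun f : dsum _ _ => f (g' + pi x)) e; rewrite /= /single eqxx => /eqP.
elim/dsum_ind => [|f1 f2 [m1 <-] [m2 <-]|mu Gmu u].
- by exists 0; rewrite (linear_fun0 Pl).
- by exists (m1 + m2); rewrite (linear_funD Pl).
have [_ [x _ <-] xmu] := Gmu; have [v wv Tv] := form_surjective x u.
by exists v; rewrite (PE _ _ wv) Tv; apply: dsum_inj; rewrite /= xmu.
Qed.

End Surjective.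
End CaseForms.

(** * Weight lines *)

Lemma symplC (K : numFieldType) (u v : 'rV[K]_2) : sympl u v = - sympl v u.
Proof. by rewrite /sympl; ring. Qed.

Lemma sympl_parallel (K : numFieldType) (u v : 'rV[K]_2) : u != 0 -> v != 0 -> sympl u v = 0 ->
  exists c, c != 0 /\ v = c *: u.
Proof.
move=> u0 v0 h.
suff [c cE] : exists c, v = c *: u.
  by exists c; split=> //; apply: contraNneq v0 => c0; rewrite cE c0 scale0r.
have E (x : 'rV[K]_2) (c : K) : v 0 0 = c * u 0 0 -> v 0 1 = c * u 0 1 -> v = c *: u.
  move=> h0 h1; apply/matrixP => i j; rewrite (ord1 i) !mxE; case: j => -[|[|//]] q.
    by have -> : Ordinal q = 0 by exact: val_inj.
  by have -> : Ordinal q = 1 by exact: val_inj.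
move: h; rewrite /sympl => /eqP; rewrite subr_eq0 => /eqP h.
have [u00|u00] := eqVneq (u 0 0) 0; last first.
  exists (v 0 0 / u 0 0); apply: E => //; first by rewrite mulfVK.
  by apply: (mulfI u00); rewrite h; field.
have [u01|u01] := eqVneq (u 0 1) 0.
  case/eqP: u0; apply/matrixP => i j; rewrite (ord1 i) mxE; case: j => -[|[|//]] q.
    by have -> : Ordinal q = 0 by exact: val_inj.
  by have -> : Ordinal q = 1 by exact: val_inj.
exists (v 0 1 / u 0 1); apply: E => //; last by rewrite mulfVK.
by apply: (mulfI u01); rewrite -h; field.
Qed.

Lemma bilin_single_eval (K : fieldType) (I : zmodType) (V : lmodType K) (B : I -> I -> V -> V)
  (Bl : forall a b, linear (B a b)) (A D : set I) (AD : forall a b, A a -> D b -> D (a + b))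
  a (Aa : A a) (m : dsum D V) b : bilin_dsum Bl AD (dsum_single Aa (1 : K^o)) m (a + b) = B a b (m b).
Proof.
have al := bilin_dsum_linr Bl AD (dsum_single Aa (1 : K^o)).
elim/dsum_ind: m => [|f1 f2 IH1 IH2|c Dc v].
- by rewrite (linear_fun0 al) (linear_fun0 (Bl a b)).
- rewrite (linear_funD al).
  exact: etrans (congr2 +%R IH1 IH2) (esym (linear_funD (Bl a b) (f1 b) (f2 b))).
rewrite bilin_dsum_single /= /single (inj_eq (addrI a)) scale1r.
by case: eqP => [->|_] //; rewrite (linear_fun0 (Bl a b)).
Qed.

Section RestrictedDualBasis.
Variables (R : realType) (N : nat).
Local Notation K := R[i].
Local Notation X := 'rV[int]_N.
Local Notation vec := 'rV[K]_2.
Variable pi : {additive X -> vec}.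
Hypothesis hinj : injective pi.
Hypothesis r_neq0 : forall b : X, b != 0 -> sympl rho (pi b) != 0.

Lemma S_mod_coord g' j x (m : S_mod (coset_at pi g')) :
  (Lop j m : dsum _ _) (g' + pi (x + j)) = sympl (pi j + rho) (g' + pi x + rho) * (m : dsum _ _) (g' + pi x).
Proof.
have -> : g' + pi (x + j) = pi j + (g' + pi x) by rewrite raddfD [RHS]addrC addrA.
exact: bilin_single_eval.
Qed.

(** Zero for [x = 0], as [L_(- rho)] is divided out. *)
Definition qclass x : S_quot pi := to_lquot (C_L_mrho pi) (dsum_single (in_coset pi (- rho) x) (1 : K^o)).

(** At [x = 0] the coordinate is not defined on the quotient and is set to
    zero. *)
Definition qcoord (x : X) (q : S_quot pi) : K^o :=
  if x == 0 then 0 else (of_lquot q : dsum _ _) (- rho + pi x).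

Lemma qcoordE x (m : S_mod (rho_coset pi)) :
  qcoord x (to_lquot (C_L_mrho pi) m) = if x == 0 then 0 else (m : dsum _ _) (- rho + pi x).
Proof.
rewrite /qcoord; case: eqVneq => // x0; apply/eqP; rewrite -subr_eq0; apply/eqP.
have /to_lquotP [c E] : to_lquot (C_L_mrho pi) (of_lquot (to_lquot (C_L_mrho pi) m)) = to_lquot (C_L_mrho pi) m by rewrite of_lquotK.
have := congr1 (fun f : dsum (rho_coset pi) _ => f (- rho + pi x)) E => /= e.
transitivity (c *: single (- rho) (1 : K^o) (- rho + pi x)); first exact: e.
rewrite /single -subr_eq0 addrC addKr.
case: eqP => [p0|_]; last exact: scaler0.
by have := r_neq0 x0; rewrite p0 /sympl !mxE !mulr0 subr0 eqxx.
Qed.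

Lemma qcoord_linear x : linear (qcoord x).
Proof.
move=> a q q'; rewrite -[q]of_lquotK -[q']of_lquotK -to_lquot_linear !qcoordE.
by case: eqP => _; rewrite ?scaler0 ?addr0.
Qed.

Lemma qcoord_act j x q : x != 0 ->
  qcoord x (Lop j q) = sympl (pi j + rho) (pi (x - j)) * qcoord (x - j) q.
Proof.
move=> x0; rewrite -[q]of_lquotK /Lop /= lquot_actE !qcoordE (negPf x0).
have := S_mod_coord j (x - j) (of_lquot q : S_mod (coset_at pi (- rho))); rewrite subrK.
have -> : - rho + pi (x - j) + rho = pi (x - j) by rewrite addrC addrA subrr add0r.
move=> ->; case: eqP => // ->; by rewrite raddf0 /sympl !mxE !mulr0 subrr mul0r.
Qed.

Lemma qcoord_weight x mu q : coset_set (rho_coset pi) mu -> weight_space (S_quot pi) mu q ->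
  qcoord x q != 0 -> mu = - rho + pi x.
Proof.
move=> [_ [z _ <-] <-] wq qx.
have x0 : x != 0 by apply: contraNneq qx => ->; rewrite /qcoord eqxx.
have wq' : wsp pi (Lop (M := S_quot pi)) (- rho) z q by rewrite wsp_weight.
have := congr1 (qcoord x) wq'; rewrite (linear_funZ (qcoord_linear x)) qcoord_act // subr0 raddf0 add0r.
move=> /(mulIf qx); rewrite symplDr -scaleN1r symplZr symplxx mulr0 add0r => e.
have [->//|zx] := eqVneq x z; have /r_neq0 : x - z != 0 by rewrite subr_eq0.
by rewrite raddfB -scaleN1r symplDr symplZr e mulN1r subrr eqxx.
Qed.

Lemma qcoord_rdual x : qcoord x \in rdual_pred (M := S_quot pi) (rho_coset pi).
Proof.
apply/rdual_predP; split; first exact: qcoord_linear.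
apply: (@sub_finite_set _ _ [set - rho + pi x]); last exact: finite_set1.
by move=> mu [Gmu [q wq qx]] /=; apply: qcoord_weight wq qx.
Qed.

(** The basis of the restricted dual that is dual to the classes [qclass x]
    with [x] nonzero. *)
Definition qdual x : S_quot_dual pi := RDual (qcoord_rdual x).

Lemma qdual_act j x : x != 0 ->
  Lop j (qdual x) = - sympl (pi j + rho) (pi (x - j)) *: qdual (x - j).
Proof.
move=> x0; apply: val_inj; apply/funext => q /=.
rewrite /contragr -/(Lop j q) qcoord_act //.
by rewrite scaleNr.
Qed.

Lemma qdual0 : qdual 0 = 0.
Proof. by apply: val_inj; apply/funext => q /=; rewrite /qcoord eqxx. Qed.

Lemma qcoord_class x z : qcoord x (qclass z) = if (x != 0) && (x == z) then 1 else 0.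
Proof.
rewrite qcoordE; case: (eqVneq x 0) => //= x0; rewrite /single (inj_eq (addrI _)) (inj_eq hinj) //.
Qed.

Lemma qclass0 : qclass 0 = 0.
Proof.
have l0 : to_lquot (C_L_mrho pi) 0 = 0 := linear_fun0 (to_lquot_linear (C_L_mrho pi)).
rewrite -l0; apply/to_lquotP; rewrite subr0; exists 1; rewrite scale1r.
by apply: dsum_inj => /=; rewrite raddf0 addr0.
Qed.

Lemma qclass_weight x : weight_space (S_quot pi) (- rho + pi x) (qclass x).
Proof.
rewrite -wsp_weight /wsp /= /Lop /= lquot_actE.
rewrite -(linear_funZ (to_lquot_linear (C_L_mrho pi))); congr to_lquot.
rewrite /= bilin_dsum_single; apply: dsum_inj => /=.
rewrite raddf0 add0r scale1r /poisson_rule add0r -(linear_funZ (@single_linear _ _ _ _)); congr single.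
congr (_ *: _); by rewrite /sympl !mxE; ring.
Qed.

Lemma qclass_act j x : Lop j (qclass x) = sympl (pi j + rho) (pi x) *: qclass (x + j).
Proof.
rewrite /Lop /= lquot_actE -(linear_funZ (to_lquot_linear (C_L_mrho pi))); congr to_lquot.
rewrite /= bilin_dsum_single; apply: dsum_inj => /=.
rewrite scale1r /poisson_rule (linear_funZ (@single_linear _ _ _ _)).
have -> : - rho + pi x + rho = pi x by rewrite addrC addrA subrr add0r.
have -> // : pi j + (- rho + pi x) = - rho + pi (x + j) by rewrite (raddfD pi); zmodring 'rV[R[i]]_2.
Qed.

Lemma quot_ind (P : S_quot pi -> Prop) : P 0 -> (forall u v, P u -> P v -> P (u + v)) ->
  (forall c x, P (c *: qclass x)) -> forall q, P q.
Proof.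
move=> P0 PD PS q; rewrite -[q]of_lquotK; move: (of_lquot q) => m.
have tl := to_lquot_linear (C_L_mrho pi).
elim/dsum_ind: m => [|f1 f2 h1 h2|mu Gmu c].
- by rewrite (linear_fun0 tl).
- by rewrite (linear_funD tl); apply: PD.
have [_ [x _ <-] xmu] := Gmu; have -> : dsum_single Gmu c = (c : K) *: dsum_single (in_coset pi (- rho) x) (1 : K^o) :> S_mod (rho_coset pi).
  apply: dsum_inj; rewrite /= -(linear_funZ (@single_linear _ _ _ _)) xmu; congr single.
  exact/esym/mulr1.
by rewrite (linear_funZ tl); apply: PS.
Qed.

Lemma qdual_span (phi : S_quot_dual pi) : exists2 l : seq X, uniq l & phi = \sum_(x <- l) ((phi : rdual _ _) (qclass x) : K) *: qdual x.
Proof.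
have [pl] := rdualP phi; move=> /finite_seqP[s sE].
pose l := undup [seq xget 0 [set x | - rho + pi x = mu] | mu <- s].
have hl x : x \notin l -> (phi : rdual _ _) (qclass x) = 0.
  rewrite mem_undup => h; apply/eqP/negPn/negP => fx; case/negP: h.
  have : form_supp (rho_coset pi) (phi : rdual _ _) (- rho + pi x).
    by split; [exact: in_coset | exists (qclass x) => //; exact: qclass_weight].
  rewrite sE /= => xs; apply/mapP; exists (- rho + pi x) => //.
  by case: xgetP => [y _ /= /addrI/hinj ->//|/(_ x)]; case.
exists l; first exact: undup_uniq.
apply: val_inj; apply/funext => q.
have E : forall r : seq X, (\sum_(x <- r) ((phi : rdual _ _) (qclass x) : K) *: qdual x : rdual _ _) q =
    \sum_(x <- r) (phi : rdual _ _) (qclass x) * qcoord x q.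
  by elim=> [|x r IH]; rewrite ?big_nil // !big_cons -IH.
rewrite [RHS]E -[LHS]/((phi : rdual _ _) q); clear E; elim/quot_ind: q => [|u v hu hv|c z].
- by rewrite (linear_fun0 pl) big1 // => x _; rewrite (linear_fun0 (qcoord_linear x)) mulr0.
- rewrite (linear_funD pl) hu hv -big_split; apply: eq_bigr => x _.
  by rewrite (linear_funD (qcoord_linear x)) mulrDr.
rewrite (linear_funZ pl) (eq_bigr (fun x => c * ((phi : rdual _ _) (qclass x) * qcoord x (qclass z)))); last first.
  by move=> x _; rewrite (linear_funZ (qcoord_linear x)) mulrCA.
rewrite -mulr_sumr; congr (_ * _).
have [->|z0] := eqVneq z 0.
  rewrite qclass0 (linear_fun0 pl) big1 // => x _; by rewrite (linear_fun0 (qcoord_linear x)) mulr0.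
have [zl|zl] := boolP (z \in l); last first.
  rewrite (hl _ zl) big1_seq // => x /andP[_ xl]; rewrite qcoord_class.
  by case: (eqVneq x z) xl zl => [-> -> //|_ _ _]; rewrite andbF mulr0.
rewrite (bigD1_seq z) ?undup_uniq //= qcoord_class z0 eqxx mulr1 big1 ?addr0 // => x xz.
by rewrite qcoord_class (negPf xz) andbF mulr0.
Qed.

End RestrictedDualBasis.

Section RankOne.
Variables (R : realType) (N : nat).
Local Notation K := R[i].
Local Notation X := 'rV[int]_N.
Local Notation vec := 'rV[K]_2.
Variable pi : {additive X -> vec}.
Hypothesis hN : (1 < N)%N.
Hypothesis hinj : injective pi.
Hypothesis hnz : forall a b : X, b != 0 -> sympl (pi a + 2 *: rho) (pi b) != 0.
Hypothesis hline : forall v : vec, v != 0 -> exists x, sympl v (pi x) != 0.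
Variables (M : lieModule (W pi)) (g : vec).
Hypothesis M_simple : lmod_simple M.
Hypothesis M_nontrivial : ~ lmod_trivial M.
Hypothesis grM : graded_by M (coset_at pi g).
Local Notation ws := (wsp pi (Lop (M := M)) g).

Let r_neq0 : forall b : X, b != 0 -> sympl rho (pi b) != 0 := lattice_r_neq0 hnz.

(** The vectors without component at [x] form a submodule. *)
Lemma missing_weight x : (exists2 v, ws x v & v != 0) -> (forall j v, j != 0 -> ws (x - j) v -> Lop j v = 0) ->
  forall z, z != x -> forall v, ws z v -> v = 0.
Proof.
move=> [u wu u0] h z zx v wv; apply/eqP/negPn/negP => v0.
have cl := wcomp_lin hinj grM; have hc := wcomp_homog hinj grM.
move/eqP: u0; apply.
suff : wcomp grM x u = 0 by rewrite (hc _ _ wu) eqxx.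
apply: (simple_stable (S := [set m | wcomp grM x m = 0]) M_simple).
- split=> [|a p q hp hq] /=; first exact: linear_fun0 (cl x).
  by rewrite cl hp hq scaler0 addr0.
- move=> j m hm /=; have -> : x = (x - j) + j by rewrite subrK.
  rewrite wcomp_Lop //; have [->|j0] := eqVneq j 0.
    by rewrite subr0 hm (linear_fun0 (Lop_lin _)).
  by rewrite h //; apply: wcomp_wsp.
- by exists v => //=; rewrite (hc _ _ wv) eq_sym (negPf zx).
Qed.

Lemma weight_moves x v : ws x v -> v != 0 -> exists2 j, j != 0 & Lop j v != 0.
Proof.
move=> wv v0; apply: contrapT => h; move/eqP: v0; apply.
apply: (cofinite_eq0 hN hnz M_simple M_nontrivial).
exists [:: 0 : X] => j; rewrite inE => j0; apply/eqP/negPn/negP => e; apply: h; by exists j.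
Qed.

(** The vectors all of whose components are killed by [T] form a submodule. *)
Lemma weight_map_inj (V : lmodType K) (T : X -> M -> V) :
  (forall x a u v, ws x u -> ws x v -> T x (a *: u + v) = a *: T x u + T x v) ->
  (forall x j v, ws x v -> T x v = 0 -> T (x + j) (Lop j v) = 0) ->
  (exists x, exists2 v, ws x v & T x v != 0) -> forall x v, ws x v -> T x v = 0 -> v = 0.
Proof.
move=> Tl TL [y [u wu Tu]] x v wv Tv; apply/eqP/negPn/negP => v0.
have cl := wcomp_lin hinj grM; have hc := wcomp_homog hinj grM.
have T0 z : T z 0 = 0.
  have w0 : ws z 0 by rewrite /wsp /= (linear_fun0 (Lop_lin _)) scaler0.
  by have := Tl z (-1) _ _ w0 w0; rewrite scaler0 addr0 scaleN1r addNr.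
move/eqP: Tu; apply.
suff : T y (wcomp grM y u) = 0 by rewrite (hc _ _ wu) eqxx.
move: y {wu}; apply: (simple_stable (S := [set m | forall y, T y (wcomp grM y m) = 0]) M_simple).
- split=> [y|a p q hp hq y]; first by rewrite (linear_fun0 (cl y)) T0.
  by rewrite cl Tl ?hp ?hq ?scaler0 ?addr0 //; apply: wcomp_wsp.
- move=> j m hm y /=; have -> : y = (y - j) + j by rewrite subrK.
  by rewrite wcomp_Lop // TL //; apply: wcomp_wsp.
- by exists v => //= y; rewrite (hc _ _ wv); case: eqP => [->|].
Qed.

Variables (g' : vec) (t : X -> M -> K).
Hypothesis t_lin : forall x a u v, ws x u -> ws x v -> t x (a *: u + v) = a * t x u + t x v.
Hypothesis t_act : forall x j v, ws x v -> t (x + j) (Lop j v) = sympl (pi j + rho) (g' + pi x + rho) * t x v.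
Hypothesis t_neq0 : exists x, exists2 v, ws x v & t x v != 0.

Let s x := g' + pi x + rho.

Let ws0 x : ws x 0.
Proof. by rewrite /wsp /= (linear_fun0 (Lop_lin _)) scaler0. Qed.

Let t0 x : t x 0 = 0.
Proof. by have := t_lin (-1) (ws0 x) (ws0 x); rewrite scaler0 addr0 mulN1r addNr. Qed.

Lemma rank_one_inj x v : ws x v -> t x v = 0 -> v = 0.
Proof.
apply: (weight_map_inj (V := K^o)) => // y j w ww tw.
by rewrite t_act // tw mulr0.
Qed.

Let Z x := exists2 v, ws x v & t x v = 1.

Let Z_intro x v : ws x v -> t x v != 0 -> Z x.
Proof.
move=> wv tv; exists ((t x v)^-1 *: v + 0); last by rewrite t_lin // t0 addr0 mulVf.
by rewrite /wsp /= Lop_lin wv (linear_fun0 (Lop_lin _)) !addr0 !scalerA mulrC.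
Qed.

Let Z_step x j : Z x -> sympl (pi j + rho) (s x) != 0 -> Z (x + j).
Proof.
by move=> [v wv tv] h; apply: (Z_intro (v := Lop j v)); [exact: Lop_wsp | rewrite t_act // tv mulr1].
Qed.

Let Z_orth x y : Z x -> ~ Z y -> sympl (s y + rho) (s x) = 0.
Proof.
move=> Zx Zy; apply/eqP/negPn/negP => h; apply: Zy.
have -> : y = x + (y - x) by rewrite addrC subrK.
apply: Z_step => //; apply: contraNneq h => e.
have -> : s y + rho = (pi (y - x) + rho) + s x.
  by rewrite /s (raddfB pi); zmodring 'rV[R[i]]_2.
by rewrite symplDl e symplxx addr0.
Qed.

(** The weights that do not occur lie on a line parallel to the one
    containing the weights that do; this leaves room for one of them only. *)
Lemma missing_label y : ~ Z y -> s y = - rho.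
Proof.
move=> Zy; apply/eqP; rewrite -subr_eq0 opprK; apply/negPn/negP => u0.
have [x0 [v0 wv0 tv0]] := t_neq0; have Zx0 := Z_intro wv0 tv0.
have ox := Z_orth Zx0 Zy; have [sx0|sx0] := eqVneq (s x0) 0.
  have v00 : v0 != 0 by apply: contraNneq tv0 => ->; rewrite t0.
  have [j j0 Lj] := weight_moves wv0 v00.
  have wj : ws (x0 + j) (Lop j v0) by apply: Lop_wsp.
  move/eqP: Lj; apply; apply: (rank_one_inj wj).
  by rewrite t_act // -/(s x0) sx0 /sympl !mxE !mulr0 subrr mul0r.
have [e he] := hline u0; pose f j := sympl (s y + rho) (pi j).
pose q := - sympl (s y + rho) rho.
have f01 j : f j = 0 \/ f j = q.
  have sj : s (x0 + j) = s x0 + pi j by rewrite /s (raddfD pi); zmodring 'rV[R[i]]_2.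
  have [Zj|Zj] := pselect (Z (x0 + j)).
    by left; have := Z_orth Zj Zy; rewrite sj symplDr ox add0r.
  right; have := Z_orth Zx0 Zj; rewrite sj => e1.
  have [c [c0 cE]] : exists c, c != 0 /\ s x0 = c *: (s y + rho) := sympl_parallel u0 sx0 ox.
  move: e1; rewrite -addrA symplDl symplxx add0r cE symplZr => /eqP.
  rewrite mulf_eq0 (negPf c0) /= => /eqP e2.
  have : sympl (s y + rho) (pi j + rho) = 0 by rewrite symplC e2 oppr0.
  by rewrite symplDr => /eqP; rewrite addr_eq0 => /eqP.
have fe0 : f e != 0 by [].
have [fe|fe] := f01 e; first by rewrite fe eqxx in fe0.
have fD : f (e + e) = f e + f e by rewrite /f raddfD symplDr.
have [] := f01 (e + e); rewrite fD.
  by rewrite -mulr2n => /eqP; rewrite mulrn_eq0 /= (negPf fe0).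
by rewrite -fe => /eqP; rewrite -subr_eq0 addrK (negPf fe0).
Qed.

Lemma S_mod_single x j c : Lop j (dsum_single (in_coset pi g' x) (c : K^o) : S_mod (coset_at pi g')) =
  dsum_single (in_coset pi g' (x + j)) (sympl (pi j + rho) (g' + pi x + rho) * c : K^o).
Proof.
rewrite /Lop /= bilin_dsum_single; apply: dsum_inj => /=; rewrite scale1r; congr single.
by rewrite raddfD addrCA [pi j + _]addrC.
Qed.

(** If all labels occur, the module is a full module of densities; the label
    [- rho] is the only one that may be missing, and the module is then the
    restricted dual of the quotient. *)
Theorem rank_one_modules :
  (exists2 G : coset pi, ~ coset_set G (- rho) /\ ~ coset_set G (- (2 *: rho)) & lmod_iso M (S_mod G)) \/
  lmod_iso M (S_quot_dual pi).
Proof.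
have [[y0 Zy0]|all] := pselect (exists y, ~ Z y); [right|left].
  have sy0 := missing_label Zy0.
  have sx x : s x = pi (x - y0) - rho.
    by rewrite -sy0 /s raddfB; zmodring 'rV[R[i]]_2.
  have Zx x : x != y0 -> Z x.
    move=> xy; apply: contrapT => /missing_label; rewrite sx => /eqP.
    rewrite -subr_eq0 addrK => /eqP e; have := @hinj (x - y0) 0; rewrite raddf0 => /(_ e)/eqP.
    by rewrite subr_eq0 (negPf xy).
  have hl x a u v : ws x u -> ws x v -> t x (a *: u + v) *: qdual r_neq0 (y0 - x) =
      a *: (t x u *: qdual r_neq0 (y0 - x)) + t x v *: qdual r_neq0 (y0 - x).
    by move=> wu wv; rewrite t_lin // scalerDl scalerA.
  have hL x j v : ws x v -> t (x + j) (Lop j v) *: qdual r_neq0 (y0 - (x + j)) =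
      Lop j (t x v *: qdual r_neq0 (y0 - x)).
    move=> wv; rewrite t_act // (linear_funZ (Lop_lin j)).
    have [e|e] := eqVneq x y0.
      have -> : t x v = 0.
        by apply/eqP/negPn/negP => tv; apply: Zy0; rewrite -e; exact: Z_intro wv tv.
      by rewrite mulr0 !scale0r.
    rewrite qdual_act; last by rewrite subr_eq0 eq_sym.
    rewrite scalerA opprD addrA mulrC; congr (_ * _ *: _); rewrite -/(s x) sx.
    have -> : pi (y0 - x - j) = - (pi (x - y0) - rho) - (pi j + rho).
      by rewrite !(raddfB pi); zmodring 'rV[R[i]]_2.
    by move: (pi j + rho) (pi (x - y0) - rho) => u w; rewrite /sympl !mxE; ring.
  have [Phi [Pl PL PE]] := graded_hom hinj grM hl hL.
  apply: (hom_iso M_simple Pl PL).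
    have [x [v wv tv]] := t_neq0; exists v; rewrite (PE _ _ wv); apply: scaler_neq0 => //.
    have xy : y0 - x != 0.
      rewrite subr_eq0; apply: contra_not_neq Zy0 => ->; exact: Z_intro wv tv.
    apply/eqP => /(congr1 (fun f : S_quot_dual pi => (f : rdual _ _) (qclass pi (y0 - x)))) /=.
    by rewrite qcoord_class // xy eqxx => /eqP; rewrite oner_eq0.
  move=> phi; have [l ul ->] := qdual_span hinj r_neq0 phi.
  elim: (l) {ul} => [|x l' [m IH]]; first by exists 0; rewrite big_nil (linear_fun0 Pl).
  rewrite big_cons; have [->|x0] := eqVneq x 0.
    by exists m; rewrite IH qdual0 scaler0 add0r.
  have [|v wv tv] := Zx (y0 - x); first by rewrite -subr_eq0 addrC addKr oppr_eq0.
  exists (((phi : rdual _ _) (qclass pi x) : K) *: v + m); rewrite Pl IH (PE _ _ wv) tv scale1r.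
  by have -> : y0 - (y0 - x) = x by zmodring 'rV[int]_N.
have {}all x : Z x by apply: contrapT => h; apply: all; exists x.
exists (coset_at pi g').
  split=> [[_ [x _ <-] e]|[_ [x _ <-] e]].
    have [v wv tv] := all x.
    have v0 : v != 0 by apply: contraTneq (oner_neq0 K) => v0; rewrite -tv v0 t0 eqxx.
    have [j j0 Lj] := weight_moves wv v0.
    move/eqP: Lj; apply; apply: (rank_one_inj (Lop_wsp j wv)).
    by rewrite t_act // e addNr /sympl !mxE !mulr0 subrr mul0r.
  have [v wv tv] := all x.
  have v0 : v != 0 by apply: contraTneq (oner_neq0 K) => v0; rewrite -tv v0 t0 eqxx.
  have [j j0 _] := weight_moves wv v0.
  have [u wu tu] := all (x + j).
  have u0 : u = 0.
    apply: (missing_weight (x := x) _ _ (z := x + j)) => //; first by exists v.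
      move=> i w _ ww; apply: (rank_one_inj (x := x)); first by have := Lop_wsp i ww; rewrite subrK.
      have := t_act i ww; rewrite subrK => ->.
      have -> : g' + pi (x - i) + rho = - (pi i + rho).
        have -> : g' + pi (x - i) + rho = g' + pi x + rho - pi i by rewrite (raddfB pi); zmodring 'rV[R[i]]_2.
        by rewrite e; apply/matrixP => a b; rewrite !mxE; ring.
      by rewrite -scaleN1r symplZr symplxx mulr0 mul0r.
    by rewrite -subr_eq0 addrC addKr.
  by move: tu; rewrite u0 t0 => /eqP; rewrite eq_sym oner_eq0.
have hl x a u v : ws x u -> ws x v -> dsum_single (in_coset pi g' x) (t x (a *: u + v) : K^o) =
    a *: (dsum_single (in_coset pi g' x) (t x u : K^o) : S_mod (coset_at pi g')) + dsum_single (in_coset pi g' x) (t x v : K^o).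
  by move=> wu wv; rewrite t_lin //; apply: dsum_inj; exact: single_linear.
have hL x j v : ws x v -> dsum_single (in_coset pi g' (x + j)) (t (x + j) (Lop j v) : K^o) =
    Lop j (dsum_single (in_coset pi g' x) (t x v : K^o) : S_mod (coset_at pi g')).
  by move=> wv; rewrite S_mod_single t_act.
have [Phi [Pl PL PE]] := graded_hom hinj grM (h := fun x v => dsum_single (in_coset pi g' x) (t x v : K^o) : S_mod (coset_at pi g')) hl hL.
apply: (hom_iso M_simple Pl PL).
  have [x [v wv tv]] := t_neq0; exists v; rewrite (PE _ _ wv); apply: contra tv => /eqP e.
  by have := congr1 (fun f : dsum _ _ => f (g' + pi x)) e; rewrite /= /single eqxx => /eqP.
elim/dsum_ind => [|f1 f2 [m1 <-] [m2 <-]|mu Gmu c].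
- by exists 0; rewrite (linear_fun0 Pl).
- by exists (m1 + m2); rewrite (linear_funD Pl).
have [_ [x _ <-] xmu] := Gmu; have [v wv tv] := all x.
exists ((c : K) *: v); rewrite (linear_funZ Pl) (PE _ _ wv) tv; apply: dsum_inj; rewrite /= xmu.
by rewrite -(linear_funZ (@single_linear _ _ _ _)); congr single; exact: mulr1.
Qed.

End RankOne.

(** * Degrees zero and one *)

Section LowDegree.
Variables (R : realType) (N : nat).
Local Notation K := R[i].
Local Notation X := 'rV[int]_N.
Local Notation vec := 'rV[K]_2.
Local Notation SV := {mpoly K[2]}.
Variable pi : {additive X -> vec}.
Hypothesis hN : (1 < N)%N.
Hypothesis hinj : injective pi.
Hypothesis hnz : forall a b : X, b != 0 -> sympl (pi a + 2 *: rho) (pi b) != 0.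
Hypothesis hline : forall v : vec, v != 0 -> exists x, sympl v (pi x) != 0.
Variables (M : lieModule (W pi)) (g : vec).
Hypothesis M_simple : lmod_simple M.
Hypothesis M_nontrivial : ~ lmod_trivial M.
Hypothesis grM : graded_by M (coset_at pi g).
Local Notation ws := (wsp pi (Lop (M := M)) g).

Let r_neq0 : forall b : X, b != 0 -> sympl rho (pi b) != 0 := lattice_r_neq0 hnz.

Lemma sym_br1 (q : SV) : sym_br q 1 = 0.
Proof. by have := br_exp q 1 0; rewrite expr0 mulr0n. Qed.

Lemma homog0 (p : SV) : p \is 0.-homog for mdeg -> p = p@_0%MM *: 1.
Proof.
move=> /form_coords[c ->]; rewrite big_ord1 !expr0 mulr1.
by rewrite mcoeffZ mcoeff1 eqxx mulr1.
Qed.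

Lemma homog1 (p : SV) : p \is 1.-homog for mdeg -> exists u : vec, p = sym_lin u.
Proof.
move=> /form_coords[c ->]; exists (c 0%N *: emu K + c 1%N *: rho).
rewrite !big_ord_recl big_ord0 addr0 /= /bump /= expr0 mul1r expr1 expr1 expr0 mulr1.
by rewrite (linear_funD (@sym_lin_linear K)) !(linear_funZ (@sym_lin_linear K)).
Qed.

Section DegreeZero.
Variables (g' : vec) (T : X -> M -> dhomog 2 K 0).
Hypothesis T_lin : forall x a u v, ws x u -> ws x v -> T x (a *: u + v) = a *: T x u + T x v.
Hypothesis T_act : forall x j v, ws x v -> T (x + j) (Lop j v) = tensor_rule (pi j) (g' + pi x) (T x v).
Hypothesis T_neq0 : exists x, exists2 v, ws x v & T x v != 0.

Lemma degree_zero_modules :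
  (exists2 G : coset pi, ~ coset_set G (- rho) /\ ~ coset_set G (- (2 *: rho)) & lmod_iso M (S_mod G)) \/
  lmod_iso M (S_quot_dual pi).
Proof.
pose t x v : K := (T x v : SV)@_0%MM.
apply: (rank_one_modules hN hinj hnz hline M_simple M_nontrivial grM (g' := g') (t := t)).
- by move=> x a u v wu wv; rewrite /t T_lin //= mcoeffD mcoeffZ.
- move=> x j v wv; rewrite /t T_act //= mcoeffD !mcoeffZ.
  rewrite [X in sym_br _ X](homog0 (dhomog_is_dhomog (T x v))) (linear_funZ (sym_br_linr _)) sym_br1.
  by rewrite scaler0 mcoeff0 mulr0 addr0.
have [x [v wv Tv]] := T_neq0; exists x, v => //; apply: contra Tv => /eqP e; apply/eqP/val_inj.
by have := homog0 (dhomog_is_dhomog (T x v)); rewrite -/(t x v) e scale0r.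
Qed.

End DegreeZero.

Section DegreeOne.
Variables (g' : vec) (T : X -> M -> dhomog 2 K 1).
Hypothesis T_lin : forall x a u v, ws x u -> ws x v -> T x (a *: u + v) = a *: T x u + T x v.
Hypothesis T_act : forall x j v, ws x v -> T (x + j) (Lop j v) = tensor_rule (pi j) (g' + pi x) (T x v).
Hypothesis T_neq0 : exists x, exists2 v, ws x v & T x v != 0.

Let s x := g' + pi x + rho + 2^-1 *: rho.

Let co (w : vec) x v : K := (sym_br (sym_lin w) (T x v))@_0%MM.

Let coE w x v u : (T x v : SV) = sym_lin u -> co w x v = sympl w u.
Proof. by rewrite /co => ->; rewrite sym_br_lin mcoeffC eqxx mulr1. Qed.

Let co_lin w x a u v : ws x u -> ws x v -> co w x (a *: u + v) = a * co w x u + co w x v.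
Proof. by move=> wu wv; rewrite /co T_lin //= sym_br_linr mcoeffD mcoeffZ. Qed.

Let vecP x v : exists u : vec, (T x v : SV) = sym_lin u.
Proof. exact: homog1 (dhomog_is_dhomog (T x v)). Qed.

Let act1 x j v u : ws x v -> (T x v : SV) = sym_lin u -> (T (x + j) (Lop j v) : SV) =
  sym_lin (sympl (pi j + rho) (s x - 2^-1 *: rho) *: u
    + 2^-1 *: (sympl (pi j + rho) u *: pi j + sympl (pi j) u *: (pi j + rho))).
Proof.
move=> wv E; rewrite T_act //= E sym_brM !sym_br_lin.
rewrite !(linear_funD (@sym_lin_linear K), linear_funZ (@sym_lin_linear K)) /s addrK mul_mpolyC.
by rewrite [_ * _%:MP]mulrC mul_mpolyC -(linear_funD (@sym_lin_linear K)).
Qed.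

Let T_inj x v : ws x v -> T x v = 0 -> v = 0.
Proof.
apply: (weight_map_inj hinj M_simple grM T_lin) => // y j w ww Tw.
by rewrite T_act // Tw (linear_fun0 (@tensor_rule_linear _ _ _ _)).
Qed.

Let s_add x j : s (x + j) = s x + pi j.
Proof. by rewrite /s (raddfD pi); zmodring 'rV[R[i]]_2. Qed.

(** A form of degree one gives a function by contraction with its label; when
    all contractions vanish, the module consists of differentials. *)
Lemma degree_one_modules :
  [\/ exists2 G : coset pi, ~ coset_set G (- rho) /\ ~ coset_set G (- (2 *: rho)) & lmod_iso M (S_mod G),
     lmod_iso M (S_quot pi) | lmod_iso M (S_quot_dual pi)].
Proof.
have [ne|all0] := pselect (exists x, exists2 v, ws x v & co (s x) x v != 0).
  have tl x : forall a u v, ws x u -> ws x v -> co (s x) x (a *: u + v) = a * co (s x) x u + co (s x) x v by apply: co_lin.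
  have tact x j v : ws x v -> co (s (x + j)) (x + j) (Lop j v) = sympl (pi j + rho) (g' - 2^-1 *: rho + pi x + rho) * co (s x) x v.
    move=> wv; have [u uE] := vecP x v; rewrite (coE _ uE) (coE _ (act1 j wv uE)) s_add.
    by rewrite /s; move: (pi j) (pi x) => k y; rewrite /sympl !mxE; field.
  have [h|h] := rank_one_modules hN hinj hnz hline M_simple M_nontrivial grM (t := fun x => co (s x) x) tl tact ne.
    exact: Or31.
  exact: Or33.
have s0 x v u : ws x v -> (T x v : SV) = sym_lin u -> sympl (s x) u = 0.
  move=> wv uE; rewrite -(coE _ uE); apply/eqP/negPn/negP => h; apply: all0; by exists x, v.
have wE y : exists w : vec, s y != 0 -> forall u, sympl (s y) u = 0 -> u = sympl w u *: s y.
  have [->|sy] := eqVneq (s y) 0; first by exists 0.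
  have [x hx] := hline sy; exists (- (sympl (s y) (pi x))^-1 *: pi x) => _ u h.
  rewrite {1}(sympl_basis u hx) h mul0r scale0r addr0 symplZl mulNr -mulrN -symplC mulrC.
  by [].
pose w y := proj1_sig (cid (wE y)).
have wP y : s y != 0 -> forall u, sympl (s y) u = 0 -> u = sympl (w y) u *: s y by rewrite /w; case: cid.
pose t x v := co (w x) x v.
have ws1 y : s y != 0 -> sympl (w y) (s y) = 1.
  move=> sy; have := wP _ sy (s y) (symplxx _) => /esym/eqP.
  by rewrite -subr_eq0 -{3}[s y]scale1r -scalerBl scaler_eq0 (negPf sy) orbF subr_eq0 => /eqP.
have TE x v : ws x v -> s x != 0 -> (T x v : SV) = sym_lin (t x v *: s x).
  move=> wv sx; have [u uE] := vecP x v; rewrite uE /t (coE _ uE) -(wP _ sx _ (s0 _ _ _ wv uE)) //.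
have act2 x j v : ws x v -> s x != 0 -> (T (x + j) (Lop j v) : SV) = sym_lin ((sympl (pi j + rho) (s x) * t x v) *: s (x + j)).
  move=> wv sx; rewrite (act1 j wv (TE x v wv sx)) s_add; congr sym_lin.
  move: (s x) (pi j) (t x v) => a b c; apply/matrixP => p q; rewrite (ord1 p) {p} /sympl !mxE.
  case: q => -[|[|//]] lt.
    by have -> : Ordinal lt = 0 by [exact: val_inj]; field.
  by have -> : Ordinal lt = 1 by [exact: val_inj]; field.
have tact x j v : ws x v -> s x != 0 -> s (x + j) != 0 -> t (x + j) (Lop j v) = sympl (pi j + rho) (s x) * t x v.
  by move=> wv sx sxj; rewrite {1}/t (coE _ (act2 x j v wv sx)) symplZr ws1 // mulr1.
have zero x1 v : s x1 = 0 -> ws x1 v -> v = 0.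
  move=> sx1 wv; apply/eqP/negPn/negP => v0.
  have [j j0 Lj] := weight_moves hN hnz M_simple M_nontrivial wv v0; move/eqP: Lj; apply.
  apply: (missing_weight hinj M_simple grM (x := x1) _ _ (z := x1 + j)); last exact: Lop_wsp.
  - by exists v.
  - move=> i u i0 wu; apply: (T_inj (x := x1)); first by have := Lop_wsp i wu; rewrite subrK.
    have si : s (x1 - i) = - pi i by rewrite s_add sx1 add0r raddfN.
    have si0 : s (x1 - i) != 0.
      by rewrite si oppr_eq0; apply: contra i0 => /eqP; rewrite -(raddf0 pi) => /hinj ->.
    apply: val_inj; have := act2 _ i _ wu si0; rewrite subrK sx1 scaler0 => h.
    exact: etrans h (linear_fun0 (@sym_lin_linear K)).
  - by rewrite -subr_eq0 addrC addKr.
have sne x v : ws x v -> v != 0 -> s x != 0.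
  by move=> wv; apply: contraNneq => sx; apply/eqP/(zero x).
have tne : exists x, exists2 v, ws x v & t x v != 0.
  have [x [v wv Tv]] := T_neq0; exists x, v => //.
  have v0 : v != 0.
    apply: contraNneq Tv => ->; have w0 : ws x 0 by rewrite /wsp /= (linear_fun0 (Lop_lin _)) scaler0.
    by have := T_lin (-1) w0 w0; rewrite scaler0 addr0 scaleN1r addNr => ->.
  apply: contra Tv => /eqP e; apply/eqP/val_inj; have := TE _ _ wv (sne _ _ wv v0); rewrite e scale0r => h.
  exact: etrans h (linear_fun0 (@sym_lin_linear K)).
have tl x : forall a u v, ws x u -> ws x v -> t x (a *: u + v) = a * t x u + t x v by apply: co_lin.
clear act2 TE; clearbody t.
have [[x1 sx1]|nos] := pselect (exists x, s x = 0); last first.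
  have sn x : s x != 0 by apply/eqP => e; apply: nos; exists x.
  have tact' x j v : ws x v -> t (x + j) (Lop j v) = sympl (pi j + rho) (g' + 2^-1 *: rho + pi x + rho) * t x v.
    have e : g' + 2^-1 *: rho + pi x + rho = s x by rewrite /s; zmodring 'rV[R[i]]_2.
    by move=> wv; rewrite (tact _ _ _ wv (sn _) (sn _)) e.
  have [h|h] := rank_one_modules hN hinj hnz hline M_simple M_nontrivial grM tl tact' tne.
    exact: Or31.
  exact: Or33.
apply: Or32.
have sx x : s x = pi (x - x1) by rewrite -[LHS]subr0 -sx1 /s (raddfB pi); zmodring 'rV[R[i]]_2.
have sx0 x : (s x == 0) = (x == x1).
  rewrite sx -[x == x1]subr_eq0; apply/eqP/eqP => [e|->]; last exact: raddf0.
  by apply: hinj; rewrite e raddf0.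
have hl x a u v : ws x u -> ws x v -> t x (a *: u + v) *: qclass pi (x - x1) =
    a *: (t x u *: qclass pi (x - x1)) + t x v *: qclass pi (x - x1).
  by move=> wu wv; rewrite (tl x a u v wu wv) scalerDl scalerA.
have t0 x : t x 0 = 0.
  have w0 : ws x 0 by rewrite /wsp /= (linear_fun0 (Lop_lin _)) scaler0.
  by have := tl x (-1) _ _ w0 w0; rewrite scaler0 addr0 mulN1r addNr.
have hL x j v : ws x v -> t (x + j) (Lop j v) *: qclass pi (x + j - x1) = Lop j (t x v *: qclass pi (x - x1)).
  move=> wv; rewrite (linear_funZ (Lop_lin j)) qclass_act.
  have -> : x - x1 + j = x + j - x1 by rewrite addrAC.
  have [e|e] := eqVneq (x + j) x1; first by rewrite e subrr qclass0 !scaler0.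
  have [e1|e1] := eqVneq x x1.
    have sx00 : s x = 0 by rewrite e1.
    by rewrite (zero x v sx00 wv) (linear_fun0 (Lop_lin j)) !t0 !scale0r.
  by rewrite tact ?sx0 // sx scalerA mulrC.
have [Phi [Pl PL PE]] := graded_hom hinj grM hl hL.
have [x [v wv tv]] := tne.
have xx1 : x != x1.
  by rewrite -sx0; apply: (sne _ _ wv); apply: contraNneq tv => ->; rewrite t0.
apply: (hom_iso M_simple Pl PL).
  exists v; rewrite (PE _ _ wv); apply: scaler_neq0 => //.
  apply: contraTneq (oner_neq0 K) => e.
  have := qcoord_class hinj r_neq0 (x - x1) (x - x1); rewrite e subr_eq0 xx1 eqxx /= => <-.
  by rewrite (linear_fun0 (qcoord_linear r_neq0 _)) eqxx.
elim/quot_ind => [|p q [m1 <-] [m2 <-]|c y].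
- by exists 0; rewrite (linear_fun0 Pl).
- by exists (m1 + m2); rewrite (linear_funD Pl).
have [->|y0] := eqVneq y 0; first by exists 0; rewrite qclass0 scaler0 (linear_fun0 Pl).
pose j := x1 + y - x; have xj : x + j = x1 + y by rewrite /j addrC subrK.
have wj := Lop_wsp j wv; have tj : t (x + j) (Lop j v) != 0.
  rewrite tact ?sx0 // ?xj; last by rewrite -subr_eq0 addrC addKr.
  by rewrite mulf_neq0 // sx; apply: (sum_bracket_neq0 hnz); rewrite subr_eq0.
exists ((c / t (x + j) (Lop j v)) *: Lop j v); rewrite (linear_funZ Pl) (PE _ _ wj) scalerA mulfVK //.
by rewrite xj addrC addKr.
Qed.

End DegreeOne.

End LowDegree.

(** * The classification *)

Section Classification.
Variables (R : realType) (N : nat).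
Local Notation K := R[i].
Local Notation X := 'rV[int]_N.
Local Notation vec := 'rV[K]_2.
Variable pi : {additive X -> vec}.
Hypothesis hN : (1 < N)%N.
Hypothesis hinj : injective pi.
Hypothesis hnz : forall a b : X, b != 0 -> sympl (pi a + 2 *: rho) (pi b) != 0.
Hypothesis hline : forall v : vec, v != 0 -> exists x, sympl v (pi x) != 0.

Theorem classification (M : lieModule (W pi)) : lmod_simple M -> ~ lmod_trivial M -> cuspidal M ->
  [\/ exists2 G : coset pi,
        ~ coset_set G (- rho) /\ ~ coset_set G (- (2 *: rho)) &
        lmod_iso M (S_mod G),
      lmod_iso M (S_quot pi) \/ lmod_iso M (S_quot_dual pi) |
      exists2 n : nat, (2 <= n)%N &
        exists G : coset pi, lmod_iso M (M_mod n G)].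
Proof.
move=> sM nM [[S [g SE]] [grM [d dM]]]; subst S.
have dimM x : dim_le (wsp pi (Lop (M := M)) g x) d.
  by rewrite wsp_weight; apply: dM; exact: in_coset.
have [[|[|k]] [g' [T [Tl TL Tn]]]] := form_model hN hinj hnz sM nM grM dimM hline.
- by have [h|h] := degree_zero_modules hN hinj hnz hline sM nM grM Tl TL Tn; [apply: Or31 | apply: Or32; right].
- have [h|h|h] := degree_one_modules hN hinj hnz hline sM nM grM Tl TL Tn; [exact: Or31| |]; apply: Or32; by [left|right].
by apply: Or33; exists k.+2 => //; exists (coset_at pi g'); exact: (iso_forms hinj sM grM Tl TL Tn).
Qed.

End Classification.

(** * Isomorphisms between the models *)

(** Cosets with the same points are equal by proof irrelevance. *)
Lemma coset_rebase (K : numFieldType) (N : nat) (pi : {additive 'rV[int]_N -> 'rV[K]_2}) (G : coset pi) mu :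
  coset_set G mu -> G = coset_at pi mu.
Proof.
case: G => S [g SE] /=; subst S => -[_ [x _ <-] <-]; rewrite /coset_at.
have E : [set g + v | v in lattice pi] = [set g + pi x + v | v in lattice pi].
  apply/seteqP; split=> [_ [_ [y _ <-] <-]|_ [_ [y _ <-] <-]].
    by exists (pi (y - x)); [exists (y - x) | rewrite raddfB -addrA; congr (_ + _); rewrite addrC subrK].
  by exists (pi (x + y)); [exists (x + y) | rewrite raddfD addrA].
move: (ex_intro _ _ _) (ex_intro _ _ _); rewrite -E => p q; congr Coset; exact: Prop_irrelevance.
Qed.

Lemma lmod_iso_sym (K : fieldType) (L : lieAlgebra K) (P Q : lieModule L) : lmod_iso P Q -> lmod_iso Q P.
Proof.
move=> [f [fl [h fK hK] fL]]; exists h; split=> [a u v||x m].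
- by apply: (can_inj fK); rewrite fl !hK.
- by exists f.
- by apply: (can_inj fK); rewrite fL !hK.
Qed.

Section RankOneShift.
Variables (R : realType) (N : nat).
Local Notation K := R[i].
Local Notation X := 'rV[int]_N.
Local Notation vec := 'rV[K]_2.
Variable pi : {additive X -> vec}.
Hypothesis hinj : injective pi.
Hypothesis r_neq0 : forall b : X, b != 0 -> sympl rho (pi b) != 0.
Hypothesis hline : forall v : vec, v != 0 -> exists x, sympl v (pi x) != 0.
Hypothesis hN : exists a : X, a != 0.

Section Intertwiner.
Variables (F : X -> K) (s s' : vec) (y : K).
Hypothesis F_rule : forall x j, F (x + j) * sympl (pi j + rho) (s + pi x) = sympl (pi j + rho) (s' + pi x) * F x.
Hypothesis sE : s' = s + y *: rho.
Hypothesis y0 : y != 0.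

(** The product of [L_(-j)] and [L_j] is the same on both sides; it is a
    quadratic function of the label, so that two labels on a line parallel to
    [rho] are symmetric. *)
Let opposite x : F x != 0 -> 2 *: (s + pi x) + (y + 1) *: rho = 0.
Proof.
move=> Fx; apply: (lattice_orth hline) => j; have [->|j0] := eqVneq j 0.
  by rewrite raddf0 /sympl !mxE !mul0r subrr.
have e1 := F_rule x j; have := F_rule (x + j) (- j); rewrite addrK sE in e1 *.
rewrite (raddfD pi) (raddfN pi) => e2.
have H : F x * (y * sympl rho (pi j) * sympl (pi j) (2 *: (s + pi x) + (y + 1) *: rho)) = 0.
  have e3 := congr1 (fun z => z * sympl (pi j + rho) (s + pi x)) e2.
  have e4 := congr1 (fun z => sympl (- pi j + rho) (s + y *: rho + (pi x + pi j)) * z) e1.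
  move: e3 e4 => /= e3 e4.
  have e5 : F x * sympl (- pi j + rho) (s + (pi x + pi j)) * sympl (pi j + rho) (s + pi x) =
     sympl (- pi j + rho) (s + y *: rho + (pi x + pi j)) * (sympl (pi j + rho) (s + y *: rho + pi x) * F x).
    by rewrite e3 -e4 mulrA.
  move: e5; rewrite /sympl !mxE => e5.
  move/eqP: e5; rewrite eq_sym -subr_eq0 => /eqP <-; ring.
move/eqP: H; rewrite !mulf_eq0 (negPf Fx) (negPf y0) (negPf (r_neq0 j0)) /= => /eqP //.
Qed.

(** By [opposite] the coefficient map is supported at one label, so that the
    target has a trivial submodule there. *)
Lemma shifted_labels : F 0 != 0 -> s' = 0.
Proof.
move=> F0; have s0 := opposite F0; have [j j0] := hN.
have Fj : F j = 0.
  apply/eqP/negPn/negP => Fj; have := opposite Fj; rewrite raddf0 addr0 in s0.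
  have -> : 2 *: (s + pi j) + (y + 1) *: rho = 2 *: s + (y + 1) *: rho + 2 *: pi j by rewrite scalerDr addrAC.
  rewrite s0 add0r => /eqP; rewrite scaler_eq0 pnatr_eq0 /= => /eqP e.
  by move: j0; rewrite -(raddf0 pi) in e; rewrite (hinj e) eqxx.
have := F_rule 0 j; rewrite add0r Fj mul0r => /esym/eqP; rewrite mulf_eq0 (negPf F0) orbF raddf0 addr0.
rewrite raddf0 addr0 in s0.
have sv : s = (- (2^-1 * (y + 1))) *: rho.
  apply: (scalerI (a := 2)); first by rewrite pnatr_eq0.
  move/eqP: s0; rewrite addr_eq0 => /eqP ->; rewrite scalerA -scaleNr; congr (_ *: _).
  by field.
have -> : s' = (2^-1 * (y - 1)) *: rho by rewrite sE sv -scalerDl; congr (_ *: _); field.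
have -> : sympl (pi j + rho) ((2^-1 * (y - 1)) *: rho) = - (2^-1 * (y - 1)) * sympl rho (pi j).
  by rewrite /sympl !mxE; ring.
rewrite mulf_eq0 (negPf (r_neq0 j0)) orbF oppr_eq0 => /eqP ->; exact: scale0r.
Qed.

End Intertwiner.

(** The rule at [j = 0] places the two labels on a line parallel to [rho]. *)
Lemma rank_one_shift (F : X -> K) (s s' : vec) :
  (forall x j, F (x + j) * sympl (pi j + rho) (s + pi x) = sympl (pi j + rho) (s' + pi x) * F x) ->
  F 0 != 0 -> s = s' \/ s' = 0.
Proof.
move=> FR F0; have [->|d0] := eqVneq s' s; [by left | right].
have := FR 0 0; rewrite addr0 raddf0 add0r !addr0 mulrC => /(mulIf F0) e.
have [y [y0 yE]] : exists y, y != 0 /\ s' - s = y *: rho.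
  apply: sympl_parallel; rewrite ?rho_neq0 ?subr_eq0 //.
  by rewrite symplDr -scaleN1r symplZr e mulN1r subrr.
by apply: (shifted_labels FR _ y0 F0); rewrite -yE addrC subrK.
Qed.

(** A family of vectors that behaves like the basis of a module of densities;
    some of them may be zero. *)
Definition rank_source (P : lieModule (W pi)) (s : vec) := exists e : X -> P,
  (forall x j, Lop j (e x) = sympl (pi j + rho) (s + pi x) *: e (x + j)) /\ exists x, e x != 0.

(** A separating family of linear forms that behaves like the coordinates of a
    module of densities. *)
Definition rank_target (P : lieModule (W pi)) (s : vec) := exists c : X -> P -> K,
  [/\ forall x m m' a, c x (a *: m + m') = a * c x m + c x m',
      forall x j m, c (x + j) (Lop j m) = sympl (pi j + rho) (s + pi x) * c x m &
      forall m, (forall x, c x m = 0) -> m = 0].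

Lemma rank_one_iso (P P' : lieModule (W pi)) s s' : rank_source P s -> rank_target P' s' -> lmod_iso P P' ->
  (exists x, s = s' + pi x) \/ (exists x, s' + pi x = 0).
Proof.
move=> [e [eL [x0 ex0]]] [c [cl cL cs]] [f [fl [h fK _] fL]].
have fe : f (e x0) != 0.
  by apply: contra ex0 => /eqP h0; apply/eqP/(can_inj fK); rewrite h0 (linear_fun0 fl).
have [x1 cx1] : exists x1, c x1 (f (e x0)) != 0.
  apply: contrapT => hh; move/eqP: fe; apply; apply: cs => x.
  by apply/eqP/negPn/negP => h0; apply: hh; exists x.
have c0 x : c x 0 = 0.
  by have := cl x 0 0 (-1); rewrite scaler0 addr0 mulN1r addNr.
have [] := @rank_one_shift (fun x => c (x1 + x) (f (e (x0 + x)))) (s + pi x0) (s' + pi x1).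
- move=> x j; have := cL (x1 + x) j (f (e (x0 + x))); rewrite /Lop -fL.
  have -> : lact (L_ (lat pi j)) (e (x0 + x)) = sympl (pi j + rho) (s + pi (x0 + x)) *: e (x0 + x + j) by exact: eL.
  rewrite (linear_funZ fl) -[_ *: f _]addr0 cl c0 addr0 !(raddfD pi) !addrA mulrC => ->.
  by [].
- by rewrite !addr0.
- move=> E; left; exists (x1 - x0); apply: (addIr (pi x0)); rewrite E -addrA; congr (_ + _).
  by rewrite raddfB subrK.
- by move=> E; right; exists x1.
Qed.

Lemma S_mod_source g : rank_source (S_mod (coset_at pi g)) (g + rho).
Proof.
exists (fun x => dsum_single (in_coset pi g x) (1 : K^o)); split=> [x j|].
  rewrite S_mod_single; apply: dsum_inj; rewrite /= -(linear_funZ (@single_linear _ _ _ _)); congr single.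
  by congr (_ * _); congr sympl; rewrite addrAC.
exists 0; apply/eqP => /(congr1 (fun f : dsum (coset_at pi g) _ => f (g + pi 0))) /=.
by rewrite /single eqxx => /eqP; rewrite oner_eq0.
Qed.

Lemma S_mod_target g : rank_target (S_mod (coset_at pi g)) (g + rho).
Proof.
exists (fun x m => (m : dsum _ _) (g + pi x)); split=> [//|x j m|m h].
  by rewrite S_mod_coord; congr (sympl _ _ * _); rewrite addrAC.
apply: dsum_inj; apply/funext => mu; apply/eqP/negPn/negP => h0.
have [_ [x _ <-] E] := (dsum_supp m).2 mu h0.
by move: h0; rewrite -E h eqxx.
Qed.

Lemma S_quot_source : rank_source (S_quot pi) 0.
Proof.
exists (qclass pi); split=> [x j|]; first by rewrite qclass_act add0r.
have [a a0] := hN; exists a; apply: contraTneq (oner_neq0 K) => e.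
have := qcoord_class hinj r_neq0 a a; rewrite e a0 eqxx /= => <-.
by rewrite (linear_fun0 (qcoord_linear r_neq0 _)) eqxx.
Qed.

Lemma S_quot_dual_target : rank_target (S_quot_dual pi) (- rho).
Proof.
exists (fun x phi => (phi : rdual _ _) (qclass pi (- x))); split=> [//|x j phi|phi h].
  have [pl _] := rdualP (phi : rdual _ _).
  have -> : (Lop j phi : rdual _ _) (qclass pi (- (x + j))) = - (phi : rdual _ _) (Lop j (qclass pi (- (x + j)))) by [].
  rewrite qclass_act (linear_funZ pl) opprD subrK -mulNr; congr (_ * _).
  by rewrite (raddfB pi) (raddfN pi); move: (pi j) (pi x) => u v; rewrite /sympl !mxE; ring.
have [l _ ->] := qdual_span hinj r_neq0 phi.
rewrite big1_seq // => x _; have := h (- x); rewrite opprK => ->; exact: scale0r.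
Qed.

End RankOneShift.

Lemma lincomb_eq (K : fieldType) (A : lmodType K) (c : K) (u u' v v' : A) : u = u' -> v = v' ->
  c *: u + v = c *: u' + v'.
Proof. by move=> -> ->. Qed.

Lemma linear_fourth (K : fieldType) (A B : lmodType K) (L : A -> B) f0 f1 f2 f3 f4 g0 g1 g2 g3 g4 : linear L ->
  L f0 = g0 -> L f1 = g1 -> L f2 = g2 -> L f3 = g3 -> L f4 = g4 ->
  L (f0 - 4 *: f1 + 6 *: f2 - 4 *: f3 + f4) = g0 - 4 *: g1 + 6 *: g2 - 4 *: g3 + g4.
Proof.
move=> Ll; have LD u v : L (u + v) = L u + L v := linear_funD Ll u v.
have LN u : L (- u) = - L u := linear_funN Ll u.
have LZ c u : L (c *: u) = c *: L u := linear_funZ Ll c u.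
by rewrite !(LD, LN, LZ) => -> -> -> -> ->.
Qed.

Section FormIntertwiners.
Variables (K : numFieldType) (N : nat).
Local Notation X := 'rV[int]_N.
Local Notation vec := 'rV[K]_2.
Local Notation SV := {mpoly K[2]}.
Variable pi : {additive X -> vec}.
Hypothesis hline : forall v : vec, v != 0 -> exists x, sympl v (pi x) != 0.

Definition casimir (p : SV) : SV := sym_br (fR K * fM K) (sym_br (fR K * fM K) p)
  + (- 2^-1) *: (sym_br (fR K * fR K) (sym_br (fM K * fM K) p) + sym_br (fM K * fM K) (sym_br (fR K * fR K) p)).

Lemma casimir_linear : linear casimir.
Proof.
exact: (quadratic_operator_linear (@sym_br_linr K)).
Qed.

(** The monomials in [fR] and [fM] are eigenvectors of [fR * fM], and the two
    other terms raise and lower their exponents and return. *)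
Lemma casimir_form n (p : SV) : p \is n.-homog for mdeg -> casimir p = (n * n.+2)%:R *: p.
Proof.
have hs (c : K) (q : SV) (Q : SV) : sym_br Q (c *: q) = c *: sym_br Q q := linear_funZ (sym_br_linr Q) c q.
move=> /form_coords[c ->].
elim: (index_enum _) => [|j s IH]; first by rewrite !big_nil (linear_fun0 casimir_linear) scaler0.
rewrite !big_cons (casimir_linear (c j)) IH [RHS]scalerDr; congr (_ + _); rewrite [RHS]scalerA [_ * c j]mulrC -[RHS]scalerA; congr (_ *: _).
have jn : (j <= n)%N by rewrite -ltnS.
have en : ((n * n.+2)%:R : K) = (j%:R + (n - j)%:R) * (j%:R + (n - j)%:R + 2).
  by rewrite -natrD subnKC // -natrD -natrM addn2.
rewrite en; move: (nat_of_ord j) (n - j)%N => i m.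
have e2 a b : sym_br (fM K * fM K) (fR K ^+ a * fM K ^+ b) = (- (2 * a%:R)) *: (fR K ^+ a.-1 * fM K ^+ b.+1).
  apply: (scalerI (a := 2^-1)); first by rewrite invr_neq0 // pnatr_eq0.
  by rewrite br_M2 scalerA mulrN mulKf // pnatr_eq0.
have f2 a b : sym_br (fR K * fR K) (fR K ^+ a * fM K ^+ b) = (2 * b%:R) *: (fR K ^+ a.+1 * fM K ^+ b.-1).
  apply: (scalerI (a := 2^-1)); first by rewrite invr_neq0 // pnatr_eq0.
  by rewrite br_R2 scalerA mulKf // pnatr_eq0.
have H1 : sym_br (fR K * fM K) (sym_br (fR K * fM K) (fR K ^+ i * fM K ^+ m)) =
    ((m%:R - i%:R) * (m%:R - i%:R)) *: (fR K ^+ i * fM K ^+ m) by rewrite br_RMm hs br_RMm scalerA.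
have H2 : sym_br (fR K * fR K) (sym_br (fM K * fM K) (fR K ^+ i * fM K ^+ m)) =
    (- (2 * i%:R) * (2 * (m%:R + 1))) *: (fR K ^+ i * fM K ^+ m).
  rewrite e2 hs f2 scalerA -[m.+1%:R]natr1.
  by case: i {H1} => [|i] //=; rewrite mulr0 oppr0 mul0r !scale0r.
have H3 : sym_br (fM K * fM K) (sym_br (fR K * fR K) (fR K ^+ i * fM K ^+ m)) =
    (2 * m%:R * - (2 * (i%:R + 1))) *: (fR K ^+ i * fM K ^+ m).
  rewrite f2 hs e2 scalerA -[i.+1%:R]natr1.
  by case: m {H1 H2} => [|m] //=; rewrite mulr0 mul0r !scale0r.
rewrite /casimir H1 H2 H3.
move: (fR K ^+ i * fM K ^+ m) (i%:R : K) (m%:R : K) => q a b; by modred K {mpoly K[2]}; field.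
Qed.

Lemma tstep_homog n (a b : vec) (p : SV) : p \is n.-homog for mdeg -> tstep a b p \is n.-homog for mdeg.
Proof.
move=> pn; apply: rpredD; apply: rpredZ => //; apply: sym_br_homog => //.
exact: dhomogM (sym_lin_homog _) (sym_lin_homog _).
Qed.

Section Intertwiner.
Variables (n n' : nat) (F : X -> SV -> SV) (g g' : vec).
Hypothesis n2 : (1 < n)%N.
Hypothesis F_lin : forall x, linear (F x).
Hypothesis F_homog : forall x p, F x p \is n'.-homog for mdeg.
Hypothesis F_step : forall x j p, p \is n.-homog for mdeg ->
  F (x + j) (tstep (pi j) (g + pi x) p) = tstep (pi j) (g' + pi x) (F x p).

Let F_square x z j p : p \is n.-homog for mdeg ->
  let A := sym_br (sym_lin (pi j) * sym_lin (pi j)) in F z (A (A p)) = A (A (F x p)).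
Proof.
move=> pn A; have six : (6%:R : K) != 0 by rewrite pnatr_eq0.
have G (t : nat) : F z (tstep (pi (z - x) - t%:R *: pi j) (g + pi x + t%:R *: pi j) (tstep (t%:R *: pi j) (g + pi x) p)) =
    tstep (pi (z - x) - t%:R *: pi j) (g' + pi x + t%:R *: pi j) (tstep (t%:R *: pi j) (g' + pi x) (F x p)).
  have pt : pi (j *+ t) = t%:R *: pi j by rewrite raddfMn scaler_nat.
  have ez : x + j *+ t + (z - x - j *+ t) = z by zmodring 'rV[int]_N.
  have e1 : pi (z - x - j *+ t) = pi (z - x) - t%:R *: pi j by rewrite (raddfB pi) pt.
  have e2 b : b + pi (x + j *+ t) = b + pi x + t%:R *: pi j by rewrite (raddfD pi) pt addrA.
  have := F_step (x + j *+ t) (z - x - j *+ t) (tstep_homog (pi (j *+ t)) (g + pi x) pn).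
  by rewrite (F_step _ _ pn) ez e1 !e2 pt.
apply: (scalerI six); rewrite -(linear_funZ (F_lin z)).
rewrite -(tstep_fourth (pi j) (pi (z - x)) (g + pi x) p) -(tstep_fourth (pi j) (pi (z - x)) (g' + pi x) (F x p)).
exact: linear_fourth (F_lin z) (G 0%N) (G 1%N) (G 2%N) (G 3%N) (G 4%N).
Qed.

Let Qf j := sym_lin (pi j) * sym_lin (pi j + rho).

Let F_Q x j p : p \is n.-homog for mdeg -> F (x + j) (sym_br (Qf j) p) =
  2 *: (sympl (pi j + rho) (g' + pi x + rho) *: F x p) + sym_br (Qf j) (F x p)
  - 2 *: (sympl (pi j + rho) (g + pi x + rho) *: F (x + j) p).
Proof.
move=> pn; have := F_step x j pn; rewrite /tstep -/(Qf j).
rewrite (linear_funD (F_lin (x + j))) !(linear_funZ (F_lin (x + j))) => e.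
have two : (2 : K) != 0 by rewrite pnatr_eq0.
have -> : F (x + j) (sym_br (Qf j) p) = 2 *: (2^-1 *: F (x + j) (sym_br (Qf j) p)) by rewrite scalerA mulfV // scale1r.
rewrite -[2^-1 *: F _ _](addKr (sympl (pi j + rho) (g + pi x + rho) *: F (x + j) p)) e.
move: (sym_br (Qf j) (F x p)) (F x p) (F (x + j) p) => u v w.
by modred K {mpoly K[2]}; field.
Qed.

(** The forms on which all coefficient maps agree are an invariant subspace;
    it contains the values of the squares in [F_square], so it is everything. *)
Let F_const p x : p \is n.-homog for mdeg -> F x p = F 0 p.
Proof.
move=> pn; pose J : set SV := [set q | q \is n.-homog for mdeg /\ forall x, F x q = F 0 q].
suff [_ H] : J p by [].
have sJ : subspace J.
  split=> [|a u v [un hu] [vn hv]]; first by split=> [|y]; [exact: rpred0 | rewrite !(linear_fun0 (F_lin _))].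
  split=> [|y]; first by rewrite rpredD // rpredZ.
  by rewrite !F_lin hu hv.
apply: (forms_irreducible sJ) pn => [v q [qn hq]|].
  split; first by apply: sym_br_homog => //; exact: dhomogM (sym_lin_homog _) (sym_lin_homog _).
  pose Y : set SV := [set Q | forall q, J q -> forall x, F x (sym_br Q q) = F 0 (sym_br Q q)].
  suff YY : Y (sym_lin v * sym_lin v) by apply: YY.
  apply: (squares_span hline) => [|j w [wn hw] y].
    split=> [w _ y|c Q Q' hQ hQ' w Jw y]; first by rewrite (linear_fun0 (sym_br_linl w)) !(linear_fun0 (F_lin _)).
    rewrite (sym_br_linl w c Q Q') (F_lin y c (sym_br Q w)) (F_lin 0 c (sym_br Q w)).
    exact: lincomb_eq (hQ w Jw y) (hQ' w Jw y).
  have E y' : F y' (sym_br (Qf j) w) = 2 *: (sympl (pi j + rho) (g' - g) *: F 0 w) + sym_br (Qf j) (F 0 w).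
    have := F_Q (y' - j) j wn; rewrite subrK !hw => ->.
    move: (sym_br (Qf j) (F 0 w)) (F 0 w) => u t.
    have -> : sympl (pi j + rho) (g' - g) = sympl (pi j + rho) (g' + pi (y' - j) + rho) - sympl (pi j + rho) (g + pi (y' - j) + rho).
      by move: (pi j) (pi (y' - j)) => a b; rewrite /sympl !mxE; ring.
    by modring K {mpoly K[2]}.
  by rewrite -/(Qf j) !E.
have Rn : fR K ^+ n \is n.-homog for mdeg.
  have := dhomogMn n (sym_lin_homog (rho : vec)); by rewrite mul1n.
have R0 : fR K ^+ n != 0.
  apply: expf_neq0; apply/eqP => e; have := br_RM K; rewrite e (linear_fun0 (sym_br_linl _)) => /esym/eqP.
  by rewrite oner_eq0.
have [j hj] := square_square_neq0 hline n2 Rn R0.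
have q2 : sym_lin (pi j) * sym_lin (pi j) \is 2.-homog for mdeg.
  exact: dhomogM (sym_lin_homog _) (sym_lin_homog _).
have hn := sym_br_homog q2 (sym_br_homog q2 Rn).
exists (sym_br (sym_lin (pi j) * sym_lin (pi j)) (sym_br (sym_lin (pi j) * sym_lin (pi j)) (fR K ^+ n))); last by rewrite hj andbT; exact: hn.
by split=> // y; rewrite !(F_square 0).
Qed.

Hypothesis F_neq0 : exists2 p, p \is n.-homog for mdeg & F 0 p != 0.

Let F_Q0 j p : p \is n.-homog for mdeg -> F 0 (sym_br (Qf j) p) =
  sym_br (Qf j) (F 0 p) + (2 * sympl (pi j + rho) (g' - g)) *: F 0 p.
Proof.
move=> pn; have := F_Q (- j) j pn; rewrite addNr (F_const (- j) pn) => ->.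
move: (sym_br (Qf j) (F 0 p)) (F 0 p) => u t.
have -> : sympl (pi j + rho) (g' - g) = sympl (pi j + rho) (g' + pi (- j) + rho) - sympl (pi j + rho) (g + pi (- j) + rho).
  by move: (pi j) (pi (- j)) => a b; rewrite /sympl !mxE; ring.
by modring K {mpoly K[2]}.
Qed.

Let F_comm (u v : vec) p : p \is n.-homog for mdeg ->
  F 0 (sym_br (sym_lin u * sym_lin v) p) = sym_br (sym_lin u * sym_lin v) (F 0 p).
Proof.
pose Y : set SV := [set Q | forall p, p \is n.-homog for mdeg -> F 0 (sym_br Q p) = sym_br Q (F 0 p)].
suff YY : Y (sym_lin u * sym_lin v) by apply: YY.
apply: (lattice_squares_span hline) => [|j w wn].
  split=> [w _|c Q Q' hQ hQ' w Jw]; first by rewrite !(linear_fun0 (sym_br_linl _)) (linear_fun0 (F_lin _)).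
  rewrite (sym_br_linl w c Q Q') (sym_br_linl (F 0 w) c Q Q') (F_lin 0 c (sym_br Q w)).
  exact: lincomb_eq (hQ w Jw) (hQ' w Jw).
have [q qn Fq] := F_neq0.
have slin := @sym_lin_linear K.
have e0 : sympl rho (g' - g) = 0.
  have := F_Q0 0 qn; rewrite /Qf raddf0 (linear_fun0 slin) mul0r !(linear_fun0 (sym_br_linl _)) (linear_fun0 (F_lin 0)) !add0r.
  by move/esym/eqP; rewrite scaler_eq0 (negPf Fq) orbF mulf_eq0 pnatr_eq0 /= => /eqP.
have E : sym_lin (pi j) * sym_lin (pi j) = 2^-1 *: (Qf (j *+ 2) + (- 2) *: Qf j).
  have e2 : sym_lin (pi (j *+ 2)) = 2 *: sym_lin (pi j) by rewrite raddfMn -scaler_nat (linear_funZ slin).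
  by rewrite /Qf !(linear_funD slin _ rho) e2 -square_from_shifts.
have bl (Q Q' p' : SV) (c c' : K) : sym_br (c *: (Q + c' *: Q')) p' = c *: (sym_br Q p' + c' *: sym_br Q' p').
  by rewrite (linear_funZ (sym_br_linl p')) (linear_funD (sym_br_linl p')) (linear_funZ (sym_br_linl p')).
rewrite E !bl (linear_funZ (F_lin 0)) (linear_funD (F_lin 0)) (linear_funZ (F_lin 0)) !F_Q0 //.
have -> : pi (j *+ 2) = 2 *: pi j by rewrite raddfMn -scaler_nat.
rewrite !symplDl e0 symplZl.
move: (sym_br (Qf (j *+ 2)) (F 0 w)) (sym_br (Qf j) (F 0 w)) (F 0 w) (sympl (pi j) (g' - g)) => a b t c.
by modred K {mpoly K[2]}; field.
Qed.

(** The coefficient maps commute with sl2, and what remains of their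
    equivariance is the pairing of the lattice with the difference of the labels.
    *)
Lemma intertwiner_label : g = g'.
Proof.
have [q qn Fq] := F_neq0.
have e j : sympl (pi j + rho) (g' - g) = 0.
  have := F_Q0 j qn; rewrite F_comm // -[X in X = _]addr0 => /addrI/esym/eqP.
  by rewrite scaler_eq0 (negPf Fq) orbF mulf_eq0 pnatr_eq0 /= => /eqP.
apply/esym/eqP; rewrite -subr_eq0; apply/eqP/(lattice_orth hline) => j.
have := e j; rewrite symplDl; have := e 0; rewrite raddf0 add0r => ->; by rewrite addr0.
Qed.

Lemma intertwiner_degree : n = n'.
Proof.
have [q qn Fq] := F_neq0.
have hh (u v : vec) (p : SV) : p \is n.-homog for mdeg -> sym_br (sym_lin u * sym_lin v) p \is n.-homog for mdeg.
  by apply: sym_br_homog; exact: dhomogM (sym_lin_homog _) (sym_lin_homog _).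
have := casimir_form (F_homog 0 q); have : F 0 (casimir q) = casimir (F 0 q).
  have FL a b c a' b' c' : F 0 a = a' -> F 0 b = b' -> F 0 c = c' -> F 0 (a + (- 2^-1) *: (b + c)) = a' + (- 2^-1) *: (b' + c').
    by rewrite (linear_funD (F_lin 0)) (linear_funZ (F_lin 0)) (linear_funD (F_lin 0)) => -> -> ->.
  have F2 (u v w z : vec) : F 0 (sym_br (sym_lin u * sym_lin v) (sym_br (sym_lin w * sym_lin z) q)) =
      sym_br (sym_lin u * sym_lin v) (sym_br (sym_lin w * sym_lin z) (F 0 q)).
    by rewrite (F_comm u v (hh w z q qn)) (F_comm w z qn).
  exact: FL (F2 rho (emu K) rho (emu K)) (F2 rho rho (emu K) (emu K)) (F2 (emu K) (emu K) rho rho).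
rewrite (casimir_form qn) (linear_funZ (F_lin 0)) => <- /eqP.
rewrite -subr_eq0 -scalerBl scaler_eq0 (negPf Fq) orbF subr_eq0 eqr_nat => /eqP e; nia.
Qed.

End Intertwiner.

Lemma fRn_homog n : fR K ^+ n \is n.-homog for mdeg.
Proof. by have := dhomogMn n (sym_lin_homog (rho : vec)); rewrite mul1n. Qed.

Lemma fMn_homog n : fM K ^+ n \is n.-homog for mdeg.
Proof. by have := dhomogMn n (sym_lin_homog (emu K)); rewrite mul1n. Qed.

Lemma fRn_neq0 n : fR K ^+ n != 0.
Proof.
apply: expf_neq0; apply/eqP => e; have := br_RM K; rewrite e (linear_fun0 (sym_br_linl _)) => /esym/eqP.
by rewrite oner_eq0.
Qed.

End FormIntertwiners.

Section FormModules.
Variables (R : realType) (N : nat).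
Local Notation K := R[i].
Local Notation X := 'rV[int]_N.
Local Notation vec := 'rV[K]_2.
Local Notation SV := {mpoly K[2]}.
Variable pi : {additive X -> vec}.
Hypothesis hinj : injective pi.
Hypothesis r_neq0 : forall b : X, b != 0 -> sympl rho (pi b) != 0.
Hypothesis hline : forall v : vec, v != 0 -> exists x, sympl v (pi x) != 0.

(** The coefficient maps of an isomorphism are extended to all polynomials by
    projection to the forms of degree [n]. *)
Lemma forms_iso_eq n n' g g' : (1 < n)%N ->
  lmod_iso (M_mod n (coset_at pi g)) (M_mod n' (coset_at pi g')) -> n = n' /\ coset_at pi g = coset_at pi g'.
Proof.
move=> n2 [f [fl [h fK _] fL]].
pose ih (p : SV) : dhomog 2 K n := DHomog (pihomogP mdeg n p).
have ihl : linear ih by move=> a p q; apply: val_inj => /=; rewrite linearP.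
have ihE p : p \is n.-homog for mdeg -> (ih p : SV) = p by move=> pn /=; exact: pihomog_dE.
pose sg x u : M_mod n (coset_at pi g) := dsum_single (in_coset pi g x) u.
have sgl x : linear (sg x) by move=> a u v; apply: dsum_inj; exact: single_linear.
have u0 : f (sg 0 (ih (fR K ^+ n))) != 0.
  apply: contra (fRn_neq0 K n) => /eqP e; have := can_inj fK (etrans e (esym (linear_fun0 fl))).
  move=> /(congr1 (fun m : dsum (coset_at pi g) (dhomog 2 K n) => (m (g + pi 0) : SV))) /=.
  rewrite /single eqxx => e'; apply/eqP; rewrite -[LHS](ihE _ (fRn_homog K n)); exact: e'.
have [x1 hx1] : exists x1, (f (sg 0 (ih (fR K ^+ n))) : dsum _ _) (g' + pi x1) != 0.
  apply: contrapT => hh; move/eqP: u0; apply; apply: dsum_inj; apply/funext => mu; apply/eqP/negPn/negP => h0.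
  have [_ [x _ <-] E] := (dsum_supp (f (sg 0 (ih (fR K ^+ n))) : dsum _ _)).2 mu h0.
  by apply: hh; exists x; rewrite E.
pose F x (p : SV) : SV := (f (sg x (ih p)) : dsum _ _) (g' + pi x1 + pi x).
have F_lin x : linear (F x) by move=> a p q; rewrite /F ihl sgl fl.
have F_homog x p : F x p \is n'.-homog for mdeg by exact: dhomog_is_dhomog.
have F_step x j p : p \is n.-homog for mdeg ->
    F (x + j) (tstep (pi j) (g + pi x) p) = tstep (pi j) (g' + pi x1 + pi x) (F x p).
  move=> pn; rewrite /F.
  have -> : ih (tstep (pi j) (g + pi x) p) = tensor_rule (pi j) (g + pi x) (ih p).
    apply: val_inj; have -> : \val (ih (tstep (pi j) (g + pi x) p)) = tstep (pi j) (g + pi x) p by exact: ihE (tstep_homog _ _ pn).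
    by rewrite /= -/(ih p) -[pihomog _ _ _]/(ih p : SV) ihE.
  have -> : sg (x + j) (tensor_rule (pi j) (g + pi x) (ih p)) = lact (L_ (lat pi j)) (sg x (ih p)).
    exact: esym (M_mod_single pi g x j _).
  rewrite fL; have -> : g' + pi x1 + pi (x + j) = pi j + (g' + pi x1 + pi x) by rewrite (raddfD pi); zmodring 'rV[R[i]]_2.
  have -> : (lact (L_ (lat pi j)) (f (sg x (ih p))) : dsum _ _) (pi j + (g' + pi x1 + pi x)) =
      tensor_rule (pi j) (g' + pi x1 + pi x) ((f (sg x (ih p)) : dsum _ _) (g' + pi x1 + pi x)).
    exact: bilin_single_eval.
  by [].
have F_neq0 : exists2 p, p \is n.-homog for mdeg & F 0 p != 0.
  exists (fR K ^+ n); first exact: fRn_homog.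
  rewrite /F raddf0 addr0; apply: contra hx1 => /eqP e; apply/eqP/val_inj; exact: e.
split; first exact: (intertwiner_degree hline n2 F_lin F_homog F_step F_neq0).
rewrite (intertwiner_label hline n2 F_lin F_step F_neq0).
by apply/esym/coset_rebase; exact: in_coset.
Qed.

(** The functions [c x] separate vectors and belong to distinct eigenvalues of
    [L 0], which forces the eigenspaces of [L 0] to have dimension at most one. *)
Definition weight_lines (P : lieModule (W pi)) := exists (c : X -> P -> K) (w : X -> K),
  [/\ forall x m m' a, c x (a *: m + m') = a * c x m + c x m',
      forall x m, c x (Lop 0 m) = w x * c x m, injective w &
      forall m, (forall x, c x m = 0) -> m = 0].

Lemma rank_target_lines P s : rank_target P s -> weight_lines P.
Proof.
move=> [c [cl cL cs]]; exists c, (fun x => sympl rho (s + pi x)); split=> // [x m|x y].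
  by have := cL x 0 m; rewrite addr0 raddf0 add0r.
rewrite !symplDr => /addrI e; apply/eqP; rewrite -subr_eq0; apply/negPn/negP => /r_neq0.
by rewrite raddfB symplDr -scaleN1r symplZr mulN1r e subrr eqxx.
Qed.

Lemma S_quot_lines : weight_lines (S_quot pi).
Proof.
exists (@qcoord _ _ pi), (fun x => sympl rho (pi x)); split=> [x m m' a|x m|x y|m h].
- exact: qcoord_linear r_neq0 _ _ _ _.
- have [->|x0] := eqVneq x 0; first by rewrite /qcoord eqxx mulr0.
  by rewrite qcoord_act // subr0 raddf0 add0r.
- move=> e; apply/eqP; rewrite -subr_eq0; apply/negPn/negP => /r_neq0.
  by rewrite raddfB symplDr -scaleN1r symplZr mulN1r e subrr eqxx.
rewrite -[m]of_lquotK; rewrite -[m]of_lquotK in h; move: (of_lquot m) h => {}m h.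
rewrite -(linear_fun0 (to_lquot_linear (C_L_mrho pi))); apply/to_lquotP; rewrite subr0.
exists ((m : dsum _ _) (- rho)); apply: dsum_inj; apply/funext => mu.
have [mu0|mu0] := eqVneq mu (- rho).
  have e : single (- rho : vec) (1 : K^o) (- rho) = 1 by rewrite /single; case: eqP.
  by rewrite mu0; apply: esym (etrans (congr1 (fun z => (m : dsum _ _) (- rho) * z) e) (mulr1 _)).
transitivity (0 : K); last first.
  have e : single (- rho) (1 : K^o) mu = 0 by rewrite /single (negPf mu0).
  exact: esym (etrans (congr1 (fun z => (m : dsum _ _) (- rho) * z) e) (mulr0 _)).
apply/eqP/negPn/negP => hm; have [_ [x _ <-] E] := (dsum_supp (m : dsum _ _)).2 mu hm.
have := h x; rewrite (qcoordE r_neq0); case: (x =P 0) => [x0|_]; first by move: mu0; rewrite -E x0 raddf0 addr0 eqxx.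
by rewrite E => e; move: hm; rewrite e eqxx.
Qed.

(** A label carries the two independent forms [fR ^+ n] and [fM ^+ n]. *)
Lemma forms_not_lines n g (P : lieModule (W pi)) : (0 < n)%N -> weight_lines P -> ~ lmod_iso (M_mod n (coset_at pi g)) P.
Proof.
move=> n0 [c [w [cl cL winj cs]]] [f [fl [h fK _] fL]].
pose sg u : M_mod n (coset_at pi g) := dsum_single (in_coset pi g 0) u.
have sgl : linear sg by move=> a u v; apply: dsum_inj; exact: single_linear.
pose u1 : dhomog 2 K n := DHomog (fRn_homog K n); pose u2 : dhomog 2 K n := DHomog (fMn_homog K n).
have c0 x : c x 0 = 0 by have := cl x 0 0 (-1); rewrite scaler0 addr0 mulN1r addNr.
have sL u : Lop 0 (sg u) = sympl rho g *: sg u.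
  have e : Lop 0 (sg u) = dsum_single (in_coset pi g (0 + 0)) (tensor_rule (pi 0) (g + pi 0) u) := M_mod_single pi g 0 0 u.
  rewrite e -(linear_funZ sgl) /sg; apply: dsum_inj; rewrite /= addr0; congr single.
  apply: val_inj; rewrite /= !raddf0 addr0 add0r (linear_fun0 (@sym_lin_linear K)) mul0r.
  by rewrite (linear_fun0 (sym_br_linl _)) scaler0 addr0 symplDr symplxx addr0.
have ev x u : (w x - sympl rho g) * c x (f (sg u)) = 0.
  have := cL x (f (sg u)); rewrite /Lop -fL -/(Lop 0 (sg u)) sL (linear_funZ fl) -[_ *: f _]addr0 cl c0 addr0 => e.
  by rewrite mulrBl -e subrr.
have f1 : f (sg u1) != 0.
  apply: contra (fRn_neq0 K n) => /eqP e; have := can_inj fK (etrans e (esym (linear_fun0 fl))).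
  move=> /(congr1 (fun m : dsum (coset_at pi g) (dhomog 2 K n) => (m (g + pi 0) : SV))) /=.
  by rewrite /single eqxx => e'; apply/eqP; exact: e'.
have [x1 hx1] : exists x1, c x1 (f (sg u1)) != 0.
  apply: contrapT => hh; move/eqP: f1; apply; apply: cs => x.
  by apply/eqP/negPn/negP => h0; apply: hh; exists x.
have wx1 : w x1 = sympl rho g.
  by have /eqP := ev x1 u1; rewrite mulf_eq0 (negPf hx1) orbF subr_eq0 => /eqP.
pose a := c x1 (f (sg u1)); pose b := c x1 (f (sg u2)).
have z0 : f (sg ((- b) *: u1 + a *: u2)) = 0.
  apply: cs => x; have [->|xx] := eqVneq x x1.
    rewrite sgl (linear_funZ sgl) fl (linear_funZ fl) cl -[a *: _]addr0 cl c0 addr0.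
    by rewrite -/a -/b mulNr mulrC addNr.
  have /eqP := ev x ((- b) *: u1 + a *: u2); rewrite mulf_eq0 -wx1 subr_eq0 (inj_eq winj) (negPf xx) /= => /eqP //.
have := can_inj fK (etrans z0 (esym (linear_fun0 fl))).
move=> /(congr1 (fun m : dsum (coset_at pi g) (dhomog 2 K n) => (m (g + pi 0) : SV))) /=.
rewrite /single eqxx => e.
pose pt (i : 'I_2) : K := if i == 0 then -1 else 1.
have mR : meval pt (fR K) = 0.
  by rewrite /fR /sym_lin mevalD !mevalZ !mevalXU /pt !mxE /= !mul1r addNr.
have mM : meval pt (fM K) = 1.
  by rewrite /fM /sym_lin mevalD !mevalZ !mevalXU /pt /emu !mxE /= mul0r add0r mul1r.
have := congr1 (meval pt) (e : (- b) *: fR K ^+ n + a *: fM K ^+ n = 0).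
have mv (a1 a2 : K) (p q : SV) : meval pt (a1 *: p + a2 *: q) = a1 * meval pt p + a2 * meval pt q.
  by rewrite mevalD !mevalZ.
have mX (p : SV) : meval pt (p ^+ n) = meval pt p ^+ n by exact: rmorphXn.
rewrite (mv (- b) a (fR K ^+ n) (fM K ^+ n)) (mX (fR K)) (mX (fM K)) mR mM.
rewrite expr0n eqn0Ngt n0 mulr0 add0r expr1n mulr1 meval0 => /eqP.
by rewrite (negPf hx1).
Qed.

End FormModules.

Section NonIsomorphism.
Variables (R : realType) (N : nat).
Local Notation K := R[i].
Local Notation X := 'rV[int]_N.
Local Notation vec := 'rV[K]_2.
Variable pi : {additive X -> vec}.
Hypothesis hN : exists a : X, a != 0.
Hypothesis hinj : injective pi.
Hypothesis r_neq0 : forall b : X, b != 0 -> sympl rho (pi b) != 0.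
Hypothesis hline : forall v : vec, v != 0 -> exists x, sympl v (pi x) != 0.
Hypothesis h2rho : forall x, pi x <> 2 *: rho.

Let rho_notin x : - rho + pi x = 0 -> False.
Proof.
move=> /eqP; rewrite addrC subr_eq0 => /eqP e; apply: (h2rho (x := x + x)).
by rewrite raddfD e; apply/matrixP => i j; rewrite !mxE; ring.
Qed.

Lemma models_not_iso (m m' : model pi) : admissible m -> admissible m' -> m <> m' ->
  ~ lmod_iso (model_module m) (model_module m').
Proof.
have cosetE (G : coset pi) : exists g, G = coset_at pi g.
  by case: G => S [g E]; exists g; subst S.
have memb g x : coset_set (coset_at pi g) (g + pi x) by exact: in_coset.
have SQ g : ~ coset_set (coset_at pi g) (- rho) -> ~ lmod_iso (S_quot pi) (S_mod (coset_at pi g)).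
  move=> a1 /(rank_one_iso hinj r_neq0 hline hN (S_quot_source hinj r_neq0 hN) (S_mod_target pi g)).
  have H x : g + rho + pi x = 0 -> False.
    move=> e; apply: a1; have := memb g x.
    by have -> : g + pi x = - rho by apply/eqP; rewrite -subr_eq0 opprK addrAC e.
  by move=> [[x /esym/H]|[x /H]].
have SD g : ~ coset_set (coset_at pi g) (- (2 *: rho)) -> ~ lmod_iso (S_mod (coset_at pi g)) (S_quot_dual pi).
  move=> a2 /(rank_one_iso hinj r_neq0 hline hN (S_mod_source pi g) (S_quot_dual_target hinj r_neq0)).
  move=> [[x e]|[x /rho_notin//]]; apply: a2; have := memb g (- x).
  have -> // : g + pi (- x) = - (2 *: rho).
  apply/eqP; rewrite -(inj_eq (addIr rho)) addrAC e raddfN; apply/eqP/matrixP => i j; rewrite !mxE; ring.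
have QD : ~ lmod_iso (S_quot pi) (S_quot_dual pi).
  move=> /(rank_one_iso hinj r_neq0 hline hN (S_quot_source hinj r_neq0 hN) (S_quot_dual_target hinj r_neq0)).
  by move=> [[x /esym/rho_notin]|[x /rho_notin]].
have lS g : weight_lines (S_mod (coset_at pi g)) := rank_target_lines r_neq0 (S_mod_target pi g).
have lD : weight_lines (S_quot_dual pi) := rank_target_lines r_neq0 (S_quot_dual_target hinj r_neq0).
have lQ := S_quot_lines r_neq0.
have nM n g P : (2 <= n)%N -> weight_lines P -> ~ lmod_iso (M_mod n (coset_at pi g)) P.
  by move=> n2; apply: forms_not_lines; exact: ltnW.
case: m => [G|||n G]; case: m' => [G'|||n' G']; rewrite /admissible /model_module.
all: try have [g ->] := cosetE G; try have [g' ->] := cosetE G'.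
- move=> [a1 _] [a1' _] ne /(rank_one_iso hinj r_neq0 hline hN (S_mod_source pi g) (S_mod_target pi g')).
  move=> [[x e]|[x e]].
    apply: ne; congr ModelS; apply/esym/coset_rebase; have := memb g' x.
    by have -> : g' + pi x = g by apply: (addIr rho); rewrite addrAC -e.
  apply: a1'; have := memb g' x.
  by have -> : g' + pi x = - rho by apply/eqP; rewrite -subr_eq0 opprK addrAC e.
- by move=> [a1 _] _ _ /lmod_iso_sym/(SQ _ a1).
- by move=> [_ a2] _ _ /(SD _ a2).
- by move=> _ n2 _ /lmod_iso_sym/(nM _ _ _ n2 (lS g)).
- by move=> _ [a1 _] _ /(SQ _ a1).
- by [].
- by move=> _ _ _ /QD.
- by move=> _ n2 _ /lmod_iso_sym/(nM _ _ _ n2 lQ).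
- by move=> _ [_ a2] _ /lmod_iso_sym/(SD _ a2).
- by move=> _ _ _ /lmod_iso_sym/QD.
- by [].
- by move=> _ n2 _ /lmod_iso_sym/(nM _ _ _ n2 lD).
- by move=> n2 _ _ /(nM _ _ _ n2 (lS g')).
- by move=> n2 _ _ /(nM _ _ _ n2 lQ).
- by move=> n2 _ _ /(nM _ _ _ n2 lD).
move=> n2 _ ne /(forms_iso_eq hline n2) [e1 e2]; apply: ne; by rewrite e1 e2.
Qed.

End NonIsomorphism.

Theorem theorem1p7 (R : realType) (N : nat)
    (pi : {additive 'rV[int]_N -> 'rV[R[i]]_2})
    (hN : (1 < N)%N)
    (hinj : injective pi)
    (hrho : ~ (lattice pi `<=` [set z | exists c : R[i], z = c *: rho]))
    (h2rho : ~ lattice pi (2 *: rho))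
    (hline : forall v : 'rV[R[i]]_2, v != 0 ->
       ~ (lattice pi `<=` [set z | exists c : R[i], z = c *: v]))
    (hnz : forall a b : 'rV[R[i]]_2, lattice pi a -> lattice pi b -> b != 0 ->
       sympl (a + 2 *: rho) b != 0) :
  (forall M : lieModule (W pi),
     lmod_simple M -> ~ lmod_trivial M -> cuspidal M ->
     [\/ exists2 G : coset pi,
           ~ coset_set G (- rho) /\ ~ coset_set G (- (2 *: rho)) &
           lmod_iso M (S_mod G),
         lmod_iso M (S_quot pi) \/ lmod_iso M (S_quot_dual pi) |
         exists2 n : nat, (2 <= n)%N &
           exists G : coset pi, lmod_iso M (M_mod n G)]) /\
  (forall m m' : model pi, admissible m -> admissible m' -> m <> m' ->
     ~ lmod_iso (model_module m) (model_module m')).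
Proof.
have hnz' (a b : 'rV[int]_N) : b != 0 -> sympl (pi a + 2 *: rho) (pi b) != 0.
  move=> b0; apply: hnz; [exact: imageT | exact: imageT |].
  by apply: contra b0 => /eqP; rewrite -(raddf0 pi) => /hinj ->.
have hline' v : v != 0 -> exists x, sympl v (pi x) != 0.
  move=> v0; apply: contrapT => h; apply: (hline v v0) => _ [x _ <-] /=.
  have [->|px] := eqVneq (pi x) 0; first by exists 0; rewrite scale0r.
  have [|c [_ cE]] := sympl_parallel v0 px; last by exists c.
  by apply/eqP/negPn/negP => e; apply: h; exists x.
split; first by move=> M; apply: classification.
have [a a0] : exists a : 'rV[int]_N, a != 0.
  by have [x hx] := hline' _ (rho_neq0 _); exists x; apply: contraNneq hx => ->; rewrite raddf0 /sympl !mxE !mulr0 subrr.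
apply: models_not_iso => //; first by exists a.
  exact: lattice_r_neq0 hnz'.
by move=> x e; apply: h2rho; rewrite -e; exact: imageT.
Qed.
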